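(* Let $\widetilde h=(\widetilde h_1,\dots,\widetilde h_d)^\top:\mathcal X^r\to\mathbb R^d$, $d=d_n$, be a measurable symmetric kernel. Suppose there exist constants $0\le q_1\le q_2\le1$, independent of $n$, such that $\|\Gamma_n\|_{\mathrm{op}}\asymp d^{q_1}$ and $\|\Gamma_n\|_{\mathrm F}\asymp d^{q_2}$. For a given constant $C>1$ independent of $n$, assume: (B.1) $\max_{1\le m\le d}\ \max_{(i_1,\dots,i_r)\in\mathcal C_n^r}\mathbb E|\widetilde h_m(X_{i_1},\dots,X_{i_r})|^4<C$; (B.2) $\lambda_{(2)}(\Gamma_n)>1/C$, where $\lambda_{(2)}(\Gamma_n)$ is the second largest eigenvalue of $\Gamma_n$. Then, with $Z_n\sim N(0,\Gamma_n)$ in $\mathbb R^d$ and $\ell_n=1-\|\Gamma_n\|_{\mathrm{op}}^2/\|\Gamma_n\|_{\mathrm F}^2$, $$\sup_{a\ge0}\big|\mathbf P(\|T_n\|\le a)-\mathbf P(\|Z_n\|\le a)\big|\lesssim\Delta_{n,d},$$ where $$\Delta_{n,d}=\max\Big\{\Big(\frac{d^{2-2q_2}}{n\,\ell_n^{3/4}}\Big)^{1/4},\ \Big(\frac{d^{3+3q_1-6q_2}}{n\,\ell_n^{3/2}}\Big)^{1/8},\ \Big(\frac{d^{3+q_1-4q_2}}{n\,\ell_n}\Big)^{1/6}\Big\}.$$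
   Context: Setting. $r\ge2$ is a fixed integer and $n\ge r$. $X_1,\dots,X_n$ are independent, not necessarily identically distributed, random elements of a measurable space $\mathcal X$; kernel, dimension $d=d_n$ and distributions may depend on $n$. $\|\cdot\|$ is the Euclidean norm on $\mathbb R^d$; $\|\cdot\|_{\mathrm{op}}$ and $\|\cdot\|_{\mathrm F}$ are the spectral and Frobenius norms. $\mathcal I_n^r$ is the set of $r$-tuples of pairwise distinct elements of $\{1,\dots,n\}$, $\mathcal C_n^r=\{1,\dots,n\}^r$, $P_{n,r}=n!/(n-r)!$. $U$-statistic: $U_n=P_{n,r}^{-1}\sum_{(i_1,\dots,i_r)\in\mathcal I_n^r}\widetilde h(X_{i_1},\dots,X_{i_r})$; $\theta_{\boldsymbol i}=\mathbb E\widetilde h(X_{i_1},\dots,X_{i_r})$ for $\boldsymbol i=(i_1,\dots,i_r)\in\mathcal I_n^r$; $\theta=\mathbb E U_n$; $T_n=\sqrt n(U_n-\theta)/r$. Hájek projection: for $i_1=1,\dots,n$, $$g^{(i_1)}(X_{i_1})=\frac1{P_{n-1,r-1}}\sum_{(i_2,\dots,i_r)}\big\{\mathbb E[\widetilde h(X_{i_1},\dots,X_{i_r})\mid X_{i_1}]-\theta_{\boldsymbol i}\big\},$$ the sum being over all $(r-1)$-tuples of pairwise distinct indices in $\{1,\dots,n\}\setminus\{i_1\}$. $\Gamma_n=n^{-1}\sum_{i=1}^n\mathbb E[g^{(i)}(X_i)g^{(i)}(X_i)^\top]$. $a\lesssim b$ means $a\le Kb$ for a constant $K>0$ independent of $n$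 and $d$ (it may depend on $C$, $r$, and the constants in the $\asymp$ hypotheses); $a\asymp b$ means $a\lesssim b$ and $b\lesssim a$. *)

(* Defs.v *)
From HB Require Import structures.
From mathcomp Require Import all_boot all_order all_fingroup all_algebra.
From mathcomp Require Import all_classical all_reals all_analysis.

Set Implicit Arguments.
Unset Strict Implicit.
Unset Printing Implicit Defensive.

Import Order.TTheory GRing.Theory Num.Theory.
Import numFieldNormedType.Exports.

Local Open Scope classical_set_scope.
Local Open Scope ring_scope.

(* The library norm on matrices is the sup norm. *)
Definition l2norm (R : realType) (d : nat) (v : 'cV[R]_d) : R :=
  Num.sqrt (\sum_(k < d) v k 0 ^+ 2).

Definition opnorm (R : realType) (d : nat) (A : 'M[R]_d) : R :=
  sup [set l2norm (A *m v) | v in [set v : 'cV[R]_d | l2norm v <= 1]].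

Definition frobnorm (R : realType) (d : nat) (A : 'M[R]_d) : R :=
  Num.sqrt (\sum_(k < d) \sum_(l < d) A k l ^+ 2).

(* The eigenvalues in nonincreasing order, repeated according to multiplicity
   (the list is unique, and exists when A is symmetric). *)
Definition eigenvalues (R : realType) (d : nat) (A : 'M[R]_d) : seq R :=
  xget [::] [set s : seq R | sorted >=%R s /\
                             char_poly A = \prod_(x <- s) ('X - x%:P)].

(* 0 when d < 2. *)
Definition second_largest_eigenvalue (R : realType) (d : nat) (A : 'M[R]_d) : R :=
  nth 0 (eigenvalues A) 1.

Definition mutually_independent (R : realType) (dO dT : measure_display)
    (Omega : measurableType dO) (T : measurableType dT) (P : probability Omega R)
    (n : nat) (X : 'I_n -> Omega -> T) : Prop :=
  forall (J : {set 'I_n}) (A : 'I_n -> set T),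
    (forall i, measurable (A i)) ->
    P (\bigcap_(i in [set i | i \in J]) X i @^-1` A i)
    = (\prod_(i in J) P (X i @^-1` A i))%E.

Definition mean (R : realType) (dO : measure_display) (Omega : measurableType dO)
    (P : probability Omega R) (Y : Omega -> R) : R := fine 'E_P[Y].

(* phi is a regression function of Y on X, that is, phi o X is a version of
   E[Y | X]. *)
Definition is_cond_mean (R : realType) (dO dT : measure_display)
    (Omega : measurableType dO) (T : measurableType dT) (P : probability Omega R)
    (Y : Omega -> R) (X : Omega -> T) (phi : T -> R) : Prop :=
  [/\ measurable_fun setT phi,
      P.-integrable setT (fun w => (phi (X w))%:E) &
      forall A : set T, measurable A ->
        (\int[P]_(w in X @^-1` A) (phi (X w))%:E
         = \int[P]_(w in X @^-1` A) (Y w)%:E)%E].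

(* The function x |-> E[Y | X = x]; a version exists as soon as Y is integrable
   (Radon-Nikodym), and is unique up to null sets of the law of X. *)
Definition cond_mean (R : realType) (dO dT : measure_display)
    (Omega : measurableType dO) (T : measurableType dT) (P : probability Omega R)
    (Y : Omega -> R) (X : Omega -> T) : T -> R :=
  xget (fun=> 0) [set phi : T -> R | is_cond_mean P Y X phi].

(* N(m, v) on the line, parametrized by the variance v >= 0; [normal_prob] takes
   the standard deviation and is not a Dirac mass when that is 0. *)
Definition normal_law (R : realType) (m v : R) (A : set R) : \bar R :=
  if v == 0 then \d_m A else normal_prob m (Num.sqrt v) A.

(* Z ~ N(0, Sigma): every linear functional u^T Z is N(0, u^T Sigma u). Sigma may
   be singular. *)
Definition centered_gaussian (R : realType) (dO : measure_display)
    (Omega : measurableType dO) (P : probability Omega R) (d : nat)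
    (Z : Omega -> 'cV[R]_d) (Sigma : 'M[R]_d) : Prop :=
  forall u : 'cV[R]_d,
    measurable_fun setT (fun w => (u^T *m Z w) 0 0) /\
    forall A : set R, measurable A ->
      P ((fun w => (u^T *m Z w) 0 0) @^-1` A)
      = normal_law 0 ((u^T *m Sigma *m u) 0 0) A.

Definition symmetric_stat_kernel (T V : Type) (r : nat) (h : r.-tuple T -> V) : Prop :=
  forall (s : {perm 'I_r}) (x : r.-tuple T), h [tuple tnth x (s k) | k < r] = h x.

Definition measurable_stat_kernel (R : realType) (dT : measure_display)
    (T : measurableType dT) (r d : nat) (h : r.-tuple T -> 'cV[R]_d) : Prop :=
  forall m : 'I_d, measurable_fun setT (fun x => h x m 0).

Section UStatistic.
Context (R : realType) (dO dT : measure_display) (Omega : measurableType dO)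
  (T : measurableType dT) (P : probability Omega R) (r n d : nat)
  (X : 'I_n -> {RV P >-> T}) (h : r.-tuple T -> 'cV[R]_d).

Definition subsample (i : r.-tuple 'I_n) (w : Omega) : r.-tuple T :=
  [tuple X (tnth i k) w | k < r].

(* P_{n,r} = n ^_ r, and [uniq i] says that i belongs to I_n^r. *)
Definition ustat (w : Omega) : 'cV[R]_d :=
  (n ^_ r)%:R^-1 *: \sum_(i : r.-tuple 'I_n | uniq i) h (subsample i w).

Definition theta_idx (i : r.-tuple 'I_n) : 'cV[R]_d :=
  \col_m mean P (fun w => h (subsample i w) m 0).

Definition theta : 'cV[R]_d := \col_m mean P (fun w => ustat w m 0).

Definition tstat (w : Omega) : 'cV[R]_d :=
  (Num.sqrt n%:R / r%:R) *: (ustat w - theta).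

(* The sum over (i_2, ..., i_r) is written as a sum over the tuples of distinct
   indices (i_1, i_2, ..., i_r) with prescribed first entry i1. *)
Definition hajek (i1 : 'I_n) (x : T) : 'cV[R]_d :=
  (n.-1 ^_ r.-1)%:R^-1 *:
  \sum_(i : r.-tuple 'I_n | uniq i && (ohead i == Some i1))
     (\col_m cond_mean P (fun w => h (subsample i w) m 0) (X i1) x
      - theta_idx i).

Definition Gamma : 'M[R]_d :=
  n%:R^-1 *: \sum_(i < n)
    \matrix_(k, l) mean P (fun w =>
      (hajek i (X i w) *m (hajek i (X i w))^T) k l).

End UStatistic.

Definition ell (R : realType) (d : nat) (G : 'M[R]_d) : R :=
  1 - opnorm G ^+ 2 / frobnorm G ^+ 2.

Definition Delta (R : realType) (n d : nat) (q1 q2 l : R) : R :=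
  Num.max
    (Num.max
      ((d%:R `^ (2 - 2 * q2) / (n%:R * l `^ (3 / 4))) `^ (1 / 4))
      ((d%:R `^ (3 + 3 * q1 - 6 * q2) / (n%:R * l `^ (3 / 2))) `^ (1 / 8)))
    ((d%:R `^ (3 + q1 - 4 * q2) / (n%:R * l)) `^ (1 / 6)).

Definition asymp (R : realType) (K1 K2 a b : R) : Prop :=
  a <= K1 * b /\ b <= K2 * a.

(* Main.v *)
(** Splitting each kernel value into its mean, its one-variable projections and a
    residual, residuals of index tuples sharing at most one index are orthogonal. Hence
    [T_n] is within [O(d / n)] in mean square of a sum [W] of independent centered vectors
    with total covariance [Gamma_n].

    A C^2 piecewise cubic approximation of the indicator of a ball, at scale [e] in the
    squared radius, lets the Lindeberg replacement compare [|W|^2] with [|G|^2], [G]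
    Gaussian with covariance [Gamma_n]. Each replacement error is a mean over the rest of
    the sum, whose law has only its second and fourth moments controlled.

    By the spectral theorem [|G|^2] is a weighted sum of independent squared normal
    variables. The probability that it falls in a window of width [e] is at most a constant
    times [e / (|Gamma_n|_F * ell_n ^ (1/4))]: if the second weight is comparable to all the
    lower ones together, by conditioning on every coordinate but the two largest; otherwise
    by integrating the characteristic function, whose modulus is an explicit product.
    Positivity of the second eigenvalue makes [ell_n] positive.

    The given [Z_n] is only known through its linear functionals; averaging their
    characteristic functions over a Gaussian frequency yields the Laplace transform of
    [|Z_n|^2], and hence identifies its law with that of [|G|^2]. Balancing [e] against the
    errors gives the three terms of [Delta]. *)

From HB Require Import structures.
From mathcomp Require Import all_boot all_order all_fingroup all_algebra.
From mathcomp Require Import all_classical all_reals all_analysis.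
From mathcomp Require Import measurable_realfun gauss_integral.
From mathcomp Require Import ring lra zify.
Require Import Defs.

Set Implicit Arguments.
Unset Strict Implicit.
Unset Printing Implicit Defensive.

Import Order.TTheory GRing.Theory Num.Theory.
Import numFieldNormedType.Exports.

Local Open Scope classical_set_scope.
Local Open Scope ring_scope.

(** * Real-valued expectations *)

(** Everything is measured against w = F l^(1/4), with F the Frobenius norm of [Gamma] and l its
    [ell]. If l_0 is the largest eigenvalue and b^2 the sum of the squares of the others, then b = F
    sqrt l and l_0 + b >= F, so (l_0 + b) b >= w^2; the window bound e / sqrt((l_0 + b) b) is thus
    at most e / w.

    Replacement costs dl / e, tau eta / e^2 and tau^3 eta / e^3, where dl = d / sqrt n, tau^2 is the
    operator norm, eta = n th^3, and th^2, of order d / n, bounds the mean square of a summand.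
    Equating each with e / w gives square, cube and fourth roots of quantities of order n^(-1/2),
    whence the exponents 1/4, 1/6 and 1/8.

    The factor tau^3 is a third absolute moment of <S, v>, S being the rest of the sum. Only a
    second moment, at most tau^2 |v|^2, and a fourth are at hand, so the third is interpolated
    between them. The fourth exceeds its Gaussian value by a term of order n th^4, a multiple of
    dl^2, harmless while dl is at most a multiple of e; if the balanced e is too small for that, the
    claimed bound exceeds 1. *)

Definition itg (R : realType) (d : measure_display) (T : measurableType d)
  (P : probability T R) (f : T -> R) : Prop := P.-integrable setT (EFin \o f).

(** Total: on non-integrable functions it returns whatever [fine] makes of the extended integral, so
    linearity and comparison carry [itg] side conditions. *)
Definition Ex (R : realType) (d : measure_display) (T : measurableType d)
  (P : probability T R) (f : T -> R) : R := \int[P]_x f x.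

Section Expectation.
Context (R : realType) (d : measure_display) (T : measurableType d)
  (P : probability T R).
Implicit Types f g : T -> R.

Lemma itg_meas f : itg P f -> measurable_fun setT f.
Proof. by move=> /measurable_int /measurable_EFinP. Qed.

Lemma itg_le f g : measurable_fun setT f -> itg P g ->
  (forall x, `|f x| <= g x) -> itg P f.
Proof.
move=> mf ig fg; apply: (le_integrable measurableT _ _ ig).
  exact/measurable_EFinP.
by move=> x _ /=; rewrite lee_fin (le_trans (fg x))// ler_norm.
Qed.

Lemma itg_cst c : itg P (fun=> c).
Proof.
apply/integrableP; split; first exact/measurable_EFinP.
rewrite integral_cst//= probability_setT mule1; exact: ltry.
Qed.

Lemma itg_bounded f c : measurable_fun setT f -> (forall x, `|f x| <= c) -> itg P f.
Proof. by move=> mf fc; apply: itg_le mf (itg_cst c) fc. Qed.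

Lemma itgD f g : itg P f -> itg P g -> itg P (fun x => f x + g x).
Proof.
move=> hf hg; have := integrableD measurableT hf hg.
by apply: eq_integrable => // x _ /=.
Qed.

Lemma itgZ c f : itg P f -> itg P (fun x => c * f x).
Proof.
move=> hf; have := integrableZl measurableT c hf.
by apply: eq_integrable => // x _ /=.
Qed.

Lemma itg_ext f g : f =1 g -> itg P f -> itg P g.
Proof. by move=> /funext ->. Qed.

Lemma itgN f : itg P f -> itg P (fun x => - f x).
Proof. by move=> hf; apply: itg_ext (itgZ (-1) hf) => x; rewrite mulN1r. Qed.

Lemma itgB f g : itg P f -> itg P g -> itg P (fun x => f x - g x).
Proof. by move=> hf /itgN; exact: itgD. Qed.

Lemma itg_sum (I : Type) (s : seq I) (p : pred I) (F : I -> T -> R) :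
  (forall i, p i -> itg P (F i)) -> itg P (fun x => \sum_(i <- s | p i) F i x).
Proof.
move=> hF; elim: s => [|i s IH].
  by apply: itg_ext (itg_cst 0) => x; rewrite big_nil.
have [pi|pi] := boolP (p i).
  by apply: itg_ext (itgD (hF _ pi) IH) => x; rewrite big_cons pi.
by apply: itg_ext IH => x; rewrite big_cons (negbTE pi).
Qed.

Lemma itg_abs f : itg P f -> itg P (fun x => `|f x|).
Proof.
move=> hf; have := integrable_abse hf.
by apply: eq_integrable => // x _ /=.
Qed.

Lemma Ex_EFin f : itg P f -> (\int[P]_x (f x)%:E)%E = (Ex P f)%:E.
Proof. by move=> hf; rewrite /Ex /Rintegral fineK//; exact: integrable_fin_num. Qed.

Lemma Ex_cst c : Ex P (fun=> c) = c.
Proof.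
transitivity (c * fine (P setT)); first exact: Rintegral_cst.
by rewrite probability_setT mulr1.
Qed.

Lemma eq_Ex f g : f =1 g -> Ex P f = Ex P g.
Proof. by move=> /funext ->. Qed.

Lemma ExD f g : itg P f -> itg P g -> Ex P (fun x => f x + g x) = Ex P f + Ex P g.
Proof. by move=> hf hg; rewrite /Ex RintegralD. Qed.

Lemma ExB f g : itg P f -> itg P g -> Ex P (fun x => f x - g x) = Ex P f - Ex P g.
Proof. by move=> hf hg; rewrite /Ex RintegralB. Qed.

Lemma ExZ c f : itg P f -> Ex P (fun x => c * f x) = c * Ex P f.
Proof. by move=> hf; rewrite /Ex RintegralZl. Qed.

Lemma ExN f : itg P f -> Ex P (fun x => - f x) = - Ex P f.
Proof.
by move=> hf; rewrite -[RHS]mulN1r -ExZ//; apply: eq_Ex => x; rewrite mulN1r.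
Qed.

Lemma Ex_sum (I : Type) (s : seq I) (p : pred I) (F : I -> T -> R) :
  (forall i, p i -> itg P (F i)) ->
  Ex P (fun x => \sum_(i <- s | p i) F i x) = \sum_(i <- s | p i) Ex P (F i).
Proof.
move=> hF; elim: s => [|i s IH].
  rewrite big_nil -[RHS]Ex_cst; apply: eq_Ex => x.
  by rewrite big_nil.
rewrite big_cons; have [pi|pi] := boolP (p i).
  rewrite -IH -ExD; [|exact: hF|exact: itg_sum].
  by apply: eq_Ex => x; rewrite big_cons pi.
by rewrite -IH; apply: eq_Ex => x; rewrite big_cons (negbTE pi).
Qed.

Lemma Ex_ge0 f : (forall x, 0 <= f x) -> 0 <= Ex P f.
Proof. by move=> f0; apply: Rintegral_ge0. Qed.

Lemma Ex_le f g : itg P f -> itg P g -> (forall x, f x <= g x) -> Ex P f <= Ex P g.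
Proof. by move=> hf hg fg; apply: le_Rintegral. Qed.

Lemma Ex_abs_le f : itg P f -> `|Ex P f| <= Ex P (fun x => `|f x|).
Proof. by move=> hf; apply: le_normr_Rintegral. Qed.

Lemma Ex_bound f c : itg P f -> (forall x, `|f x| <= c) -> `|Ex P f| <= c.
Proof.
move=> hf fc; apply: le_trans (Ex_abs_le hf) _.
by rewrite -[leRHS]Ex_cst; apply: Ex_le => //; [exact: itg_abs|exact: itg_cst].
Qed.

Lemma itg_indic (A : set T) : measurable A -> itg P \1_A.
Proof.
move=> mA; apply: (@itg_bounded _ 1) => // x.
by rewrite indicE; case: (_ \in _); rewrite ?normr1 ?normr0.
Qed.

Lemma Ex_indic (A : set T) : measurable A -> Ex P \1_A = fine (P A).
Proof. by move=> mA; rewrite /Ex /Rintegral integral_indic// setIT. Qed.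

Lemma ae_eq_Ex f g : measurable_fun setT f -> measurable_fun setT g ->
  {ae P, forall x, f x = g x} -> Ex P f = Ex P g.
Proof.
move=> mf mg fg; rewrite /Ex /Rintegral; congr fine.
apply: ae_eq_integral => //; try exact/measurable_EFinP.
by apply: filterS fg => x /= ->.
Qed.

Lemma ae_itg f g : measurable_fun setT g ->
  {ae P, forall x, f x = g x} -> itg P f -> itg P g.
Proof.
move=> mg fg hf; have mf := itg_meas hf.
apply/integrableP; split; first exact/measurable_EFinP.
move/integrableP : hf => [_]; congr (_ < _)%E.
apply: ge0_ae_eq_integral => //; try by apply/measurableT_comp => //; exact/measurable_EFinP.
by apply: filterS fg => x /= ->.
Qed.

End Expectation.

(** * Change of variables under a measurable map *)

Section Change.
Context (R : realType) (d d' : measure_display) (S : measurableType d)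
  (T : measurableType d') (P : probability S R) (phi : S -> T).
Hypothesis mphi : measurable_fun setT phi.

Definition mphi_mfun : {mfun S >-> T} := mfun_Sub (mem_set mphi).

Definition law : probability T R := distribution P mphi_mfun.

Lemma lawE A : law A = P (phi @^-1` A).
Proof. by []. Qed.

Lemma itg_law (f : T -> R) : measurable_fun setT f ->
  itg law f <-> itg P (f \o phi).
Proof.
move=> mf; have mfE : measurable_fun setT (abse \o (EFin \o f)).
  by apply: measurableT_comp => //; exact/measurable_EFinP.
have E : (\int[law]_y `|(f y)%:E| = \int[P]_x `|(f (phi x))%:E|)%E.
  apply: (@ge0_integral_distribution _ _ _ _ _ P mphi_mfun _ mfE) => y.
  exact: abse_ge0.
split=> /integrableP[_ h]; apply/integrableP; split.
- exact/measurable_EFinP/measurableT_comp.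
- by move: h; rewrite /= E.
- exact/measurable_EFinP.
- by rewrite /= E.
Qed.

Lemma Ex_law (f : T -> R) : measurable_fun setT f -> itg P (f \o phi) ->
  Ex law f = Ex P (f \o phi).
Proof.
move=> mf hf; rewrite /Ex /Rintegral; congr fine.
have mfE : measurable_fun setT (EFin \o f) by exact/measurable_EFinP.
by rewrite -(@integral_distribution _ _ _ _ _ P mphi_mfun _ mfE).
Qed.
End Change.

(** * Fubini's theorem for real-valued expectations *)

Section Fubini.
Context (R : realType) (d d' : measure_display) (S : measurableType d)
  (T : measurableType d') (P : probability S R) (Q : probability T R).

Definition prodP : probability (S * T)%type R := (P \x Q)%E.

(** This is how the error of a replacement, bounded in mean for each fixed value of the summand,
    becomes integrable jointly. *)
Lemma itg_prod_tonelli (f : S * T -> R) (g : S -> R) :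
  measurable_fun setT f ->
  (forall x, itg Q (fun y => f (x, y))) ->
  itg P g -> (forall x, Ex Q (fun y => `|f (x, y)|) <= g x) -> itg prodP f.
Proof.
move=> mf hf hg fg; apply/integrable12ltyP; first exact/measurable_EFinP.
have mF : measurable_fun setT (fun x : S => (\int[Q]_y `|(f (x, y))%:E|)%E).
  apply: (measurable_fun_fubini_tonelli_F (fun z => `|(f z)%:E|%E)) => //=.
  by apply/measurable_EFinP; exact: measurableT_comp.
apply: (@le_lt_trans _ _ (\int[P]_x (g x)%:E)%E).
  apply: ge0_le_integral => //.
  - by move=> x _; apply: integral_ge0.
  - by apply/measurable_EFinP; exact: itg_meas hg.
  - move=> x _; have /itg_abs/Ex_EFin /= E := hf x.
    by rewrite /= E lee_fin.
by rewrite Ex_EFin// ltry.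
Qed.

Lemma itg_tensor (f : S -> R) (g : T -> R) : itg P f -> itg Q g ->
  itg prodP (fun z => f z.1 * g z.2).
Proof.
move=> hf hg; apply: (@itg_prod_tonelli _ (fun x => `|f x| * Ex Q (fun y => `|g y|))).
- apply: measurable_funM.
    exact: (measurableT_comp (itg_meas hf)).
  exact: (measurableT_comp (itg_meas hg)).
- by move=> x /=; exact: itgZ.
- apply: itg_ext (itgZ (Ex Q (fun y => `|g y|)) (itg_abs hf)) => x.
  by rewrite mulrC.
- move=> x; rewrite -ExZ; last exact: itg_abs.
  by under eq_Ex do rewrite /= normrM.
Qed.

Lemma itg_fst (f : S -> R) : itg P f -> itg prodP (fun z => f z.1).
Proof.
by move=> hf; apply: itg_ext (itg_tensor hf (itg_cst Q 1)) => z; rewrite mulr1.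
Qed.

Lemma itg_snd (f : T -> R) : itg Q f -> itg prodP (fun z => f z.2).
Proof.
by move=> hf; apply: itg_ext (itg_tensor (itg_cst P 1) hf) => z; rewrite mul1r.
Qed.

Lemma Ex_prod (f : S * T -> R) : itg prodP f ->
  Ex prodP f = Ex P (fun x => Ex Q (fun y => f (x, y))).
Proof.
move=> hf; rewrite /Ex /Rintegral; congr fine.
rewrite -[LHS](integral12_prod_meas1 hf).
apply: ae_eq_integral => //.
- exact: measurable_fubini_F hf.
- have := integrable_fubini_F hf => /(measurable_int)/measurableT_comp h.
  apply/measurable_EFinP; apply: (measurableT_comp (f := fine)) => //.
  exact: measurable_fubini_F hf.
(* Sections are integrable only for almost every x; elsewhere the inner [Ex] is a default value, so
   the two outer integrands agree almost everywhere and not pointwise. *)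
- have := ae_integrable1 hf; apply: filterS => x /= hx _.
  by rewrite /fubini_F fineK//; exact: integrable_fin_num.
Qed.

Lemma Ex_prod2 (f : S * T -> R) : itg prodP f ->
  Ex prodP f = Ex Q (fun y => Ex P (fun x => f (x, y))).
Proof.
move=> hf; rewrite /Ex /Rintegral; congr fine.
rewrite -[LHS](integral21_prod_meas1 hf).
apply: ae_eq_integral => //.
- exact: measurable_fubini_G hf.
- apply/measurable_EFinP; apply: (measurableT_comp (f := fine)) => //.
  exact: measurable_fubini_G hf.
- have := ae_integrable2 hf; apply: filterS => x /= hx _.
  by rewrite /fubini_G fineK//; exact: integrable_fin_num.
Qed.

Lemma ae_itg_prod (f : S * T -> R) : itg prodP f ->
  {ae P, forall x, itg Q (fun y => f (x, y))}.
Proof. by move=> hf; exact: ae_integrable1 hf. Qed.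

Lemma itg_inner (f : S * T -> R) : itg prodP f ->
  itg P (fun x => Ex Q (fun y => f (x, y))).
Proof.
move=> hf; have h := integrable_fubini_F hf.
have mF : measurable_fun setT (fun x => Ex Q (fun y => f (x, y))).
  apply: (measurableT_comp (f := fine)) => //.
  exact: measurable_fubini_F hf.
apply/integrableP; split; first exact/measurable_EFinP.
move/integrableP : h => [mh]; congr (_ < _)%E.
apply: ge0_ae_eq_integral => //.
- exact: measurableT_comp.
- by apply: measurableT_comp => //; exact/measurable_EFinP.
- have := ae_integrable1 hf; apply: filterS => x /= hx _.
  by rewrite -[fubini_F _ _ _]/(\int[Q]_y (f (x, y))%:E)%E (Ex_EFin hx).
Qed.

End Fubini.

Section L4.
Context (R : realType) (d : measure_display) (T : measurableType d)
  (P : probability T R).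
Implicit Types f g h k : T -> R.

(** The moment class given by hypothesis (B.1). It is a vector space, and any product of at most
    four members is integrable. *)
Definition L4 f : Prop := measurable_fun setT f /\ itg P (fun x => f x ^+ 4).

Lemma L4_cst c : L4 (fun=> c).
Proof. by split => //; exact: itg_cst. Qed.

Lemma L4Z c f : L4 f -> L4 (fun x => c * f x).
Proof.
move=> [mf hf]; split; first exact: measurable_funM.
by apply: itg_ext (itgZ (c ^+ 4) hf) => x; rewrite exprMn.
Qed.

Lemma L4D f g : L4 f -> L4 g -> L4 (fun x => f x + g x).
Proof.
move=> [mf hf] [mg hg]; split; first exact: measurable_funD.
apply: (@itg_le _ _ _ _ _ (fun x => 8 * f x ^+ 4 + 8 * g x ^+ 4)).
- by apply: measurable_funX; exact: measurable_funD.
- by apply: itgD; exact: itgZ.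
move=> x; rewrite ger0_norm ?exprn_even_ge0//.
set a := f x; set b := g x.
(* The squares below certify (a + b)^4 <= 8 a^4 + 8 b^4. *)
have h (u : R) : 0 <= u ^+ 2 by exact: sqr_ge0.
have := h (a - b); have := h (a ^+ 2 - b ^+ 2); have := h (a * (a - b)).
have := h (b * (a - b)); have := h (a ^+ 2 + b ^+ 2 - 2 * a * b).
nra.
Qed.

Lemma L4N f : L4 f -> L4 (fun x => - f x).
Proof.
move=> /(L4Z (-1)) [hm hi]; split; first by apply: eq_measurable_fun hm => x _; rewrite mulN1r.
by apply: itg_ext hi => x; rewrite mulN1r.
Qed.

Lemma L4B f g : L4 f -> L4 g -> L4 (fun x => f x - g x).
Proof. by move=> hf /L4N; exact: L4D. Qed.

Lemma L4_ext f g : f =1 g -> L4 f -> L4 g.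
Proof. by move=> /funext ->. Qed.

Lemma L4_sum (I : Type) (s : seq I) (p : pred I) (F : I -> T -> R) :
  (forall i, p i -> L4 (F i)) -> L4 (fun x => \sum_(i <- s | p i) F i x).
Proof.
move=> hF; elim: s => [|i s IH].
  by apply: L4_ext (L4_cst 0) => x; rewrite big_nil.
have [pi|pi] := boolP (p i).
  by apply: L4_ext (L4D (hF _ pi) IH) => x; rewrite big_cons pi.
by apply: L4_ext IH => x; rewrite big_cons (negbTE pi).
Qed.

Lemma L4_mul4 f g h k : L4 f -> L4 g -> L4 h -> L4 k ->
  itg P (fun x => f x * g x * h x * k x).
Proof.
move=> [mf hf] [mg hg] [mh hh] [mk hk].
apply: (@itg_le _ _ _ _ _
    (fun x => f x ^+ 4 + g x ^+ 4 + (h x ^+ 4 + k x ^+ 4))).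
- by do !apply: measurable_funM.
- by do !apply: itgD.
move=> x; set a := f x; set b := g x; set c := h x; set e := k x.
rewrite !normrM.
have X4 (u : R) : u ^+ 4 = `|u| ^+ 4 by rewrite -normrX ger0_norm// exprn_even_ge0.
rewrite (X4 a) (X4 b) (X4 c) (X4 e).
have : 0 <= `|a| by []. have : 0 <= `|b| by [].
have : 0 <= `|c| by []. have : 0 <= `|e| by [].
move: `|a| `|b| `|c| `|e| => a' b' c' e' e0 c0 b0 a0.
have H (u v : R) : u * v <= (u ^+ 2 + v ^+ 2) / 2.
  by have := sqr_ge0 (u - v); rewrite sqrrB; lra.
have h1 := H (a' * b') (c' * e'); have h2 := H (a' ^+ 2) (b' ^+ 2).
have h3 := H (c' ^+ 2) (e' ^+ 2).
have ? : 0 <= a' ^+ 4 by rewrite exprn_ge0.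
have ? : 0 <= b' ^+ 4 by rewrite exprn_ge0.
have ? : 0 <= c' ^+ 4 by rewrite exprn_ge0.
have ? : 0 <= e' ^+ 4 by rewrite exprn_ge0.
lra.
Qed.

Lemma L4_itg f : L4 f -> itg P f.
Proof.
move=> hf; have h1 := L4_cst 1; apply: itg_ext (L4_mul4 hf h1 h1 h1) => x.
by rewrite !mulr1.
Qed.

Lemma L4_mul2 f g : L4 f -> L4 g -> itg P (fun x => f x * g x).
Proof.
move=> hf hg; have h1 := L4_cst 1; apply: itg_ext (L4_mul4 hf hg h1 h1) => x.
by rewrite !mulr1.
Qed.

Lemma L4_mul3 f g h : L4 f -> L4 g -> L4 h -> itg P (fun x => f x * g x * h x).
Proof.
move=> hf hg hh; apply: itg_ext (L4_mul4 hf hg hh (L4_cst 1)) => x.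
by rewrite !mulr1.
Qed.

Lemma L4_sqr f : L4 f -> itg P (fun x => f x ^+ 2).
Proof. by move=> hf; apply: itg_ext (L4_mul2 hf hf). Qed.

Lemma L4_cube f : L4 f -> itg P (fun x => f x ^+ 3).
Proof. by move=> hf; apply: itg_ext (L4_mul3 hf hf hf) => x; rewrite !exprS expr0 mulr1 mulrA. Qed.

End L4.

Lemma L4_comp (R : realType) d d' (S : measurableType d) (T : measurableType d')
  (P : probability S R) (phi : S -> T) (mphi : measurable_fun setT phi) (f : T -> R) :
  measurable_fun setT f -> L4 (law P mphi) f <-> L4 P (f \o phi).
Proof.
move=> mf; have mf4 : measurable_fun setT (fun x => f x ^+ 4) by exact: measurable_funX.
split=> -[_ h]; split => //; first exact: measurableT_comp.
  exact: (itg_law P mphi mf4).1 h.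
exact: (itg_law P mphi mf4).2 h.
Qed.

Lemma L4_fst (R : realType) d d' (S : measurableType d) (T : measurableType d')
  (P : probability S R) (Q : probability T R) (f : S -> R) :
  L4 P f -> L4 (prodP P Q) (fun z => f z.1).
Proof. by move=> [mf hf]; split; [exact: measurableT_comp|exact: itg_fst hf]. Qed.

Lemma L4_snd (R : realType) d d' (S : measurableType d) (T : measurableType d')
  (P : probability S R) (Q : probability T R) (f : T -> R) :
  L4 Q f -> L4 (prodP P Q) (fun z => f z.2).
Proof. by move=> [mf hf]; split; [exact: measurableT_comp|exact: itg_snd hf]. Qed.

Lemma Ex_tensor (R : realType) d d' (S : measurableType d) (T : measurableType d')
  (P : probability S R) (Q : probability T R) (f : S -> R) (g : T -> R) :
  itg P f -> itg Q g -> Ex (prodP P Q) (fun z => f z.1 * g z.2) = Ex P f * Ex Q g.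
Proof.
move=> hf hg; rewrite Ex_prod; last exact: itg_tensor.
rewrite mulrC -ExZ//; apply: eq_Ex => x /=.
by rewrite ExZ// mulrC.
Qed.

(** * Moments and characteristic functions of normal laws *)

Section RealCalculus.
Context (R : realType).
Implicit Types f g : R -> R.

Lemma is_derive_mul f g (x df dg : R) : is_derive x 1 f df -> is_derive x 1 g dg ->
  is_derive x 1 (fun y => f y * g y) (f x * dg + df * g x).
Proof.
move=> hf hg; have := is_deriveM hf hg.
by move=> h; apply: is_derive_eq; rewrite /GRing.scale /= [g x * df]mulrC.
Qed.

Lemma is_derive_comp f g (x df dg : R) : is_derive (g x) 1 f df ->
  is_derive x 1 g dg -> is_derive x 1 (fun y => f (g y)) (df * dg).
Proof. by move=> hf hg; exact: (is_derive1_comp hf hg). Qed.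

Lemma is_derive_add f g (x df dg : R) : is_derive x 1 f df -> is_derive x 1 g dg ->
  is_derive x 1 (fun y => f y + g y) (df + dg).
Proof. by move=> hf hg; exact: is_deriveD hf hg. Qed.

Lemma is_derive_scal (c : R) f (x df : R) : is_derive x 1 f df ->
  is_derive x 1 (fun y => c * f y) (c * df).
Proof. by move=> hf; have := is_deriveZ c hf. Qed.

Lemma is_derive_pow f n (x df : R) : is_derive x 1 f df ->
  is_derive x 1 (fun y => f y ^+ n.+1) (n.+1%:R * f x ^+ n * df).
Proof.
move=> hf; have h : is_derive x 1 (fun y => f y ^+ n.+1) ((n.+1%:R * f x ^+ n) *: df).
  by have := is_deriveX n.+1 hf; rewrite exprfctE.
exact: is_derive_eq.
Qed.

Lemma is_derive_ext f g (x df : R) : f =1 g -> is_derive x 1 f df -> is_derive x 1 g df.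
Proof. by move=> /funext ->. Qed.

Lemma is_derive_conv f (x a b : R) : is_derive x 1 f a -> a = b -> is_derive x 1 f b.
Proof. by move=> h <-. Qed.

Lemma derive1_is f (x df : R) : is_derive x 1 f df -> derive1 f x = df.
Proof. by move=> h; rewrite derive1E derive_val. Qed.

Lemma is_derive_continuous f (x df : R) : is_derive x 1 f df -> {for x, continuous f}.
Proof.
by move=> h; apply/differentiable_continuous/derivable1_diffP; exact: ex_derive.
Qed.

Lemma is_derive0_cst f (x y : R) : (forall z : R, is_derive z 1 f 0) -> f x = f y.
Proof. by move=> h; apply: is_derive_0_is_cst. Qed.

Lemma continuous_meas f : continuous f -> measurable_fun setT f.
Proof. exact: continuous_measurable_fun. Qed.

End RealCalculus.

Section IntegralDerive.
Context (R : realType).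
Local Notation mu := (@lebesgue_measure R).

(** The fundamental theorem on [-n, n] followed by dominated convergence. Limits along integers
    suffice, since f is integrable over the whole line. This is the integration by parts behind
    Stein's identity. *)
Lemma integral_derive_eq0 (F f : R -> R) :
  (forall x : R, is_derive x 1 F (f x)) -> continuous f ->
  mu.-integrable setT (EFin \o f) ->
  (F (n%:R) @[n --> \oo] --> (0 : R)) -> (F (- n%:R) @[n --> \oo] --> (0 : R)) ->
  (\int[mu]_x (f x)%:E = 0)%E.
Proof.
move=> dF cf hf Fy FNy.
pose fn (n : nat) (x : R) := ((EFin \o f) \_ `[- n%:R, n%:R]%classic) x.
have mf : measurable_fun setT (EFin \o f) by exact: measurable_int hf.
have fnE n : (0 < n)%N -> (\int[mu]_x fn n x = (F n%:R - F (- n%:R))%:E)%E.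
  move=> n0; rewrite /fn -integral_mkcond EFinB; apply: continuous_FTC2.
  - by rewrite -subr_gt0 opprK; rewrite addr_gt0// ltr0n.
  - by apply: continuous_subspaceT => x; exact: cf.
  - split.
    + by move=> x _; have := dF x; move=> h; exact: ex_derive.
    + apply: cvg_at_right_filter; exact: is_derive_continuous (dF _).
    + apply: cvg_at_left_filter; exact: is_derive_continuous (dF _).
  - by move=> x _; exact: derive1_is.
have h : (\int[mu]_x fn n x)%E @[n --> \oo] --> (\int[mu]_x (f x)%:E)%E.
  apply: (@dominated_cvg _ _ _ mu setT measurableT fn _ (fun x => `|(f x)%:E|)%E).
  - move=> n; apply/(measurable_restrictT _ _).1 => //.
    exact: measurable_funS mf.
  - move=> x _; apply: cvg_near_cst.
    near=> n; rewrite /fn patchE ifT// inE /= in_itv /= -ler_norml.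
    near: n; exact: nbhs_infty_ger.
  - by [].
  - exact: integrable_abse hf.
  - move=> n x _; rewrite /fn patchE; case: ifPn => _ //.
    by rewrite abse0; exact: abse_ge0.
have h0 : (\int[mu]_x fn n x)%E @[n --> \oo] --> (0 : \bar R)%E.
  have e : (F n%:R - F (- n%:R))%:E @[n --> \oo] --> ((0 : R) - 0)%:E.
    by apply: cvg_EFin; [exact: nearW|exact: cvgB].
  move: e; rewrite subr0 => e; apply: cvg_trans e; apply: near_eq_cvg.
  by near=> n; rewrite fnE//; near: n; exact: nbhs_infty_gt.
exact: (cvg_unique _ h h0).
Unshelve. all: by end_near. Qed.

End IntegralDerive.

Definition gaussP (R : realType) (s : R) : probability (measurableTypeR R) R :=
  normal_prob 0 s.

Section NormalIntegral.
Context (R : realType).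
Local Notation mu := (@lebesgue_measure R).
Variable s : R.
Hypothesis s0 : s != 0.
Local Notation N := (gaussP s).
Local Notation phi := (normal_pdf 0 s).

(** The Radon-Nikodym derivative of the normal law is almost everywhere its density, because both
    have the same integral over every measurable set. *)
Lemma normal_ge0_integral (f : R -> \bar R) : measurable_fun setT f ->
  (forall x, 0 <= f x)%E -> (\int[N]_x f x = \int[mu]_x (f x * (phi x)%:E))%E.
Proof.
move=> mf f0; have dom := @normal_prob_dominates R 0 s.
rewrite -(Radon_Nikodym_SigmaFinite.change_of_variables dom)//.
apply: ae_eq_integral => //.
- apply: emeasurable_funM => //; apply: (measurable_int mu).
  exact: Radon_Nikodym_SigmaFinite.f_integrable.
- apply: emeasurable_funM => //; apply/measurable_EFinP.
  exact: measurable_normal_pdf.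
- apply: ae_eqe_mul2l; apply: integral_ae_eq => //=.
  + exact: Radon_Nikodym_SigmaFinite.f_integrable.
  + by apply/measurable_EFinP; exact: measurable_normal_pdf.
  + by move=> E _ mE; rewrite -Radon_Nikodym_SigmaFinite.f_integral.
Qed.

Lemma normal_itg (f : R -> R) : measurable_fun setT f ->
  mu.-integrable setT (fun x => (f x * phi x)%:E) -> itg N f.
Proof.
move=> mf /integrableP[_ hi]; apply/integrableP; split; first exact/measurable_EFinP.
rewrite normal_ge0_integral//; last first.
  by apply: measurableT_comp => //; exact/measurable_EFinP.
move: hi; congr (_ < _)%E; apply: eq_integral => x _.
by rewrite /= normrM (ger0_norm (normal_pdf_ge0 _ _ _)).
Qed.

Lemma normal_Ex (f : R -> R) : itg N f ->
  (Ex N f)%:E = (\int[mu]_x (f x * phi x)%:E)%E.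
Proof.
move=> hf; have mf : measurable_fun setT (EFin \o f) by exact: measurable_int hf.
rewrite -Ex_EFin// integralE normal_ge0_integral//; last 1 first.
  exact: measurable_funepos.
rewrite normal_ge0_integral//; last exact: measurable_funeneg.
rewrite [RHS]integralE; congr (_ - _)%E; apply: eq_integral => x _.
- rewrite !funeposE -!EFin_max -EFinM; congr EFin.
  by rewrite mulrC maxr_pMr ?normal_pdf_ge0// mulr0 mulrC.
- rewrite !funenegE -!EFinN -!EFin_max -EFinM; congr EFin.
  by rewrite mulrC maxr_pMr ?normal_pdf_ge0// mulr0 mulrC mulNr.
Qed.

Lemma normal_pdf0E x : phi x = normal_peak s * expR (- x ^+ 2 / (s ^+ 2 *+ 2)).
Proof. by rewrite normal_pdfE// /normal_fun subr0. Qed.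

Lemma is_derive_normal_pdf (x : R) : is_derive x 1 phi (- x / s ^+ 2 * phi x).
Proof.
apply: (@is_derive_ext _ (fun y => normal_peak s * expR ((- (s ^+ 2 *+ 2)^-1) * y ^+ 2))).
  by move=> y; rewrite normal_pdf0E !mulNr [y ^+ 2 * _]mulrC.
have h := is_derive_scal (- (s ^+ 2 *+ 2)^-1)
  (@is_derive_pow _ id 1 _ _ (is_derive_id x (1 : R))).
have := is_derive_scal (normal_peak s) (is_derive_comp (is_derive_expR _) h).
move=> {}h; apply: (is_derive_conv h).
rewrite normal_pdf0E expr1 mulr1.
rewrite (_ : - (s ^+ 2 *+ 2)^-1 * x ^+ 2 = - x ^+ 2 / (s ^+ 2 *+ 2)); last first.
  by rewrite !mulNr mulrC.
by field.
Qed.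

(** With y = x^2 / (4 s^2) one has x^4 = 16 s^4 y^2 and y^2 exp(-y) <= 4: half of the exponent
    absorbs the polynomial, which leaves the shape of a normal density of doubled variance. *)
Lemma normal_pdf_moment4 (x : R) :
  x ^+ 4 * phi x <= 64 * s ^+ 4 * (normal_peak s * expR (- x ^+ 2 / (s ^+ 2 *+ 4))).
Proof.
rewrite normal_pdf0E; set y := x ^+ 2 / (s ^+ 2 *+ 4).
have s2 : 0 < s ^+ 2 by rewrite exprn_even_gt0.
have E1 : - x ^+ 2 / (s ^+ 2 *+ 2) = - y - y by rewrite /y; field.
have E2 : - x ^+ 2 / (s ^+ 2 *+ 4) = - y by rewrite /y mulNr.
rewrite E1 E2 expRD.
have -> : x ^+ 4 = 16 * s ^+ 4 * y ^+ 2 by rewrite /y; field.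
have y0 : 0 <= y by rewrite divr_ge0// ?sqr_ge0// pmulrn_lge0// ltW.
have h1 : y ^+ 2 * expR (- y) <= 4.
  rewrite expRN ler_pdivrMr ?expR_gt0//.
  have := expR_ge1Dx (y / 2); have -> : expR y = expR (y / 2) ^+ 2.
    by rewrite -expRM_natl; congr expR; field.
  nra.
have p0 := normal_peak_ge0 s; have e0 := expR_ge0 (- y).
have s4 : 0 <= s ^+ 4 by rewrite exprn_even_ge0.
rewrite [leLHS](_ : _ = (16 * s ^+ 4 * normal_peak s * expR (- y)) * (y ^+ 2 * expR (- y))); last by ring.
rewrite [leRHS](_ : _ = (16 * s ^+ 4 * normal_peak s * expR (- y)) * 4); last by ring.
by apply: ler_wpM2l => //; rewrite mulr_ge0// mulr_ge0// mulr_ge0.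
Qed.

End NormalIntegral.

(** * Gaussian integration by parts *)

Section NormalMoments.
Context (R : realType).
Local Notation mu := (@lebesgue_measure R).
Variable s : R.
Hypothesis s0 : s != 0.
Local Notation N := (gaussP s).
Local Notation phi := (normal_pdf 0 s).

Let K : R := Num.max 1 (64 * s ^+ 4).

Let wide x : R := normal_peak s * expR (- x ^+ 2 / (s ^+ 2 *+ 4)).

Lemma wide_normal_pdf x : wide x = Num.sqrt 2 * normal_pdf 0 (Num.sqrt 2 * s) x.
Proof.
have q0 : Num.sqrt (2 : R) != 0 by rewrite gt_eqF// sqrtr_gt0.
have q2 : Num.sqrt (2 : R) ^+ 2 = 2 by rewrite sqr_sqrtr.
rewrite normal_pdf0E ?mulf_neq0// exprMn q2 mulrA; congr (_ * _).
  rewrite /normal_peak exprMn q2 (_ : 2 * s ^+ 2 * pi *+ 2 = 2 * (s ^+ 2 * pi *+ 2)).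
    by rewrite sqrtrM// invfM mulVKf.
  by ring.
by rewrite (_ : 2 * s ^+ 2 *+ 2 = s ^+ 2 *+ 4)//; ring.
Qed.

Lemma itg_wide : mu.-integrable setT (fun x => (wide x)%:E).
Proof.
have := integrableZl measurableT (Num.sqrt 2) (@integrable_normal_pdf R 0 (Num.sqrt 2 * s)).
by apply: eq_integrable => // x _; rewrite /= wide_normal_pdf.
Qed.

Lemma normal_pdf_growth (f : R -> R) c x : `|f x| <= c * (1 + x ^+ 4) -> 0 <= c ->
  `|f x * phi x| <= c * (1 + K) * wide x.
Proof.
move=> hf c0; have p0 := normal_pdf_ge0 0 s x.
rewrite normrM (ger0_norm p0).
apply: (@le_trans _ _ (c * (1 + x ^+ 4) * phi x)); first exact: ler_wpM2r.
rewrite -!mulrA; apply: ler_wpM2l => //; rewrite !mulrDl !mul1r.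
have w0 : 0 <= wide x by rewrite mulr_ge0 ?normal_peak_ge0 ?expR_ge0.
apply: lerD.
  rewrite normal_pdf0E// /wide; apply: ler_wpM2l; first exact: normal_peak_ge0.
  rewrite ler_expR !mulNr lerN2 ler_wpM2l ?sqr_ge0//.
  have s2 : 0 < s ^+ 2 by rewrite exprn_even_gt0.
  by rewrite lef_pV2 ?posrE ?pmulrn_lgt0//; lra.
apply: le_trans (normal_pdf_moment4 s0 x) _.
by apply: ler_wpM2r => //; rewrite le_max lexx orbT.
Qed.

Lemma normal_growth_itg (f : R -> R) c : measurable_fun setT f -> 0 <= c ->
  (forall x, `|f x| <= c * (1 + x ^+ 4)) ->
  mu.-integrable setT (fun x => (f x * phi x)%:E).
Proof.
move=> mf c0 hf.
have := integrableZl measurableT (c * (1 + K)) itg_wide.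
apply: le_integrable => //.
  by apply/measurable_EFinP/measurable_funM => //; exact: measurable_normal_pdf.
move=> x _; rewrite /= lee_fin; apply: le_trans (normal_pdf_growth (hf x) c0) _.
exact: ler_norm.
Qed.

Lemma normal_growth (f : R -> R) c : measurable_fun setT f -> 0 <= c ->
  (forall x, `|f x| <= c * (1 + x ^+ 4)) -> itg N f.
Proof. by move=> mf c0 hf; apply: normal_itg => //; exact: normal_growth_itg hf. Qed.

Lemma wide_le (n : nat) : (0 < n)%N ->
  wide n%:R <= normal_peak s * (s ^+ 2 *+ 4) * n%:R^-1.
Proof.
move=> n0; rewrite -mulrA /wide; apply: ler_wpM2l; first exact: normal_peak_ge0.
have s2 : 0 < s ^+ 2 by rewrite exprn_even_gt0.
have n1 : (1 : R) <= n%:R by rewrite ler1n.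
set y := (n%:R : R) ^+ 2 / (s ^+ 2 *+ 4); rewrite mulNr -/y expRN.
have y0 : 0 < y by rewrite divr_gt0 ?exprn_gt0 ?pmulrn_lgt0 ?ltr0n.
rewrite -[leRHS]invrK lef_pV2 ?posrE ?expR_gt0//; last first.
  by rewrite invr_gt0 divr_gt0 ?pmulrn_lgt0 ?ltr0n.
apply: (@le_trans _ _ y); last by have := expR_ge1Dx y; lra.
rewrite invf_div /y; apply: ler_wpM2r; first by rewrite invr_ge0 pmulrn_lge0// ltW.
by rewrite expr2 ler_peMl.
Qed.

(** Here e is 1 or -1, which covers both ends of the line. The decay 1/n taken from [wide] is crude
    but kills the boundary terms. *)
Lemma growth_cvg0 (f : R -> R) c (e : R) : e ^+ 2 = 1 -> 0 <= c ->
  (forall x, `|f x| <= c * (1 + x ^+ 4)) ->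
  (f (e * n%:R) * phi (e * n%:R)) @[n --> \oo] --> (0 : R).
Proof.
move=> e2 c0 hf; set B := c * (1 + K) * (normal_peak s * (s ^+ 2 *+ 4)).
have hB : (B * harmonic n) @[n --> \oo] --> (0 : R).
  by rewrite -[X in _ --> X](mulr0 B); apply: cvgM; [exact: cvg_cst|exact: cvg_harmonic].
have hB' : (B * n%:R^-1) @[n --> \oo] --> (0 : R).
  by rewrite -cvg_shiftS; exact: hB.
apply: norm_cvg0; apply: (squeeze_cvgr _ (cvg_cst 0) hB').
near=> n; rewrite normr_ge0 /=.
apply: le_trans (normal_pdf_growth (hf _) c0) _.
rewrite /B -[leRHS]mulrA; apply: ler_wpM2l.
  by rewrite mulr_ge0// addr_ge0// le_max ler01.
have -> : wide (e * n%:R) = wide n%:R by rewrite /wide exprMn e2 mul1r.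
apply: wide_le; near: n; exact: nbhs_infty_gt.
Unshelve. all: by end_near. Qed.

(** The product of g with the density has derivative (g' - x g / s^2) times the density, and it
    vanishes at both ends by the growth bounds. All Gaussian moments and transforms below come from
    this identity. *)
Lemma stein (g g' : R -> R) c : 0 <= c ->
  (forall x : R, is_derive x 1 g (g' x)) -> continuous g' ->
  (forall x, `|g x| <= c * (1 + x ^+ 4)) -> (forall x, `|x * g x| <= c * (1 + x ^+ 4)) ->
  (forall x, `|g' x| <= c * (1 + x ^+ 4)) ->
  Ex N (fun x => x * g x) = s ^+ 2 * Ex N g'.
Proof.
move=> c0 dg cg' hg hxg hg'.
have cg : continuous g by move=> x; exact: is_derive_continuous (dg x).
have mg := continuous_meas cg; have mg' := continuous_meas cg'.
have cphi : continuous (normal_pdf 0 s) by exact: continuous_normal_pdf.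
have mxg : measurable_fun setT (fun x : R => x * g x) by exact: measurable_funM.
have i1 := normal_growth mxg c0 hxg; have i2 := normal_growth mg' c0 hg'.
have j1 := normal_growth_itg mxg c0 hxg; have j2 := normal_growth_itg mg' c0 hg'.
pose f x := (g' x - (s ^+ 2)^-1 * (x * g x)) * phi x.
have dF (x : R) : is_derive x 1 (fun y => g y * phi y) (f x).
  apply: is_derive_conv (is_derive_mul (dg x) (is_derive_normal_pdf s0 x)) _.
  by rewrite /f; field.
have fE x : f x = g' x * phi x - (s ^+ 2)^-1 * (x * g x * phi x) by rewrite /f; ring.
have cf : continuous f.
  move=> x; apply: cvgM; last exact: cphi.
  apply: cvgB; first exact: cg'.
  by apply: cvgM; [exact: cvg_cst|apply: cvgM => //; exact: cg].
have fi : mu.-integrable setT (EFin \o f).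
  have := integrableB measurableT j2 (integrableZl measurableT ((s ^+ 2)^-1) j1).
  by apply: eq_integrable => // x _; rewrite /= fE.
have := integral_derive_eq0 dF cf fi.
have l1 := @growth_cvg0 g c 1 (expr1n _ _) c0 hg.
have N1 : (- 1 : R) ^+ 2 = 1 by rewrite sqrrN expr1n.
have l2 := @growth_cvg0 g c (- 1) N1 c0 hg.
move=> /(_ _ _); set I := (\int[mu]_x _)%E => h.
have : I = 0%E.
  apply: h; [move: l1|move: l2]; apply: cvg_trans; apply: near_eq_cvg; apply: nearW => n.
    by rewrite mul1r.
  by rewrite mulN1r.
rewrite /I; under eq_integral do rewrite fE EFinB.
rewrite integralB//; last exact: (integrableZl measurableT ((s ^+ 2)^-1) j1).
under [X in (_ - X)%E]eq_integral do rewrite EFinM.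
rewrite integralZl// -!normal_Ex// -EFinM -EFinB => -[] /eqP.
rewrite subr_eq0 => /eqP ->; rewrite mulrA mulfV ?mul1r// expf_neq0//.
Qed.

End NormalMoments.

Section Trig.
Context (R : realType) (d : measure_display) (T : measurableType d)
  (P : probability T R).

Lemma abs_sin_le1 (x : R) : `|sin x| <= 1.
Proof. by rewrite ler_norml sin_geN1 sin_le1. Qed.

Lemma abs_cos_le1 (x : R) : `|cos x| <= 1.
Proof. by rewrite ler_norml cos_geN1 cos_le1. Qed.

Lemma meas_cos (f : T -> R) : measurable_fun setT f ->
  measurable_fun setT (fun x => cos (f x)).
Proof. by move=> mf; apply: measurableT_comp mf; exact: continuous_meas (@continuous_cos R). Qed.

Lemma meas_sin (f : T -> R) : measurable_fun setT f ->
  measurable_fun setT (fun x => sin (f x)).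
Proof. by move=> mf; apply: measurableT_comp mf; exact: continuous_meas (@continuous_sin R). Qed.

Lemma itg_cos (f : T -> R) : measurable_fun setT f -> itg P (fun x => cos (f x)).
Proof.
move=> mf; apply: (@itg_bounded _ _ _ _ _ 1); first exact: meas_cos.
by move=> x; exact: abs_cos_le1.
Qed.

Lemma itg_sin (f : T -> R) : measurable_fun setT f -> itg P (fun x => sin (f x)).
Proof.
move=> mf; apply: (@itg_bounded _ _ _ _ _ 1); first exact: meas_sin.
by move=> x; exact: abs_sin_le1.
Qed.

End Trig.

Section NormalFourier.
Context (R : realType).
Variable s : R.
Hypothesis s0 : s != 0.
Local Notation N := (gaussP s).

Lemma continuous_pow n : continuous (fun x : R => x ^+ n).
Proof. exact: exprn_continuous. Qed.

Lemma abs_le_1p4 (x : R) : `|x| <= 1 + x ^+ 4.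
Proof.
have -> : x ^+ 4 = `|x| ^+ 4 by rewrite -normrX ger0_norm// exprn_even_ge0.
have : 0 <= `|x| by []. move: (`|x| : R) => y y0.
have := sqr_ge0 (y ^+ 2 - 1); have := sqr_ge0 (y - 1); nra.
Qed.

Lemma sqr_le_1p4 (x : R) : x ^+ 2 <= 1 + x ^+ 4.
Proof. have := sqr_ge0 (x ^+ 2 - 1); nra. Qed.

Lemma cube_le_1p4 (x : R) : `|x ^+ 3| <= 1 + x ^+ 4.
Proof.
rewrite normrX; have -> : x ^+ 4 = `|x| ^+ 4 by rewrite -normrX ger0_norm// exprn_even_ge0.
have : 0 <= `|x| by []. move: (`|x| : R) => y y0.
have := sqr_ge0 (y ^+ 2 - 1); have := sqr_ge0 (y - 1); have := sqr_ge0 (y * (y - 1)); nra.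
Qed.

Lemma one_le_1p4 (x : R) : 1 <= 1 + x ^+ 4.
Proof. by rewrite lerDl exprn_even_ge0. Qed.

Lemma normal_moment4 : L4 N (fun x => x).
Proof.
split => //; apply: (@normal_growth _ _ s0 _ 1) => //.
by move=> x; rewrite mul1r ger0_norm ?exprn_even_ge0// lerDr.
Qed.

Lemma normal_mean : Ex N (fun x => x) = 0.
Proof.
transitivity (Ex N (fun x : R => x * 1)); first by apply: eq_Ex => x; rewrite mulr1.
transitivity (s ^+ 2 * Ex N (fun=> 0)); last by rewrite Ex_cst mulr0.
apply: (@stein _ _ s0 (fun=> 1) (fun=> 0) 1 ler01).
- by move=> x; exact: cvg_cst.
- by move=> x; rewrite normr1 mul1r one_le_1p4.
- by move=> x; rewrite mulr1 mul1r abs_le_1p4.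
- by move=> x; rewrite normr0 mul1r (le_trans _ (one_le_1p4 x)).
Qed.

Lemma normal_var : Ex N (fun x => x ^+ 2) = s ^+ 2.
Proof.
transitivity (Ex N (fun x : R => x * id x)) => //.
transitivity (s ^+ 2 * Ex N (fun=> 1)); last by rewrite Ex_cst mulr1.
apply: (@stein _ _ s0 id (fun=> 1) 1 ler01).
- by move=> x; exact: cvg_cst.
- by move=> x; rewrite mul1r abs_le_1p4.
- by move=> x; rewrite mul1r -expr2 ger0_norm ?sqr_ge0// sqr_le_1p4.
- by move=> x; rewrite normr1 mul1r one_le_1p4.
Qed.

Lemma normal_mean4 : Ex N (fun x => x ^+ 4) = 3 * s ^+ 4.
Proof.
transitivity (Ex N (fun x : R => x * x ^+ 3)); first by apply: eq_Ex => x; rewrite -exprS.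
transitivity (s ^+ 2 * Ex N (fun x : R => 3 * x ^+ 2)); last first.
  rewrite ExZ ?normal_var; [by ring|exact: L4_sqr normal_moment4].
apply: (@stein _ _ s0 (fun x => x ^+ 3) (fun x => 3 * x ^+ 2) 3 (ler0n _ _)).
- by move=> x; apply: is_derive_conv (@is_derive_pow _ id 2 _ _ (is_derive_id x _)) _; rewrite mulr1.
- by move=> x; apply: cvgM; [exact: cvg_cst|exact: continuous_pow].
- move=> x; apply: le_trans (cube_le_1p4 x) _; have := one_le_1p4 x; lra.
- move=> x; rewrite -exprS ger0_norm ?exprn_even_ge0//.
  have : 0 <= x ^+ 4 by rewrite exprn_even_ge0.
  lra.
- by move=> x; rewrite normrM ger0_norm// ler_wpM2l// ger0_norm ?sqr_ge0// sqr_le_1p4.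
Qed.

Lemma derive_under (f f' : R -> R -> R) (G : R -> R) (a : R) :
  (forall u, itg N (f u)) -> (forall u x : R, is_derive u 1 (fun v => f v x) (f' u x)) ->
  itg N G -> (forall u x, `|u - a| < 1 -> `|f' u x| <= G x) ->
  is_derive a 1 (fun u => Ex N (f u)) (Ex N (f' a)).
Proof.
move=> hf df hG fG.
have Ia : `]a - 1, a + 1[%classic a by rewrite /= in_itv /= ltrBlDr !ltrDl ltr01.
have G0 x : 0 <= G x by apply: le_trans (fG a x _); rewrite ?subrr ?normr0.
have Gub x y : `]a - 1, a + 1[%classic x -> setT y -> `|partial1of2 f x y| <= G y.
  rewrite /= in_itv /= => /andP[h1 h2] _.
  rewrite /partial1of2 (derive1_is (df x y)); apply: fG.
  by rewrite ltr_norml; apply/andP; split; lra.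
have D x y : `]a - 1, a + 1[%classic x -> setT y -> derivable (f ^~ y) x 1.
  by move=> _ _; have h := df x y; exact: ex_derive.
have F0 (x : R) : `]a - 1, a + 1[%classic x -> N.-integrable setT (EFin \o f x) by move=> _; exact: hf.
apply: DeriveDef.
  exact: (@derivable_under_integral _ _ _ N f setT measurableT a (a - 1) (a + 1) Ia F0 D G G0 hG Gub).
rewrite -derive1E (@differentiation_under_integral _ _ _ N f setT measurableT a (a - 1) (a + 1) Ia F0 D G G0 hG Gub).
by apply: eq_Ex => x; rewrite /partial1of2 (derive1_is (df a x)).
Qed.

Lemma is_derive_lin (c x : R) : is_derive x 1 (fun y => c * y) c.
Proof. by apply: is_derive_conv (is_derive_scal c (is_derive_id x _)) _; rewrite mulr1. Qed.

(** The product f(u) exp(s^2 u^2 / 2) has derivative zero. *)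
Lemma ode_gauss (f : R -> R) : (forall u : R, is_derive u 1 f (- s ^+ 2 * u * f u)) ->
  forall u, f u = f 0 * expR (- s ^+ 2 * u ^+ 2 / 2).
Proof.
move=> df u; pose g v := f v * expR ((s ^+ 2 / 2) * v ^+ 2).
have dg (v : R) : is_derive v 1 g 0.
  have h := is_derive_scal (s ^+ 2 / 2) (@is_derive_pow _ id 1 _ _ (is_derive_id v _)).
  apply: is_derive_conv (is_derive_mul (df v) (is_derive_comp (is_derive_expR _) h)) _.
  by field.
have := is_derive0_cst u 0 dg; rewrite /g expr0n mulr0 expR0 mulr1 => <-.
rewrite -mulrA -expRD (_ : _ + _ = 0) ?expR0 ?mulr1//.
by field.
Qed.

(** Differentiating under the expectation and applying Stein's identity to -sin(v x) gives the
    differential equation of [ode_gauss]. *)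
Lemma normal_cos u : Ex N (fun x => cos (u * x)) = expR (- s ^+ 2 * u ^+ 2 / 2).
Proof.
pose f u := Ex N (fun x => cos (u * x)).
have ml v : measurable_fun setT (fun x : R => v * x) by exact: measurable_funM.
have df (v : R) : is_derive v 1 f (- s ^+ 2 * v * f v).
  have h1 : Ex N (fun x => - x * sin (v * x)) = - s ^+ 2 * v * f v.
    have -> : Ex N (fun x => - x * sin (v * x)) = Ex N (fun x => x * - sin (v * x)).
      by apply: eq_Ex => x; ring.
    transitivity (s ^+ 2 * Ex N (fun x => - v * cos (v * x))); last first.
      rewrite ExZ; first by rewrite /f; ring.
      by apply: itg_cos; exact: ml.
    apply: (@stein _ _ s0 (fun x => - sin (v * x)) (fun x => - v * cos (v * x)) (1 + `|v|)).
    - by rewrite addr_ge0.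
    - move=> x; have h := is_derive_comp (is_derive_sin _) (is_derive_lin v x).
      by apply: is_derive_conv (is_deriveN h) _; rewrite mulrC mulNr.
    - move=> x; apply: cvgM; first exact: cvg_cst.
      apply: continuous_comp; last exact: continuous_cos.
      by apply: cvgM; [exact: cvg_cst|].
    - move=> x; rewrite normrN; apply: le_trans (abs_sin_le1 _) _.
      by have := one_le_1p4 x; have : 0 <= `|v| by []; nra.
    - move=> x; rewrite normrM normrN; apply: (@le_trans _ _ (`|x| * 1)); first by rewrite ler_wpM2l// abs_sin_le1.
      by have := abs_le_1p4 x; have := one_le_1p4 x; have : 0 <= `|v| by []; nra.
    - move=> x; rewrite normrM normrN; apply: (@le_trans _ _ (`|v| * 1)); first by rewrite ler_wpM2l// abs_cos_le1.
      by have := one_le_1p4 x; have : 0 <= `|v| by []; nra.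
  rewrite -h1; apply: (@derive_under (fun v x => cos (v * x)) (fun v x => - x * sin (v * x)) (fun x => `|x|)).
  - by move=> w; apply: itg_cos; exact: ml.
  - move=> w x; have hw : is_derive w 1 (fun z => z * x) x.
      by apply: is_derive_ext (is_derive_lin x w) => z; rewrite mulrC.
    by apply: is_derive_conv (is_derive_comp (is_derive_cos _) hw) _; ring.
  - exact: itg_abs (L4_itg normal_moment4).
  - by move=> w x _; rewrite normrM normrN ler_piMr// abs_sin_le1.
rewrite -[LHS]/(f u) (ode_gauss df) /f.
rewrite (@eq_Ex _ _ _ N (fun x : R => cos (0 * x)) (fun=> 1)) ?Ex_cst ?mul1r//.
by move=> x; rewrite mul0r cos0.
Qed.

Lemma normal_sin u : Ex N (fun x => sin (u * x)) = 0.
Proof.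
pose f u := Ex N (fun x => sin (u * x)).
have ml v : measurable_fun setT (fun x : R => v * x) by exact: measurable_funM.
have df (v : R) : is_derive v 1 f (- s ^+ 2 * v * f v).
  have h1 : Ex N (fun x => x * cos (v * x)) = - s ^+ 2 * v * f v.
    transitivity (s ^+ 2 * Ex N (fun x => - v * sin (v * x))); last first.
      rewrite ExZ; first by rewrite /f; ring.
      by apply: itg_sin; exact: ml.
    apply: (@stein _ _ s0 (fun x => cos (v * x)) (fun x => - v * sin (v * x)) (1 + `|v|)).
    - by rewrite addr_ge0.
    - move=> x; have h := is_derive_comp (is_derive_cos _) (is_derive_lin v x).
      by apply: is_derive_conv h _; ring.
    - move=> x; apply: cvgM; first exact: cvg_cst.
      apply: continuous_comp; last exact: continuous_sin.
      by apply: cvgM; [exact: cvg_cst|].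
    - move=> x; apply: le_trans (abs_cos_le1 _) _.
      by have := one_le_1p4 x; have : 0 <= `|v| by []; nra.
    - move=> x; rewrite normrM; apply: (@le_trans _ _ (`|x| * 1)); first by rewrite ler_wpM2l// abs_cos_le1.
      by have := abs_le_1p4 x; have := one_le_1p4 x; have : 0 <= `|v| by []; nra.
    - move=> x; rewrite normrM normrN; apply: (@le_trans _ _ (`|v| * 1)); first by rewrite ler_wpM2l// abs_sin_le1.
      by have := one_le_1p4 x; have : 0 <= `|v| by []; nra.
  rewrite -h1; apply: (@derive_under (fun v x => sin (v * x)) (fun v x => x * cos (v * x)) (fun x => `|x|)).
  - by move=> w; apply: itg_sin; exact: ml.
  - move=> w x; have hw : is_derive w 1 (fun z => z * x) x.
      by apply: is_derive_ext (is_derive_lin x w) => z; rewrite mulrC.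
    by apply: is_derive_conv (is_derive_comp (is_derive_sin _) hw) _; ring.
  - exact: itg_abs (L4_itg normal_moment4).
  - by move=> w x _; rewrite normrM ler_piMr// abs_cos_le1.
rewrite -[LHS]/(f u) (ode_gauss df) /f.
rewrite (@eq_Ex _ _ _ N (fun x : R => sin (0 * x)) (fun=> 0)) ?Ex_cst ?mul0r//.
by move=> x; rewrite mul0r sin0.
Qed.

End NormalFourier.

(** * The characteristic function of a squared normal variable *)

Section NormalSquare.
Context (R : realType).
Local Notation N := (gaussP (1 : R)).

Let C (t : R) := Ex N (fun x : R => cos (t * x ^+ 2)).
Let S (t : R) := Ex N (fun x : R => sin (t * x ^+ 2)).
Let A (t : R) := Ex N (fun x : R => x ^+ 2 * cos (t * x ^+ 2)).
Let B (t : R) := Ex N (fun x : R => x ^+ 2 * sin (t * x ^+ 2)).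

Let n1 : (1 : R) != 0. Proof. exact: oner_neq0. Qed.

Let mq (t : R) : measurable_fun setT (fun x : R => t * x ^+ 2).
Proof. by apply: measurable_funM => //; exact: exprn_measurable. Qed.

Let is_derive_tx (t x : R) : is_derive x 1 (fun y => t * y ^+ 2) (t * (2 * x)).
Proof.
apply: is_derive_conv (is_derive_scal t (@is_derive_pow _ id 1 _ _ (is_derive_id x _))) _.
by rewrite /= expr1 mulr1.
Qed.

Let continuous_q (t : R) : continuous (fun x : R => t * x ^+ 2).
Proof. by move=> x; apply: cvgM; [exact: cvg_cst|exact: exprn_continuous]. Qed.

Let i2 : itg N (fun x : R => x ^+ 2). Proof. exact: L4_sqr (normal_moment4 n1). Qed.

Let x2cos (t : R) : itg N (fun x : R => x ^+ 2 * cos (t * x ^+ 2)).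
Proof.
apply: itg_le i2 _.
  by apply: measurable_funM; [exact: exprn_measurable|apply: meas_cos; exact: mq].
by move=> x; rewrite normrM ger0_norm ?sqr_ge0// ler_piMr ?sqr_ge0// abs_cos_le1.
Qed.

Let x2sin (t : R) : itg N (fun x : R => x ^+ 2 * sin (t * x ^+ 2)).
Proof.
apply: itg_le i2 _.
  by apply: measurable_funM; [exact: exprn_measurable|apply: meas_sin; exact: mq].
by move=> x; rewrite normrM ger0_norm ?sqr_ge0// ler_piMr ?sqr_ge0// abs_sin_le1.
Qed.

Let dt (x t : R) : is_derive t 1 (fun v => v * x ^+ 2) (x ^+ 2).
Proof. by apply: is_derive_ext (is_derive_lin (x ^+ 2) t) => z; rewrite mulrC. Qed.

Let dC (t : R) : is_derive t 1 C (- B t).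
Proof.
have -> : - B t = Ex N (fun x : R => - (x ^+ 2 * sin (t * x ^+ 2))) by rewrite ExN//; exact: x2sin.
apply: (@derive_under _ 1 (fun v x => cos (v * x ^+ 2)) (fun v x => - (x ^+ 2 * sin (v * x ^+ 2))) (fun x => x ^+ 2)).
- by move=> v; apply: itg_cos; exact: mq.
- move=> v x; apply: is_derive_conv (is_derive_comp (is_derive_cos _) (dt x v)) _; ring.
- exact: i2.
- by move=> v x _; rewrite normrN normrM ger0_norm ?sqr_ge0// ler_piMr ?sqr_ge0// abs_sin_le1.
Qed.

Let dS (t : R) : is_derive t 1 S (A t).
Proof.
apply: (@derive_under _ 1 (fun v x => sin (v * x ^+ 2)) (fun v x => x ^+ 2 * cos (v * x ^+ 2)) (fun x => x ^+ 2)).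
- by move=> v; apply: itg_sin; exact: mq.
- move=> v x; apply: is_derive_conv (is_derive_comp (is_derive_sin _) (dt x v)) _; ring.
- exact: i2.
- by move=> v x _; rewrite normrM ger0_norm ?sqr_ge0// ler_piMr ?sqr_ge0// abs_cos_le1.
Qed.

Let x4 (x : R) : 0 <= x ^+ 4. Proof. by rewrite exprn_even_ge0. Qed.

Let AE (t : R) : A t = C t - 2 * t * B t.
Proof.
transitivity (Ex N (fun x : R => x * (x * cos (t * x ^+ 2)))).
  by apply: eq_Ex => x; rewrite mulrA.
transitivity (1 ^+ 2 * Ex N (fun x : R => cos (t * x ^+ 2) - 2 * t * (x ^+ 2 * sin (t * x ^+ 2)))).
  apply: (@stein _ _ n1 (fun x => x * cos (t * x ^+ 2)) _ (1 + 2 * `|t|)).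
  - by rewrite addr_ge0// mulr_ge0.
  - move=> x; apply: is_derive_conv (is_derive_mul (is_derive_id x _)
      (is_derive_comp (is_derive_cos _) (is_derive_tx t x))) _; ring.
  - move=> x; apply: cvgB; first by apply: continuous_comp; [exact: continuous_q|exact: continuous_cos].
    apply: cvgM; first exact: cvg_cst.
    apply: cvgM; first exact: exprn_continuous.
    by apply: continuous_comp; [exact: continuous_q|exact: continuous_sin].
  - move=> x; rewrite normrM; apply: (@le_trans _ _ (`|x| * 1)); first by rewrite ler_wpM2l// abs_cos_le1.
    by have := abs_le_1p4 x; have := x4 x; have : 0 <= `|t| by []; nra.
  - move=> x; rewrite mulrA -expr2 normrM ger0_norm ?sqr_ge0//.
    apply: (@le_trans _ _ (x ^+ 2 * 1)); first by rewrite ler_wpM2l ?sqr_ge0// abs_cos_le1.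
    by have := sqr_le_1p4 x; have := x4 x; have : 0 <= `|t| by []; nra.
  - move=> x; apply: le_trans (ler_normB _ _) _; rewrite (normrM (2 * t)) (normrM (x ^+ 2)) (normrM 2) (ger0_norm (sqr_ge0 x)) (ger0_norm (ler0n R 2)).
    have := abs_cos_le1 (t * x ^+ 2); have := abs_sin_le1 (t * x ^+ 2).
    have := sqr_ge0 x; have := sqr_le_1p4 x; have := x4 x; have : 0 <= `|t| by [].
    move: (`|t| : R) (`|cos (t * x ^+ 2)| : R) (`|sin (t * x ^+ 2)| : R) => a c e a0 h4 h2 h20 he hc.
    have : x ^+ 2 * e <= 1 + x ^+ 4 by nra.
    nra.
rewrite expr1n mul1r ExB; [|apply: itg_cos; exact: mq|apply: itgZ; exact: x2sin].
by rewrite ExZ//; exact: x2sin.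
Qed.

Let BE (t : R) : B t = S t + 2 * t * A t.
Proof.
transitivity (Ex N (fun x : R => x * (x * sin (t * x ^+ 2)))).
  by apply: eq_Ex => x; rewrite mulrA.
transitivity (1 ^+ 2 * Ex N (fun x : R => sin (t * x ^+ 2) + 2 * t * (x ^+ 2 * cos (t * x ^+ 2)))).
  apply: (@stein _ _ n1 (fun x => x * sin (t * x ^+ 2)) _ (1 + 2 * `|t|)).
  - by rewrite addr_ge0// mulr_ge0.
  - move=> x; apply: is_derive_conv (is_derive_mul (is_derive_id x _)
      (is_derive_comp (is_derive_sin _) (is_derive_tx t x))) _; ring.
  - move=> x; apply: cvgD; first by apply: continuous_comp; [exact: continuous_q|exact: continuous_sin].
    apply: cvgM; first exact: cvg_cst.
    apply: cvgM; first exact: exprn_continuous.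
    by apply: continuous_comp; [exact: continuous_q|exact: continuous_cos].
  - move=> x; rewrite normrM; apply: (@le_trans _ _ (`|x| * 1)); first by rewrite ler_wpM2l// abs_sin_le1.
    by have := abs_le_1p4 x; have := x4 x; have : 0 <= `|t| by []; nra.
  - move=> x; rewrite mulrA -expr2 normrM ger0_norm ?sqr_ge0//.
    apply: (@le_trans _ _ (x ^+ 2 * 1)); first by rewrite ler_wpM2l ?sqr_ge0// abs_sin_le1.
    by have := sqr_le_1p4 x; have := x4 x; have : 0 <= `|t| by []; nra.
  - move=> x; apply: le_trans (ler_normD _ _) _; rewrite (normrM (2 * t)) (normrM (x ^+ 2)) (normrM 2) (ger0_norm (sqr_ge0 x)) (ger0_norm (ler0n R 2)).
    have := abs_cos_le1 (t * x ^+ 2); have := abs_sin_le1 (t * x ^+ 2).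
    have := sqr_ge0 x; have := sqr_le_1p4 x; have := x4 x; have : 0 <= `|t| by [].
    move: (`|t| : R) (`|cos (t * x ^+ 2)| : R) (`|sin (t * x ^+ 2)| : R) => a c e a0 h4 h2 h20 he hc.
    have : x ^+ 2 * c <= 1 + x ^+ 4 by nra.
    nra.
rewrite expr1n mul1r ExD; [|apply: itg_sin; exact: mq|apply: itgZ; exact: x2cos].
by rewrite ExZ//; exact: x2cos.
Qed.

(* With phi = C + i S, Stein's identity gives phi' (1 - 2 i t) = i phi. *)
Lemma normal_square_modulus (t : R) :
  (Ex N (fun x : R => cos (t * x ^+ 2)) ^+ 2 + Ex N (fun x : R => sin (t * x ^+ 2)) ^+ 2) ^+ 2
    * (1 + 4 * t ^+ 2) = 1.
Proof.
pose m v := C v * C v + S v * S v.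
(* [m] is the squared modulus of the characteristic function of x^2, so constancy of [g] says that
   its fourth power of modulus is 1 / (1 + 4 v^2); fourth powers avoid all roots. *)
pose g v := (m v * m v) * (1 + 4 * v ^+ 2).
have dg (v : R) : is_derive v 1 g 0.
  have dm := is_derive_add (is_derive_mul (dC v) (dC v)) (is_derive_mul (dS v) (dS v)).
  have dq := is_derive_add (is_derive_cst (1 : R) v (1 : R)) (is_derive_tx 4 v).
  apply: is_derive_conv (is_derive_mul (is_derive_mul dm dm) dq) _.
  have v0 : 1 + 4 * v ^+ 2 != 0 by rewrite gt_eqF// ltr_pwDl// mulr_ge0// sqr_ge0.
  (* The two Stein relations form a linear system in A and B with determinant 1 + 4 v^2. *)
  have eA : A v = (C v - 2 * v * S v) / (1 + 4 * v ^+ 2).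
    apply: (mulIf v0); rewrite divfK//; have := AE v; rewrite BE => e.
    by rewrite mulrDr mulr1 {1}e; ring.
  have eB : B v = (S v + 2 * v * C v) / (1 + 4 * v ^+ 2).
    by rewrite BE eA; field.
  rewrite eA eB /m /cst /=; field.
  exact: v0.
have := is_derive0_cst t 0 dg; rewrite /g /m expr0n mulr0 addr0 mulr1.
have -> : C 0 = 1 by rewrite /C -[RHS](@Ex_cst _ _ _ N); apply: eq_Ex => x; rewrite mul0r cos0.
have -> : S 0 = 0 by rewrite /S -[RHS](@Ex_cst _ _ _ N); apply: eq_Ex => x; rewrite mul0r sin0.
by rewrite !mulr1 mulr0 addr0 mulr1 -!expr2 => ->.
Qed.

End NormalSquare.

Lemma Ex_fst (R : realType) d d' (S : measurableType d) (T : measurableType d')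
  (P : probability S R) (Q : probability T R) (f : S -> R) :
  itg P f -> Ex (prodP P Q) (fun z => f z.1) = Ex P f.
Proof.
move=> hf; rewrite Ex_prod; last exact: itg_fst.
by apply: eq_Ex => x /=; rewrite Ex_cst.
Qed.

Lemma Ex_snd (R : realType) d d' (S : measurableType d) (T : measurableType d')
  (P : probability S R) (Q : probability T R) (g : T -> R) :
  itg Q g -> Ex (prodP P Q) (fun z => g z.2) = Ex Q g.
Proof.
move=> hg; rewrite Ex_prod; last exact: itg_snd.
by rewrite /= Ex_cst.
Qed.

Lemma eq_measure_Ex (R : realType) d (T : measurableType d) (P Q : probability T R)
  (f : T -> R) : (forall A, measurable A -> P A = Q A) -> Ex P f = Ex Q f.
Proof.
move=> h; rewrite /Ex /Rintegral; congr fine; apply: eq_measure_integral => A mA _.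
exact: h.
Qed.

(** * Moments of a sum of two independent variables *)

Section IndepSum.
Context (R : realType) d d' (S : measurableType d) (T : measurableType d')
  (P : probability S R) (Q : probability T R) (f : S -> R) (g : T -> R).

Hypotheses (f4 : L4 P f) (g4 : L4 Q g).

Lemma indep_sum1 : Ex (prodP P Q) (fun z => f z.1 + g z.2) = Ex P f + Ex Q g.
Proof.
have f1 := L4_itg f4; have g1 := L4_itg g4.
by rewrite (ExD (itg_fst Q f1) (itg_snd P g1)) (Ex_fst Q f1) (Ex_snd P g1).
Qed.

Hypotheses (f0 : Ex P f = 0) (g0 : Ex Q g = 0).

Lemma indep_sum2 : Ex (prodP P Q) (fun z => (f z.1 + g z.2) ^+ 2) =
  Ex P (fun x => f x ^+ 2) + Ex Q (fun x => g x ^+ 2).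
Proof.
have f1 := L4_itg f4; have g1 := L4_itg g4; have f2 := L4_sqr f4; have g2 := L4_sqr g4.
transitivity (Ex (prodP P Q) (fun z => f z.1 ^+ 2 + g z.2 ^+ 2 + 2 * (f z.1 * g z.2))).
  by apply: eq_Ex => z; ring.
have t := itg_tensor f1 g1; have F := itg_fst Q f2; have G := itg_snd P g2.
rewrite (ExD (itgD F G) (itgZ 2 t)) (ExZ 2 t) (ExD F G) (Ex_tensor f1 g1) f0 mul0r mulr0 addr0.
by rewrite (Ex_fst Q f2) (Ex_snd P g2).
Qed.

(** In the binomial expansion every mixed term of odd degree contains a first power, whose mean is
    zero. *)
Lemma indep_sum4 : Ex (prodP P Q) (fun z => (f z.1 + g z.2) ^+ 4) =
  Ex P (fun x => f x ^+ 4) + 6 * (Ex P (fun x => f x ^+ 2) * Ex Q (fun x => g x ^+ 2))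
  + Ex Q (fun x => g x ^+ 4).
Proof.
have f1 := L4_itg f4; have g1 := L4_itg g4; have f2 := L4_sqr f4; have g2 := L4_sqr g4.
have f3 := L4_cube f4; have g3 := L4_cube g4; have F := itg_fst Q f4.2; have G := itg_snd P g4.2.
have t22 := itg_tensor f2 g2; have t31 := itg_tensor f3 g1; have t13 := itg_tensor f1 g3.
transitivity (Ex (prodP P Q) (fun z => (f z.1 ^+ 4 + g z.2 ^+ 4) + (6 * (f z.1 ^+ 2 * g z.2 ^+ 2)
   + (4 * (f z.1 ^+ 3 * g z.2) + 4 * (f z.1 * g z.2 ^+ 3))))).
  by apply: eq_Ex => z; ring.
rewrite (ExD (itgD F G) (itgD (itgZ 6 t22) (itgD (itgZ 4 t31) (itgZ 4 t13)))).
rewrite (ExD (itgZ 6 t22) (itgD (itgZ 4 t31) (itgZ 4 t13))) (ExD (itgZ 4 t31) (itgZ 4 t13)).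
rewrite (ExZ 6 t22) (ExZ 4 t31) (ExZ 4 t13) (Ex_tensor f2 g2) (Ex_tensor f3 g1) (Ex_tensor f1 g3).
rewrite f0 g0 mulr0 mul0r mulr0 !addr0 (ExD F G).
rewrite (Ex_fst Q f4.2) (Ex_snd P g4.2).
by rewrite addrAC.
Qed.

End IndepSum.

(** * Gaussian vectors *)

Section GaussianScalar.
Context (R : realType).

(** The consequences of f ~ N(0, v) that the argument consumes: transform and moments of orders 1, 2
    and 4. They pass to independent sums without any identification of laws, and v = 0 is
    allowed. *)
Definition gsc d (T : measurableType d) (P : probability T R) (f : T -> R) (v : R) : Prop :=
  [/\ L4 P f, Ex P (fun x => cos (f x)) = expR (- v / 2), Ex P (fun x => sin (f x)) = 0
    & [/\ Ex P f = 0, Ex P (fun x => f x ^+ 2) = v & Ex P (fun x => f x ^+ 4) = 3 * v ^+ 2]].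

Lemma gsc_cst0 d (T : measurableType d) (P : probability T R) : gsc P (fun=> 0) 0.
Proof.
split; first exact: L4_cst.
- by rewrite Ex_cst cos0 oppr0 mul0r expR0.
- by rewrite Ex_cst sin0.
- by split; rewrite Ex_cst ?expr0n//= mulr0.
Qed.

Lemma gsc_ext d (T : measurableType d) (P : probability T R) (f g : T -> R) (v w : R) :
  f =1 g -> v = w -> gsc P f v -> gsc P g w.
Proof. by move=> /funext -> ->. Qed.

Lemma gsc_gauss (c : R) : gsc (gaussP (1 : R)) (fun x : R => c * x) (c ^+ 2).
Proof.
have n1 := oner_neq0 R; have h4 := normal_moment4 n1.
split; first exact: (L4Z c h4).
- by rewrite (normal_cos n1) expr1n mulN1r.
- exact: (normal_sin n1).
- split.
  + by rewrite ExZ ?(normal_mean n1) ?mulr0//; exact: L4_itg h4.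
  + under eq_Ex do rewrite exprMn.
    by rewrite ExZ ?(normal_var n1) ?expr1n ?mulr1//; exact: L4_sqr h4.
  + under eq_Ex do rewrite exprMn.
    by rewrite ExZ ?(normal_mean4 n1) ?expr1n ?mulr1 -?exprM 1?mulrC//; exact: h4.2.
Qed.

Lemma gsc_law d d' (S : measurableType d) (T : measurableType d') (P : probability S R)
  (phi : S -> T) (mphi : measurable_fun setT phi) (f : T -> R) v :
  measurable_fun setT f -> gsc P (f \o phi) v -> gsc (law P mphi) f v.
Proof.
move=> mf [h4 hc hs [h1 h2 h3]]; split; first exact/L4_comp.
- by rewrite Ex_law//; [exact: meas_cos|apply: itg_cos; exact: h4.1].
- by rewrite Ex_law//; [exact: meas_sin|apply: itg_sin; exact: h4.1].
- split; rewrite Ex_law//; first exact: L4_itg h4.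
  + exact: measurable_funX.
  + exact: L4_sqr h4.
  + exact: measurable_funX.
  + exact: h4.2.
Qed.

Lemma gsc_add d d' (S : measurableType d) (T : measurableType d') (P : probability S R)
  (Q : probability T R) (f : S -> R) (g : T -> R) v w :
  gsc P f v -> gsc Q g w -> gsc (prodP P Q) (fun z => f z.1 + g z.2) (v + w).
Proof.
move=> [f4 fc fs [f1 f2 f3]] [g4 gc gs [g1 g2 g3]].
have F4 := L4_fst Q f4; have G4 := L4_snd P g4.
have mf := f4.1; have mg := g4.1.
have ic := itg_cos P mf; have is_ := itg_sin P mf.
have jc := itg_cos Q mg; have js := itg_sin Q mg.
split; first exact: L4D.
- under eq_Ex do rewrite cosD.
  rewrite (ExB (itg_tensor ic jc) (itg_tensor is_ js)) (Ex_tensor ic jc) (Ex_tensor is_ js).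
  by rewrite fc fs gc gs mul0r subr0 -expRD; congr expR; ring.
- under eq_Ex do rewrite sinD.
  rewrite (ExD (itg_tensor is_ jc) (itg_tensor ic js)) (Ex_tensor is_ jc) (Ex_tensor ic js).
  by rewrite fs gs mul0r mulr0 addr0.
- split; first by rewrite indep_sum1// f1 g1 addr0.
  + by rewrite indep_sum2// f2 g2.
  + by rewrite indep_sum4// f2 g2 f3 g3; ring.
Qed.

End GaussianScalar.

Section GaussN.
Context (R : realType).
Local Notation TR m := (m.-tuple (measurableTypeR R)).

Definition consT m (z : measurableTypeR R * TR m) : TR m.+1 := [tuple of z.1 :: z.2].

Lemma measurable_consT m : measurable_fun setT (@consT m).
Proof.
exact: (@measurable_cons _ _ (measurableTypeR R * TR m)%type (measurableTypeR R) fst m snd).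
Qed.

(** Built one coordinate at a time, so that Fubini's theorem proceeds by induction on the
    dimension. *)
Fixpoint gaussN m : probability (TR m) R :=
  match m with
  | 0 => dirac [tuple]
  | m'.+1 => law (prodP (gaussP (1 : R)) (gaussN m')) (@measurable_consT m')
  end.

Definition linT m (u : 'I_m -> R) (t : TR m) : R := \sum_(k < m) u k * tnth t k.

Lemma measurable_linT m (u : 'I_m -> R) : measurable_fun setT (linT u).
Proof.
apply: measurable_sum => k; apply: measurable_funM => //.
exact: measurable_tnth.
Qed.

Lemma linT_cons m (u : 'I_m.+1 -> R) z :
  linT u (consT z) = u ord0 * z.1 + linT (fun k => u (lift ord0 k)) z.2.
Proof.
rewrite /linT big_ord_recl; congr (_ + _).
by apply: eq_bigr => k _; rewrite tnthS.
Qed.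

Lemma gsc_gaussN m (u : 'I_m -> R) : gsc (gaussN m) (linT u) (\sum_(k < m) u k ^+ 2).
Proof.
elim: m u => [|m IH] u.
  apply: gsc_ext (gsc_cst0 _); last by rewrite big_ord0.
  by move=> t; rewrite /linT big_ord0.
apply: gsc_law; first exact: measurable_linT.
apply: gsc_ext (gsc_add (gsc_gauss (u ord0)) (IH (fun k => u (lift ord0 k)))).
  by move=> z; rewrite /= linT_cons.
by rewrite big_ord_recl.
Qed.

Definition colT m (t : TR m) : 'cV[R]_m := \col_k tnth t k.

(** The analogue of [centered_gaussian] with [gsc] in place of the law of each linear functional; no
    nondegeneracy is required of [Sigma]. *)
Definition gvec d d' (T : measurableType d') (P : probability T R)
    (Z : T -> 'cV[R]_d) (Sigma : 'M[R]_d) : Prop :=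
  forall u : 'cV[R]_d, gsc P (fun w => (u^T *m Z w) 0 0) ((u^T *m Sigma *m u) 0 0).

Lemma gvec_gaussN d m (A : 'M[R]_(d, m)) :
  gvec (gaussN m) (fun t => A *m colT t) (A *m A^T).
Proof.
move=> u; apply: gsc_ext (gsc_gaussN (fun k => (u^T *m A) 0 k)).
  by move=> t; rewrite /linT mulmxA [RHS]mxE; apply: eq_bigr => k _; rewrite [colT t k 0]mxE.
rewrite mulmxA -mulmxA -[A^T *m u]trmxK trmx_mul trmxK [RHS]mxE.
by apply: eq_bigr => k _; rewrite [_^T k 0]mxE expr2.
Qed.

Lemma gvec_add d d1 d2 (T1 : measurableType d1) (T2 : measurableType d2)
    (P1 : probability T1 R) (P2 : probability T2 R)
    (Z1 : T1 -> 'cV[R]_d) (Z2 : T2 -> 'cV[R]_d) (S1 S2 : 'M[R]_d) :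
  gvec P1 Z1 S1 -> gvec P2 Z2 S2 ->
  gvec (prodP P1 P2) (fun z => Z1 z.1 + Z2 z.2) (S1 + S2).
Proof.
move=> h1 h2 u; apply: gsc_ext (gsc_add (h1 u) (h2 u)).
  by move=> z; rewrite mulmxDr [RHS]mxE.
by rewrite mulmxDr mulmxDl [RHS]mxE.
Qed.

Lemma gvec_cst0 d d' (T : measurableType d') (P : probability T R) :
  gvec P (fun=> 0 : 'cV[R]_d) 0.
Proof.
move=> u; apply: gsc_ext (gsc_cst0 P); first by move=> x; rewrite mulmx0 mxE.
by rewrite mulmx0 mul0mx mxE.
Qed.

Lemma coord_lin d (z : 'cV[R]_d) k : ((delta_mx k 0 : 'cV[R]_d)^T *m z) 0 0 = z k 0.
Proof. by rewrite trmx_delta -rowE mxE. Qed.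

Lemma gvec_meas d d' (T : measurableType d') (P : probability T R)
    (Z : T -> 'cV[R]_d) Sigma : gvec P Z Sigma -> forall k, L4 P (fun w => Z w k 0).
Proof.
move=> h k; have [h4 _ _ _] := h (delta_mx k 0).
by apply: L4_ext h4 => w; rewrite coord_lin.
Qed.

Lemma gvec_cov d d' (T : measurableType d') (P : probability T R)
    (Z : T -> 'cV[R]_d) Sigma : gvec P Z Sigma ->
  forall k, Ex P (fun w => Z w k 0) = 0 /\ Ex P (fun w => Z w k 0 ^+ 2) = Sigma k k
     /\ Ex P (fun w => Z w k 0 ^+ 4) = 3 * Sigma k k ^+ 2.
Proof.
move=> h k; have [h4 _ _ [h1 h2 h3]] := h (delta_mx k 0).
have e : ((delta_mx k 0 : 'cV[R]_d)^T *m Sigma *m (delta_mx k 0 : 'cV[R]_d)) 0 0 = Sigma k k.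
  by rewrite -mulmxA coord_lin -colE mxE.
split; first by rewrite -[RHS]h1; apply: eq_Ex => w; rewrite coord_lin.
split; first by rewrite -e -h2; apply: eq_Ex => w; rewrite coord_lin.
by rewrite -e -h3; apply: eq_Ex => w; rewrite coord_lin.
Qed.

(** The bridge from [centered_gaussian] to cosine transforms, the only distributional information on
    Z_n carried further. The case v = 0 is the Dirac branch of [normal_law]. *)
Lemma meas_normal_law_cos (v : R) d (T : measurableType d) (P : probability T R) (f : T -> R) :
  0 <= v -> measurable_fun setT f ->
  (forall A : set R, measurable A -> P (f @^-1` A) = normal_law 0 v A) ->
  Ex P (fun w => cos (f w)) = expR (- v / 2).
Proof.
move=> v0 mf hf.
have mc : measurable_fun setT (@cos R) by exact: continuous_meas (@continuous_cos R).
have -> : Ex P (fun w => cos (f w)) = Ex (law P (mf : measurable_fun setT (f : T -> measurableTypeR R))) (@cos R).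
  by rewrite Ex_law//; apply: itg_cos.
have [v00|vn0] := eqVneq v 0.
  rewrite v00 oppr0 mul0r expR0.
  have -> : Ex (law P (mf : measurable_fun setT (f : T -> measurableTypeR R))) (@cos R)
      = Ex (\d_(0 : measurableTypeR R)) (@cos R).
    by apply: eq_measure_Ex => A mA; rewrite lawE hf// /normal_law v00 eqxx.
  rewrite /Ex /Rintegral integral_dirac//; last exact/measurable_EFinP.
  by rewrite diracT mul1e /= cos0.
have s0 : Num.sqrt v != 0 by rewrite gt_eqF// sqrtr_gt0 lt_def vn0.
transitivity (Ex (gaussP (Num.sqrt v)) (fun x : R => cos (1 * x))).
  rewrite (@eq_measure_Ex _ _ _ _ (gaussP (Num.sqrt v))).
    by apply: eq_Ex => x; rewrite mul1r.
  by move=> A mA; rewrite lawE hf// /normal_law (negbTE vn0).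
by rewrite (normal_cos s0) sqr_sqrtr// expr1n mulr1.
Qed.

End GaussN.

(** * Laplace transforms of squared norms *)

Section Laplace.
Context (R : realType).
Local Notation TR m := (m.-tuple (measurableTypeR R)).

Definition sqn d (z : 'cV[R]_d) : R := \sum_k z k 0 ^+ 2.

Lemma sqn_ge0 d (z : 'cV[R]_d) : 0 <= sqn z.
Proof. by apply: sumr_ge0 => k _; exact: sqr_ge0. Qed.

Lemma l2norm_le d (z : 'cV[R]_d) (a : R) : 0 <= a -> (l2norm z <= a) = (sqn z <= a ^+ 2).
Proof.
move=> a0; rewrite /l2norm -[X in _ <= X](ger0_norm a0) -sqrtr_sqr ler_sqrt//.
exact: sqr_ge0.
Qed.

Definition meas_vec d d' (T : measurableType d') (Z : T -> 'cV[R]_d) : Prop :=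
  forall k, measurable_fun setT (fun w => Z w k 0).

Lemma measurable_sqn d d' (T : measurableType d') (Z : T -> 'cV[R]_d) :
  meas_vec Z -> measurable_fun setT (fun w => sqn (Z w)).
Proof. by move=> mZ; apply: measurable_sum => k; apply: measurable_funX. Qed.

Section one.
Context d d' (T : measurableType d') (P : probability T R) (Z : T -> 'cV[R]_d).
Hypothesis mZ : meas_vec Z.

(* Averaging the cosine transform over a Gaussian frequency gives the Laplace
   transform of the squared norm. *)
Lemma laplace_sqn (c : R) :
  Ex P (fun w => expR (- (c ^+ 2 * sqn (Z w)) / 2)) =
  Ex (gaussN R d) (fun t => Ex P (fun w => cos (((c *: colT t)^T *m Z w) 0 0))).
Proof.
pose F (z : T * TR d) : R := cos (((c *: colT z.2)^T *m Z z.1) 0 0).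
have FE z : F z = cos (\sum_k (c * Z z.1 k 0) * tnth z.2 k).
  congr cos; rewrite mxE; apply: eq_bigr => k _.
  by rewrite !mxE; ring.
have mF : measurable_fun setT F.
  rewrite (_ : F = fun z => cos (\sum_k (c * Z z.1 k 0) * tnth z.2 k)); last exact/funext.
  apply: meas_cos; apply: measurable_sum => k; apply: measurable_funM.
    by apply: measurable_funM => //; apply: (measurableT_comp (mZ k)).
  by apply: (measurableT_comp (measurable_tnth k)).
have iF : itg (prodP P (gaussN R d)) F.
  by apply: (@itg_bounded _ _ _ _ _ 1) => // z; exact: abs_cos_le1.
rewrite -[RHS](Ex_prod2 iF) (Ex_prod iF); apply: eq_Ex => w.
under eq_Ex do rewrite FE.
have [_ h _ _] := gsc_gaussN (fun k => c * Z w k 0).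
rewrite /linT in h; rewrite h; congr (expR (- _ / 2)).
by rewrite mulr_sumr; apply: eq_bigr => k _; rewrite exprMn.
Qed.

End one.

Section two.
Context d d1 d2 (T1 : measurableType d1) (T2 : measurableType d2)
  (P1 : probability T1 R) (P2 : probability T2 R)
  (Z1 : T1 -> 'cV[R]_d) (Z2 : T2 -> 'cV[R]_d).
Hypotheses (mZ1 : meas_vec Z1) (mZ2 : meas_vec Z2).
Hypothesis same_cos : forall u : 'cV[R]_d,
  Ex P1 (fun w => cos ((u^T *m Z1 w) 0 0)) = Ex P2 (fun w => cos ((u^T *m Z2 w) 0 0)).

Lemma same_laplace (k : R) : 0 <= k ->
  Ex P1 (fun w => expR (- (k * sqn (Z1 w)))) = Ex P2 (fun w => expR (- (k * sqn (Z2 w)))).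
Proof.
move=> k0; pose c := Num.sqrt (2 * k).
have c2 : c ^+ 2 = 2 * k by rewrite sqr_sqrtr// mulr_ge0.
have E y : expR (- (k * y)) = expR (- (c ^+ 2 * y) / 2).
  by congr expR; rewrite c2; field.
under eq_Ex do rewrite E; rewrite (laplace_sqn P1 mZ1).
under [RHS]eq_Ex do rewrite E; rewrite (laplace_sqn P2 mZ2).
by apply: eq_Ex => t; exact: same_cos.
Qed.

Lemma itg_expN d' (T : measurableType d') (P : probability T R) (Z : T -> 'cV[R]_d) (k : R) :
  meas_vec Z -> 0 <= k -> itg P (fun w => expR (- (k * sqn (Z w)))).
Proof.
move=> mZ k0; apply: (@itg_bounded _ _ _ _ _ 1).
  apply: measurableT_comp => //; apply: measurableT_comp => //.
  by apply: measurable_funM => //; exact: measurable_sqn.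
by move=> w; rewrite ger0_norm ?expR_ge0// -expR0 ler_expR oppr_le0 mulr_ge0// sqn_ge0.
Qed.

(** Powers of exp(-k y) are Laplace kernels at the multiples of k, so equality of Laplace transforms
    extends to polynomials in exp(-k y). *)
Lemma same_poly (k : R) (p : {poly R}) : 0 <= k ->
  Ex P1 (fun w => p.[expR (- (k * sqn (Z1 w)))]) = Ex P2 (fun w => p.[expR (- (k * sqn (Z2 w)))]).
Proof.
move=> k0.
have E y : p.[expR (- (k * y))] = \sum_(i < size p) p`_i * expR (- (i%:R * k * y)).
  rewrite horner_coef; apply: eq_bigr => i _; congr (_ * _).
  by rewrite -expRM_natl; congr expR; ring.
under eq_Ex do rewrite E; under [RHS]eq_Ex do rewrite E.
have ik (i : nat) : 0 <= i%:R * k by rewrite mulr_ge0.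
rewrite !Ex_sum; try by move=> i _; apply: itgZ; exact: itg_expN.
by apply: eq_bigr => i _; rewrite !ExZ ?same_laplace//; exact: itg_expN.
Qed.

Lemma bernoulli_pow (x : R) m : 0 <= x <= 1 -> 1 - m%:R * x <= (1 - x) ^+ m.
Proof.
move=> /andP[x0 x1]; elim: m => [|m IH]; first by rewrite mul0r subr0 expr0.
rewrite exprS; apply: (@le_trans _ _ ((1 - x) * (1 - m%:R * x))).
  rewrite -natr1; have : 0 <= (m%:R : R) by []; nra.
by apply: ler_wpM2l => //; lra.
Qed.

(** The induction rests on (1 - x) (1 + (m + 1) x) <= 1 + m x. It makes (1 - x)^m small when m x is
    large, whereas Bernoulli's inequality keeps it near 1 when m x is small. *)
Lemma pow_upper (x : R) m : 0 <= x <= 1 -> (1 - x) ^+ m * (1 + m%:R * x) <= 1.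
Proof.
move=> /andP[x0 x1]; elim: m => [|m IH]; first by rewrite mul0r addr0 expr0 mulr1.
apply: le_trans IH; rewrite exprS -mulrA mulrCA; apply: ler_wpM2l.
  by rewrite exprn_ge0// subr_ge0.
rewrite -natr1; have : 0 <= (m%:R : R) by []; nra.
Qed.

(* y |-> 1 - (1 - exp(-k y))^m is close to the indicator of [0, ln m / k]. *)
Lemma sqn_cdf_le (s s' : R) : 0 <= s -> s < s' ->
  Ex P1 \1_[set w | sqn (Z1 w) <= s] <= Ex P2 \1_[set w | sqn (Z2 w) <= s'].
Proof.
move=> s0 ss'.
have mm d' (T : measurableType d') (Z : T -> 'cV[R]_d) (a : R) : meas_vec Z -> measurable [set w | sqn (Z w) <= a].
  move=> mZ; rewrite -[X in measurable X]setTI.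
  have := measurable_sqn mZ; move=> /(_ measurableT `]-oo, a]%classic (measurable_itv _)).
  by congr measurable; apply/seteqP; split => x /=; rewrite in_itv.
have m1 := mm _ _ _ s mZ1; have m2 := mm _ _ _ s' mZ2.
have i1 := itg_indic P1 m1; have i2 := itg_indic P2 m2.
have p1le : Ex P1 \1_[set w | sqn (Z1 w) <= s] <= 1.
  rewrite -[leRHS](@Ex_cst _ _ _ P1); apply: Ex_le => //; first exact: itg_cst.
apply/ler_addgt0Pr => e0 e00.
pose e := Num.min (e0 / 2) (1 / 2).
have ee : e <= e0 / 2 by rewrite ge_min lexx.
have e12 : e <= 1 / 2 by rewrite ge_min lexx orbT.
have e_0 : 0 < e by rewrite lt_min; apply/andP; split; lra.
(* With y = k (s' - s) = 2 / e^2, exp(-y) is below e^2 / 2, so the values x1 and x2 of the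
   exponential at s and s' have ratio x2 / x1 <= e^2 / 2. *)
pose k := 2 / (e ^+ 2 * (s' - s)).
have k0 : 0 <= k by rewrite divr_ge0// mulr_ge0 ?sqr_ge0// subr_ge0 ltW.
pose x1 := expR (- (k * s)); pose x2 := expR (- (k * s')).
have x10 : 0 < x1 by exact: expR_gt0.
have x11 : x1 <= 1 by rewrite -expR0 ler_expR oppr_le0 mulr_ge0.
(* The exponent lies between 1 / (e x1) and 2 / (e x1): then m x1 >= 1 / e makes the polynomial at
   least 1 - e up to s, and m x2 <= e makes it at most e beyond s'. *)
pose m := (Num.truncn (1 / (e * x1))).+1.
have h1 : 1 / (e * x1) <= m%:R by apply/ltW; exact: truncnS_gt.
have ex0 : 0 < e * x1 by rewrite mulr_gt0.
have h2 : m%:R <= 2 / (e * x1).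
  rewrite /m -natr1; have : (Num.truncn (1 / (e * x1)))%:R <= 1 / (e * x1).
    by rewrite truncn_le// divr_ge0// ltW.
  have : 1 <= 1 / (e * x1) by rewrite ler_pdivlMr// mul1r; nra.
  lra.
have x2E : x2 * (2 / (e * x1)) <= e.
  have -> : x2 = x1 * expR (- (k * (s' - s))) by rewrite /x2 /x1 -expRD; congr expR; ring.
  rewrite expRN; set y := k * (s' - s).
  have y2 : y * e ^+ 2 = 2 by rewrite /y /k; field; rewrite subr_eq0 !gt_eqF.
  have := expR_ge1Dx y => hy; have e0y := expR_gt0 y.
  have -> : x1 * (expR y)^-1 * (2 / (e * x1)) = 2 / e / expR y by field; rewrite !gt_eqF.
  rewrite ler_pdivrMr// ler_pdivrMr//; nra.
pose p : {poly R} := 1 - (1 - 'X) ^+ m.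
have pE y : p.[y] = 1 - (1 - y) ^+ m by rewrite !hornerE.
have := same_poly p k0.
pose psi1 w := p.[expR (- (k * sqn (Z1 w)))]; pose psi2 w := p.[expR (- (k * sqn (Z2 w)))].
rewrite -/(psi1) -/(psi2) => E.
have rng d' (T : measurableType d') (Z : T -> 'cV[R]_d) w : 0 <= expR (- (k * sqn (Z w))) <= 1.
  by rewrite expR_ge0 /= -expR0 ler_expR oppr_le0 mulr_ge0// sqn_ge0.
have pr01 y : 0 <= y <= 1 -> 0 <= p.[y] <= 1.
  move=> /andP[y0 y1]; rewrite pE subr_ge0 exprn_ile1 ?subr_ge0//; last by lra.
  by rewrite lerBlDr lerDl exprn_ge0// subr_ge0.
have ip d' (T : measurableType d') (P : probability T R) (Z : T -> 'cV[R]_d) : meas_vec Z ->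
    itg P (fun w => p.[expR (- (k * sqn (Z w)))]).
  move=> mZ; apply: (@itg_bounded _ _ _ _ _ 1).
    under eq_fun do rewrite pE.
    apply: measurable_funB => //; apply: measurable_funX; apply: measurable_funB => //.
    exact: itg_meas (itg_expN P mZ k0).
  by move=> w; have /andP[a b] := pr01 _ (rng _ _ Z w); rewrite ger0_norm.
have L : (1 - e) * Ex P1 \1_[set w | sqn (Z1 w) <= s] <= Ex P1 psi1.
  rewrite -ExZ//; apply: Ex_le; [exact: itgZ|exact: ip|] => w.
  rewrite indicE; case: (boolP (w \in _)); last first.
    by move=> _; rewrite mulr0; have /andP[] := pr01 _ (rng _ _ Z1 w).
  rewrite inE /= => hw; rewrite mulr1 /psi1 pE; set y := expR _.
  have y1 : x1 <= y by rewrite ler_expR lerN2 ler_wpM2l.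
  have yr := rng _ _ Z1 w; rewrite -/y in yr.
  have := pow_upper m yr.
  have : 1 / e <= m%:R * y.
    apply: (@le_trans _ _ (m%:R * x1)); last by rewrite ler_wpM2l.
    by move: h1; rewrite ler_pdivrMr// => h1; rewrite ler_pdivrMr//; lra.
  rewrite ler_pdivrMr// => hmy.
  have : 0 <= (1 - y) ^+ m by rewrite exprn_ge0// subr_ge0; case/andP: yr.
  move: ((1 - y) ^+ m) (m%:R * y) hmy => a b hb a0 hab.
  have : a * b <= 1 by lra.
  nra.
have U : Ex P2 psi2 <= Ex P2 \1_[set w | sqn (Z2 w) <= s'] + e.
  rewrite -[X in _ + X](@Ex_cst _ _ _ P2) -ExD//; last exact: itg_cst.
  apply: Ex_le; [exact: ip|by apply: itgD => //; exact: itg_cst|] => w.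
  have /andP[a b] := pr01 _ (rng _ _ Z2 w).
  rewrite indicE; case: (boolP (w \in _)) => [_|]; first by apply: (le_trans b); rewrite lerDl ltW.
  rewrite notin_setE /= => /negP; rewrite -ltNge => hw; rewrite add0r /psi2 pE; set y := expR _.
  have y2 : y <= x2 by rewrite ler_expR lerN2 ler_wpM2l// ltW.
  have := bernoulli_pow m (rng _ _ Z2 w); rewrite -/y => hb.
  have : m%:R * y <= e.
    apply: le_trans x2E; rewrite [leRHS]mulrC; apply: ler_pM => //.
    exact: expR_ge0.
  lra.
have P0 : 0 <= Ex P1 \1_[set w | sqn (Z1 w) <= s] by apply: Ex_ge0 => w; rewrite indicE.
rewrite E in L.
move: (Ex P1 _) (Ex P2 \1__) (Ex P2 psi2) L U P0 p1le => a b c; nra.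
Qed.

End two.
End Laplace.

(** * Spectral decomposition *)

Section Spectral.
Context (R : realType).

Lemma continuous_sumr (T : topologicalType) (I : Type) (s : seq I) (f : I -> T -> R) :
  (forall i, continuous (f i)) -> continuous (fun x => \sum_(i <- s) f i x).
Proof.
move=> cf; elim: s => [|i s IH].
  rewrite (_ : (fun _ => _) = cst 0); first exact: cst_continuous.
  by apply/funext => x; rewrite big_nil.
rewrite (_ : (fun _ => _) = (fun x => f i x + \sum_(j <- s) f j x)).
  by move=> x; apply: cvgD; [exact: cf|exact: IH].
by apply/funext => x; rewrite big_cons.
Qed.

Lemma continuous_mulr (T : topologicalType) (f g : T -> R) :
  continuous f -> continuous g -> continuous (fun x => f x * g x).
Proof. by move=> cf cg x; apply: cvgM; [exact: cf|exact: cg]. Qed.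

Lemma continuous_coord n k : continuous (fun v : 'rV[R]_n => v 0 k).
Proof. exact: coord_continuous. Qed.

Definition dotr n (u v : 'rV[R]_n) : R := (u *m v^T) 0 0.

Lemma dotrE n (u v : 'rV[R]_n) : dotr u v = \sum_k u 0 k * v 0 k.
Proof. by rewrite /dotr mxE; apply: eq_bigr => k _; rewrite mxE. Qed.

Lemma dotrC n (u v : 'rV[R]_n) : dotr u v = dotr v u.
Proof. by rewrite !dotrE; apply: eq_bigr => k _; rewrite mulrC. Qed.

Lemma dotrDl n (u v w : 'rV[R]_n) : dotr (u + v) w = dotr u w + dotr v w.
Proof. by rewrite /dotr mulmxDl mxE. Qed.

Lemma dotrZl n c (u w : 'rV[R]_n) : dotr (c *: u) w = c * dotr u w.
Proof. by rewrite /dotr -scalemxAl mxE. Qed.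

Lemma dotrDr n (u v w : 'rV[R]_n) : dotr w (u + v) = dotr w u + dotr w v.
Proof. by rewrite dotrC dotrDl !(dotrC w). Qed.

Lemma dotrZr n c (u w : 'rV[R]_n) : dotr w (c *: u) = c * dotr w u.
Proof. by rewrite dotrC dotrZl dotrC. Qed.

Lemma dotrBl n (u v w : 'rV[R]_n) : dotr (u - v) w = dotr u w - dotr v w.
Proof. by rewrite /dotr mulmxBl mxE [X in _ + X]mxE. Qed.

Lemma dotrBr n (u v w : 'rV[R]_n) : dotr w (u - v) = dotr w u - dotr w v.
Proof. by rewrite dotrC dotrBl !(dotrC w). Qed.

Lemma dotr_ge0 n (u : 'rV[R]_n) : 0 <= dotr u u.
Proof. by rewrite dotrE; apply: sumr_ge0 => k _; rewrite -expr2 sqr_ge0. Qed.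

Lemma dotr_eq0 n (u : 'rV[R]_n) : dotr u u = 0 -> u = 0.
Proof.
rewrite dotrE => /eqP; rewrite psumr_eq0; last by move=> k _; rewrite -expr2 sqr_ge0.
move=> /allP h; apply/rowP => k; rewrite mxE.
by have := h k (mem_index_enum _); rewrite mulf_eq0 orbb => /eqP.
Qed.

Lemma dotr_mulmx n m (u : 'rV[R]_n) (v : 'rV[R]_m) (A : 'M[R]_(n, m)) :
  dotr (u *m A) v = dotr u (v *m A^T).
Proof. by rewrite /dotr trmx_mul trmxK mulmxA. Qed.

Lemma dotr_row n m (u : 'rV[R]_m) (A : 'M[R]_(n, m)) i : dotr (row i A) u = (A *m u^T) i 0.
Proof. by rewrite dotrE mxE; apply: eq_bigr => k _; rewrite !mxE. Qed.

Lemma sphere_compact n : compact [set v : 'rV[R]_n | dotr v v = 1].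
Proof.
apply: bounded_closed_compact.
  exists 1; split => // x x1 v /= hv; apply: le_trans (ltW x1).
  rewrite [leLHS]/Num.Def.normr /= mx_normrE; apply/bigmax_leP; split => // -[i j] _ /=.
  rewrite (ord1 i) -(@ler_pXn2r _ 2)// ?nnegrE// expr1n real_normK ?num_real//.
  rewrite -hv dotrE (bigD1 j)//= -expr2 lerDl; apply: sumr_ge0 => k _.
  by rewrite -expr2 sqr_ge0.
rewrite (_ : [set _ | _] = (fun v : 'rV[R]_n => dotr v v) @^-1` [set 1]); last by [].
apply: closed_comp; last exact: closed_eq.
move=> v _; have -> : (fun v : 'rV[R]_n => dotr v v) = (fun v => \sum_k v 0 k * v 0 k).
  by apply/funext => u; exact: dotrE.
by apply: continuous_sumr => k; apply: continuous_mulr; exact: continuous_coord.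
Qed.

(** c maximises the quadratic form on the compact unit sphere. Were w = c A - f(c) c nonzero, moving
    c to c + t w would raise the Rayleigh quotient to first order by 2 t |w|^2; a t small compared
    with |w|^2 / |B|, B the second-order coefficient, gives the contradiction. *)
Lemma max_eigenvector n (A : 'M[R]_n.+1) : A^T = A ->
  exists c : 'rV[R]_n.+1, exists l : R, [/\ dotr c c = 1, c *m A = l *: c
    & forall v : 'rV[R]_n.+1, dotr (v *m A) v <= l * dotr v v].
Proof.
move=> sA; pose f (v : 'rV[R]_n.+1) := dotr (v *m A) v.
have cf : continuous f.
  have -> : f = (fun v => \sum_k (\sum_j v 0 j * A j k) * v 0 k).
    by apply/funext => v; rewrite /f dotrE; apply: eq_bigr => k _; rewrite mxE.
  apply: continuous_sumr => k; apply: continuous_mulr; last exact: continuous_coord.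
  apply: continuous_sumr => j; apply: continuous_mulr; first exact: continuous_coord.
  exact: cst_continuous.
have ne : [set v : 'rV[R]_n.+1 | dotr v v = 1] !=set0.
  exists (delta_mx 0 0); rewrite /= /dotr trmx_delta -rowE !mxE !eqxx//.
have [c] := EVT_max_rV ne (@sphere_compact n.+1) (continuous_subspaceT cf).
rewrite inE /= => c1 cmax; exists c, (f c).
have ub (v : 'rV[R]_n.+1) : f v <= f c * dotr v v.
  have [v0|vn0] := eqVneq (dotr v v) 0.
    by rewrite (dotr_eq0 v0) /f mul0mx /dotr !mul0mx !mxE mulr0.
  have vp : 0 < dotr v v by rewrite lt_def vn0 dotr_ge0.
  pose q := Num.sqrt (dotr v v); have q0 : 0 < q by rewrite sqrtr_gt0.
  have q2 : q ^+ 2 = dotr v v by rewrite sqr_sqrtr// ltW.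
  have := cmax (q^-1 *: v); rewrite inE /= dotrZl dotrZr mulrA -q2 => /(_ _).
  rewrite /f -scalemxAl dotrZl dotrZr => h.
  have : q^-1 * (q^-1 * dotr (v *m A) v) <= dotr (c *m A) c.
    by apply: h; field; rewrite gt_eqF.
  by rewrite mulrA -invfM -expr2 mulrC ler_pdivrMr// exprn_gt0.
split => //.
apply/eqP; rewrite -subr_eq0; apply/eqP; apply: dotr_eq0.
have [w wE] : exists w, w = c *m A - f c *: c by exists (c *m A - f c *: c).
rewrite -wE.
have E t : f (c + t *: w) <= f c * dotr (c + t *: w) (c + t *: w) by exact: ub.
have Ac : dotr (w *m A) c = dotr (c *m A) w by rewrite dotr_mulmx sA dotrC.
have ww : dotr w w = dotr (c *m A) w - f c * dotr c w.
  by rewrite {1}wE dotrBl dotrZl.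
pose B := f w - f c * dotr w w.
have H t : 2 * t * dotr w w + t ^+ 2 * B <= 0.
  have := E t; rewrite /f mulmxDl -scalemxAl !(dotrDl, dotrDr, dotrZl, dotrZr) Ac c1 (dotrC w c).
  have -> : dotr (c *m A) w = dotr w w + dotr (c *m A) c * dotr c w by rewrite ww subrK.
  by rewrite /B /f; lra.
have w0 := dotr_ge0 w.
apply/eqP; rewrite eq_le w0 andbT leNgt; apply/negP => wp.
have := H (dotr w w / (1 + `|B|)).
have b1 : 0 < 1 + `|B| by rewrite ltr_pwDl.
set t := _ / _; have t0 : 0 < t by rewrite divr_gt0.
have tb : t * (1 + `|B|) = dotr w w by rewrite /t divfK// gt_eqF.
have : - `|B| <= B by rewrite lerNnormlW.
move: (`|B| : R) tb b1 => b tb b1 hb hh.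
have : t * B >= - (t * b) by nra.
nra.
Qed.

(** The reflection in the hyperplane orthogonal to c - e exchanges the unit vectors c and e. *)
Lemma householder n (c : 'rV[R]_n.+1) : dotr c c = 1 ->
  exists H : 'M[R]_n.+1, [/\ H^T = H, H *m H = 1%:M & delta_mx 0 0 *m H = c].
Proof.
move=> c1; pose e : 'rV[R]_n.+1 := delta_mx 0 0.
have e1 : dotr e e = 1 by rewrite /dotr trmx_delta -rowE !mxE !eqxx.
have [->|ce] := eqVneq c e.
  by exists 1%:M; rewrite trmx1 mulmx1; split => //; rewrite mulmx1.
pose w := c - e; pose q := dotr w w.
have q0 : q != 0 by apply/eqP => /dotr_eq0/eqP; rewrite subr_eq0 (negbTE ce).
pose W := w^T *m w.
have WT : W^T = W by rewrite trmx_mul trmxK.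
have uW (u : 'rV[R]_n.+1) : u *m W = dotr u w *: w.
  by rewrite mulmxA [u *m _]mx11_scalar mul_scalar_mx.
have WW : W *m W = q *: W.
  rewrite /W -mulmxA (mulmxA w) [w *m w^T]mx11_scalar mul_scalar_mx.
  by rewrite -scalemxAr.
exists (1%:M - (2 / q) *: W); split.
- by rewrite linearB /= trmx1 linearZ /= WT.
- rewrite mulmxBl mul1mx mulmxBr mulmx1 -scalemxAl -scalemxAr WW !scalerA.
  rewrite opprB addrA (_ : _ / q * _ * _ = 2 / q + 2 / q); last by field.
  by rewrite scalerDl addrA subrK addrK.
- rewrite mulmxBr mulmx1 -scalemxAr uW scalerA.
  have -> : 2 / q * dotr e w = -1.
    have eq : dotr e w = - (q / 2).
      by rewrite /q /w !dotrBr !dotrBl c1 e1 (dotrC e c); field.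
    by rewrite eq; field.
  by rewrite scaleN1r opprK /w addrC subrK.
Qed.

(** Deflation: conjugation by the reflection puts the largest eigenvalue in the corner, and symmetry
    clears the rest of the first row and column, leaving a smaller symmetric block. *)
Theorem spectral n (A : 'M[R]_n) : A^T = A ->
  exists O : 'M[R]_n, exists l : 'rV[R]_n,
  [/\ O *m O^T = 1%:M, A = O^T *m diag_mx l *m O
    & forall i j : 'I_n, (i <= j)%N -> l 0 j <= l 0 i].
Proof.
elim: n A => [|n IH] A sA.
  exists 1%:M, 0; split; first by rewrite mul1mx trmx1.
    by apply/matrixP => -[].
  by case.
have [c [l0 [c1 cA ub]]] := max_eigenvector sA.
have [H [HT HH eH]] := householder c1.
have [B BD] : exists B : 'M[R]_(1 + n), B = H *m A *m H by exists (H *m A *m H).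
have BT : B^T = B by rewrite BD !trmx_mul HT sA mulmxA.
have eB : delta_mx 0 0 *m B = l0 *: delta_mx 0 0 :> 'rV[R]_(1 + n).
  rewrite BD !mulmxA eH cA -scalemxAl; congr (_ *: _).
  by rewrite -eH -mulmxA HH mulmx1.
pose B' := drsubmx B.
have B'T : B'^T = B' by rewrite /B' trmx_drsub BT.
have BE : B = block_mx (l0%:M : 'M[R]_1) 0 0 B'.
  have r0 j : B 0 j = l0 *+ (j == 0).
    have := congr1 (fun v : 'rV[R]_(1 + n) => v 0 j) eB.
    by rewrite -rowE !mxE eqxx /= mulr_natr.
  rewrite -[LHS]submxK; congr block_mx.
  - apply/matrixP => i j; rewrite !mxE !ord1 (_ : lshift n 0 = 0); last exact/val_inj.
    by rewrite r0 eqxx.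
  - apply/matrixP => i j; rewrite !mxE ord1 (_ : lshift n 0 = 0); last exact/val_inj.
    by rewrite r0 (_ : _ == 0 = false) ?mulr0n.
  - apply/matrixP => i j; rewrite -BT !mxE ord1 (_ : lshift n 0 = 0); last exact/val_inj.
    by rewrite r0 (_ : _ == 0 = false) ?mulr0n.
have [Q0 [l' [OO BE' so]]] := IH _ B'T.
pose O1 : 'M[R]_(1 + n) := block_mx 1%:M 0 0 Q0.
have O1T : O1^T = block_mx 1%:M 0 0 Q0^T by rewrite tr_block_mx trmx1 !trmx0.
have O11 : O1 *m O1^T = 1%:M.
  by rewrite O1T mulmx_block !mulmx0 !mul0mx !addr0 !add0r mul1mx OO -scalar_mx_block.
have l0M : (l0%:M : 'M[R]_1) = diag_mx (const_mx l0) by rewrite diag_const_mx.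
have OB : B = O1^T *m diag_mx (row_mx (const_mx l0) l') *m O1.
  rewrite diag_mx_row -l0M O1T !mulmx_block !mulmx0 !mul0mx !addr0 !add0r !mulmx1 !mul1mx.
  by rewrite mul0mx -BE'.
have AE : A = H *m B *m H by rewrite BD !mulmxA HH mul1mx -mulmxA HH mulmx1.
(* An eigenvalue of the block is a Rayleigh quotient of A at a unit vector, so maximality of l0
   orders the list. *)
have l'le j : l' 0 j <= l0.
  pose v : 'rV[R]_(1 + n) := row (rshift 1 j) O1.
  have v1 : dotr v v = 1.
    by rewrite dotr_row /v tr_row colE mulmxA O11 mul1mx !mxE eqxx.
  have vE : v = delta_mx 0 (rshift 1 j) *m O1 by rewrite -rowE.
  have vB : v *m B = l' 0 j *: v.
    rewrite OB vE !mulmxA -(mulmxA _ O1) O11 mulmx1 scalemxAl; congr (_ *m _).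
    apply/rowP => k; rewrite -rowE [LHS]mxE [LHS]mxE [RHS]mxE [X in _ = _ * X]mxE eqxx /=.
    by rewrite row_mxEr mulr_natr eq_sym.
  have := ub (v *m H).
  have -> : dotr (v *m H *m A) (v *m H) = l' 0 j.
    rewrite [in RHS](_ : l' 0 j = dotr (v *m B) v); last by rewrite vB dotrZl v1 mulr1.
    by rewrite dotrC dotr_mulmx HT dotrC BD !mulmxA.
  by rewrite dotr_mulmx HT -mulmxA HH mulmx1 v1 mulr1.
pose L : 'rV[R]_(1 + n) := row_mx (const_mx l0) l'.
have LL i : L 0 (lshift n i) = l0 by rewrite row_mxEl mxE.
have LR i : L 0 (rshift 1 i) = l' 0 i by rewrite row_mxEr.
exists (O1 *m H), L; split.
- by rewrite trmx_mul HT mulmxA -(mulmxA O1) HH mulmx1.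
- by rewrite trmx_mul HT AE OB !mulmxA.
- move=> i j; case: (@split_ordP 1 n i) => i' ->; case: (@split_ordP 1 n j) => j' -> /=.
  + by rewrite -[leLHS]/(L 0 (lshift n j')) -[leRHS]/(L 0 (lshift n i')) !LL.
  + by rewrite -[leLHS]/(L 0 (rshift 1 j')) -[leRHS]/(L 0 (lshift n i')) LL LR.
  + by rewrite (ord1 j').
  + rewrite -[leLHS]/(L 0 (rshift 1 j')) -[leRHS]/(L 0 (rshift 1 i')) !LR leq_add2l.
    exact: so.
Qed.

End Spectral.

(** * Anticoncentration of Gaussian quadratic forms *)

Section GaussLebesgue.
Context (R : realType).
Local Notation mu := (@lebesgue_measure R).
Local Notation G := (gaussP (1 : R)).

Lemma normal_pdf_le1 (x : R) : normal_pdf 0 1 x <= 1.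
Proof.
apply: le_trans (normal_pdf_ub _ _ (oner_neq0 R)) _.
rewrite /normal_peak expr1n mul1r invf_le1; last first.
  by rewrite sqrtr_gt0 pmulrn_lgt0// pi_gt0.
by rewrite -[leLHS]sqrtr1 ler_wsqrtr//; have := pi_ge2 R; lra.
Qed.

(** The standard normal density is at most 1, so bounds may be computed for Lebesgue measure. *)
Lemma gauss_Ex_le (f : R -> R) (c : R) : measurable_fun setT f -> (forall x, 0 <= f x) ->
  (\int[mu]_x (f x)%:E <= c%:E)%E -> itg G f /\ Ex G f <= c.
Proof.
move=> mf f0 fc.
have mfp : measurable_fun setT (fun x : R => f x * normal_pdf 0 1 x).
  by apply: measurable_funM => //; exact: measurable_normal_pdf.
have le1 : (\int[mu]_x (f x * normal_pdf 0 1 x)%:E <= c%:E)%E.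
  apply: le_trans fc; apply: ge0_le_integral => //.
  - by move=> x _; rewrite lee_fin mulr_ge0// normal_pdf_ge0.
  - exact/measurable_EFinP.
  - exact/measurable_EFinP.
  - by move=> x _; rewrite lee_fin ler_piMr// normal_pdf_le1.
have ig : itg G f.
  apply: (normal_itg mf); apply/integrableP; split; first exact/measurable_EFinP.
  apply: le_lt_trans (ltry c); apply: le_trans le1.
  rewrite le_eqVlt; apply/orP; left; apply/eqP; apply: eq_integral => x _.
  by rewrite /= ger0_norm// mulr_ge0// normal_pdf_ge0.
by split=> //; rewrite -lee_fin (normal_Ex ig).
Qed.

Lemma gauss_itv (a b : R) : a <= b -> Ex G \1_`[a, b] <= b - a.
Proof.
move=> ab; apply: (gauss_Ex_le _ _ _).2 => //.
rewrite integral_indic//= setIT lebesgue_measure_itv/= lte_fin.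
by case: ltP => // _; rewrite lee_fin subr_ge0.
Qed.

(* the chi-square density blows up at 0, hence the square roots *)
Lemma gauss_sqr_itv (l z e : R) : 0 < l -> 0 <= e ->
  Ex G \1_[set u | z <= l * u ^+ 2 <= z + e] <=
  2 * (Num.sqrt (z + e) - Num.sqrt z) / Num.sqrt l.
Proof.
move=> l0 e0; have sl : 0 < Num.sqrt l by rewrite sqrtr_gt0.
pose a := Num.sqrt z / Num.sqrt l; pose b := Num.sqrt (z + e) / Num.sqrt l.
have ab : a <= b by rewrite ler_pM2r ?invr_gt0// ler_wsqrtr// lerDl.
have mI c c' : measurable (`[c, c']%classic : set R) by exact: measurable_itv.
have m1 : measurable [set u : R | z <= l * u ^+ 2 <= z + e].
  rewrite -[X in measurable X]setTI.
  have : measurable_fun setT (fun u : R => l * u ^+ 2) by apply: measurable_funM => //; exact: exprn_measurable.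
  move=> /(_ measurableT _ (mI z (z + e))).
  by congr measurable; apply/seteqP; split => x /=; rewrite in_itv.
apply: (@le_trans _ _ (Ex G (fun u => \1_`[a, b] u + \1_`[- b, - a] u))).
  apply: Ex_le; [exact: itg_indic|apply: itgD; exact: itg_indic|] => u.
  rewrite {1}indicE; case: (boolP (u \in _)); last first.
    by move=> _; rewrite !indicE addr_ge0.
  rewrite inE /= => /andP[h1 h2].
  have u2 : Num.sqrt (l * u ^+ 2) = Num.sqrt l * `|u| by rewrite sqrtrM ?ltW// sqrtr_sqr.
  have au : a <= `|u| by rewrite ler_pdivrMr// mulrC -u2 ler_wsqrtr.
  have ub : `|u| <= b by rewrite ler_pdivlMr// mulrC -u2 ler_wsqrtr.
  have [u0|u0] := leP 0 u.
    rewrite ger0_norm// in au ub.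
    by rewrite [X in _ <= X + _]indicE mem_set /= ?in_itv /= ?au ?ub// lerDl indicE.
  rewrite ltr0_norm// in au ub.
  rewrite [X in _ <= _ + X]indicE mem_set /=; first by rewrite lerDr indicE.
  by rewrite in_itv /= lerNl ub lerNr au.
rewrite ExD; [|exact: itg_indic|exact: itg_indic].
have h1 := gauss_itv ab; have h2 : Ex G \1_`[- b, - a] <= b - a.
  by apply: le_trans (gauss_itv _) _; [rewrite lerN2|rewrite opprK addrC].
have -> : 2 * (Num.sqrt (z + e) - Num.sqrt z) / Num.sqrt l = (b - a) + (b - a).
  by rewrite /a /b; ring.
exact: lerD.
Qed.

Lemma is_derive_opp (f : R -> R) (x df : R) : is_derive x 1 f df ->
  is_derive x 1 (fun y => - f y) (- df).
Proof. by move=> hf; exact: is_deriveN. Qed.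

Lemma is_derive_sqrt (f : R -> R) (x df : R) : 0 < f x -> is_derive x 1 f df ->
  is_derive x 1 (fun y => Num.sqrt (f y)) (df / (2 * Num.sqrt (f x))).
Proof.
move=> f0 hf; apply: is_derive_conv (is_derive_comp (is_derive1_sqrt f0) hf) _.
by rewrite mulrC.
Qed.

(** The shift to a + 2e keeps the denominator positive where a is close to 0 or negative, the square
    root of a negative number being 0. The integral over the second coordinate is then
    nonsingular. *)
Lemma sqrt_diff_le (a e : R) : 0 < e -> 0 <= a + e ->
  Num.sqrt (a + e) - Num.sqrt a <= 2 * e / Num.sqrt (a + 2 * e).
Proof.
move=> e0 ae; have p0 : 0 < a + 2 * e by lra.
have sp : 0 < Num.sqrt (a + 2 * e) by rewrite sqrtr_gt0.
rewrite ler_pdivlMr//.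
have u2 := sqr_sqrtr ae; have u0 := sqrtr_ge0 (a + e).
have w2 := sqr_sqrtr (ltW p0); have w0 := ltW sp.
have v0 := sqrtr_ge0 a; have v2 : a <= Num.sqrt a ^+ 2.
  by have [a0|/ltW a0] := leP 0 a; [rewrite sqr_sqrtr|apply: le_trans a0 _; exact: sqr_ge0].
move: (Num.sqrt (a + e)) (Num.sqrt a) (Num.sqrt (a + 2 * e)) u2 u0 w2 w0 v0 v2 {sp} => u v w u2 u0 w2 w0 v0 v2.
have [uv|uv] := leP u v; first by nra.
have [ue|ue] := leP (u ^+ 2) e.
  apply: (@le_trans _ _ (u * w)); first by apply: ler_wpM2r => //; lra.
  rewrite -(@ler_pXn2r _ 2)// ?nnegrE ?mulr_ge0//; last by lra.
  by rewrite exprMn w2; nra.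
have wu : w <= 2 * u by rewrite -(@ler_pXn2r _ 2)// ?nnegrE ?mulr_ge0//; nra.
have : (u - v) * w <= (u - v) * (2 * u) by apply: ler_wpM2l => //; lra.
have : (u - v) * (u + v) <= e by nra.
nra.
Qed.

Lemma ftc_closed (F g : R -> R) (a b : R) : a < b ->
  (forall x : R, a <= x <= b -> is_derive x 1 F (g x)) ->
  (forall x : R, a <= x <= b -> {for x, continuous g}) ->
  (\int[mu]_(x in `[a, b]) (g x)%:E = (F b)%:E - (F a)%:E)%E.
Proof.
move=> ab dF cg; apply: continuous_FTC2 => //.
- apply: continuous_in_subspaceT => x; rewrite inE /= in_itv /=; exact: cg.
- split.
  + move=> x; rewrite in_itv /= => /andP[/ltW h1 /ltW h2].
    by have h := dF x; apply: ex_derive; apply: h; rewrite h1 h2.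
  + by apply: cvg_at_right_filter; apply: (is_derive_continuous (dF a _)); rewrite lexx ltW.
  + by apply: cvg_at_left_filter; apply: (is_derive_continuous (dF b _)); rewrite lexx ltW.
- move=> x; rewrite in_itv /= => /andP[/ltW h1 /ltW h2].
  by apply: derive1_is; apply: dF; rewrite h1 h2.
Qed.

(** A majorant of the arcsine density 1 / sqrt(h^2 - k^2 v^2) whose primitive needs square roots
    only. *)
Definition arcbound (h k v : R) : R :=
  h^-1 * ((Num.sqrt (1 + k / h * v))^-1 + (Num.sqrt (1 - k / h * v))^-1).

Lemma arcbound_ge (h k v : R) : 0 < h -> 0 < h ^+ 2 - k ^+ 2 * v ^+ 2 ->
  (Num.sqrt (h ^+ 2 - k ^+ 2 * v ^+ 2))^-1 <= arcbound h k v.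
Proof.
move=> h0 q0; rewrite /arcbound; set s := k / h * v.
have -> : h ^+ 2 - k ^+ 2 * v ^+ 2 = h ^+ 2 * ((1 + s) * (1 - s)).
  by rewrite /s; field; rewrite gt_eqF.
have {q0} p0 : 0 < (1 + s) * (1 - s).
  have : 0 < h ^+ 2 * ((1 + s) * (1 - s)).
    by move: q0; congr (_ < _); rewrite /s; field; rewrite gt_eqF.
  by rewrite pmulr_rgt0// exprn_gt0.
rewrite sqrtrM ?sqr_ge0// sqrtr_sqr (ger0_norm (ltW h0)) invfM.
apply: ler_wpM2l; first by rewrite invr_ge0 ltW.
have s1 : 0 < 1 + s by nra.
have s2 : 0 < 1 - s by nra.
rewrite (sqrtrM (1 - s) (ltW s1)) invfM.
have r1 : 0 < Num.sqrt (1 + s) by rewrite sqrtr_gt0.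
have r2 : 0 < Num.sqrt (1 - s) by rewrite sqrtr_gt0.
have [ss|ss] := leP 0 s.
  have h1 : (Num.sqrt (1 + s))^-1 <= 1.
    rewrite invf_le1// -[leLHS]sqrtr1; apply: ler_wsqrtr; lra.
  apply: (@le_trans _ _ (1 * (Num.sqrt (1 - s))^-1)).
    by apply: ler_wpM2r => //; rewrite invr_ge0 ltW.
  by rewrite mul1r lerDr invr_ge0 ltW.
have h1 : (Num.sqrt (1 - s))^-1 <= 1.
  rewrite invf_le1// -[leLHS]sqrtr1; apply: ler_wsqrtr; lra.
apply: (@le_trans _ _ ((Num.sqrt (1 + s))^-1 * 1)).
  by apply: ler_wpM2l => //; rewrite invr_ge0 ltW.
by rewrite mulr1 lerDl invr_ge0 ltW.
Qed.

Lemma arc_pos (h k B v : R) : 0 < k -> 0 < B -> k * B < h -> - B <= v <= B ->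
  0 < 1 + k / h * v /\ 0 < 1 - k / h * v.
Proof.
move=> k0 B0 kB; have h0 : 0 < h by apply: lt_trans kB; exact: mulr_gt0.
move=> /andP[v1 v2].
have e : k / h * v = (k * v) / h by rewrite mulrAC.
have b1 : (k * v) / h < 1 by rewrite ltr_pdivrMr//; nra.
have b2 : - 1 < (k * v) / h by rewrite ltr_pdivlMr//; nra.
by rewrite e; split; lra.
Qed.

Lemma continuous_arcbound (h k B v : R) : 0 < k -> 0 < B -> k * B < h -> - B <= v <= B ->
  {for v, continuous (arcbound h k)}.
Proof.
move=> k0 B0 kB /(arc_pos k0 B0 kB) [p1 p2]; apply: cvgM; first exact: cvg_cst.
apply: cvgD; apply: cvgV; rewrite ?gt_eqF ?sqrtr_gt0//.
  apply: (continuous_comp (f := fun y => 1 + k / h * y)); last exact: sqrt_continuous.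
  by apply: cvgD; [exact: cvg_cst|apply: cvgM; [exact: cvg_cst|exact: cvg_id]].
apply: (continuous_comp (f := fun y => 1 - k / h * y)); last exact: sqrt_continuous.
by apply: cvgB; [exact: cvg_cst|apply: cvgM; [exact: cvg_cst|exact: cvg_id]].
Qed.

(** Up to the constant this is the mass pi / k of the arcsine density, whatever h and B are. *)
Lemma integral_arcbound (h k B : R) : 0 < k -> 0 < B -> k * B < h ->
  (\int[mu]_(v in `[(- B)%R, B]) (arcbound h k v)%:E <= (8 / k)%:E)%E.
Proof.
move=> k0 B0 kB; have h0 : 0 < h by apply: lt_trans kB; exact: mulr_gt0.
pose F v := 2 / k * (Num.sqrt (1 + k / h * v) - Num.sqrt (1 - k / h * v)).
have pos v : - B <= v <= B -> 0 < 1 + k / h * v /\ 0 < 1 - k / h * v by exact: arc_pos.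
have dl (c v : R) : is_derive v 1 (fun y => 1 + c * y) c.
  by apply: is_derive_conv (is_derive_add (is_derive_cst (1 : R) v (1 : R)) (is_derive_lin c v)) _; rewrite add0r.
have dF (v : R) : - B <= v <= B -> is_derive v 1 F (arcbound h k v).
  move=> /pos [p1 p2].
  have d1 := @is_derive_sqrt (fun y => 1 + k / h * y) _ _ p1 (dl (k / h) v).
  have p2' : 0 < 1 + - (k / h) * v by rewrite mulNr.
  have d2 := @is_derive_sqrt (fun y => 1 + - (k / h) * y) _ _ p2' (dl (- (k / h)) v).
  have := is_derive_scal (2 / k) (is_derive_add d1 (is_derive_opp d2)).
  move=> D; apply: (@is_derive_ext _ _ F _ _ _ (is_derive_conv D _)).
    by move=> y; rewrite /F mulNr.
  have e : 1 + - (k / h) * v = 1 - k / h * v by rewrite mulNr.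
  rewrite /arcbound e; field.
  by rewrite !gt_eqF// sqrtr_gt0.
have cg (v : R) : - B <= v <= B -> {for v, continuous (arcbound h k)} by exact: continuous_arcbound.
rewrite (ftc_closed _ dF cg); last by lra.
rewrite -EFinB lee_fin /F.
have b2 : k / h * B < 1 by rewrite mulrAC ltr_pdivrMr// mul1r.
have b0 : 0 < k / h * B by rewrite mulr_gt0// divr_gt0.
have S (x : R) : 0 <= x <= 2 -> Num.sqrt x <= 2.
  move=> /andP[x0 x2]; rewrite -(@ler_pXn2r _ 2)// ?nnegrE ?sqrtr_ge0// sqr_sqrtr//; lra.
have -> : 8 / k = 2 / k * 4 by ring.
rewrite -mulrBr; apply: ler_wpM2l; first by rewrite divr_ge0// ltW.
have := sqrtr_ge0 (1 - k / h * B); have := sqrtr_ge0 (1 + k / h * (- B)).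
have : Num.sqrt (1 + k / h * B) <= 2 by apply: S; apply/andP; split; lra.
have : Num.sqrt (1 - k / h * (- B)) <= 2 by apply: S; apply/andP; split; lra.
lra.
Qed.

(** The density of l u^2 alone is unbounded at 0. Averaging its window bound over v turns the
    singularity into an arcsine integral of order 1 / sqrt m. *)
Lemma gauss2_itv (l m y e : R) : 0 < l -> 0 < m -> 0 < e ->
  Ex G (fun v => Ex G \1_[set u | y <= l * u ^+ 2 + m * v ^+ 2 <= y + e]) <=
  32 * e / (Num.sqrt l * Num.sqrt m).
Proof.
move=> l0 m0 e0; have sl : 0 < Num.sqrt l by rewrite sqrtr_gt0.
have sm : 0 < Num.sqrt m by rewrite sqrtr_gt0.
have sm2 : Num.sqrt m ^+ 2 = m by rewrite sqr_sqrtr// ltW.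
pose D v := 2 * (Num.sqrt (y - m * v ^+ 2 + e) - Num.sqrt (y - m * v ^+ 2)) / Num.sqrt l.
pose I v := Ex G \1_[set u | y <= l * u ^+ 2 + m * v ^+ 2 <= y + e].
have I0 v : 0 <= I v by apply: Ex_ge0 => x; rewrite indicE.
have SE v : [set u | y <= l * u ^+ 2 + m * v ^+ 2 <= y + e] =
    [set u | y - m * v ^+ 2 <= l * u ^+ 2 <= y - m * v ^+ 2 + e].
  by apply/seteqP; split => u /= /andP[h1 h2]; apply/andP; split; lra.
have ID v : I v <= D v by rewrite /I SE; apply: gauss_sqr_itv => //; exact: ltW.
have mS : measurable [set z : measurableTypeR R * measurableTypeR R |
    y <= l * z.2 ^+ 2 + m * z.1 ^+ 2 <= y + e].
  rewrite -[X in measurable X]setTI.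
  have : measurable_fun setT (fun z : measurableTypeR R * measurableTypeR R => l * z.2 ^+ 2 + m * z.1 ^+ 2).
    by apply: measurable_funD; apply: measurable_funM => //; apply: measurable_funX.
  move=> /(_ measurableT _ (measurable_itv `[y, y + e])).
  by congr measurable; apply/seteqP; split => x /=; rewrite in_itv.
have iI : itg G I by exact: (itg_inner (itg_indic (prodP G G) mS)).
pose Y := y + e.
have D0 v : Y - m * v ^+ 2 <= 0 -> I v = 0.
  move=> h; apply/eqP; rewrite eq_le I0 andbT; apply: le_trans (ID v) _.
  have e1 : y - m * v ^+ 2 + e <= 0 by move: h; rewrite /Y; lra.
  have e2 : y - m * v ^+ 2 <= 0 by lra.
  by rewrite /D (ler0_sqrtr e1) (ler0_sqrtr e2) subrr mulr0 mul0r.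
have C0 : 0 <= 32 * e / (Num.sqrt l * Num.sqrt m).
  by rewrite divr_ge0// ?mulr_ge0// ltW.
have [Y0|Y0] := leP Y 0.
  have -> : Ex G I = 0; last exact: C0.
  rewrite -[RHS](@Ex_cst _ _ _ G); apply: eq_Ex => v; apply: D0.
  have : 0 <= m * v ^+ 2 by rewrite mulr_ge0 ?sqr_ge0// ltW.
  lra.
pose B := Num.sqrt Y / Num.sqrt m; pose h := Num.sqrt (Y + e); pose k := Num.sqrt m.
have Ye : 0 < Y + e by lra.
have h0 : 0 < h by rewrite sqrtr_gt0.
have B0 : 0 < B by rewrite divr_gt0// sqrtr_gt0.
have kB : k * B < h.
  by rewrite /B mulrCA divff ?gt_eqF// mulr1 ltr_sqrt//; lra.
have h2 : h ^+ 2 = Y + e by rewrite sqr_sqrtr// ltW.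
have B2 : m * B ^+ 2 = Y.
  by rewrite /B exprMn exprVn sm2 sqr_sqrtr ?(ltW Y0)//; field; rewrite gt_eqF.
pose f v := 4 * e / Num.sqrt l * (arcbound h k \_ `[(- B)%R, B]) v.
have arc0 v : 0 <= arcbound h k v.
  by rewrite mulr_ge0 ?addr_ge0// invr_ge0 ?sqrtr_ge0// ltW.
have f0 v : 0 <= f v.
  rewrite mulr_ge0 ?divr_ge0 ?mulr_ge0 ?sqrtr_ge0//; first exact: ltW.
  by rewrite patchE; case: ifP.
have mpatch : measurable_fun setT (arcbound h k \_ `[(- B)%R, B]).
  apply/(measurable_restrictT _ _).1 => //.
  apply: subspace_continuous_measurable_fun => //.
  apply: continuous_in_subspaceT => v; rewrite inE /= in_itv /= => hv.
  exact: continuous_arcbound hv.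
have mf : measurable_fun setT f by apply: measurable_funM.
have If v : I v <= f v.
  rewrite /f patchE; case: ifPn.
    rewrite inE /= in_itv /= => /andP[v1 v2].
    have vB : m * v ^+ 2 <= Y by rewrite -B2 ler_pM2l//; nra.
    apply: le_trans (ID v) _; rewrite /D.
    have := @sqrt_diff_le (y - m * v ^+ 2) e e0; rewrite /Y in vB => /(_ _) h1.
    have {}h1 := h1 ltac:(lra).
    have e2 : y - m * v ^+ 2 + 2 * e = h ^+ 2 - k ^+ 2 * v ^+ 2 by rewrite h2 sm2 /Y; ring.
    rewrite e2 in h1.
    have p : 0 < h ^+ 2 - k ^+ 2 * v ^+ 2 by rewrite -e2; lra.
    have := arcbound_ge h0 p => h3.
    rewrite mulrAC [leRHS](_ : _ = 2 * (2 * e * arcbound h k v) / Num.sqrt l); last by ring.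
    rewrite mulrAC; apply: ler_wpM2r; first by rewrite invr_ge0 ltW.
    apply: ler_wpM2l => //; apply: le_trans h1 _.
    by apply: ler_wpM2l => //; lra.
  rewrite notin_setE /= in_itv /= => /negP hv; rewrite mulr0 D0//.
  rewrite -B2 -mulrBr pmulr_rle0//.
  have : B < `|v| by rewrite ltNge ler_norml.
  move=> Bv; have : 0 <= `|v| by [].
  rewrite -(real_normK (num_real v)); nra.
have fint : (\int[mu]_v (f v)%:E <= (32 * e / (Num.sqrt l * Num.sqrt m))%:E)%E.
  under eq_integral do rewrite EFinM.
  rewrite ge0_integralZl//; first last.
  - by rewrite lee_fin divr_ge0 ?mulr_ge0 ?sqrtr_ge0// ltW.
  - by move=> v _; rewrite lee_fin patchE; case: ifP.
  - exact/measurable_EFinP.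
  have -> : (\int[mu]_v ((arcbound h k \_ `[(- B)%R, B]) v)%:E =
      \int[mu]_(v in `[(- B)%R, B]) (arcbound h k v)%:E)%E.
    by rewrite [RHS]integral_mkcond; apply: eq_integral => v _; rewrite !patchE; case: ifP.
  have := integral_arcbound sm B0 kB.
  rewrite -/k => h1.
  apply: (@le_trans _ _ ((4 * e / Num.sqrt l)%:E * (8 / k)%:E)%E).
    by apply: lee_wpmul2l => //; rewrite lee_fin divr_ge0 ?mulr_ge0 ?sqrtr_ge0// ltW.
  rewrite -EFinM lee_fin le_eqVlt; apply/orP; left; apply/eqP.
  by rewrite invfM /k; ring.
have [itf Ef] := gauss_Ex_le mf f0 fint.
by apply: le_trans Ef; apply: Ex_le.
Qed.

End GaussLebesgue.

(** * An integrable majorant for characteristic functions *)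

Section Escape.
Context (R : realType).
Local Notation mu := (@lebesgue_measure R).
Local Notation G := (gaussP (1 : R)).

(* The fourth root of 625 / ((1 + r t)^2 (1 + b t)^6) has an explicit primitive. *)
Definition wf (r b t : R) : R :=
  5 * ((Num.sqrt (1 + r * t))^-1 * (Num.sqrt (1 + b * t))^-1 / (1 + b * t)).

Lemma wf_ge0 (r b t : R) : 0 <= r -> 0 <= b -> 0 <= t -> 0 <= wf r b t.
Proof.
move=> r0 b0 t0; rewrite mulr_ge0// mulr_ge0// ?invr_ge0 ?mulr_ge0 ?invr_ge0 ?sqrtr_ge0//.
by rewrite addr_ge0// mulr_ge0.
Qed.

Lemma wf4 (r b t : R) : 0 <= r -> 0 <= b -> 0 <= t ->
  wf r b t ^+ 4 * ((1 + r * t) ^+ 2 * (1 + b * t) ^+ 6) = 625.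
Proof.
move=> r0 b0 t0; rewrite /wf.
have p1 : 0 < 1 + r * t by rewrite ltr_pwDl// mulr_ge0.
have p2 : 0 < 1 + b * t by rewrite ltr_pwDl// mulr_ge0.
have s1 := sqr_sqrtr (ltW p1); have s2 := sqr_sqrtr (ltW p2).
have q1 : Num.sqrt (1 + r * t) != 0 by rewrite gt_eqF// sqrtr_gt0.
have q2 : Num.sqrt (1 + b * t) != 0 by rewrite gt_eqF// sqrtr_gt0.
move: (Num.sqrt (1 + r * t)) (Num.sqrt (1 + b * t)) s1 s2 q1 q2 => u v <- <- q1 q2.
field.
by rewrite q1 q2.
Qed.

Lemma continuous_wf (r b : R) : 0 < r -> 0 < b ->
  forall x, 0 <= x -> {for x, continuous (wf r b)}.
Proof.
move=> r0 b0.
have pos (c x : R) : 0 < c -> 0 <= x -> 0 < 1 + c * x.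
  by move=> c0 x0; rewrite ltr_pwDl// mulr_ge0// ltW.
have cont (c x : R) : 0 < c -> 0 <= x -> {for x, continuous (fun y : R => 1 + c * y)}.
by move=> _ _; apply: cvgD; [exact: cvg_cst|apply: cvgM; [exact: cvg_cst|exact: cvg_id]].
move=> x x0; apply: cvgM; first exact: cvg_cst.
have c1 := pos r x r0 x0; have c2 := pos b x b0 x0.
apply: cvgM; last by apply: cvgV; [rewrite gt_eqF|exact: cont].
apply: cvgM; apply: cvgV; rewrite ?gt_eqF ?sqrtr_gt0//.
  by apply: (continuous_comp (cont r x r0 x0)); exact: sqrt_continuous.
by apply: (continuous_comp (cont b x b0 x0)); exact: sqrt_continuous.
Qed.

Lemma continuous_wf_norm (r b : R) : 0 < r -> 0 < b -> continuous (fun x : R => wf r b `|x|).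
Proof.
move=> r0 b0 x; apply: (continuous_comp (f := fun y : R => `|y|)); first exact: norm_continuous.
exact: continuous_wf.
Qed.

Lemma integral_wf (r b : R) : 0 < b -> b < r ->
  (\int[mu]_x (wf r b `|x|)%:E <= (20 / (Num.sqrt r * Num.sqrt b))%:E)%E.
Proof.
move=> b0 br; have r0 : 0 < r by exact: lt_trans br.
have pos (c x : R) : 0 < c -> 0 <= x -> 0 < 1 + c * x.
  by move=> c0 x0; rewrite ltr_pwDl// mulr_ge0// ltW.
have cwf (x : R) : 0 <= x -> {for x, continuous (wf r b)} by exact: continuous_wf.
have cwfn := continuous_wf_norm r0 b0.
rewrite ge0_symfun_integralT//; first last.
- by move=> x; rewrite /= normrN.
- by move=> x; apply: wf_ge0 => //; exact: ltW.
rewrite (_ : [set x | 0 <= x] = `[0, +oo[%classic); last first.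
  by apply/seteqP; split => x /=; rewrite in_itv /= andbT.
pose k := 10 / (r - b).
have rb : 0 < r - b by rewrite subr_gt0.
(* This is k sqrt((1 + r x) / (1 + b x)), in a form that shows the limit at infinity. *)
pose F x := k * Num.sqrt (r / b - (r / b - 1) / (1 + b * x)).
have FE x : 0 <= x -> r / b - (r / b - 1) / (1 + b * x) = (1 + r * x) / (1 + b * x).
  by move=> x0; have c2 := pos b x b0 x0; field; rewrite !gt_eqF.
have dl (c v : R) : is_derive v 1 (fun y => 1 + c * y) c.
  by apply: is_derive_conv (is_derive_add (is_derive_cst (1 : R) v (1 : R)) (is_derive_lin c v)) _; rewrite add0r.
have dinv (f : R -> R) (x df : R) : 0 < f x -> is_derive x 1 f df -> is_derive x 1 (fun y => (f y)^-1) (- df / f x ^+ 2).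
  move=> f0 hf; apply: is_derive_conv (is_deriveV _ hf) _; first by rewrite gt_eqF.
  by rewrite /GRing.scale /= mulrC mulNr mulrN.
have dF (x : R) : 0 <= x -> is_derive x 1 F (wf r b x).
  move=> x0; have c1 := pos r x r0 x0; have c2 := pos b x b0 x0.
  have h1 := is_derive_scal (r / b - 1) (dinv (fun y => 1 + b * y) x b c2 (dl b x)).
  have h2 := is_derive_add (is_derive_cst (r / b) x (1 : R)) (is_derive_opp h1).
  have p : 0 < r / b - (r / b - 1) * (1 + b * x)^-1 by rewrite FE// divr_gt0.
  have h3 := is_derive_scal k (@is_derive_sqrt R (fun y => r / b - (r / b - 1) * (1 + b * y)^-1) x _ p h2).
  apply: is_derive_conv h3 _.
  rewrite FE// /wf /k (sqrtrM _ (ltW c1)) sqrtrV ?(ltW c2)//.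
  have s1 := sqr_sqrtr (ltW c1); have s2 := sqr_sqrtr (ltW c2).
  have q1 : Num.sqrt (1 + r * x) != 0 by rewrite gt_eqF// sqrtr_gt0.
  have q2 : Num.sqrt (1 + b * x) != 0 by rewrite gt_eqF// sqrtr_gt0.
  move: (Num.sqrt (1 + b * x)) s2 q2 => v s2 q2.
  rewrite -s2; field.
  by rewrite q1 q2 !gt_eqF.
have FTC : (\int[mu]_(x in `[0%R, +oo[) (wf r b x)%:E = (k * Num.sqrt (r / b))%:E - (F 0)%:E)%E.
  apply: ge0_continuous_FTC2y.
  - by move=> x x0; apply: wf_ge0 => //; exact: ltW.
  - by apply: continuous_in_subspaceT => x; rewrite inE /= in_itv /= andbT; exact: cwf.
  - apply: cvgM; first exact: cvg_cst.
    have lim : (r / b - (r / b - 1) / (1 + b * x)) @[x --> +oo%R] --> r / b.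
      rewrite -[X in _ --> X]subr0; apply: cvgB; first exact: cvg_cst.
      rewrite -[X in _ --> X](mulr0 (r / b - 1)); apply: cvgM; first exact: cvg_cst.
      apply/gtr0_cvgV0; first by near=> x; apply: pos => //; near: x; exact: nbhs_pinfty_ge.
      apply: (@cvg_comp _ _ _ (fun x : R => b * x) (fun y => 1 + y) _ (pinfty_nbhs R)); last exact: cvg_addrl.
      rewrite (_ : (fun x : R => b * x) = (fun x => x * b)); last by apply/funext => x; rewrite mulrC.
      by apply: gt0_cvgMly => //; exact: cvg_id.
    exact: (continuous_cvg _ (@sqrt_continuous R _) lim).
  - by move=> x /ltW x0; have h := dF x x0; exact: ex_derive.
  - by apply: cvg_at_right_filter; exact: is_derive_continuous (dF 0 (lexx 0)).
  - by move=> x; rewrite in_itv /= andbT => /ltW x0; apply: derive1_is; exact: dF.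
rewrite (_ : (\int[mu]_(x in `[0%R, +oo[) (wf r b `|x|)%:E) = \int[mu]_(x in `[0%R, +oo[) (wf r b x)%:E)%E; last first.
  by apply: eq_integral => x; rewrite inE /= in_itv /= andbT => x0; rewrite ger0_norm.
rewrite FTC -EFinB -EFinM lee_fin /F FE// !mulr0 !addr0 divr1 sqrtr1 mulr1 -[X in _ * (_ - X)](mulr1 k) -mulrBr.
have sr : 0 < Num.sqrt r by rewrite sqrtr_gt0.
have sb : 0 < Num.sqrt b by rewrite sqrtr_gt0.
have sr2 := sqr_sqrtr (ltW r0); have sb2 := sqr_sqrtr (ltW b0).
have srb : Num.sqrt b < Num.sqrt r by rewrite ltr_sqrt.
rewrite (sqrtrM _ (ltW r0)) sqrtrV ?(ltW b0)// /k.
move: (Num.sqrt r) (Num.sqrt b) sr sb sr2 sb2 srb => s v s0 v0 s2 v2 vs.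
rewrite -s2 -v2 [leLHS](_ : _ = 20 / ((s + v) * v)); last first.
  have sv : s - v != 0 by rewrite subr_eq0 gt_eqF.
  have svD : s + v != 0 by rewrite gt_eqF// addr_gt0.
  rewrite subr_sqr; field.
  by rewrite svD sv !gt_eqF.
rewrite ler_pM2l// lef_pV2 ?posrE ?mulr_gt0 ?addr_gt0// ler_pM2r//.
by rewrite lerDl ltW.
Unshelve. all: by end_near. Qed.

End Escape.

(** * Growth of the product in the modulus of the characteristic function *)

Section ProductBound.
Context (R : realType).

(* [e2], [e3], [e4] are the elementary symmetric functions of [s]. *)
Lemma prod_1D_ge (s : seq R) (A : R) : (forall x, x \in s -> 0 <= x <= A) ->
  exists e2 : R, exists e3 : R, exists e4 : R, let S := \sum_(x <- s) x in
  [/\ 0 <= S, 0 <= e2 /\ S ^+ 2 / 2 - A * S / 2 <= e2,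
      0 <= e3 /\ S ^+ 3 / 6 - A * S ^+ 2 / 2 <= e3,
      0 <= e4 /\ S ^+ 4 / 24 - A * S ^+ 3 / 4 <= e4
    & 1 + S + e2 + e3 + e4 <= \prod_(x <- s) (1 + x)].
Proof.
elim: s => [|X s IH] hs.
  exists 0, 0, 0; rewrite /= !big_nil !expr0n/= !mulr0 !mul0r subrr.
  by split => //; rewrite !addr0.
have [e2 [e3 [e4 /= [S0 [e20 h2] [e30 h3] [e40 h4] hP]]]] : _ := IH (fun x xs => hs x (@mem_behead _ (X :: s) x xs)).
have /andP[X0 XA] := hs X (mem_head _ _).
have A0 : 0 <= A by apply: le_trans XA.
(* The recursion e_k(X, s) = e_k(s) + X e_{k-1}(s). The lower bounds say that e_k is S^k / k! minus
   the contribution of repeated indices, which A controls. *)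
exists (e2 + X * (\sum_(x <- s) x)), (e3 + X * e2), (e4 + X * e3) => /=; rewrite !big_cons.
move: (\sum_(x <- s) x) (\prod_(x <- s) (1 + x)) S0 h2 h3 h4 hP => S Q S0 h2 h3 h4 hP.
have XAX : X * X <= A * X by rewrite ler_wpM2r.
have X20 : 0 <= X * X by rewrite mulr_ge0.
have SX0 : 0 <= S * X by rewrite mulr_ge0.
have k1 : S * (X * X) <= S * (A * X) by rewrite ler_wpM2l.
have k2 : X * (X * X) <= A * (X * X) by rewrite ler_wpM2r.
have AX : 0 <= A * (X * X) by rewrite mulr_ge0.
split; first by rewrite addr_ge0.
- split; first by rewrite addr_ge0// mulr_ge0.
  by lra.
- split; first by rewrite addr_ge0// mulr_ge0.
  have := ler_wpM2l X0 h2; have := mulr_ge0 S0 X20; lra.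
- split; first by rewrite addr_ge0// mulr_ge0.
  have := ler_wpM2l X0 h3.
  have := ler_wpM2l (mulr_ge0 S0 S0) XAX.
  have := ler_wpM2l S0 k2; have := ler_wpM2l X0 k2.
  have := mulr_ge0 S0 AX; have := mulr_ge0 X0 AX; have := mulr_ge0 S0 (mulr_ge0 X0 X20); lra.
have := ler_wpM2l X0 hP; have := mulr_ge0 X0 e40; have := mulr_ge0 X0 e30; have := mulr_ge0 X0 e20; lra.
Qed.

Lemma pow8_le (s : R) : 0 <= s -> (1 + s) ^+ 8 <= 128 * (1 + s ^+ 8).
Proof.
move=> s0; have h (x : R) : (1 + x) ^+ 2 <= 2 * (1 + x ^+ 2) by have := sqr_ge0 (1 - x); lra.
have sq (x y : R) : 0 <= x -> x <= y -> x ^+ 2 <= y ^+ 2.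
  by move=> x0 xy; rewrite lerXn2r ?nnegrE// (le_trans x0).
have a1 := sq _ _ (sqr_ge0 (1 + s)) (h s).
have a2 : ((1 + s) ^+ 2) ^+ 2 <= 8 * (1 + s ^+ 4).
  by have := h (s ^+ 2); rewrite -exprM; move: a1; rewrite exprMn; lra.
have a3 := sq _ _ (sqr_ge0 _) a2.
rewrite (_ : (1 + s) ^+ 8 = (((1 + s) ^+ 2) ^+ 2) ^+ 2); last by rewrite -!exprM.
have := h (s ^+ 4); rewrite -exprM; move: a3; rewrite exprMn; lra.
Qed.

(** Put S = 4 t^2 b^2; no term exceeds S / 12, so e_4 >= S^4 / 24 - S^4 / 48 = (16/3) (t b)^8 and
    the product is at least 1 + (t b)^8. With the factor of l this forces decay of order t^(-2) on
    the characteristic function, hence integrability. *)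
Lemma wf_prod (l b t : R) (s : seq R) : 0 < l -> 0 < b -> 0 <= t ->
  (forall x, x \in s -> x ^+ 2 <= b ^+ 2 / 12) -> \sum_(x <- s) x ^+ 2 = b ^+ 2 ->
  1 <= wf (l + b) b t ^+ 4 * ((1 + 4 * t ^+ 2 * l ^+ 2) * \prod_(x <- s) (1 + 4 * t ^+ 2 * x ^+ 2)).
Proof.
move=> l0 b0 t0 hs hb.
have r0 : 0 <= l + b by rewrite addr_ge0// ltW.
have := @wf4 R (l + b) b t r0 (ltW b0) t0.
set W := wf _ _ _ ^+ 4 => hW.
have W0 : 0 <= W by rewrite exprn_ge0// wf_ge0// ltW.
have ha a : a \in [seq 4 * t ^+ 2 * x ^+ 2 | x <- s] -> 0 <= a <= 4 * t ^+ 2 * (b ^+ 2 / 12).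
  move=> /mapP[x xs ->]; rewrite mulr_ge0 ?sqr_ge0 ?mulr_ge0 ?sqr_ge0//=.
  by rewrite ler_wpM2l ?mulr_ge0 ?sqr_ge0//; exact: hs.
have [e2 [e3 [e4 /=]]] := prod_1D_ge ha.
rewrite !big_map -mulr_sumr hb => [[S0 [e20 h2] [e30 h3] [e40 h4] hP]].
have p8 : 1 + (t * b) ^+ 8 <= \prod_(x <- s) (1 + 4 * t ^+ 2 * x ^+ 2).
  have := exprn_ge0 8 (mulr_ge0 t0 (ltW b0)).
  suff : 5 * (t * b) ^+ 8 <= e4 by lra.
  apply: le_trans h4; rewrite -subr_ge0.
  rewrite (_ : _ - _ = (t * b) ^+ 8 / 3); last by field.
  by rewrite divr_ge0 ?exprn_ge0 ?mulr_ge0// ltW.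
apply: (@le_trans _ _ (W * ((1 + 4 * t ^+ 2 * l ^+ 2) * (1 + (t * b) ^+ 8)))); last first.
  apply: ler_wpM2l => //; apply: ler_wpM2l => //.
  by rewrite addr_ge0// mulr_ge0 ?sqr_ge0 ?mulr_ge0 ?sqr_ge0.
have tb0 : 0 <= t * b by rewrite mulr_ge0// ltW.
have tl0 : 0 <= t * l by rewrite mulr_ge0// ltW.
suff : (1 + (l + b) * t) ^+ 2 * (1 + b * t) ^+ 6 <= 256 * ((1 + 4 * t ^+ 2 * l ^+ 2) * (1 + (t * b) ^+ 8)).
  by move/(ler_wpM2l W0); rewrite hW; lra.
apply: (@le_trans _ _ ((1 + t * l) ^+ 2 * (1 + t * b) ^+ 8)).
  rewrite (_ : (1 + t * b) ^+ 8 = (1 + t * b) ^+ 2 * (1 + b * t) ^+ 6); last by rewrite (mulrC b) -exprD.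
  rewrite mulrA -exprMn ler_wpM2r ?exprn_ge0 ?addr_ge0 ?mulr_ge0 ?(ltW b0)//.
  rewrite lerXn2r ?nnegrE ?mulr_ge0 ?addr_ge0//; have := mulr_ge0 tl0 tb0; lra.
rewrite (_ : 256 * _ = (2 * (1 + 4 * t ^+ 2 * l ^+ 2)) * (128 * (1 + (t * b) ^+ 8))); last by ring.
apply: ler_pM; rewrite ?exprn_ge0 ?addr_ge0//; last exact: pow8_le.
have := sqr_ge0 (1 - t * l); have := sqr_ge0 (t * l); rewrite exprMn; lra.
Qed.
End ProductBound.

(** * Weighted sums of squares of independent normal variables *)

Section Quad.
Context (R : realType).
Local Notation G := (gaussP (1 : R)).
Local Notation TR m := (m.-tuple (measurableTypeR R)).

Definition quadT m (l : 'I_m -> R) (t : TR m) : R := \sum_(k < m) l k * tnth t k ^+ 2.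

Lemma measurable_quadT m (l : 'I_m -> R) : measurable_fun setT (quadT l).
Proof.
apply: measurable_sum => k; apply: measurable_funM => //.
by apply: measurable_funX; exact: measurable_tnth.
Qed.

Lemma quadT_cons m (l : 'I_m.+1 -> R) z :
  quadT l (consT z) = l ord0 * z.1 ^+ 2 + quadT (fun k => l (lift ord0 k)) z.2.
Proof.
rewrite /quadT big_ord_recl; congr (_ + _).
by apply: eq_bigr => k _; rewrite tnthS.
Qed.

(** Cosine and sine transforms of independent sums combine like real and imaginary parts of a
    complex product, so squared moduli multiply. *)
Lemma quadT_modulus m (l : 'I_m -> R) (t : R) :
  (Ex (gaussN R m) (fun x => cos (t * quadT l x)) ^+ 2 +
   Ex (gaussN R m) (fun x => sin (t * quadT l x)) ^+ 2) ^+ 2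
    * \prod_(k < m) (1 + 4 * t ^+ 2 * l k ^+ 2) = 1.
Proof.
elim: m l => [|m IH] l.
  rewrite big_ord0 mulr1 (eq_Ex _ (g := fun=> 1)); last first.
    by move=> x; rewrite /quadT big_ord0 mulr0 cos0.
  rewrite (eq_Ex _ (f := fun x => sin _) (g := fun=> 0)); last first.
    by move=> x; rewrite /quadT big_ord0 mulr0 sin0.
  by rewrite !Ex_cst expr1n expr0n/= addr0 expr1n.
rewrite big_ord_recl /=.
pose l' k := l (lift ord0 k).
have mq1 : measurable_fun setT (fun x : measurableTypeR R => t * (l ord0 * x ^+ 2)).
  by apply: measurable_funM => //; apply: measurable_funM => //; exact: measurable_funX.
have mq2 : measurable_fun setT (fun x : TR m => t * quadT l' x).
  by apply: measurable_funM => //; exact: measurable_quadT.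
have mq : measurable_fun setT (fun x : TR m.+1 => t * quadT l x).
  by apply: measurable_funM => //; exact: measurable_quadT.
have qE z : t * quadT l (consT z) = t * (l ord0 * z.1 ^+ 2) + t * quadT l' z.2.
  by rewrite quadT_cons mulrDr.
pose C1 := Ex G (fun x : R => cos (t * (l ord0 * x ^+ 2))).
pose S1 := Ex G (fun x : R => sin (t * (l ord0 * x ^+ 2))).
pose C2 := Ex (gaussN R m) (fun x => cos (t * quadT l' x)).
pose S2 := Ex (gaussN R m) (fun x => sin (t * quadT l' x)).
have c1 : itg G (fun x : measurableTypeR R => cos (t * (l ord0 * x ^+ 2))) by exact: itg_cos.
have s1 : itg G (fun x : measurableTypeR R => sin (t * (l ord0 * x ^+ 2))) by exact: itg_sin.
have c2 : itg (gaussN R m) (fun x => cos (t * quadT l' x)) by exact: itg_cos.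
have s2 : itg (gaussN R m) (fun x => sin (t * quadT l' x)) by exact: itg_sin.
have mqc : measurable_fun setT (fun z : measurableTypeR R * TR m => t * quadT l (consT z)).
  exact: (measurableT_comp mq (@measurable_consT R m)).
have -> : Ex (law (prodP G (gaussN R m)) (@measurable_consT R m)) (fun x => cos (t * quadT l x)) = C1 * C2 - S1 * S2.
  rewrite Ex_law; [|exact: meas_cos|exact: itg_cos].
  rewrite (eq_Ex _ (g := fun z : measurableTypeR R * TR m => cos (t * (l ord0 * z.1 ^+ 2)) * cos (t * quadT l' z.2) - sin (t * (l ord0 * z.1 ^+ 2)) * sin (t * quadT l' z.2))); last first.
    by move=> z /=; rewrite qE cosD.
  by rewrite (ExB (itg_tensor c1 c2) (itg_tensor s1 s2)) (Ex_tensor c1 c2) (Ex_tensor s1 s2).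
have -> : Ex (law (prodP G (gaussN R m)) (@measurable_consT R m)) (fun x => sin (t * quadT l x)) = S1 * C2 + C1 * S2.
  rewrite Ex_law; [|exact: meas_sin|exact: itg_sin].
  rewrite (eq_Ex _ (g := fun z : measurableTypeR R * TR m => sin (t * (l ord0 * z.1 ^+ 2)) * cos (t * quadT l' z.2) + cos (t * (l ord0 * z.1 ^+ 2)) * sin (t * quadT l' z.2))); last first.
    by move=> z /=; rewrite qE sinD.
  by rewrite (ExD (itg_tensor s1 c2) (itg_tensor c1 s2)) (Ex_tensor s1 c2) (Ex_tensor c1 s2).
have h1 : (C1 ^+ 2 + S1 ^+ 2) ^+ 2 * (1 + 4 * t ^+ 2 * l ord0 ^+ 2) = 1.
  have := normal_square_modulus (t * l ord0).
  have -> : Ex G (fun x : R => cos (t * l ord0 * x ^+ 2)) = C1 by apply: eq_Ex => x; rewrite mulrA.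
  have -> : Ex G (fun x : R => sin (t * l ord0 * x ^+ 2)) = S1 by apply: eq_Ex => x; rewrite mulrA.
  by rewrite exprMn mulrA.
have h2 := IH l'; rewrite -/C2 -/S2 in h2.
rewrite -[RHS](mulr1 1) -[X in _ = X * _]h1 -[X in _ = _ * X]h2.
move: (\prod_(k < m) _) (1 + 4 * t ^+ 2 * l ord0 ^+ 2) => x y; ring.
Qed.

(** The left side is the real part of exp(-i t x) times the characteristic function, hence at most
    its modulus. *)
Lemma char_quadT m (l : 'I_m -> R) (t x W : R) : 0 <= W ->
  1 <= W ^+ 4 * \prod_(k < m) (1 + 4 * t ^+ 2 * l k ^+ 2) ->
  Ex (gaussN R m) (fun v => cos (t * (quadT l v - x))) <= W.
Proof.
move=> W0 hW; have := quadT_modulus l t.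
set C := Ex _ _; set S := Ex _ _; set p := \prod_(k < m) _ in hW * => hm.
have mq : measurable_fun setT (fun x : TR m => t * quadT l x).
  by apply: measurable_funM => //; exact: measurable_quadT.
have -> : Ex (gaussN R m) (fun v => cos (t * (quadT l v - x))) = cos (t * x) * C + sin (t * x) * S.
  rewrite (eq_Ex _ (g := fun v => cos (t * x) * cos (t * quadT l v) + sin (t * x) * sin (t * quadT l v))); last first.
    by move=> v; rewrite mulrBr cosB; ring.
  have c2 : itg (gaussN R m) (fun x => cos (t * quadT l x)) by exact: itg_cos.
  have s2 : itg (gaussN R m) (fun x => sin (t * quadT l x)) by exact: itg_sin.
  by rewrite (ExD (itgZ _ c2) (itgZ _ s2)) (ExZ _ c2) (ExZ _ s2).
have M0 : 0 <= C ^+ 2 + S ^+ 2 by rewrite addr_ge0 ?sqr_ge0.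
have p0 : 0 < p.
  rewrite /p; apply: prodr_gt0 => k _; rewrite ltr_pwDl// mulr_ge0 ?sqr_ge0//.
  by rewrite mulr_ge0// sqr_ge0.
have MW : C ^+ 2 + S ^+ 2 <= W ^+ 2.
  rewrite -(@ler_pXn2r _ 2)// ?nnegrE ?sqr_ge0// -exprM.
  by rewrite -(ler_pM2r p0) hm.
rewrite leNgt; apply/negP => Wlt.
have : W ^+ 2 < (cos (t * x) * C + sin (t * x) * S) ^+ 2.
  by rewrite ltr_pXn2r ?nnegrE// ltW// (le_lt_trans W0).
have := cos2Dsin2 (t * x).
have := sqr_ge0 (cos (t * x) * S - sin (t * x) * C); nra.
Qed.

Lemma itg_inner2 d d' (S : measurableType d) (T : measurableType d') (P : probability S R)
  (Q : probability T R) (f : S * T -> R) : itg (prodP P Q) f ->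
  itg Q (fun y => Ex P (fun x => f (x, y))).
Proof.
move=> hf.
have mF : measurable_fun setT (fun y => Ex P (fun x => f (x, y))).
  apply: (measurableT_comp (f := fine)) => //.
  exact: measurable_fubini_G hf.
have mf : measurable_fun setT (EFin \o f) by case/integrableP : hf.
have mn : measurable_fun setT (fun z => `|(f z)%:E|)%E by exact: measurableT_comp.
apply/integrableP; split; first exact/measurable_EFinP.
have /integrableP[_] := hf; apply: le_lt_trans.
rewrite [leRHS](fubini_tonelli1 (m1 := P) (m2 := Q) _ mn)// [leRHS](fubini_tonelli (m1 := P) (m2 := Q) _ mn)//.
apply: ge0_le_integral => //.
- by apply: measurableT_comp => //; exact/measurable_EFinP.
- exact: (measurable_fun_fubini_tonelli_G (m1 := P) (fun z : S * T => `|(f z)%:E|)%E).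
move=> y _; apply: (@le_trans _ _ (`|\int[P]_x (f (x, y))%:E|)%E).
  have fE (z : \bar R) : (`|(fine z)%:E| <= `|z|)%E.
    by case: z => [z| |] /=; rewrite ?normr0 ?lexx ?leey.
  exact: fE.
apply: le_abse_integral => //.
exact: (measurableT_comp mf (measurable_pair2 y)).
Qed.

Lemma measurable_band d (T : measurableType d) (f : T -> R) (x y : R) :
  measurable_fun setT f -> measurable [set t | x <= f t <= y].
Proof.
move=> mf; rewrite (_ : [set t | _] = f @^-1` `[x, y]%classic).
  by rewrite -[_ @^-1` _]setTI; apply: mf.
by apply/seteqP; split => t /=; rewrite in_itv.
Qed.

(** With y = (q - x) / e, q being the quadratic form, exp(-y^2 / 2) is at least 1/2 on the window
    and is the mean of cos(u y) over a standard Gaussian u. Exchanging the expectations leaves the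
    characteristic function at u / e, bounded by [wf]; the constant 40 is 2 times the 20 of
    [integral_wf]. *)
Lemma esseen_quadT m (l : 'I_m -> R) (x e r b : R) : 0 < e -> 0 < b -> b < r ->
  (forall t : R, 0 <= t -> 1 <= wf r b t ^+ 4 * \prod_(k < m) (1 + 4 * t ^+ 2 * l k ^+ 2)) ->
  Ex (gaussN R m) \1_[set t | x <= quadT l t <= x + e] <= 40 * e / (Num.sqrt r * Num.sqrt b).
Proof.
move=> e0 b0 br hw; have r0 : 0 < r by exact: lt_trans br.
have mq := @measurable_quadT m l.
have mA : measurable [set t | x <= quadT l t <= x + e].
  rewrite (_ : [set t | _] = quadT l @^-1` `[x, x + e]%classic).
    by rewrite -[_ @^-1` _]setTI; apply: mq.
  by apply/seteqP; split => t /=; rewrite in_itv.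
pose F (z : measurableTypeR R * TR m) : R := cos (z.1 * ((quadT l z.2 - x) / e)).
have mF : measurable_fun setT (fun z : measurableTypeR R * TR m => z.1 * ((quadT l z.2 - x) / e)).
  apply: measurable_funM => //; apply: measurable_funM => //; apply: measurable_funB => //.
  exact: measurableT_comp.
have iF : itg (prodP G (gaussN R m)) F by exact: itg_cos.
have e2 : expR (2^-1) <= 2 :> R.
  have := @expR_ge1Dx R (- 2^-1); rewrite expRN => h.
  have := ler_wpM2r (expR_ge0 (2^-1 : R)) h.
  rewrite mulVf ?gt_eqF ?expR_gt0//; lra.
apply: (@le_trans _ _ (2 * Ex (prodP G (gaussN R m)) F)).
  rewrite Ex_prod2// -ExZ; last first.
    exact: (itg_inner2 iF).
  have E (t : TR m) : Ex G (fun u => F (u, t)) = expR (- ((quadT l t - x) / e) ^+ 2 / 2).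
    transitivity (Ex G (fun u : R => cos ((quadT l t - x) / e * u))).
      by apply: eq_Ex => u; rewrite /F mulrC.
    by rewrite (normal_cos (oner_neq0 R)) expr1n mulN1r.
  apply: Ex_le.
  - exact: itg_indic.
  - apply: (@itg_bounded _ _ _ _ _ 2).
      apply: measurable_funM => //; under eq_fun do rewrite E.
      apply: measurableT_comp => //; apply: measurable_funM => //; apply: measurableT_comp => //.
      by apply: measurable_funX; apply: measurable_funM => //; exact: measurable_funB.
    move=> t; rewrite E ger0_norm ?mulr_ge0 ?expR_ge0//.
    by rewrite -[leRHS]mulr1 ler_pM2l// expR_le1 mulNr oppr_le0 divr_ge0// sqr_ge0.
  move=> t; rewrite E indicE; case: (boolP (t \in _)) => [|_]; last by rewrite mulr_ge0 ?expR_ge0.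
  rewrite inE /= => /andP[h1 h2].
  have q1 : ((quadT l t - x) / e) ^+ 2 <= 1.
    rewrite expr_le1// ?divr_ge0 ?subr_ge0 ?(ltW e0)//.
    by rewrite ler_pdivrMr// mul1r; lra.
  apply: (@le_trans _ _ (expR 2^-1 * expR (- ((quadT l t - x) / e) ^+ 2 / 2))); last first.
    by rewrite ler_wpM2r ?expR_ge0.
  rewrite -expRD -[leLHS]expR0 ler_expR; lra.
have re0 : 0 < r / e by rewrite divr_gt0.
have be0 : 0 < b / e by rewrite divr_gt0.
have bre : b / e < r / e by rewrite ltr_pM2r ?invr_gt0.
have cwf : measurable_fun setT (fun u : R => wf (r / e) (b / e) `|u|).
  by apply: continuous_meas; exact: continuous_wf_norm.
have [iw Ew] := gauss_Ex_le cwf (fun u => wf_ge0 (ltW re0) (ltW be0) (normr_ge0 u)) (integral_wf be0 bre).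
rewrite Ex_prod//.
have : Ex G (fun u => Ex (gaussN R m) (fun t => F (u, t))) <= Ex G (fun u : R => wf (r / e) (b / e) `|u|).
  apply: Ex_le => //; first exact: itg_inner.
  move=> u; rewrite /F.
  rewrite (eq_Ex _ (g := fun t => cos (u / e * (quadT l t - x)))); last first.
    by move=> t /=; congr cos; ring.
  have -> : wf (r / e) (b / e) `|u| = wf r b (`|u| / e).
    have cE c : c / e * `|u| = c * (`|u| / e) by ring.
    by rewrite /wf !cE.
  have ue : 0 <= `|u| / e by rewrite divr_ge0// ltW.
  apply: char_quadT; first by rewrite wf_ge0// ltW.
  rewrite (eq_bigr (fun k => 1 + 4 * (`|u| / e) ^+ 2 * l k ^+ 2)); first exact: hw.
  by move=> k _; rewrite !exprMn real_normK// num_real.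
move/le_trans/(_ Ew) => h.
apply: (@le_trans _ _ (2 * (20 / (Num.sqrt (r / e) * Num.sqrt (b / e))))); first by rewrite ler_pM2l.
rewrite !sqrtrM ?(ltW r0) ?(ltW b0)// sqrtrV ?(ltW e0)//.
rewrite -[X in 40 * X](sqr_sqrtr (ltW e0)).
have : 0 < Num.sqrt e by rewrite sqrtr_gt0.
have : 0 < Num.sqrt r by rewrite sqrtr_gt0.
have : 0 < Num.sqrt b by rewrite sqrtr_gt0.
move: (Num.sqrt e) (Num.sqrt r) (Num.sqrt b) => x1 x2 x3 y1 y2 y3.
rewrite le_eqVlt; apply/orP; left; apply/eqP; field.
by rewrite !gt_eqF.
Qed.

Lemma itg_gaussNS m (f : TR m.+1 -> R) : itg (gaussN R m.+1) f ->
  itg (prodP G (gaussN R m)) (f \o @consT R m).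
Proof. move=> hf; have := @itg_law R _ _ _ _ (prodP G (gaussN R m)) _ (@measurable_consT R m) f (itg_meas hf).
by case=> + _; apply. Qed.

Lemma Ex_gaussNS m (f : TR m.+1 -> R) : itg (gaussN R m.+1) f ->
  Ex (gaussN R m.+1) f = Ex (prodP G (gaussN R m)) (f \o @consT R m).
Proof. by move=> hf; apply: Ex_law; [exact: itg_meas hf|exact: itg_gaussNS]. Qed.

Lemma two_quadT m (l : 'I_m.+2 -> R) (x e : R) : 0 < l ord0 -> 0 < l (lift ord0 ord0) -> 0 < e ->
  Ex (gaussN R m.+2) \1_[set t | x <= quadT l t <= x + e] <=
  32 * e / (Num.sqrt (l ord0) * Num.sqrt (l (lift ord0 ord0))).
Proof.
move=> l0 l1 e0.
pose l' k := l (lift ord0 k); pose l'' k := l' (lift ord0 k).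
have mA := measurable_band x (x + e) (measurable_quadT l).
rewrite (Ex_gaussNS (itg_indic _ mA)).
pose A1 := [set z : measurableTypeR R * TR m.+1 | x <= l ord0 * z.1 ^+ 2 + quadT l' z.2 <= x + e].
have mA1 : measurable A1.
  apply: measurable_band; apply: measurable_funD.
    by apply: measurable_funM => //; exact: measurable_funX.
  by apply: measurableT_comp => //; exact: measurable_quadT.
rewrite (eq_Ex _ (g := \1_A1)); last first.
  move=> z; rewrite /= !indicE; congr (nat_of_bool _)%:R.
  by apply/idP/idP; rewrite !inE /A1 /= quadT_cons.
have iA1 := itg_indic (prodP G (gaussN R m.+1)) mA1.
rewrite Ex_prod2//.
have i1 := itg_inner2 iA1.
have i2 := itg_gaussNS i1.
rewrite (Ex_gaussNS i1) Ex_prod2//.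
rewrite -[leRHS](Ex_cst (gaussN R m)); apply: Ex_le; [exact: itg_inner2|exact: itg_cst|].
move=> t /=.
apply: le_trans (gauss2_itv (x - quadT l'' t) l0 l1 e0).
rewrite le_eqVlt; apply/orP; left; apply/eqP; apply: eq_Ex => v; apply: eq_Ex => u.
rewrite !indicE; congr (nat_of_bool _)%:R; apply/idP/idP; rewrite !inE /A1 /= quadT_cons /= => /andP[h1 h2];
  apply/andP; split; move: h1 h2; rewrite -/(l'' _) /l'' /l'; lra.
Qed.

Lemma quadT_anticoncentration m (l : 'I_m.+2 -> R) (x e b : R) :
  (forall k, 0 <= l k) -> (forall k : 'I_m.+2, (0 < k)%N -> l k <= l (lift ord0 ord0)) ->
  l (lift ord0 ord0) <= l ord0 -> 0 < l (lift ord0 ord0) -> 0 <= b ->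
  b ^+ 2 = \sum_(k < m.+1) l (lift ord0 k) ^+ 2 -> 0 < e ->
  Ex (gaussN R m.+2) \1_[set t | x <= quadT l t <= x + e] <=
  128 * e / (Num.sqrt (l ord0 + b) * Num.sqrt b).
Proof.
move=> l_ge0 l1_max l10 l1 b0 bE e0.
have l0 : 0 < l ord0 by exact: lt_le_trans l10.
have bp : 0 < b.
  rewrite lt_neqAle b0 andbT; apply/eqP => b00; move: bE; rewrite -b00 expr0n/= big_ord_recl.
  have : 0 <= \sum_(k < m) l (lift ord0 (lift ord0 k)) ^+ 2 by apply: sumr_ge0 => k _; exact: sqr_ge0.
  have : 0 < l (lift ord0 ord0) ^+ 2 by rewrite exprn_gt0.
  by move=> h1 h2 h3; lra.
have rp : 0 < l ord0 + b by rewrite addr_gt0.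
have srp : 0 < Num.sqrt (l ord0 + b) by rewrite sqrtr_gt0.
have sbp : 0 < Num.sqrt b by rewrite sqrtr_gt0.
case: (leP (l (lift ord0 ord0) ^+ 2) (b ^+ 2 / 12)) => h12.
  apply: (@le_trans _ _ (40 * e / (Num.sqrt (l ord0 + b) * Num.sqrt b))); last first.
    by rewrite ler_wpM2r ?invr_ge0 ?mulr_ge0 ?sqrtr_ge0// ler_wpM2r ?(ltW e0)//; lra.
  apply: esseen_quadT => //; first by rewrite ltrDr.
  move=> t t0; rewrite big_ord_recl.
  have := @wf_prod R (l ord0) b t [seq l (lift ord0 k) | k <- index_enum 'I_m.+1] l0 bp t0.
  rewrite !big_map; apply => //.
  move=> _ /mapP[k _ ->]; apply: le_trans h12.
  by rewrite lerXn2r ?nnegrE// l1_max.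
have sl0 : 0 < Num.sqrt (l ord0) by rewrite sqrtr_gt0.
have sl1 : 0 < Num.sqrt (l (lift ord0 ord0)) by rewrite sqrtr_gt0.
apply: le_trans (two_quadT x l0 l1 e0) _.
rewrite -!sqrtrM ?(ltW l0) ?(ltW rp)//.
(* Here b^2 < 12 l_1^2 with l_1 <= l_0, so (l_0 + b) b <= 4 l_0 l_1 + 12 l_1^2 <= 16 l_0 l_1; the
   square root 4 turns the 32 of the two-coordinate bound into 128. *)
have b4 : b <= 4 * l (lift ord0 ord0) by nra.
have le16 : (l ord0 + b) * b <= 16 * (l ord0 * l (lift ord0 ord0)).
  have p5 : l ord0 + b <= 5 * l ord0 by lra.
  nra.
have p1 : 0 < (l ord0 + b) * b by rewrite mulr_gt0.
have p2 : 0 < l ord0 * l (lift ord0 ord0) by rewrite mulr_gt0.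
have : Num.sqrt ((l ord0 + b) * b) <= Num.sqrt (4 ^+ 2 * (l ord0 * l (lift ord0 ord0))).
  by apply: ler_wsqrtr; lra.
rewrite (sqrtrM _ (sqr_ge0 4)) sqrtr_sqr ger0_norm// => h.
rewrite ler_pdivrMr ?sqrtr_gt0// mulrAC ler_pdivlMr ?sqrtr_gt0//.
have := ler_wpM2l (ltW e0) h; lra.
Qed.

End Quad.

(** * Norms, eigenvalues and Gaussian windows of a covariance matrix *)

Section Spectrum.
Context (R : realType).

Lemma spectral_char_poly n (V : 'M[R]_n) (l : 'rV[R]_n) : V *m V^T = 1%:M ->
  char_poly (V^T *m diag_mx l *m V) = \prod_(k < n) ('X - (l 0 k)%:P).
Proof.
move=> OO; have OO' := mulmx1C OO.
have -> : char_poly (V^T *m diag_mx l *m V) = char_poly (diag_mx l).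
  rewrite /char_poly.
  have -> : char_poly_mx (V^T *m diag_mx l *m V) =
      map_mx polyC V^T *m char_poly_mx (diag_mx l) *m map_mx polyC V.
    rewrite /char_poly_mx mulmxBr mulmxBl !map_mxM; congr (_ - _).
    by rewrite scalar_mxC -mulmxA -map_mxM OO' map_mx1 mulmx1.
  rewrite !det_mulmx mulrC mulrA -det_mulmx -map_mxM OO map_mx1 det1 mul1r //.
rewrite char_poly_trig ?diag_mx_is_trig//.
by apply: eq_bigr => k _; rewrite mxE eqxx mulr1n.
Qed.

(** Positivity of the second eigenvalue excludes the default branch of [xget], the empty list, whose
    second entry reads 0. Otherwise the sorted roots of a split polynomial are unique. *)
Lemma spectral_eigenvalues n (V : 'M[R]_n) (l : 'rV[R]_n) : V *m V^T = 1%:M ->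
  (forall i j : 'I_n, (i <= j)%N -> l 0 j <= l 0 i) ->
  0 < second_largest_eigenvalue (V^T *m diag_mx l *m V) ->
  eigenvalues (V^T *m diag_mx l *m V) = [seq l 0 k | k <- enum 'I_n].
Proof.
move=> OO ls; rewrite /second_largest_eigenvalue /eigenvalues.
case: xgetP => [s ->|_]; last by rewrite ltxx.
move=> [ss hs] _.
have sl : sorted >=%R [seq l 0 k | k <- enum 'I_n].
  rewrite sorted_map.
  have : sorted ltn (map val (enum 'I_n)) by rewrite val_enum_ord iota_ltn_sorted.
  rewrite sorted_map; apply: sub_sorted => i j /= ij; apply: ls; exact: ltnW.
apply: (sorted_eq _ _ ss sl).
- by move=> x y z /= h1 h2; exact: le_trans h1.
- by move=> x y /= /andP[h1 h2]; apply/eqP; rewrite eq_le h1 h2.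
apply: prod_XsubC_eq; rewrite -hs spectral_char_poly// big_map big_enum //.
Qed.

Lemma sqn_dot n (v : 'cV[R]_n) : sqn v = (v^T *m v) 0 0.
Proof. by rewrite mxE /sqn; apply: eq_bigr => k _; rewrite mxE expr2. Qed.

Lemma sqn_isometry n (V : 'M[R]_n) (v : 'cV[R]_n) : V^T *m V = 1%:M -> sqn (V *m v) = sqn v.
Proof. by move=> OO; rewrite !sqn_dot trmx_mul mulmxA -(mulmxA v^T) OO mulmx1. Qed.

Lemma quad_form_spectral n (V : 'M[R]_n) (l : 'rV[R]_n) (u : 'cV[R]_n) :
  (u^T *m (V^T *m diag_mx l *m V) *m u) 0 0 = \sum_k l 0 k * (V *m u) k 0 ^+ 2.
Proof.
rewrite -!mulmxA mulmxA -trmx_mul mul_diag_mx mxE; apply: eq_bigr => k _.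
by rewrite !mxE; ring.
Qed.

Lemma sqn_diag n (l : 'rV[R]_n) (v : 'cV[R]_n) :
  sqn (diag_mx l *m v) = \sum_k l 0 k ^+ 2 * v k 0 ^+ 2.
Proof. by rewrite mul_diag_mx /sqn; apply: eq_bigr => k _; rewrite mxE exprMn. Qed.

Lemma opnorm_spectral n (V : 'M[R]_n.+1) (l : 'rV[R]_n.+1) : V *m V^T = 1%:M ->
  (forall k, 0 <= l 0 k <= l 0 0) -> opnorm (V^T *m diag_mx l *m V) = l 0 0.
Proof.
move=> OO hl; have OO' := mulmx1C OO.
have l0 : 0 <= l 0 0 by case/andP: (hl 0).
have normE (v : 'cV[R]_n.+1) : sqn (V^T *m diag_mx l *m V *m v) = \sum_k l 0 k ^+ 2 * (V *m v) k 0 ^+ 2.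
  by rewrite -!mulmxA sqn_isometry ?trmxK// mulmxA -mulmxA sqn_diag.
have ub (v : 'cV[R]_n.+1) : l2norm v <= 1 -> l2norm (V^T *m diag_mx l *m V *m v) <= l 0 0.
  rewrite !l2norm_le// expr1n => v1.
  rewrite normE; apply: (@le_trans _ _ (\sum_k l 0 0 ^+ 2 * (V *m v) k 0 ^+ 2)).
    apply: ler_sum => k _; apply: ler_wpM2r; first exact: sqr_ge0.
    by case/andP: (hl k) => h1 h2; rewrite lerXn2r ?nnegrE.
  rewrite -mulr_sumr -[X in _ <= X]mulr1 ler_wpM2l ?sqr_ge0//.
  by rewrite -/(sqn _) sqn_isometry.
pose v0 : 'cV[R]_n.+1 := V^T *m delta_mx 0 0.
have Ov0 : V *m v0 = delta_mx 0 0 by rewrite mulmxA OO mul1mx.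
have sv0 : sqn (delta_mx 0 0 : 'cV[R]_n.+1) = 1.
  by rewrite /sqn (bigD1 0)//= big1 ?addr0 => [|k k0]; rewrite mxE ?eqxx ?expr1n// (negbTE k0) expr0n.
have v01 : l2norm v0 <= 1 by rewrite l2norm_le// sqn_isometry ?trmxK// sv0 expr1n.
apply/eqP; rewrite eq_le; apply/andP; split.
  apply: ge_sup; first by exists (l2norm (V^T *m diag_mx l *m V *m v0)), v0.
  by move=> _ [v v1 <-]; exact: ub.
apply: (@le_trans _ _ (l2norm (V^T *m diag_mx l *m V *m v0))).
  rewrite /l2norm -[leLHS](ger0_norm l0) -sqrtr_sqr ler_wsqrtr// -/(sqn _) normE Ov0.
  by rewrite (bigD1 0)//= big1 ?addr0 => [|k k0]; rewrite mxE ?eqxx ?expr1n ?mulr1// (negbTE k0) expr0n/= mulr0.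
apply: ub_le_sup; first by exists (l 0 0) => _ [v v1 <-]; exact: ub.
by exists v0.
Qed.

Lemma frobnorm_spectral n (V : 'M[R]_n) (l : 'rV[R]_n) : V *m V^T = 1%:M ->
  frobnorm (V^T *m diag_mx l *m V) ^+ 2 = \sum_k l 0 k ^+ 2.
Proof.
move=> OO; have OO' := mulmx1C OO; rewrite /frobnorm sqr_sqrtr; last first.
  by apply: sumr_ge0 => i _; apply: sumr_ge0 => j _; exact: sqr_ge0.
set A := _ *m V.
have -> : \sum_(k < n) \sum_(m < n) A k m ^+ 2 = \tr (A *m A^T).
  rewrite /mxtrace; apply: eq_bigr => i _; rewrite mxE; apply: eq_bigr => j _.
  by rewrite [A^T _ _]mxE expr2.
have -> : A *m A^T = V^T *m (diag_mx l *m diag_mx l) *m V.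
  by rewrite /A !trmx_mul trmxK tr_diag_mx -!mulmxA (mulmxA V) OO mul1mx.
rewrite mxtrace_mulC (mulmxA V) OO mul1mx mulmx_diag mxtrace_diag; apply: eq_bigr => k _.
by rewrite mxE expr2.
Qed.

Lemma gauss_model n (V : 'M[R]_n) (l : 'rV[R]_n) : (forall k, 0 <= l 0 k) ->
  gvec (gaussN R n) (fun t => V^T *m diag_mx (map_mx Num.sqrt l) *m colT t)
    (V^T *m diag_mx l *m V).
Proof.
move=> l0; have := gvec_gaussN (V^T *m diag_mx (map_mx Num.sqrt l)).
congr gvec; rewrite trmx_mul trmxK tr_diag_mx -!mulmxA; congr (_ *m _).
rewrite mulmxA mulmx_diag; congr (diag_mx _ *m _).
by apply/rowP => k; rewrite !mxE -expr2 sqr_sqrtr.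
Qed.

Lemma sqn_gauss_model n (V : 'M[R]_n) (l : 'rV[R]_n) t : V *m V^T = 1%:M -> (forall k, 0 <= l 0 k) ->
  sqn (V^T *m diag_mx (map_mx Num.sqrt l) *m colT t) = quadT (fun k => l 0 k) t.
Proof.
move=> OO l0; rewrite -mulmxA sqn_isometry ?trmxK// sqn_diag.
by apply: eq_bigr => k _; rewrite !mxE sqr_sqrtr.
Qed.

Definition psd n (A : 'M[R]_n) : Prop := forall u : 'cV[R]_n, 0 <= (u^T *m A *m u) 0 0.

Lemma psd_spectral n (V : 'M[R]_n) (l : 'rV[R]_n) : V *m V^T = 1%:M ->
  psd (V^T *m diag_mx l *m V) -> forall k, 0 <= l 0 k.
Proof.
move=> OO hp k; have := hp (V^T *m delta_mx k 0).
rewrite quad_form_spectral mulmxA OO mul1mx (bigD1 k)//= big1 ?addr0 => [|j jk]; rewrite mxE ?eqxx ?expr1n ?mulr1//.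
by rewrite (negbTE jk) expr0n/= mulr0.
Qed.

Lemma eigen2 n (A : 'M[R]_n) : A^T = A -> psd A -> 0 < second_largest_eigenvalue A ->
  exists V : 'M[R]_n, exists l : 'rV[R]_n,
  [/\ V *m V^T = 1%:M, A = V^T *m diag_mx l *m V, forall i j : 'I_n, (i <= j)%N -> l 0 j <= l 0 i,
    forall k, 0 <= l 0 k & exists i : 'I_n, i = 1%N :> nat /\ 0 < l 0 i].
Proof.
move=> sA pA hA; have [V [l [OO AE ls]]] := spectral sA.
exists V, l; rewrite AE in pA hA; split => //; first exact: psd_spectral pA.
have E := spectral_eigenvalues OO ls hA; move: hA; rewrite /second_largest_eigenvalue E.
case: (ltnP 1 n) => n1; last by rewrite nth_default ?ltxx// size_map size_enum_ord.
rewrite (nth_map (Ordinal n1)) ?size_enum_ord// => h; exists (nth (Ordinal n1) (enum 'I_n) 1).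
by split => //; rewrite nth_enum_ord.
Qed.

(** The squared Frobenius norm is at least l_0^2 + l_1^2 with l_1 > 0, so the operator norm falls
    strictly short of it. *)
Lemma frob_ell n (A : 'M[R]_n) : A^T = A -> psd A -> 0 < second_largest_eigenvalue A ->
  0 < frobnorm A /\ 0 < ell A <= 1.
Proof.
move=> sA pA hA; have [V [l [OO AE ls l0 [i [i1 li]]]]] := eigen2 sA pA hA.
case: n A sA pA hA V l OO AE ls l0 i i1 li => [|n] A sA pA hA V l OO AE ls l0 i i1 li; first by case: i {li i1}.
have F := frobnorm_spectral l OO; rewrite -AE in F.
have op : opnorm A = l 0 0.
  by rewrite AE; apply: opnorm_spectral => // k; rewrite l0 ls.
have i0 : i != 0 by apply/eqP => i0; rewrite i0 in i1.
have F1 : l 0 0 ^+ 2 + l 0 i ^+ 2 <= frobnorm A ^+ 2.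
  rewrite F (bigD1 0)//= lerD2l (bigD1 i)//= lerDl.
  by apply: sumr_ge0 => k _; exact: sqr_ge0.
have li2 : 0 < l 0 i ^+ 2 by rewrite exprn_gt0.
have F2 : 0 < frobnorm A ^+ 2 by apply: lt_le_trans F1; rewrite ltr_wpDl ?sqr_ge0.
have F0 : 0 < frobnorm A.
  by rewrite lt_neqAle sqrtr_ge0 andbT; apply/eqP => F0; rewrite -F0 expr0n ltxx in F2.
split => //; rewrite /ell op; apply/andP; split.
  by rewrite subr_gt0 ltr_pdivrMr// mul1r; lra.
by rewrite gerBl divr_ge0 ?sqr_ge0.
Qed.

Lemma opnorm_quad n (A : 'M[R]_n) : A^T = A -> psd A -> 0 < second_largest_eigenvalue A ->
  0 < opnorm A /\ forall v : 'cV[R]_n, (v^T *m A *m v) 0 0 <= opnorm A * sqn v.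
Proof.
move=> sA pA hA; have [V [l [OO AE ls l0 [i [i1 li]]]]] := eigen2 sA pA hA.
case: n A sA pA hA V l OO AE ls l0 i i1 li => [|n] A sA pA hA V l OO AE ls l0 i i1 li; first by case: i {li i1}.
have -> : opnorm A = l 0 0 by rewrite AE; apply: opnorm_spectral => // k; rewrite l0 ls.
split; first by apply: lt_le_trans li _; apply: ls.
move=> v; rewrite AE quad_form_spectral -(sqn_isometry (V := V) v (mulmx1C OO)) mulr_sumr.
by apply: ler_sum => k _; rewrite ler_wpM2r ?sqr_ge0// ls.
Qed.

Lemma indic_leU (T : Type) (A B C : set T) t : (A t -> B t \/ C t) ->
  \1_A t <= \1_B t + \1_C t :> R.
Proof.
rewrite !indicE; case: (boolP (t \in A)) => [|_ _]; last by rewrite addr_ge0.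
rewrite inE => At /(_ At) [Bt|Ct]; first by rewrite (mem_set Bt) lerDl.
by rewrite (mem_set Ct) lerDr.
Qed.

(** Z is compared with the diagonal model through [sqn_cdf_le], which asks for strict room at each
    end. The window of width e therefore becomes one of width 3e, and 640 leaves slack over 3 times
    128. *)
Lemma gauss_window n (A : 'M[R]_n) d (T : measurableType d) (Q : probability T R)
    (Z : T -> 'cV[R]_n) (s e : R) : A^T = A -> psd A -> 0 < second_largest_eigenvalue A ->
  meas_vec Z ->
  (forall u : 'cV[R]_n, Ex Q (fun w => cos ((u^T *m Z w) 0 0)) = expR (- (u^T *m A *m u) 0 0 / 2)) ->
  0 <= s + e -> 0 < e ->
  Ex Q \1_[set w | sqn (Z w) <= s + e] - Ex Q \1_[set w | sqn (Z w) <= s] <=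
  640 * e / (frobnorm A * Num.sqrt (Num.sqrt (ell A))).
Proof.
move=> sA pA hA mZ hZ s0 e0.
have [F0 /andP[ell0 _]] := frob_ell sA pA hA.
have [V [l [OO AE ls l0 [i [i1 li]]]]] := eigen2 sA pA hA.
case: n A sA pA hA Z mZ hZ V l OO AE ls l0 i i1 li F0 ell0
  => [|[|n]] A sA pA hA Z mZ hZ V l OO AE ls l0 i i1 li F0 ell0.
- by case: i {li i1}.
- by case: i i1 {li} => [[]].
have F := frobnorm_spectral l OO; rewrite -AE in F.
have op : opnorm A = l 0 0.
  by rewrite AE; apply: opnorm_spectral => // k; rewrite l0 ls.
pose N t := V^T *m diag_mx (map_mx Num.sqrt l) *m colT t.
have gN : gvec (gaussN R n.+2) N A by rewrite AE; exact: gauss_model.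
have mN : meas_vec N by move=> k; case: (gvec_meas gN k).
have same (u : 'cV[R]_n.+2) : Ex (gaussN R n.+2) (fun w => cos ((u^T *m N w) 0 0)) = Ex Q (fun w => cos ((u^T *m Z w) 0 0)).
  by case: (gN u) => _ -> _ _; rewrite (hZ u).
have NE t : sqn (N t) = quadT (fun k => l 0 k) t by exact: sqn_gauss_model.
have setE c : [set t | sqn (N t) <= c] = [set t | quadT (fun k => l 0 k) t <= c].
  by apply/seteqP; split => t /=; rewrite NE.
have mq := measurable_quadT (fun k => l 0 k).
have mle (c : R) : measurable [set t | quadT (fun k => l 0 k) t <= c].
  rewrite (_ : [set t | _] = quadT (fun k => l 0 k) @^-1` `]-oo, c]%classic); last first.
    by apply/seteqP; split => t /=; rewrite in_itv.
  by rewrite -[_ @^-1` _]setTI; apply: mq.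
have q0 t : 0 <= quadT (fun k => l 0 k) t.
  by apply: sumr_ge0 => k _; rewrite mulr_ge0 ?sqr_ge0.
have up : Ex Q \1_[set w | sqn (Z w) <= s + e] <= Ex (gaussN R n.+2) \1_[set t | quadT (fun k => l 0 k) t <= s + 2 * e].
  have := sqn_cdf_le mZ mN (fun u => esym (same u)) (s := s + e) (s' := s + 2 * e).
  rewrite setE.
  by apply; lra.
have low : Ex (gaussN R n.+2) \1_[set t | quadT (fun k => l 0 k) t <= s - e] <= Ex Q \1_[set w | sqn (Z w) <= s].
  case: (lerP 0 (s - e)) => se.
    have := sqn_cdf_le mN mZ same (s := s - e) (s' := s).
    rewrite setE.
    by apply; lra.
  apply: (@le_trans _ _ 0); last by apply: Ex_ge0 => w; rewrite indicE.
  rewrite (eq_Ex _ (g := fun=> 0)) ?Ex_cst// => t; rewrite indicE memNset//= => h.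
  by have := q0 t; lra.
pose b := Num.sqrt (\sum_(k < n.+1) l 0 (lift ord0 k) ^+ 2).
have b2 : b ^+ 2 = \sum_(k < n.+1) l 0 (lift ord0 k) ^+ 2.
  by rewrite sqr_sqrtr//; apply: sumr_ge0 => k _; exact: sqr_ge0.
have i_eq : i = lift ord0 ord0 by apply/val_inj; exact: i1.
have b0 : 0 <= b by exact: sqrtr_ge0.
have h : Ex (gaussN R n.+2) \1_[set t | s - e <= quadT (fun k => l 0 k) t <= s - e + 3 * e] <=
    128 * (3 * e) / (Num.sqrt (l 0 0 + b) * Num.sqrt b).
  apply: quadT_anticoncentration => //; rewrite -?i_eq//.
  - by move=> k k0; apply: ls; rewrite i1.
  - by apply: ls.
  - by rewrite mulr_gt0.
have split3 : Ex (gaussN R n.+2) \1_[set t | quadT (fun k => l 0 k) t <= s + 2 * e] <=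
    Ex (gaussN R n.+2) \1_[set t | quadT (fun k => l 0 k) t <= s - e] +
    Ex (gaussN R n.+2) \1_[set t | s - e <= quadT (fun k => l 0 k) t <= s - e + 3 * e].
  rewrite -ExD; [|exact: itg_indic|by apply: itg_indic; exact: measurable_band].
  apply: Ex_le; [exact: itg_indic|by apply: itgD; apply: itg_indic => //; exact: measurable_band|].
  move=> t; apply: indic_leU => /= h2.
  by case: (leP (quadT (fun k => l 0 k) t) (s - e)) => h1; [left|right; apply/andP; split; lra].
have key : frobnorm A * Num.sqrt (Num.sqrt (ell A)) <= Num.sqrt (l 0 0 + b) * Num.sqrt b.
  have l00 : 0 <= l 0 0 by exact: l0.
  have FE : frobnorm A ^+ 2 = l 0 0 ^+ 2 + b ^+ 2 by rewrite F big_ord_recl b2.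
  have bE : b = frobnorm A * Num.sqrt (ell A).
    apply/eqP; rewrite -(@eqrXn2 _ 2)// ?mulr_ge0 ?sqrtr_ge0 ?(ltW F0)//.
    rewrite exprMn (sqr_sqrtr (ltW ell0)) /ell op mulrBr mulr1 mulrCA divff ?mulr1 ?expf_neq0 ?(gt_eqF F0)//.
    by rewrite FE; apply/eqP; ring.
  rewrite {2}bE (sqrtrM _ (ltW F0)) mulrA -{1}(sqr_sqrtr (ltW F0)) expr2.
  rewrite ler_wpM2r ?sqrtr_ge0// ler_wpM2r ?sqrtr_ge0// ler_wsqrtr//.
  by rewrite -(@ler_pXn2r _ 2)// ?nnegrE ?addr_ge0 ?(ltW F0)//; have := mulr_ge0 l00 b0; lra.
have K0 : 0 < frobnorm A * Num.sqrt (Num.sqrt (ell A)) by rewrite mulr_gt0// !sqrtr_gt0.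
have : 128 * (3 * e) / (Num.sqrt (l 0 0 + b) * Num.sqrt b) <= 640 * e / (frobnorm A * Num.sqrt (Num.sqrt (ell A))).
  apply: ler_pM => //; rewrite ?invr_ge0 ?mulr_ge0 ?(ltW e0) ?sqrtr_ge0//; first lra.
  by rewrite lef_pV2// posrE// (lt_le_trans K0).
lra.
Qed.

End Spectrum.

(** * Smoothing and Lindeberg replacement *)

Section Step.
Context (R : realType).
Implicit Types x y h : R.

Definition tp (x : R) : R := Num.max 0 x.

Lemma tpP x : (0 <= x /\ tp x = x) \/ (x <= 0 /\ tp x = 0).
Proof. by rewrite /tp; case: (lerP 0 x) => h; [left|right; split => //; exact: ltW]. Qed.

Lemma tp_taylor x h : `|tp (x + h) ^+ 3 - tp x ^+ 3 - 3 * tp x ^+ 2 * h - 3 * tp x * h ^+ 2| <= `|h| ^+ 3.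
Proof.
rewrite -normrX ler_norml.
case: (tpP x) => [[h1 ->]|[h1 ->]]; case: (tpP (x + h)) => [[h2 ->]|[h2 ->]].
- rewrite (_ : _ - _ - _ - _ = h ^+ 3); last by ring.
  by rewrite ler_norm andbT lerNl -normrN ler_norm.
- have h0 : h <= 0 by lra.
  have c : h ^+ 3 <= 0 by rewrite exprS mulr_le0_ge0// sqr_ge0.
  have c2 : (x + h) ^+ 3 <= 0 by rewrite exprS mulr_le0_ge0// sqr_ge0.
  have c3 : h ^+ 3 <= (x + h) ^+ 3.
    have := sqr_ge0 (x + 2 * h); have := sqr_ge0 x; nra.
  by rewrite (ler0_norm c) opprK; apply/andP; split; nra.
- have h0 : 0 <= h by lra.
  have c : 0 <= h ^+ 3 by rewrite exprn_ge0.
  have c3 : (x + h) ^+ 3 <= h ^+ 3 by rewrite lerXn2r ?nnegrE//; lra.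
  have c4 : 0 <= (x + h) ^+ 3 by rewrite exprn_ge0.
  by rewrite (ger0_norm c); apply/andP; split; lra.
- by rewrite !expr0n/= !mulr0 !mul0r !subr0 normr_ge0 andbT oppr_le0 normr_ge0.
Qed.

(** The probability that a sum of three independent uniform variables on [0, 1] exceeds y
    (Irwin-Hall): it is C^2, equal to 1 before 0 and to 0 after 3. *)
Definition step y : R :=
  1 - (tp y ^+ 3 - 3 * tp (y - 1) ^+ 3 + 3 * tp (y - 2) ^+ 3 - tp (y - 3) ^+ 3) / 6.
Definition step1 y : R :=
  - (tp y ^+ 2 - 3 * tp (y - 1) ^+ 2 + 3 * tp (y - 2) ^+ 2 - tp (y - 3) ^+ 2) / 2.
(** Half of the second derivative, that is, the Taylor coefficient of h^2. *)
Definition step2 y : R := - (tp y - 3 * tp (y - 1) + 3 * tp (y - 2) - tp (y - 3)) / 2.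

(** The constant is (1 + 3 + 3 + 1) / 6, one remainder at most |h|^3 for each of the four truncated
    cubes. *)
Lemma step_taylor y h :
  `|step (y + h) - step y - step1 y * h - step2 y * h ^+ 2| <= 4 / 3 * `|h| ^+ 3.
Proof.
have t0 := tp_taylor y h; have t1 := tp_taylor (y - 1) h.
have t2 := tp_taylor (y - 2) h; have t3 := tp_taylor (y - 3) h.
move: t0 t1 t2 t3; rewrite /step /step1 /step2 (addrAC y (-1)) (addrAC y (-2)) (addrAC y (-3)).
rewrite !ler_norml => /andP[a0 b0] /andP[a1 b1] /andP[a2 b2] /andP[a3 b3].
by apply/andP; split; lra.
Qed.

Lemma stepP y : [/\ 0 <= step y <= 1, -1 <= step1 y <= 0 & -1 <= step2 y <= 1].
Proof.
rewrite /step /step1 /step2.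
case: (tpP y) => [[h0 ->]|[h0 ->]]; case: (tpP (y - 1)) => [[h1 ->]|[h1 ->]];
  case: (tpP (y - 2)) => [[h2 ->]|[h2 ->]]; case: (tpP (y - 3)) => [[h3 ->]|[h3 ->]]; try lra.
- by split; apply/andP; split; lra.
- pose t := 3 - y; have -> : y = 3 - t by rewrite /t; ring.
  have t0 : 0 <= t <= 1 by rewrite /t; apply/andP; split; lra.
  case/andP: t0 => t0 t1; have t2 : 0 <= t ^+ 2 <= 1 by rewrite sqr_ge0 expr_le1.
  have t3 : 0 <= t ^+ 3 <= 1 by rewrite exprn_ge0//= expr_le1.
  case/andP: t2 => t2 t2'; case/andP: t3 => t3 t3'.
  by split; apply/andP; split; lra.
- pose t := y - 1; have -> : y = 1 + t by rewrite /t; ring.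
  have t0 : 0 <= t <= 1 by rewrite /t; apply/andP; split; lra.
  case/andP: t0 => t0 t1; have t2 : 0 <= t ^+ 2 <= t by rewrite sqr_ge0 expr2 ler_piMr.
  case/andP: t2 => t2 t2'.
  have t3 : 0 <= t ^+ 3 <= t ^+ 2 by rewrite exprn_ge0//= exprS ler_piMl.
  case/andP: t3 => t3 t3'.
  have tc : 0 <= (1 - t) * (4 + t - 2 * t ^+ 2) by rewrite mulr_ge0//; lra.
  by have := sqr_ge0 (2 * t - 1) => tq; split; apply/andP; split; lra.
- have t2 : 0 <= y ^+ 2 <= 1 by rewrite sqr_ge0 expr_le1//; lra.
  have t3 : 0 <= y ^+ 3 <= 1 by rewrite exprn_ge0//= expr_le1//; lra.
  case/andP: t2 => t2 t2'; case/andP: t3 => t3 t3'.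
  by split; apply/andP; split; lra.
- by rewrite !expr0n/=; split; apply/andP; split; lra.
Qed.

Lemma step_le0 y : y <= 0 -> step y = 1.
Proof.
move=> y0; rewrite /step /tp !max_l ?expr0n/=; [by field|lra|lra|lra|lra].
Qed.

Lemma step_ge3 y : 3 <= y -> step y = 0.
Proof.
move=> y0; rewrite /step /tp !max_r; [by field|lra|lra|lra|lra].
Qed.

Lemma step_lipschitz y h : `|step (y + h) - step y| <= 4 * `|h|.
Proof.
have [/andP[a0 a1] _ _] := stepP (y + h); have [/andP[b0 b1] /andP[c0 c1] /andP[d0 d1]] := stepP y.
case: (lerP 1 `|h|) => h1; first by rewrite ler_norml; apply/andP; split; lra.
have := step_taylor y h.
have n0 := normr_ge0 h.
have h3 : `|h| ^+ 3 <= `|h|.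
  by rewrite exprS ler_piMr// expr_le1// ltW.
have h2 : `|step2 y * h ^+ 2| <= `|h|.
  rewrite normrM -[leRHS]mul1r ler_pM//; first by rewrite ler_norml d0.
  by rewrite normrX expr2 ler_piMr// ltW.
have h1' : `|step1 y * h| <= `|h|.
  by rewrite normrM ler_piMl// ler_norml c0; lra.
move: h1' h2; rewrite !ler_norml => /andP[? ?] /andP[? ?] /andP[? ?].
by apply/andP; split; lra.
Qed.

(** u stands for the linear part 2 <s, v> / e and w for the quadratic part |v|^2 / e of the
    increment. At second order only u^2 is kept, the part fixed by the covariance. If |w| <= 1
    Taylor's formula applies; if |w| > 1, w^2 pays for every bounded term. *)
Lemma step_expand y u w :
  `|step (y + (u + w)) - step y - step1 y * (u + w) - step2 y * u ^+ 2| <=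
  10 * (`|u| ^+ 3 + `|u| * `|w| + w ^+ 2).
Proof.
have [/andP[a0 a1] _ _] := stepP (y + (u + w)).
have [/andP[b0 b1] /andP[c0 c1] /andP[d0 d1]] := stepP y.
have u0 := normr_ge0 u; have w0 := normr_ge0 w.
have w2 : w ^+ 2 = `|w| ^+ 2 by rewrite real_normK ?num_real.
have u2 : u ^+ 2 = `|u| ^+ 2 by rewrite real_normK ?num_real.
have n1 (a b : R) : -1 <= a <= 1 -> `|a * b| <= `|b|.
  by move=> ?; rewrite normrM ler_piMl// ler_norml.
case: (lerP `|w| 1) => h1.
  have := step_taylor y (u + w).
  have e1 : `|step2 y * (2 * (u * w) + w ^+ 2)| <= 2 * (`|u| * `|w|) + w ^+ 2.
    apply: le_trans (n1 _ _ _) _; first by rewrite d0.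
    apply: le_trans (ler_normD _ _) _.
    by rewrite (ger0_norm (sqr_ge0 w)) !normrM (@ger0_norm _ 2).
  have e2 : `|u + w| ^+ 3 <= 4 * (`|u| ^+ 3 + `|w| ^+ 3).
    apply: (@le_trans _ _ ((`|u| + `|w|) ^+ 3)).
      by rewrite lerXn2r ?nnegrE ?addr_ge0// ler_normD.
    rewrite -subr_ge0 (_ : _ - _ = 3 * ((`|u| + `|w|) * (`|u| - `|w|) ^+ 2)); last by ring.
    by rewrite mulr_ge0// mulr_ge0 ?sqr_ge0// addr_ge0.
  have e3 : `|w| ^+ 3 <= w ^+ 2 by rewrite w2 exprS ler_piMl// exprn_ge0.
  have : 0 <= `|u| * `|w| by rewrite mulr_ge0.
  have : 0 <= `|u| ^+ 3 by rewrite exprn_ge0.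
  have := sqr_ge0 w.
  move: e1; rewrite !ler_norml => /andP[? ?] ? ? ? /andP[? ?].
  by apply/andP; split; lra.
have e1 : `|step1 y * (u + w)| <= `|u| * `|w| + w ^+ 2.
  apply: le_trans (n1 _ _ _) _; first by apply/andP; split; lra.
  apply: le_trans (ler_normD _ _) _.
  rewrite w2 expr2; apply: lerD; first by rewrite ler_peMr// (ltW h1).
  by rewrite ler_peMr// (ltW h1).
have w1 : 1 <= w ^+ 2 by rewrite w2 expr_ge1// ltW.
have e2 : `|step2 y * u ^+ 2| <= `|u| ^+ 3 + w ^+ 2.
  apply: le_trans (n1 _ _ _) _; first by rewrite d0.
  rewrite (ger0_norm (sqr_ge0 _)) u2; case: (lerP `|u| 1) => h2.
    have : `|u| ^+ 2 <= 1 by rewrite expr_le1.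
    have : 0 <= `|u| ^+ 3 by rewrite exprn_ge0.
    lra.
  have : `|u| ^+ 2 <= `|u| ^+ 3 by rewrite (exprS _ 2) ler_peMl ?exprn_ge0// ltW.
  lra.
have : 0 <= `|u| * `|w| by rewrite mulr_ge0.
have : 0 <= `|u| ^+ 3 by rewrite exprn_ge0.
move: e1 e2; rewrite !ler_norml => /andP[? ?] /andP[? ?] ? ?.
by apply/andP; split; lra.
Qed.

Lemma measurable_step d (T : measurableType d) (f : T -> R) : measurable_fun setT f ->
  measurable_fun setT (fun t => step (f t)).
Proof.
move=> mf.
have mt (c : R) : measurable_fun setT (fun t => tp (f t - c) ^+ 3).
  by apply: measurable_funX; apply: measurable_maxr => //; exact: measurable_funB.
have mt0 : measurable_fun setT (fun t => tp (f t) ^+ 3).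
  by apply: measurable_funX; apply: measurable_maxr.
apply: measurable_funB => //; apply: measurable_funM => //.
apply: measurable_funB; last exact: mt.
apply: measurable_funD; last by apply: measurable_funM => //; exact: mt.
by apply: measurable_funB => //; apply: measurable_funM => //; exact: mt.
Qed.

End Step.

(** * Inner products and random vectors with fourth moments *)

Section InnerProduct.
Context (R : realType) (n : nat).
Implicit Types u v s x : 'cV[R]_n.

Definition ip u v : R := (u^T *m v) 0 0.

Lemma ipE u v : ip u v = \sum_k u k 0 * v k 0.
Proof. by rewrite /ip mxE; apply: eq_bigr => k _; rewrite mxE. Qed.

Lemma ipC u v : ip u v = ip v u.
Proof. by rewrite !ipE; apply: eq_bigr => k _; rewrite mulrC. Qed.

Lemma ipDr u v x : ip u (v + x) = ip u v + ip u x.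
Proof. by rewrite /ip mulmxDr mxE. Qed.

Lemma sqnD s x : sqn (s + x) = sqn s + (2 * ip s x + sqn x).
Proof.
rewrite /sqn ipE mulr_sumr -!big_split /=; apply: eq_bigr => k _.
by rewrite !mxE; ring.
Qed.

Lemma sqnZ (c : R) v : sqn (c *: v) = c ^+ 2 * sqn v.
Proof. by rewrite /sqn mulr_sumr; apply: eq_bigr => k _; rewrite mxE exprMn. Qed.

Lemma sqn_eq0 v : sqn v = 0 -> v = 0.
Proof.
move=> h; apply/matrixP => k j; rewrite mxE (ord1 j); apply/eqP.
move/eqP: h; rewrite psumr_eq0 => [/allP /(_ k)|i _]; last exact: sqr_ge0.
by rewrite mem_index_enum /= sqrf_eq0 => /(_ isT).
Qed.

Lemma ip_cs u v : ip u v ^+ 2 <= sqn u * sqn v.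
Proof.
have h : 0 <= sqn (sqn v *: u + (- ip u v) *: v) by exact: sqn_ge0.
move: h; rewrite sqnD !sqnZ.
have -> : ip (sqn v *: u) (- ip u v *: v) = - (sqn v * ip u v ^+ 2).
  rewrite {1}ipE (eq_bigr (fun k => - (sqn v * ip u v) * (u k 0 * v k 0))).
    by rewrite -mulr_sumr -ipE; ring.
  by move=> k _; move: (ip u v) (sqn v) => c c'; rewrite !mxE; ring.
have [v0|v0] := eqVneq (sqn v) 0.
  by move=> _; rewrite (sqn_eq0 v0) /ip mulmx0 mxE expr0n/= mulr_ge0 ?sqn_ge0.
have vp : 0 < sqn v by rewrite lt_neqAle eq_sym v0 sqn_ge0.
move: (ip u v) (sqn u) (sqn v) vp => c p q vp h.
have : 0 <= q * (p * q - c ^+ 2) by lra.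
by rewrite pmulr_rge0// subr_ge0.
Qed.

End InnerProduct.

Section RandomVector.
Context (R : realType) (n : nat).

Definition L4v d (T : measurableType d) (P : probability T R) (X : T -> 'cV[R]_n) :=
  forall k, L4 P (fun w => X w k 0).

Lemma sqn2_le (v : 'cV[R]_n) : sqn v ^+ 2 <= n%:R * \sum_(k < n) v k 0 ^+ 4.
Proof.
have := ip_cs (const_mx 1 : 'cV[R]_n) (\col_k v k 0 ^+ 2).
rewrite ipE (_ : \sum_k _ = sqn v); last by apply: eq_bigr => k _; rewrite !mxE mul1r.
rewrite (_ : sqn (const_mx 1) = n%:R); last first.
  rewrite /sqn (eq_bigr (fun=> 1)); last by move=> k _; rewrite mxE expr1n.
  by rewrite sumr_const card_ord.
by rewrite (_ : sqn (\col_k _) = \sum_k v k 0 ^+ 4)//; apply: eq_bigr => k _; rewrite mxE -exprM.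
Qed.

Section one.
Context d (T : measurableType d) (P : probability T R) (X : T -> 'cV[R]_n).
Hypothesis hX : L4v P X.

Lemma L4v_ip v : L4 P (fun w => ip v (X w)).
Proof.
apply: (L4_ext (f := fun w => \sum_k v k 0 * X w k 0)); first by move=> w; rewrite ipE.
by apply: L4_sum => k _; exact: L4Z.
Qed.

Lemma L4v_sqn : itg P (fun w => sqn (X w)).
Proof. by apply: itg_sum => k _; exact: L4_sqr. Qed.

Lemma L4v_sqn2 : itg P (fun w => sqn (X w) ^+ 2).
Proof.
apply: (itg_ext (f := fun w => \sum_k \sum_j (X w k 0 * X w k 0 * X w j 0 * X w j 0))).
  move=> w; rewrite expr2 {1}/sqn mulr_suml; apply: eq_bigr => k _.
  by rewrite /sqn mulr_sumr; apply: eq_bigr => j _; ring.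
by apply: itg_sum => k _; apply: itg_sum => j _; exact: L4_mul4.
Qed.

Lemma L4v_meas : meas_vec X.
Proof. by move=> k; case: (hX k). Qed.

Lemma Ex_sqn : Ex P (fun w => sqn (X w)) = \sum_k Ex P (fun w => X w k 0 ^+ 2).
Proof. by rewrite Ex_sum// => k _; exact: L4_sqr. Qed.

Lemma Ex_sqn2 (c : R) : (forall k, Ex P (fun w => X w k 0 ^+ 4) <= c) ->
  Ex P (fun w => sqn (X w) ^+ 2) <= n%:R ^+ 2 * c.
Proof.
move=> hc; have i4 k : itg P (fun w => X w k 0 ^+ 4) by case: (hX k).
apply: (@le_trans _ _ (Ex P (fun w => n%:R * \sum_k X w k 0 ^+ 4))).
  apply: Ex_le; [exact: L4v_sqn2|by apply: itgZ; exact: itg_sum|].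
  by move=> w; exact: sqn2_le.
rewrite ExZ; last by apply: itg_sum.
rewrite Ex_sum// expr2 -mulrA ler_wpM2l//.
apply: (@le_trans _ _ (\sum_(k < n) c)); first by apply: ler_sum.
by rewrite sumr_const card_ord mulr_natl.
Qed.

End one.

Lemma gvec_L4v d (T : measurableType d) (P : probability T R) (Z : T -> 'cV[R]_n) Sigma :
  gvec P Z Sigma -> L4v P Z.
Proof. exact: gvec_meas. Qed.

Lemma L4v_fst d d' (S : measurableType d) (T : measurableType d') (P : probability S R)
  (Q : probability T R) (X : S -> 'cV[R]_n) : L4v P X -> L4v (prodP P Q) (fun z => X z.1).
Proof. by move=> hX k; exact: (L4_fst Q (hX k)). Qed.

Lemma L4v_snd d d' (S : measurableType d) (T : measurableType d') (P : probability S R)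
  (Q : probability T R) (X : T -> 'cV[R]_n) : L4v Q X -> L4v (prodP P Q) (fun z => X z.2).
Proof. by move=> hX k; exact: (L4_snd P (hX k)). Qed.

Lemma L4vD d (T : measurableType d) (P : probability T R) (X Y : T -> 'cV[R]_n) :
  L4v P X -> L4v P Y -> L4v P (fun w => X w + Y w).
Proof. by move=> hX hY k; apply: L4_ext (L4D (hX k) (hY k)) => w; rewrite mxE. Qed.

End RandomVector.

(** * Replacement of one summand *)

Section Swap.
Context (R : realType) (n : nat) (a e : R) (e0 : 0 < e).

Definition sstep (z : 'cV[R]_n) : R := step ((sqn z - a) / e).

Definition srem (s v : 'cV[R]_n) : R :=
  10 * (`|2 * ip s v / e| ^+ 3 + `|2 * ip s v / e| * `|sqn v / e| + (sqn v / e) ^+ 2).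

Lemma meas_sstep d (T : measurableType d) (X : T -> 'cV[R]_n) : meas_vec X ->
  measurable_fun setT (fun w => sstep (X w)).
Proof.
move=> mX; apply: measurable_step; apply: measurable_funM => //; apply: measurable_funB => //.
exact: measurable_sqn.
Qed.

Lemma itg_sstep d (T : measurableType d) (P : probability T R) (X : T -> 'cV[R]_n) : meas_vec X ->
  itg P (fun w => sstep (X w)).
Proof.
move=> mX; apply: (@itg_bounded _ _ _ _ _ 1); first exact: meas_sstep.
by move=> w; rewrite /sstep; case: (stepP ((sqn (X w) - a) / e)) => /andP[h1 h2] _ _; rewrite ger0_norm.
Qed.

Section mean.
Context d (T : measurableType d) (P : probability T R) (X : T -> 'cV[R]_n).
Hypothesis hX : L4v P X.

Lemma itg_srem s : itg P (fun w => srem s (X w)).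
Proof.
have hi := L4v_ip hX s.
have mi := hi.1; have ms := measurable_sqn (L4v_meas hX).
have m1 : measurable_fun setT (fun w => `|2 * ip s (X w) / e|).
  by apply: measurableT_comp => //; apply: measurable_funM => //; exact: measurable_funM.
have m2 : measurable_fun setT (fun w => `|sqn (X w) / e|).
  by apply: measurableT_comp => //; exact: measurable_funM.
have m3 : measurable_fun setT (fun w => sqn (X w) / e) by exact: measurable_funM.
have i2 : itg P (fun w => (sqn (X w) / e) ^+ 2).
  apply: (itg_ext (f := fun w => e^-1 ^+ 2 * sqn (X w) ^+ 2)); first by move=> w; rewrite exprMn mulrC.
  by apply: itgZ; exact: L4v_sqn2.
have h2 : L4 P (fun w => 2 * ip s (X w) / e).
  by apply: (L4_ext (f := fun w => 2 / e * ip s (X w))); [move=> w; ring|exact: L4Z].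
apply: itgZ; apply: itgD => //; apply: itgD.
  apply: (itg_ext (f := fun w => `|(2 * ip s (X w) / e) ^+ 3|)); first by move=> w; rewrite normrX.
  by apply: itg_abs; exact: L4_cube.
apply: (@itg_le _ _ _ _ _ (fun w => (2 * ip s (X w) / e) ^+ 2 + (sqn (X w) / e) ^+ 2)).
- exact: measurable_funM.
- by apply: itgD => //; exact: L4_sqr.
move=> w; rewrite normrM !normr_id.
rewrite -(real_normK (num_real (2 * _ / e))) -(real_normK (num_real (sqn _ / e))).
move: (`|2 * _ / e|) (`|sqn _ / e|) => p q; have := sqr_ge0 (p - q); have := sqr_ge0 p; have := sqr_ge0 q; lra.
Qed.

(** Up to [srem], the mean depends on X only through its mean square norm and its variance in the
    direction s. A summand and its Gaussian substitute share both, so the main terms cancel in a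
    swap. *)
Lemma sstep_mean (s : 'cV[R]_n) (V : R) : (forall v, Ex P (fun w => ip v (X w)) = 0) ->
  Ex P (fun w => ip s (X w) ^+ 2) = V ->
  `|Ex P (fun w => sstep (s + X w)) -
    (step ((sqn s - a) / e) + step1 ((sqn s - a) / e) * (Ex P (fun w => sqn (X w)) / e)
      + step2 ((sqn s - a) / e) * (4 * V / e ^+ 2))| <= Ex P (fun w => srem s (X w)).
Proof.
move=> h0 hV; have hi := L4v_ip hX s.
set y := (sqn s - a) / e.
have i1 : itg P (fun w => ip s (X w)) by exact: L4_itg.
have i2 : itg P (fun w => ip s (X w) ^+ 2) by exact: L4_sqr.
have i3 := L4v_sqn hX.
have mX : meas_vec (fun w => s + X w).
  move=> k; rewrite (_ : (fun w => _) = (fun w => s k 0 + X w k 0)); last by apply/funext => w; rewrite mxE.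
  by apply: measurable_funD => //; exact: L4v_meas.
have i4 := itg_sstep P mX.
pose q w := step y + step1 y * (2 / e * ip s (X w)) + step1 y * (e^-1 * sqn (X w)) + step2 y * (4 / e ^+ 2 * ip s (X w) ^+ 2).
have iq0 : itg P (fun w => step1 y * (2 / e * ip s (X w))) by do 2 apply: itgZ.
have iq1 : itg P (fun w => step1 y * (e^-1 * sqn (X w))) by do 2 apply: itgZ.
have iq2 : itg P (fun w => step2 y * (4 / e ^+ 2 * ip s (X w) ^+ 2)) by do 2 apply: itgZ.
have iq3 := itgD (itg_cst P (step y)) iq0.
have iq4 := itgD iq3 iq1.
have iq : itg P q by exact: (itgD iq4 iq2).
have Eq : Ex P q = step y + step1 y * (Ex P (fun w => sqn (X w)) / e) + step2 y * (4 * V / e ^+ 2).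
  rewrite /q (ExD iq4 iq2) (ExD iq3 iq1) (ExD (itg_cst P (step y)) iq0) Ex_cst.
  rewrite !ExZ ?h0 ?hV//; try by apply: itgZ.
  by rewrite !mulr0 addr0 (mulrC e^-1); congr (_ + _ * _); ring.
rewrite -Eq -ExB//; apply: le_trans (Ex_abs_le (itgB i4 iq)) _.
apply: Ex_le; [by apply: itg_abs; exact: itgB|exact: itg_srem|].
move=> w; have := step_expand y (2 * ip s (X w) / e) (sqn (X w) / e).
rewrite /sstep sqnD.
rewrite (_ : y + _ = (sqn s + (2 * ip s (X w) + sqn (X w)) - a) / e); last by rewrite /y; ring.
move=> h; rewrite /q; apply: le_trans h; rewrite le_eqVlt; apply/orP; left; apply/eqP; congr `|_|.
by rewrite exprMn exprMn -exprVn; ring.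
Qed.

End mean.

(** Interpolates the third absolute moment between the second and the fourth. Here r will be |v|,
    and A stays free until it is balanced in [lindeberg_rate]. *)
Lemma cube_young (x r A : R) : 0 < A -> 0 < r ->
  `|x| ^+ 3 <= (A * r * x ^+ 2 + (A * r)^-1 * x ^+ 4) / 2.
Proof.
move=> A0 r0; have c0 : 0 < A * r by rewrite mulr_gt0.
move: (A * r) c0 => c c0.
have -> : x ^+ 2 = `|x| ^+ 2 by rewrite real_normK ?num_real.
have -> : x ^+ 4 = `|x| ^+ 4 by rewrite -[4%N]/(2 * 2)%N !exprM real_normK ?num_real.
move: `|x| (normr_ge0 x) => y y0.
rewrite -subr_ge0 (_ : _ - _ = (c - y) ^+ 2 * y ^+ 2 / (2 * c)); last by field; rewrite gt_eqF.
by apply: divr_ge0; [apply: mulr_ge0; exact: sqr_ge0|rewrite mulr_ge0// ltW].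
Qed.

Lemma abs_young (x r t : R) : 0 < t -> 0 < r -> `|x| <= ((t * r)^-1 * x ^+ 2 + t * r) / 2.
Proof.
move=> t0 r0; have c0 : 0 < t * r by rewrite mulr_gt0.
move: (t * r) c0 => c c0.
have -> : x ^+ 2 = `|x| ^+ 2 by rewrite real_normK ?num_real.
move: `|x| => y.
rewrite -subr_ge0 (_ : _ - _ = (c - y) ^+ 2 / (2 * c)); last by field; rewrite gt_eqF.
by rewrite divr_ge0 ?sqr_ge0 ?mulr_ge0 ?(ltW c0).
Qed.

Section bounds.
Context (tau M A th : R) (tau0 : 0 < tau) (A0 : 0 < A) (th0 : 0 < th) (M0 : 0 <= M).

(** A bound for the mean of [srem] over the rest of the sum. The cube |v|^3 is already split between
    |v|^2 and |v|^4 at the scale [th], so averaging over the summand uses its second and fourth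
    moments only. *)
Definition sbnd (v : 'cV[R]_n) : R :=
  10 * ((2 * (A * tau ^+ 2 + M / A) / e ^+ 3 + tau / e ^+ 2) * (th * sqn v + sqn v ^+ 2 / th)
     + sqn v ^+ 2 / e ^+ 2).

Section hybrid.
Context d (T : measurableType d) (Q : probability T R) (S : T -> 'cV[R]_n).
Hypothesis hS : L4v Q S.
Hypothesis S2 : forall v, Ex Q (fun w => ip v (S w) ^+ 2) <= tau ^+ 2 * sqn v.
Hypothesis S4 : forall v, Ex Q (fun w => ip v (S w) ^+ 4) <= M * sqn v ^+ 2.

Lemma Ex_srem v : itg Q (fun w => srem (S w) v) /\ Ex Q (fun w => srem (S w) v) <= sbnd v.
Proof.
have [v0|v0] := eqVneq (sqn v) 0.
  have E w : srem (S w) v = 0.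
    by rewrite /srem v0 (sqn_eq0 v0) /ip mulmx0 mxE mulr0 mul0r normr0 !expr0n/= mul0r !addr0 mulr0.
  split; first by apply: itg_ext (itg_cst Q 0) => w; rewrite E.
  by rewrite (eq_Ex _ (g := fun=> 0) E) Ex_cst /sbnd v0 expr0n/= !mul0r !mulr0 !addr0 mulr0 mulr0.
have vp : 0 < sqn v by rewrite lt_neqAle eq_sym v0 sqn_ge0.
pose r := Num.sqrt (sqn v); have r0 : 0 < r by rewrite sqrtr_gt0.
have r2 : sqn v = r ^+ 2 by rewrite sqr_sqrtr// ltW.
have hv := L4v_ip hS v.
have i2 := L4_sqr hv.
have i4 : itg Q (fun w => ip v (S w) ^+ 4) by case: hv.
have p3 : 0 <= 8 / e ^+ 3 by rewrite divr_ge0// exprn_ge0// ltW.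
have p2 : 0 <= 2 / e ^+ 2 * sqn v by rewrite mulr_ge0 ?sqn_ge0// divr_ge0// exprn_ge0// ltW.
pose c1 := 10 * (8 / e ^+ 3 * (A * r / 2) + 2 / e ^+ 2 * sqn v * ((tau * r)^-1 / 2)).
pose c2 := 10 * (8 / e ^+ 3 * ((A * r)^-1 / 2)).
pose c0 := 10 * (2 / e ^+ 2 * sqn v * (tau * r / 2) + (sqn v / e) ^+ 2).
have le w : srem (S w) v <= c1 * ip v (S w) ^+ 2 + c2 * ip v (S w) ^+ 4 + c0.
  rewrite /srem (ipC (S w)); move: (ip v (S w)) => x.
  have k3 := ler_wpM2l p3 (cube_young x A0 r0).
  have k2 := ler_wpM2l p2 (abs_young x tau0 r0).
  have -> : `|2 * x / e| ^+ 3 = 8 / e ^+ 3 * `|x| ^+ 3.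
    by rewrite !normrM normfV (gtr0_norm e0) (@gtr0_norm _ 2)// !exprMn exprVn; ring.
  have -> : `|2 * x / e| * `|sqn v / e| = 2 / e ^+ 2 * sqn v * `|x|.
    by rewrite !normrM normfV (gtr0_norm e0) (@gtr0_norm _ 2)// (gtr0_norm vp) expr2 invfM; ring.
  by rewrite /c1 /c2 /c0; lra.
have s0 w : 0 <= srem (S w) v.
  by rewrite mulr_ge0// !addr_ge0 ?sqr_ge0 ?exprn_ge0 ?mulr_ge0.
have j1 := itgZ c1 i2; have j2 := itgZ c2 i4; have j3 := itgD j1 j2.
have j := itgD j3 (itg_cst Q c0).
have isr : itg Q (fun w => srem (S w) v).
  apply: (itg_le _ j) => [|w]; last by rewrite ger0_norm.
  have mi : measurable_fun setT (fun w => ip (S w) v).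
    by rewrite (_ : (fun w => _) = (fun w => ip v (S w))); [case: hv|apply/funext => w; rewrite ipC].
  have m1 : measurable_fun setT (fun w => `|2 * ip (S w) v / e|).
    by apply: measurableT_comp => //; apply: measurable_funM => //; exact: measurable_funM.
  apply: measurable_funM => //; apply: measurable_funD => //; apply: measurable_funD; first exact: measurable_funX.
  exact: measurable_funM.
split => //; apply: le_trans (Ex_le isr j le) _.
rewrite (ExD j3 (itg_cst Q c0)) (ExD j1 j2) Ex_cst !ExZ//.
have c10 : 0 <= c1.
  rewrite mulr_ge0// addr_ge0// mulr_ge0// mulr_ge0 ?invr_ge0 ?mulr_ge0 ?(ltW A0) ?(ltW r0) ?(ltW tau0)//.
have c20 : 0 <= c2 by rewrite mulr_ge0// mulr_ge0// mulr_ge0 ?invr_ge0 ?mulr_ge0 ?(ltW A0) ?(ltW r0).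
have b1 := ler_wpM2l c10 (S2 v); have b2 := ler_wpM2l c20 (S4 v).
have e3 : 0 < e ^+ 3 by rewrite exprn_gt0.
have e2 : 0 < e ^+ 2 by rewrite exprn_gt0.
apply: (@le_trans _ _ (c1 * (tau ^+ 2 * sqn v) + c2 * (M * sqn v ^+ 2) + c0)); first lra.
have -> : c1 * (tau ^+ 2 * sqn v) + c2 * (M * sqn v ^+ 2) + c0 =
   10 * ((2 * (A * tau ^+ 2 + M / A) / e ^+ 3 + tau / e ^+ 2) * (2 * r ^+ 3) + sqn v ^+ 2 / e ^+ 2).
  rewrite /c1 /c2 /c0 r2; field.
  by rewrite !gt_eqF.
rewrite /sbnd ler_pM2l// lerD2r; apply: ler_wpM2l.
  rewrite addr_ge0 ?divr_ge0 ?(ltW tau0) ?(ltW e2) ?(ltW e3)// mulr_ge0// addr_ge0 ?divr_ge0 ?(ltW A0)//.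
  by rewrite mulr_ge0 ?sqr_ge0 ?(ltW A0).
rewrite r2 -subr_ge0 (_ : _ - _ = r ^+ 2 * (th - r) ^+ 2 / th); last by field; rewrite gt_eqF.
by apply: divr_ge0; [apply: mulr_ge0; exact: sqr_ge0|exact: ltW].
Qed.

Section mixed.
Context d1 (T1 : measurableType d1) (P : probability T1 R) (X : T1 -> 'cV[R]_n).
Hypothesis hX : L4v P X.
Hypothesis X2 : Ex P (fun w => sqn (X w)) <= th ^+ 2.
Hypothesis X4 : Ex P (fun w => sqn (X w) ^+ 2) <= 3 * th ^+ 4.

Lemma meas_srem : measurable_fun setT (fun z : T1 * T => srem (S z.2) (X z.1)).
Proof.
have h1 := L4v_fst Q hX; have h2 := L4v_snd P hS.
have mi : measurable_fun setT (fun z : T1 * T => 2 * ip (S z.2) (X z.1) / e).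
  apply: measurable_funM => //; apply: measurable_funM => //.
  rewrite (_ : (fun w => _) = (fun w : T1 * T => \sum_k S w.2 k 0 * X w.1 k 0)); last by apply/funext => w; rewrite ipE.
  by apply: measurable_sum => k; apply: measurable_funM; [case: (h2 k)|case: (h1 k)].
have ms : measurable_fun setT (fun z : T1 * T => sqn (X z.1) / e).
  by apply: measurable_funM => //; exact: measurable_sqn (L4v_meas h1).
apply: measurable_funM => //; apply: measurable_funD; last exact: measurable_funX.
apply: measurable_funD; first by apply: measurable_funX; exact: measurableT_comp.
by apply: measurable_funM; exact: measurableT_comp.
Qed.

Lemma itg_sbnd : itg P (fun w => sbnd (X w)).
Proof.
have i2 := L4v_sqn hX; have i4 := L4v_sqn2 hX.
have j4 (c : R) : itg P (fun w => sqn (X w) ^+ 2 / c).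
  by apply: (itg_ext (f := fun w => c^-1 * sqn (X w) ^+ 2)); [move=> w; rewrite mulrC|exact: itgZ].
by apply: itgZ; apply: itgD => //; apply: itgZ; apply: itgD => //; exact: itgZ.
Qed.

(** [sbnd] averaged with mean square th^2 and mean fourth power 3 th^4, whence the factor 4 = 1 + 3;
    the 3 accommodates Gaussian summands. *)
Definition swap_bound : R :=
  10 * ((2 * (A * tau ^+ 2 + M / A) / e ^+ 3 + tau / e ^+ 2) * (4 * th ^+ 3) + 3 * th ^+ 4 / e ^+ 2).

Lemma Ex_srem_prod : itg (prodP P Q) (fun z => srem (S z.2) (X z.1)) /\
  Ex (prodP P Q) (fun z => srem (S z.2) (X z.1)) <= swap_bound.
Proof.
have s0 s v : 0 <= srem s v.
  by rewrite mulr_ge0// !addr_ge0 ?sqr_ge0 ?exprn_ge0 ?mulr_ge0.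
have i : itg (prodP P Q) (fun z => srem (S z.2) (X z.1)).
  apply: (@itg_prod_tonelli _ _ _ _ _ _ _ _ (fun w => sbnd (X w))).
  - exact: meas_srem.
  - by move=> x; case: (Ex_srem (X x)).
  - exact: itg_sbnd.
  - move=> x; case: (Ex_srem (X x)) => _; apply: le_trans.
    by rewrite le_eqVlt; apply/orP; left; apply/eqP; apply: eq_Ex => y /=; rewrite ger0_norm.
split => //; rewrite Ex_prod//.
apply: le_trans (Ex_le (itg_inner i) itg_sbnd _) _.
  by move=> x /=; case: (Ex_srem (X x)).
have i2 := L4v_sqn hX; have i4 := L4v_sqn2 hX.
pose c := 2 * (A * tau ^+ 2 + M / A) / e ^+ 3 + tau / e ^+ 2.
have -> : Ex P (fun w => sbnd (X w)) = 10 * c * th * Ex P (fun w => sqn (X w)) +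
    10 * (c / th + (e ^+ 2)^-1) * Ex P (fun w => sqn (X w) ^+ 2).
  rewrite -!ExZ// -ExD; [|exact: itgZ|exact: itgZ].
  by apply: eq_Ex => w; rewrite /sbnd -/c; ring.
have e3 : 0 < e ^+ 3 by rewrite exprn_gt0.
have e2 : 0 < e ^+ 2 by rewrite exprn_gt0.
have c0 : 0 <= c.
  rewrite addr_ge0 ?divr_ge0 ?(ltW tau0) ?(ltW e2) ?(ltW e3)// mulr_ge0// addr_ge0 ?divr_ge0 ?(ltW A0)//.
  by rewrite mulr_ge0 ?sqr_ge0 ?(ltW A0).
have k1 : 0 <= 10 * c * th by rewrite !mulr_ge0 ?(ltW th0).
have k2 : 0 <= 10 * (c / th + (e ^+ 2)^-1).
  by rewrite mulr_ge0// addr_ge0 ?divr_ge0 ?invr_ge0 ?(ltW e2) ?(ltW th0).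
have := ler_wpM2l k1 X2; have := ler_wpM2l k2 X4.
have -> : 10 * (c / th + (e ^+ 2)^-1) * (3 * th ^+ 4) = 10 * (c * (3 * th ^+ 3) + 3 * th ^+ 4 / e ^+ 2).
  by field; rewrite !gt_eqF.
rewrite /swap_bound -/c; lra.
Qed.

End mixed.

Lemma swap_step d1 (T1 : measurableType d1) (P : probability T1 R) (X : T1 -> 'cV[R]_n)
  d2 (T2 : measurableType d2) (N : probability T2 R) (Z : T2 -> 'cV[R]_n) :
  L4v P X -> (forall v, Ex P (fun w => ip v (X w)) = 0) ->
  L4v N Z -> (forall v, Ex N (fun w => ip v (Z w)) = 0) ->
  (forall v, Ex P (fun w => ip v (X w) ^+ 2) = Ex N (fun w => ip v (Z w) ^+ 2)) ->
  Ex P (fun w => sqn (X w)) = Ex N (fun w => sqn (Z w)) ->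
  Ex P (fun w => sqn (X w)) <= th ^+ 2 ->
  Ex P (fun w => sqn (X w) ^+ 2) <= 3 * th ^+ 4 -> Ex N (fun w => sqn (Z w) ^+ 2) <= 3 * th ^+ 4 ->
  `|Ex (prodP P Q) (fun z => sstep (X z.1 + S z.2)) - Ex (prodP N Q) (fun z => sstep (Z z.1 + S z.2))|
   <= 2 * swap_bound.
Proof.
move=> hX X1 hZ Z1 XZ2 XZs X2 X4 Z4.
have Zs : Ex N (fun w => sqn (Z w)) <= th ^+ 2 by rewrite -XZs.
have [iX bX] := Ex_srem_prod hX X2 X4; have [iZ bZ] := Ex_srem_prod hZ Zs Z4.
have fX := itg_sstep (prodP P Q) (L4v_meas (L4vD (L4v_fst Q hX) (L4v_snd P hS))).
have fZ := itg_sstep (prodP N Q) (L4v_meas (L4vD (L4v_fst Q hZ) (L4v_snd N hS))).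
rewrite (Ex_prod2 fX) (Ex_prod2 fZ).
have jX := itg_inner2 fX; have jZ := itg_inner2 fZ.
have kX := itg_inner2 iX; have kZ := itg_inner2 iZ.
rewrite -ExB//; apply: le_trans (Ex_abs_le (itgB jX jZ)) _.
apply: (@le_trans _ _ (Ex Q (fun y => Ex P (fun x => srem (S y) (X x)) + Ex N (fun x => srem (S y) (Z x))))).
  apply: Ex_le; [by apply: itg_abs; exact: itgB|exact: itgD|].
  move=> y /=; have := sstep_mean hX X1 (erefl (Ex P (fun w => ip (S y) (X w) ^+ 2))).
  have := sstep_mean hZ Z1 (esym (XZ2 (S y))); rewrite -XZs.
  under [X in _ -> _ -> `|X - _| <= _]eq_Ex do rewrite addrC.
  under [X in _ -> _ -> `|_ - X| <= _]eq_Ex do rewrite addrC.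
  set a1 := Ex _ _; set a2 := Ex N (fun w => srem _ _); set a3 := Ex P (fun w => sstep _); set a4 := Ex P (fun w => srem _ _).
  rewrite !ler_norml => /andP[? ?] /andP[? ?]; apply/andP; split; lra.
rewrite ExD// -(Ex_prod2 iX) -(Ex_prod2 iZ); lra.
Qed.

End hybrid.
End bounds.
End Swap.

(** * Reordering the factors of a product space *)

Section Reassociate.
Context (R : realType) da db dc (A : measurableType da) (B : measurableType db)
  (C : measurableType dc) (P : probability A R) (Q : probability B R) (N : probability C R).

Lemma Ex_prodC (f : A * B -> R) (c : R) : measurable_fun setT f -> (forall z, `|f z| <= c) ->
  Ex (prodP P Q) f = Ex (prodP Q P) (fun z => f (z.2, z.1)).
Proof.
move=> mf fc; rewrite (Ex_prod (itg_bounded _ mf fc)).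
by rewrite (Ex_prod2 (itg_bounded (prodP Q P) (measurableT_comp mf (@measurable_swap _ _ B A)) (fun z => fc _))).
Qed.

Lemma Ex_prodA (F : A -> B -> C -> R) (c : R) :
  measurable_fun setT (fun z : A * (B * C) => F z.1 z.2.1 z.2.2) ->
  (forall x y z, `|F x y z| <= c) ->
  Ex (prodP P (prodP Q N)) (fun z => F z.1 z.2.1 z.2.2) =
  Ex (prodP (prodP P Q) N) (fun z => F z.1.1 z.1.2 z.2).
Proof.
move=> mF Fc.
have mF' : measurable_fun setT (fun z : (A * B) * C => F z.1.1 z.1.2 z.2).
  rewrite (_ : (fun z => _) = (fun z : A * (B * C) => F z.1 z.2.1 z.2.2) \o (fun z : (A * B) * C => (z.1.1, (z.1.2, z.2))))//.
  apply: (measurableT_comp mF); apply: measurable_fun_pair; first exact: measurableT_comp.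
  by apply: measurable_fun_pair => //; exact: measurableT_comp.
have i1 := itg_bounded (prodP P (prodP Q N)) mF (fun z => Fc _ _ _).
have i2 := itg_bounded (prodP (prodP P Q) N) mF' (fun z => Fc _ _ _).
rewrite (Ex_prod i1) (Ex_prod i2) (Ex_prod (itg_inner i2)); apply: eq_Ex => x.
rewrite Ex_prod//; apply: (itg_bounded _ _ (fun z => Fc _ _ _)).
exact: (measurableT_comp mF (measurable_pair1 x)).
Qed.
End Reassociate.

(** * Products of different laws on tuples *)

Section ProductSpace.
Context (R : realType) dT (T : measurableType dT).

Definition consX m (z : T * m.-tuple T) : m.+1.-tuple T := [tuple of z.1 :: z.2].

Lemma measurable_consX m : measurable_fun setT (@consX m).
Proof. exact: (@measurable_cons _ _ (T * m.-tuple T)%type T fst m snd). Qed.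

Lemma tnth_consX0 m (z : T * m.-tuple T) : tnth (consX z) ord0 = z.1.
Proof. by []. Qed.

Lemma tnth_consXS m (z : T * m.-tuple T) k : tnth (consX z) (lift ord0 k) = tnth z.2 k.
Proof. by rewrite /consX tnthS. Qed.

Fixpoint prodN m : ('I_m -> probability T R) -> probability (m.-tuple T) R :=
  match m with
  | 0 => fun=> dirac [tuple]
  | m'.+1 => fun mu => law (prodP (mu ord0) (prodN (fun k => mu (lift ord0 k)))) (@measurable_consX m')
  end.

Lemma itg_prodNS m (mu : 'I_m.+1 -> probability T R) (f : m.+1.-tuple T -> R) : measurable_fun setT f ->
  itg (prodN mu) f <-> itg (prodP (mu ord0) (prodN (fun k => mu (lift ord0 k)))) (f \o @consX m).
Proof.
move=> mf; exact: (@itg_law R _ _ _ _ (prodP (mu ord0) (prodN (fun k => mu (lift ord0 k)))) _ (@measurable_consX m) f mf).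
Qed.

Lemma Ex_prodNS m (mu : 'I_m.+1 -> probability T R) (f : m.+1.-tuple T -> R) : itg (prodN mu) f ->
  Ex (prodN mu) f = Ex (prodP (mu ord0) (prodN (fun k => mu (lift ord0 k)))) (f \o @consX m).
Proof.
by move=> hf; apply: Ex_law; [exact: itg_meas hf|apply/itg_prodNS => //; exact: itg_meas hf].
Qed.

Lemma sum_consX (V : nmodType) m (f : 'I_m.+1 -> T -> V) z :
  \sum_k f k (tnth (consX z) k) = f ord0 z.1 + \sum_k f (lift ord0 k) (tnth z.2 k).
Proof.
by rewrite big_ord_recl tnth_consX0; congr (_ + _); apply: eq_bigr => k _; rewrite tnth_consXS.
Qed.

(* Only the excess of a fourth moment over the Gaussian value 3 (sigma^2)^2 accumulates along
   independent sums. *)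
Lemma sum_prodN m (mu : 'I_m -> probability T R) (f : 'I_m -> T -> R) (s : 'I_m -> R) (c : R) : 0 <= c ->
  (forall k, L4 (mu k) (f k)) -> (forall k, Ex (mu k) (f k) = 0) ->
  (forall k, Ex (mu k) (fun x => f k x ^+ 2) = s k) -> (forall k, Ex (mu k) (fun x => f k x ^+ 4) <= c) ->
  [/\ L4 (prodN mu) (fun t => \sum_k f k (tnth t k)),
      Ex (prodN mu) (fun t => \sum_k f k (tnth t k)) = 0,
      Ex (prodN mu) (fun t => (\sum_k f k (tnth t k)) ^+ 2) = \sum_k s k &
      Ex (prodN mu) (fun t => (\sum_k f k (tnth t k)) ^+ 4) <= 3 * (\sum_k s k) ^+ 2 + m%:R * c].
Proof.
move=> c0; elim: m mu f s => [|m IH] mu f s f4 f1 f2 fc.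
  have E (t : 0.-tuple T) : \sum_k f k (tnth t k) = 0 by rewrite big_ord0.
  split; rewrite ?big_ord0.
  - by apply: L4_ext (L4_cst _ 0) => t; rewrite E.
  - by rewrite (eq_Ex _ E) Ex_cst.
  - by rewrite (eq_Ex _ (g := fun=> 0)) ?Ex_cst// => t; rewrite E expr0n.
  by rewrite (eq_Ex _ (g := fun=> 0)) ?Ex_cst ?expr0n/= ?mulr0 ?mul0r ?addr0// => t; rewrite E expr0n.
pose f' k := f (lift ord0 k); pose mu' k := mu (lift ord0 k).
have [g4 g1 g2 gc] := IH mu' f' (fun k => s (lift ord0 k)) (fun k => f4 _) (fun k => f1 _) (fun k => f2 _) (fun k => fc _).
have E z : \sum_k f k (tnth (consX z) k) = f ord0 z.1 + \sum_k f' k (tnth z.2 k) by exact: sum_consX.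
have sE p : (fun t : m.+1.-tuple T => (\sum_k f k (tnth t k)) ^+ p) \o @consX m =1
    (fun z => (f ord0 z.1 + \sum_k f' k (tnth z.2 k)) ^+ p) by move=> z /=; rewrite E.
have L : L4 (prodN mu) (fun t => \sum_k f k (tnth t k)).
  apply/(@L4_comp R _ _ _ _ (prodP (mu ord0) (prodN mu')) _ (@measurable_consX m)).
    apply: measurable_sum => k; case: (f4 k) => mf _.
    by apply: measurableT_comp => //; exact: measurable_tnth.
  apply: L4_ext (L4D (L4_fst (prodN mu') (f4 ord0)) (L4_snd (mu ord0) g4)).
  by move=> z; rewrite /= E.
rewrite !big_ord_recl; split => //.
- rewrite Ex_prodNS; last exact: L4_itg.
  by rewrite (eq_Ex _ E) (indep_sum1 (f4 ord0) g4) f1 g1 addr0.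
- rewrite Ex_prodNS; last exact: L4_sqr.
  by rewrite (eq_Ex _ (sE 2)) (indep_sum2 (f4 ord0) g4)// f2 g2.
rewrite Ex_prodNS; last by case: L.
rewrite (eq_Ex _ (sE 4)) (indep_sum4 (f4 ord0) g4)// f2 g2.
have := fc ord0; move: gc; rewrite -natr1.
have : 0 <= s ord0 ^+ 2 by exact: sqr_ge0.
lra.
Qed.

(** Brings the first summand to the front, as the factor that a Lindeberg step replaces, with the
    Gaussian part and the remaining summands together as the rest. *)
Lemma Ex_prod_consX dS (S : measurableType dS) (Q : probability S R) m
    (mu : 'I_m.+1 -> probability T R) (H : S -> m.+1.-tuple T -> R) (c : R) :
  let mu' := fun k => mu (lift ord0 k) in
  measurable_fun setT (fun z : S * m.+1.-tuple T => H z.1 z.2) -> (forall s t, `|H s t| <= c) ->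
  Ex (prodP Q (prodN mu)) (fun z => H z.1 z.2) =
  Ex (prodP (mu ord0) (prodP Q (prodN mu'))) (fun z => H z.2.1 (consX (z.1, z.2.2))).
Proof.
move=> mu' mH Hc.
pose F s x t := H s (consX (x, t)).
have mF1 : measurable_fun setT (fun z : S * (T * m.-tuple T) => F z.1 z.2.1 z.2.2).
  rewrite (_ : (fun z => _) = (fun z : S * m.+1.-tuple T => H z.1 z.2) \o (fun z : S * (T * m.-tuple T) => (z.1, consX z.2))).
    apply: (measurableT_comp mH); apply: measurable_fun_pair => //.
    by apply: measurableT_comp => //; exact: measurable_consX.
  by apply/funext => -[s [x t]].
have mF2 : measurable_fun setT (fun z : T * (S * m.-tuple T) => F z.2.1 z.1 z.2.2).
  rewrite (_ : (fun z => _) = (fun z : S * (T * m.-tuple T) => F z.1 z.2.1 z.2.2) \o (fun z : T * (S * m.-tuple T) => (z.2.1, (z.1, z.2.2))))//.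
  apply: (measurableT_comp mF1); apply: measurable_fun_pair; first exact: measurableT_comp.
  by apply: measurable_fun_pair => //; exact: measurableT_comp.
rewrite (@Ex_prodA _ _ _ _ _ _ _ (mu ord0) Q (prodN mu') (fun x s t => F s x t) c)//; last by move=> *; exact: Hc.
have i0 := itg_bounded (prodP Q (prodN mu)) mH (fun z => Hc _ _).
transitivity (Ex (prodP Q (prodP (mu ord0) (prodN mu'))) (fun z => F z.1 z.2.1 z.2.2)).
  rewrite (Ex_prod i0) Ex_prod; last exact: (itg_bounded _ mF1 (fun z => Hc _ _)).
  apply: eq_Ex => s; rewrite Ex_prodNS; last first.
    by apply: (itg_bounded _ _ (Hc s)); exact: (measurableT_comp mH (measurable_pair1 s)).
  by apply: eq_Ex => -[x t].
rewrite (@Ex_prodA _ _ _ _ _ _ _ Q (mu ord0) (prodN mu') F c)//; last by move=> *; exact: Hc.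
have mF3 : measurable_fun setT (fun z : (S * T) * m.-tuple T => F z.1.1 z.1.2 z.2).
  rewrite (_ : (fun z => _) = (fun z : S * (T * m.-tuple T) => F z.1 z.2.1 z.2.2) \o (fun z : (S * T) * m.-tuple T => (z.1.1, (z.1.2, z.2))))//.
  apply: (measurableT_comp mF1); apply: measurable_fun_pair; first exact: measurableT_comp.
  by apply: measurable_fun_pair => //; exact: measurableT_comp.
have mF4 : measurable_fun setT (fun z : (T * S) * m.-tuple T => F z.1.2 z.1.1 z.2).
  rewrite (_ : (fun z => _) = (fun z : (S * T) * m.-tuple T => F z.1.1 z.1.2 z.2) \o (fun z : (T * S) * m.-tuple T => ((z.1.2, z.1.1), z.2)))//.
  apply: (measurableT_comp mF3); apply: measurable_fun_pair => //.
  by apply: measurable_fun_pair => //; exact: measurableT_comp.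
have i3 := itg_bounded (prodP (prodP Q (mu ord0)) (prodN mu')) mF3 (fun z => Hc _ _).
have i4 := itg_bounded (prodP (prodP (mu ord0) Q) (prodN mu')) mF4 (fun z => Hc _ _).
rewrite (Ex_prod i3) (Ex_prod i4).
rewrite (@Ex_prodC _ _ _ _ _ Q (mu ord0) _ c)//; first exact: itg_meas (itg_inner i3).
move=> z; apply: Ex_bound; last by move=> t; exact: Hc.
by apply: (itg_bounded _ _ (fun t => Hc _ _)); exact: (measurableT_comp mF3 (measurable_pair1 z)).
Qed.

End ProductSpace.

Lemma quad_formD (R : realType) n (A B : 'M[R]_n) (v : 'cV[R]_n) :
  (v^T *m (A + B) *m v) 0 0 = (v^T *m A *m v) 0 0 + (v^T *m B *m v) 0 0.
Proof. by rewrite mulmxDr mulmxDl [LHS]mxE. Qed.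

Section GaussianModel.
Context (R : realType).

Lemma gvec_exists n (A : 'M[R]_n) : A^T = A -> psd A ->
  exists Z : n.-tuple (measurableTypeR R) -> 'cV[R]_n, gvec (gaussN R n) Z A.
Proof.
move=> sA pA; have [V [l [OO AE _]]] := spectral sA.
exists (fun t => V^T *m diag_mx (map_mx Num.sqrt l) *m colT t).
by rewrite [X in gvec _ _ X]AE; apply: gauss_model; apply: (psd_spectral OO); rewrite -AE.
Qed.

End GaussianModel.

(** * Replacement of all summands *)

Section Lindeberg.
Context (R : realType) (d : nat) dT (T : measurableType dT).
Context (a e tau M A th c : R).
Hypotheses (e0 : 0 < e) (tau0 : 0 < tau) (A0 : 0 < A) (th0 : 0 < th) (c0 : 0 <= c).
Hypothesis thE : th ^+ 2 = d%:R * c.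

(** The fourth-moment bound c^2 forces each coordinate variance below c, so that th^2 = d c bounds
    the mean square norm. *)
Definition summand (mu : probability T R) (xi : T -> 'cV[R]_d) (Sigma : 'M[R]_d) : Prop :=
  [/\ L4v mu xi, (forall v, Ex mu (fun x => ip v (xi x)) = 0),
      (forall v, Ex mu (fun x => ip v (xi x) ^+ 2) = (v^T *m Sigma *m v) 0 0),
      Sigma^T = Sigma & (forall k, Ex mu (fun x => xi x k 0 ^+ 4) <= c ^+ 2)].

Lemma Ex_sqr_le d' (S : measurableType d') (P : probability S R) (f : S -> R) :
  L4 P f -> Ex P (fun x => f x ^+ 2) ^+ 2 <= Ex P (fun x => f x ^+ 4).
Proof.
move=> hf; set m := Ex P (fun x => f x ^+ 2).
have i2 := L4_sqr hf; have i4 : itg P (fun x => f x ^+ 4) by case: hf.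
have : 0 <= Ex P (fun x => f x ^+ 4 - 2 * m * f x ^+ 2 + m ^+ 2).
  apply: Ex_ge0 => x; rewrite (_ : _ + _ = (f x ^+ 2 - m) ^+ 2) ?sqr_ge0//.
  by rewrite -[4%N]/(2 * 2)%N exprM; ring.
rewrite (ExD (itgB i4 (itgZ _ i2)) (itg_cst _ _)) (ExB i4 (itgZ _ i2)) (ExZ _ i2) Ex_cst -/m.
lra.
Qed.

Section facts.
Variables (mu : probability T R) (xi : T -> 'cV[R]_d) (Sigma : 'M[R]_d).
Hypothesis h : summand mu xi Sigma.

Lemma summand_coord k : Ex mu (fun x => xi x k 0 ^+ 2) = Sigma k k /\ 0 <= Sigma k k <= c.
Proof.
have [h4 _ h2 _ hc] := h.
have E : Ex mu (fun x => xi x k 0 ^+ 2) = Sigma k k.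
  have := h2 (delta_mx k 0); rewrite (eq_Ex _ (g := fun x => xi x k 0 ^+ 2)); last first.
    by move=> x; rewrite /ip coord_lin.
  by move=> ->; rewrite -mulmxA coord_lin -colE mxE.
split => //; rewrite -E Ex_ge0 => [/=|x]; last exact: sqr_ge0.
rewrite -(@ler_pXn2r _ 2)// ?nnegrE//; last by apply: Ex_ge0 => x; exact: sqr_ge0.
exact: le_trans (Ex_sqr_le (h4 k)) (hc k).
Qed.

Lemma summand_psd : psd Sigma.
Proof. by move=> u; have [_ _ <- _ _] := h; apply: Ex_ge0 => x; exact: sqr_ge0. Qed.

Lemma summand_sqn : Ex mu (fun x => sqn (xi x)) <= th ^+ 2.
Proof.
have [h4 _ _ _ _] := h; rewrite Ex_sqn// thE.
apply: (@le_trans _ _ (\sum_(k < d) c)); last by rewrite sumr_const card_ord mulr_natl.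
by apply: ler_sum => k _; case: (summand_coord k) => -> /andP[].
Qed.

Lemma summand_sqn2 : Ex mu (fun x => sqn (xi x) ^+ 2) <= th ^+ 4.
Proof.
have [h4 _ _ _ hc] := h; apply: le_trans (Ex_sqn2 h4 hc) _.
by rewrite -exprMn -thE -exprM.
Qed.

Lemma summand_ip4 v : Ex mu (fun x => ip v (xi x) ^+ 4) <= th ^+ 4 * sqn v ^+ 2.
Proof.
have [h4 _ _ _ hc] := h.
have i := L4v_sqn2 h4.
apply: (@le_trans _ _ (Ex mu (fun x => sqn v ^+ 2 * sqn (xi x) ^+ 2))).
  apply: Ex_le; [by case: (L4v_ip h4 v)|exact: itgZ|move=> x].
  rewrite -exprMn -[4%N]/(2 * 2)%N exprM lerXn2r ?nnegrE ?sqr_ge0 ?mulr_ge0 ?sqn_ge0//.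
  exact: ip_cs.
by rewrite ExZ// mulrC ler_wpM2r ?sqr_ge0// summand_sqn2.
Qed.

Lemma gauss_sqn2 d' (S : measurableType d') (P : probability S R) (Z : S -> 'cV[R]_d) :
  gvec P Z Sigma -> Ex P (fun x => sqn (Z x)) = Ex mu (fun x => sqn (xi x)) /\
   Ex P (fun x => sqn (Z x) ^+ 2) <= 3 * th ^+ 4.
Proof.
move=> gZ; have hZ := gvec_L4v gZ; have [h4 _ _ _ hc] := h; split.
  rewrite !Ex_sqn//; apply: eq_bigr => k _; case: (gvec_cov gZ k) => _ [-> _].
  by case: (summand_coord k).
have -> : 3 * th ^+ 4 = d%:R ^+ 2 * (3 * c ^+ 2).
  by rewrite -[4%N]/(2 * 2)%N exprM thE; ring.
apply: (Ex_sqn2 hZ) => k; case: (gvec_cov gZ k) => _ [_ ->].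
case: (summand_coord k) => _ /andP[s0 sc].
by rewrite ler_pM2l// lerXn2r ?nnegrE.
Qed.

End facts.

Definition sumX m (xi : 'I_m -> T -> 'cV[R]_d) (t : m.-tuple T) : 'cV[R]_d :=
  \sum_k xi k (tnth t k).

Lemma ip_sumX m (xi : 'I_m -> T -> 'cV[R]_d) v t :
  ip v (sumX xi t) = \sum_k ip v (xi k (tnth t k)).
Proof. by rewrite /ip /sumX mulmx_sumr summxE. Qed.

Lemma sumX_moments m (mu : 'I_m -> probability T R) (xi : 'I_m -> T -> 'cV[R]_d)
    (Sigma : 'I_m -> 'M[R]_d) : (forall k, summand (mu k) (xi k) (Sigma k)) ->
  L4v (prodN mu) (sumX xi) /\
  forall v, [/\ Ex (prodN mu) (fun t => ip v (sumX xi t)) = 0,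
     Ex (prodN mu) (fun t => ip v (sumX xi t) ^+ 2) = (v^T *m (\sum_k Sigma k) *m v) 0 0 &
     Ex (prodN mu) (fun t => ip v (sumX xi t) ^+ 4) <=
       3 * (v^T *m (\sum_k Sigma k) *m v) 0 0 ^+ 2 + m%:R * (th ^+ 4 * sqn v ^+ 2)].
Proof.
move=> h.
have P0 (v : 'cV[R]_d) : 0 <= th ^+ 4 * sqn v ^+ 2 by rewrite mulr_ge0 ?sqr_ge0 ?exprn_ge0 ?(ltW th0).
have key (v : 'cV[R]_d) := sum_prodN (P0 v) (fun k => L4v_ip (let: And5 h4 _ _ _ _ := h k in h4) v)
  (fun k => let: And5 _ h1 _ _ _ := h k in h1 v)
  (fun k => let: And5 _ _ h2 _ _ := h k in h2 v : _ = (fun j => (v^T *m Sigma j *m v) 0 0) k)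
  (fun k => summand_ip4 (h k) v).
have E (v : 'cV[R]_d) : (v^T *m (\sum_k Sigma k) *m v) 0 0 = \sum_k (v^T *m Sigma k *m v) 0 0.
  by rewrite mulmx_sumr mulmx_suml summxE.
split.
  move=> k; have [h4 _ _ _] := key (delta_mx k 0).
  by apply: L4_ext h4 => t; rewrite -ip_sumX /ip coord_lin.
move=> v; have [h4 h1 h2 h3] := key v; rewrite E; split.
- by rewrite -h1; apply: eq_Ex => t; rewrite ip_sumX.
- by rewrite -h2; apply: eq_Ex => t; rewrite ip_sumX.
by apply: le_trans h3; rewrite le_eqVlt; apply/orP; left; apply/eqP; apply: eq_Ex => t; rewrite ip_sumX.
Qed.

Lemma sumX_cons m (xi : 'I_m.+1 -> T -> 'cV[R]_d) z :
  sumX xi (consX z) = xi ord0 z.1 + sumX (fun k => xi (lift ord0 k)) z.2.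
Proof. exact: sum_consX. Qed.

Lemma sstep_abs s : `|sstep a e (s : 'cV[R]_d)| <= 1.
Proof. by rewrite /sstep; case: (stepP ((sqn s - a) / e)) => /andP[h1 h2] _ _; rewrite ger0_norm. Qed.

(** Induction on the summands not yet replaced. Each step adds one independent Gaussian to G0, which
    enlarges the probability space; hence the existential over spaces. The total covariance never
    changes, so [tau] and [M] bound the second and fourth moments of every intermediate sum. *)
Lemma lindeberg m (mu : 'I_m -> probability T R) (xi : 'I_m -> T -> 'cV[R]_d)
    (Sigma : 'I_m -> 'M[R]_d) dS (S : measurableType dS) (Q : probability S R)
    (G0 : S -> 'cV[R]_d) (Sigma0 : 'M[R]_d) :
  (forall k, summand (mu k) (xi k) (Sigma k)) -> gvec Q G0 Sigma0 ->
  (forall v, (v^T *m (Sigma0 + \sum_k Sigma k) *m v) 0 0 <= tau ^+ 2 * sqn v) ->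
  3 * tau ^+ 4 + m%:R * th ^+ 4 <= M ->
  exists dS' (S' : measurableType dS') (Q' : probability S' R) (G : S' -> 'cV[R]_d),
    gvec Q' G (Sigma0 + \sum_k Sigma k) /\
    `|Ex (prodP Q (prodN mu)) (fun z => sstep a e (G0 z.1 + sumX xi z.2)) - Ex Q' (fun w => sstep a e (G w))|
      <= m%:R * (2 * swap_bound e tau M A th).
Proof.
elim: m mu xi Sigma dS S Q G0 Sigma0 => [|m IH] mu xi Sigma dS S Q G0 Sigma0 h g0 hV hM.
  exists dS, S, Q, G0; rewrite big_ord0 addr0; split => //.
  rewrite (eq_Ex _ (g := fun z => sstep a e (G0 z.1))); last by move=> z; rewrite /sumX big_ord0 addr0.
  rewrite (Ex_fst _ (itg_sstep _ _ Q (L4v_meas (gvec_L4v g0)))) subrr normr0 mul0r//.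
pose mu' k := mu (lift ord0 k); pose xi' k := xi (lift ord0 k); pose Sigma' k := Sigma (lift ord0 k).
have h' k : summand (mu' k) (xi' k) (Sigma' k) by exact: h.
have [X4 Xm] := sumX_moments h'.
have [Z gZ] := gvec_exists (let: And5 _ _ _ hs _ := h ord0 in hs) (summand_psd (h ord0)).
have M0 : 0 <= M.
  apply: le_trans hM; rewrite addr_ge0 ?mulr_ge0 ?exprn_ge0 ?(ltW tau0) ?(ltW th0)//.
have [N hN] : exists N : probability (d.-tuple (measurableTypeR R)) R, N = gaussN R d by exists (gaussN R d).
rewrite -hN in gZ.
have gZ0 := gvec_add gZ g0.
pose S1 z := G0 z.1 + sumX xi' z.2.
have S1_4 : L4v (prodP Q (prodN mu')) S1.
  exact: L4vD (L4v_fst _ (gvec_L4v g0)) (L4v_snd _ X4).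
have SigE : Sigma0 + \sum_k Sigma k = Sigma ord0 + (Sigma0 + \sum_k Sigma' k).
  by rewrite big_ord_recl addrCA.
have hV1 (v : 'cV[R]_d) : (v^T *m (Sigma0 + \sum_k Sigma' k) *m v) 0 0 <= tau ^+ 2 * sqn v.
  apply: le_trans (hV v); rewrite SigE [X in _ <= X](_ : _ =
    (v^T *m Sigma ord0 *m v) 0 0 + (v^T *m (Sigma0 + \sum_k Sigma' k) *m v) 0 0); last first.
    exact: quad_formD.
  rewrite lerDr; exact: (summand_psd (h ord0)).
have V0 (v : 'cV[R]_d) : 0 <= (v^T *m (Sigma0 + \sum_k Sigma' k) *m v) 0 0.
  rewrite quad_formD addr_ge0//.
    by have [_ _ _ [_ <- _]] := g0 v; apply: Ex_ge0 => x; exact: sqr_ge0.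
  by have [_ <- _] := Xm v; apply: Ex_ge0 => x; exact: sqr_ge0.
have E2 (v : 'cV[R]_d) : Ex (prodP Q (prodN mu')) (fun w => ip v (S1 w) ^+ 2) = (v^T *m (Sigma0 + \sum_k Sigma' k) *m v) 0 0.
  under eq_Ex do rewrite /S1 ipDr.
  have [g4 _ _ [g1 g2 _]] := g0 v; have [x1 x2 _] := Xm v.
  by rewrite (indep_sum2 g4 (L4v_ip X4 v))// g2 x2 quad_formD.
have S2 (v : 'cV[R]_d) : Ex (prodP Q (prodN mu')) (fun w => ip v (S1 w) ^+ 2) <= tau ^+ 2 * sqn v by rewrite E2.
have S4 (v : 'cV[R]_d) : Ex (prodP Q (prodN mu')) (fun w => ip v (S1 w) ^+ 4) <= M * sqn v ^+ 2.
  under eq_Ex do rewrite /S1 ipDr.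
  have [g4 _ _ [g1 g2 g3]] := g0 v; have [x1 x2 x3] := Xm v.
  rewrite (indep_sum4 g4 (L4v_ip X4 v))// g2 g3 x2.
  have := V0 v; have := hV1 v; rewrite quad_formD.
  move: x3.
  move: ((v^T *m Sigma0 *m v) 0 0) ((v^T *m (\sum_k Sigma' k) *m v) 0 0) => p q x3 pq pq0.
  have sq : (p + q) ^+ 2 <= (tau ^+ 2 * sqn v) ^+ 2.
    by rewrite lerXn2r ?nnegrE// mulr_ge0 ?sqr_ge0 ?sqn_ge0.
  have hM' := ler_wpM2r (sqr_ge0 (sqn v)) hM.
  have mm : (m%:R : R) * (th ^+ 4 * sqn v ^+ 2) <= m.+1%:R * th ^+ 4 * sqn v ^+ 2.
    by rewrite mulrA ler_wpM2r ?sqr_ge0// ler_wpM2r ?exprn_ge0 ?(ltW th0)// ler_nat.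
  have : tau ^+ 4 = (tau ^+ 2) ^+ 2 by rewrite -exprM.
  move: sq; rewrite exprMn; lra.
have [x4 x1 x2 xs xc] := h ord0.
have [Zs Z4] := gauss_sqn2 (h ord0) gZ.
have gZ1 (v : 'cV[R]_d) : Ex N (fun w => ip v (Z w)) = 0 by have [_ _ _ []] := gZ v.
have gZ2 (v : 'cV[R]_d) : Ex (mu ord0) (fun x => ip v (xi ord0 x) ^+ 2) = Ex N (fun w => ip v (Z w) ^+ 2).
  by rewrite x2; have [_ _ _ [_ <- _]] := gZ v.
have th4 : th ^+ 4 <= 3 * th ^+ 4 by have := exprn_ge0 4 (ltW th0); lra.
have := @swap_step R d a e e0 tau M A th tau0 A0 th0 M0 _ _ _ S1 S1_4 S2 S4
  _ _ (mu ord0) (xi ord0) _ _ N Z x4 x1 (gvec_L4v gZ) gZ1 gZ2 (esym Zs) (summand_sqn (h ord0))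
  (le_trans (summand_sqn2 (h ord0)) th4) Z4.
have hV' (v : 'cV[R]_d) : (v^T *m (Sigma ord0 + Sigma0 + \sum_k Sigma' k) *m v) 0 0 <= tau ^+ 2 * sqn v.
  by rewrite -addrA -SigE.
have hM1 : 3 * tau ^+ 4 + m%:R * th ^+ 4 <= M.
  apply: le_trans hM; rewrite lerD2l ler_wpM2r ?exprn_ge0 ?(ltW th0)// ler_nat//.
have [dS' [S' [Q' [G [gG hG]]]]] := IH mu' xi' Sigma' _ _ _ _ _ h' gZ0 hV' hM1.
move=> step1; exists dS', S', Q', G; split; first by rewrite SigE addrA.
pose H s (t : m.+1.-tuple T) := sstep a e (G0 s + sumX xi t).
have mH : measurable_fun setT (fun z : S * m.+1.-tuple T => H z.1 z.2).
  apply: (@meas_sstep _ _ a e _ _ (fun z : S * m.+1.-tuple T => G0 z.1 + sumX xi z.2)).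
  have [X4' _] := sumX_moments h.
  exact: L4v_meas (L4vD (L4v_fst (prodN mu) (gvec_L4v g0)) (L4v_snd Q X4')).
rewrite (Ex_prod_consX _ _ mH (fun s t => sstep_abs _)).
rewrite -/mu'.
rewrite (eq_Ex _ (g := fun z => sstep a e (xi ord0 z.1 + S1 z.2))); last first.
  by move=> z; rewrite /H sumX_cons /S1 addrCA.
have E : Ex (prodP N (prodP Q (prodN mu'))) (fun z => sstep a e (Z z.1 + S1 z.2)) =
    Ex (prodP (prodP N Q) (prodN mu')) (fun z => sstep a e (Z z.1.1 + G0 z.1.2 + sumX xi' z.2)).
  transitivity (Ex (prodP N (prodP Q (prodN mu'))) (fun z => sstep a e (Z z.1 + G0 z.2.1 + sumX xi' z.2.2))).
    by apply: eq_Ex => z; rewrite /S1 addrA.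
  rewrite (@Ex_prodA _ _ _ _ _ _ _ N Q (prodN mu') (fun z s t => sstep a e (Z z + G0 s + sumX xi' t)) 1)//; last first.
    by move=> *; exact: sstep_abs.
  apply: (@meas_sstep _ _ a e _ _ (fun z => Z z.1 + G0 z.2.1 + sumX xi' z.2.2)).
  rewrite (_ : (fun z => _) = (fun z => Z z.1 + S1 z.2)); last by apply/funext => z; rewrite /S1 addrA.
  exact: L4v_meas (L4vD (L4v_fst _ (gvec_L4v gZ)) (L4v_snd N S1_4)).
move: step1 hG; rewrite E -natr1.
move: (Ex (prodP (mu ord0) _) _) (Ex (prodP (prodP N Q) _) _) (Ex Q' _) (swap_bound _ _ _ _ _) => p q r b.
rewrite !ler_norml => /andP[? ?] /andP[? ?]; apply/andP; split; lra.
Qed.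

End Lindeberg.

(** * Product laws and resampling *)

Section Rectangles.
Context (R : realType) dT (T : measurableType dT).

Definition rect m (A : 'I_m -> set T) : set (m.-tuple T) := [set t | forall k, A k (tnth t k)].

Lemma measurable_rect m (A : 'I_m -> set T) : (forall k, measurable (A k)) -> measurable (rect A).
Proof.
move=> mA; rewrite (_ : rect A = \bigcap_(k in [set: 'I_m]) ((fun t : m.-tuple T => tnth t k) @^-1` A k)).
  apply: fin_bigcap_measurable; first exact: finite_finset.
  by move=> k _; rewrite -[_ @^-1` _]setTI; exact: measurable_tnth.
apply/seteqP; split => t h k; first by move=> _; exact: h.
exact: (h k I).
Qed.

Lemma prodP_rect d1 d2 (T1 : measurableType d1) (T2 : measurableType d2) (P : probability T1 R)
  (Q : probability T2 R) A B : measurable A -> measurable B -> prodP P Q (A `*` B) = (P A * Q B)%E.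
Proof. exact: product_measure1E. Qed.

Lemma prodN_rect m (mu : 'I_m -> probability T R) (A : 'I_m -> set T) :
  (forall k, measurable (A k)) -> prodN mu (rect A) = (\prod_(k < m) mu k (A k))%E.
Proof.
elim: m mu A => [|m IH] mu A mA.
  rewrite big_ord0 /= (_ : rect A = setT); first by rewrite diracT.
  by apply/seteqP; split => // t _ [].
rewrite big_ord_recl -IH//.
rewrite (_ : prodN mu (rect A) = prodP (mu ord0) (prodN (fun k => mu (lift ord0 k))) (@consX _ T m @^-1` rect A))//.
rewrite (_ : _ @^-1` _ = A ord0 `*` rect (fun k => A (lift ord0 k))); last first.
  apply/seteqP; split => -[x t] /= => [h|[h1 h2] k].
    by split; [exact: (h ord0)|move=> k; have := h (lift ord0 k); rewrite tnth_consXS].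
  by case: (unliftP ord0 k) => [j ->|->]; [rewrite tnth_consXS; exact: h2|].
by rewrite prodP_rect//; exact: measurable_rect.
Qed.

(** Measurable rectangles form a generating pi-system. *)
Lemma prodN_unique m (mu : 'I_m -> probability T R) (Q : probability (m.-tuple T) R) :
  (forall A : 'I_m -> set T, (forall k, measurable (A k)) -> Q (rect A) = (\prod_(k < m) mu k (A k))%E) ->
  forall B, measurable B -> Q B = prodN mu B.
Proof.
move=> h B mB; pose G := [set C : set (m.-tuple T) | exists2 A : 'I_m -> set T, (forall k, measurable (A k)) & C = rect A].
apply: (measure_unique G (fun=> setT)) => //.
- apply/seteqP; split => C.
    apply: smallest_sub; first exact: smallest_sigma_algebra.
    move=> D; rewrite -bigcup_seq /= => -[k _] [E mE <-].
    apply: sub_sigma_algebra; exists (fun j => if j == k then E else setT).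
      by move=> j; case: ifP.
    rewrite setTI; apply/seteqP; split => t /=.
      by move=> Et j; case: eqP => // ->.
    by move=> /(_ k); rewrite eqxx.
  apply: smallest_sub; first exact: sigma_algebra_measurable.
  by move=> D [A mA ->]; exact: measurable_rect.
- move=> _ _ [A mA ->] [A' mA' ->]; exists (fun k => A k `&` A' k); first by move=> k; exact: measurableI.
  by apply/seteqP; split => t /= => [[h1 h2] k|h1]; [split|split => k; case: (h1 k)].
- by move=> _; exists (fun=> setT) => //; apply/seteqP; split.
- by rewrite bigcup_const//; exists 0%N.
- by move=> _ [A mA ->]; exact: etrans (h A mA) (esym (prodN_rect mu mA)).
by move=> _; apply: (@le_lt_trans _ _ 1%E); [exact: probability_le1|exact: ltry].
Qed.

Lemma Ex_law_eq d (S : measurableType d) (P : probability S R) m (mu : 'I_m -> probability T R)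
    (phi : S -> m.-tuple T) : measurable_fun setT phi ->
  (forall A : 'I_m -> set T, (forall k, measurable (A k)) ->
     P (phi @^-1` rect A) = (\prod_(k < m) mu k (A k))%E) ->
  forall f : m.-tuple T -> R, measurable_fun setT f ->
    (itg P (f \o phi) <-> itg (prodN mu) f) /\ (itg (prodN mu) f -> Ex P (f \o phi) = Ex (prodN mu) f).
Proof.
move=> mphi h f mf.
have E B : measurable B -> law P mphi B = prodN mu B by apply: prodN_unique.
have I : itg (law P mphi) f <-> itg (prodN mu) f.
  have Ei : (\int[law P mphi]_x `|(f x)%:E| = \int[prodN mu]_x `|(f x)%:E|)%E.
    by apply: eq_measure_integral => A mA _; exact: E.
  by split => /integrableP[m1 i1]; apply/integrableP; split => //; [rewrite -Ei|rewrite Ei].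
rewrite -(itg_law P mphi mf); split => // hf.
rewrite -(@Ex_law _ _ _ _ _ P _ mphi)//; last by apply/(itg_law P mphi mf)/I.
exact: eq_measure_Ex.
Qed.

Lemma L4_law_eq d (S : measurableType d) (P : probability S R) m (mu : 'I_m -> probability T R)
    (phi : S -> m.-tuple T) : measurable_fun setT phi ->
  (forall A : 'I_m -> set T, (forall k, measurable (A k)) ->
     P (phi @^-1` rect A) = (\prod_(k < m) mu k (A k))%E) ->
  forall f : m.-tuple T -> R, L4 (prodN mu) f -> L4 P (f \o phi).
Proof.
move=> mphi h f [mf f4]; split; first exact: measurableT_comp.
have [I _] := Ex_law_eq mphi h (measurable_funX 4 mf).
exact/I.
Qed.

End Rectangles.

Section Resampling.
Context (R : realType) dT (T : measurableType dT) (n : nat) (mu : 'I_n -> probability T R).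
Local Notation Pi := (prodN mu).

Definition upd (a : 'I_n) (x : T) (t : n.-tuple T) : n.-tuple T :=
  [tuple if k == a then x else tnth t k | k < n].

(** Keeps the coordinates in I and takes the others from an independent copy: averaging over that
    copy is conditioning on the coordinates in I. *)
Definition merge (I : {set 'I_n}) (z : n.-tuple T * n.-tuple T) : n.-tuple T :=
  [tuple if k \in I then tnth z.1 k else tnth z.2 k | k < n].

Lemma measurable_merge I : measurable_fun setT (merge I).
Proof.
apply/measurable_fun_tnthP => k; rewrite (_ : _ \o _ = fun z => if k \in I then tnth z.1 k else tnth z.2 k).
  by case: (k \in I); [exact: (measurableT_comp (measurable_tnth k) measurable_fst)|exact: (measurableT_comp (measurable_tnth k) measurable_snd)].
by apply/funext => z /=; rewrite tnth_mktuple.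
Qed.

Lemma measurable_upd a : measurable_fun setT (fun z : T * n.-tuple T => upd a z.1 z.2).
Proof.
apply/measurable_fun_tnthP => k; rewrite (_ : _ \o _ = fun z => if k == a then z.1 else tnth z.2 k).
  by case: (k == a); [exact: measurable_fst|exact: (measurableT_comp (measurable_tnth k) measurable_snd)].
by apply/funext => z /=; rewrite tnth_mktuple.
Qed.

Lemma merge_rect I (A : 'I_n -> set T) : (forall k, measurable (A k)) ->
  prodP Pi Pi (merge I @^-1` rect A) = (\prod_(k < n) mu k (A k))%E.
Proof.
move=> mA; pose A1 k := if k \in I then A k else setT; pose A2 k := if k \in I then setT else A k.
have m1 k : measurable (A1 k) by rewrite /A1; case: ifP.
have m2 k : measurable (A2 k) by rewrite /A2; case: ifP.
rewrite (_ : _ @^-1` _ = rect A1 `*` rect A2); last first.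
  apply/seteqP; split => -[t t'] /= => [h|[h1 h2] k].
    by split => k; have := h k; rewrite tnth_mktuple /A1 /A2; case: ifP.
  by have := h1 k; have := h2 k; rewrite tnth_mktuple /A1 /A2; case: ifP.
rewrite prodP_rect; [|exact: measurable_rect|exact: measurable_rect].
rewrite (prodN_rect mu m1) (prodN_rect mu m2) -big_split /=; apply: eq_bigr => k _.
by rewrite /A1 /A2; case: ifP => _; rewrite probability_setT ?mule1 ?mul1e.
Qed.

Lemma upd_rect a (A : 'I_n -> set T) : (forall k, measurable (A k)) ->
  prodP (mu a) Pi ((fun z : T * n.-tuple T => upd a z.1 z.2) @^-1` rect A) = (\prod_(k < n) mu k (A k))%E.
Proof.
move=> mA; pose A2 k := if k == a then setT else A k.
have m2 k : measurable (A2 k) by rewrite /A2; case: ifP.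
rewrite (_ : _ @^-1` _ = A a `*` rect A2); last first.
  apply/seteqP; split => -[t t'] /= => [h|[h1 h2] k].
    split => [|k]; first by have := h a; rewrite tnth_mktuple eqxx.
    by have := h k; rewrite tnth_mktuple /A2; case: ifP.
  by have := h2 k; rewrite tnth_mktuple /A2; case: eqP => // ->.
rewrite prodP_rect//; last exact: measurable_rect.
rewrite (prodN_rect mu m2) [RHS](bigD1 a)//= (bigD1 a)//= {1}/A2 eqxx probability_setT mul1e.
by congr (_ * _)%E; apply: eq_bigr => k /negbTE ka; rewrite /A2 ka.
Qed.

Lemma coord_law a (A : set T) : measurable A -> Pi ((fun t => tnth t a) @^-1` A) = mu a A.
Proof.
move=> mA; rewrite (_ : _ @^-1` _ = rect (fun k => if k == a then A else setT)); last first.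
  apply/seteqP; split => t /= => [h k|h]; first by case: eqP => // ->.
  by have := h a; rewrite eqxx.
rewrite prodN_rect => [|k]; last by case: ifP.
rewrite (bigD1 a)//= eqxx big1 ?mule1// => k /negbTE ->.
exact: probability_setT.
Qed.

Lemma Ex_coord a (f : T -> R) : measurable_fun setT f ->
  (itg Pi (fun t => f (tnth t a)) <-> itg (mu a) f) /\
  (itg (mu a) f -> Ex Pi (fun t => f (tnth t a)) = Ex (mu a) f).
Proof.
move=> mf; have mt : measurable_fun setT (fun t : n.-tuple T => tnth t a) by exact: measurable_tnth.
have E B : measurable B -> law Pi mt B = mu a B by move=> mB; rewrite lawE coord_law.
have I : itg (law Pi mt) f <-> itg (mu a) f.
  have Ei : (\int[law Pi mt]_x `|(f x)%:E| = \int[mu a]_x `|(f x)%:E|)%E.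
    by apply: eq_measure_integral => A mA _; exact: E.
  by split => /integrableP[m1 i1]; apply/integrableP; split => //; [rewrite -Ei|rewrite Ei].
have J := itg_law Pi mt mf.
split => [|hf]; first by rewrite -I J.
rewrite -[LHS](@Ex_law _ _ _ _ _ Pi _ mt)//; last by apply/J/I.
exact: eq_measure_Ex.
Qed.

End Resampling.

(** * Moments of conditional means *)

Section Jensen.
Context (R : realType).

Lemma Ex_pow2_le d (T : measurableType d) (P : probability T R) (f : T -> R) :
  L4 P f -> Ex P f ^+ 2 <= Ex P (fun x => f x ^+ 2).
Proof.
move=> hf; set m := Ex P f.
have i1 := L4_itg hf; have i2 := L4_sqr hf.
have : 0 <= Ex P (fun x => f x ^+ 2 - 2 * m * f x + m ^+ 2).
  apply: Ex_ge0 => x; rewrite (_ : _ + _ = (f x - m) ^+ 2) ?sqr_ge0//; ring.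
rewrite (ExD (itgB i2 (itgZ _ i1)) (itg_cst _ _)) (ExB i2 (itgZ _ i1)) (ExZ _ i1) Ex_cst -/m.
lra.
Qed.

Lemma Ex_pow4_le d (T : measurableType d) (P : probability T R) (f : T -> R) :
  L4 P f -> Ex P f ^+ 4 <= Ex P (fun x => f x ^+ 4).
Proof.
move=> hf; apply: le_trans (Ex_sqr_le hf); rewrite -[4%N]/(2 * 2)%N exprM.
rewrite lerXn2r ?nnegrE ?sqr_ge0//; last exact: Ex_pow2_le.
by apply: Ex_ge0 => x; exact: sqr_ge0.
Qed.

Lemma cond_L4 d d' (S : measurableType d) (T : measurableType d') (P : probability S R)
    (Q : probability T R) (F : S * T -> R) : L4 (prodP P Q) F ->
  L4 P (fun x => Ex Q (fun y => F (x, y))) /\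
  Ex P (fun x => Ex Q (fun y => F (x, y)) ^+ 4) <= Ex (prodP P Q) (fun z => F z ^+ 4).
Proof.
move=> hF; have [mF F4] := hF.
have me : measurable_fun setT (fun x => Ex Q (fun y => F (x, y))) by exact: itg_meas (itg_inner (L4_itg hF)).
pose b x := Ex Q (fun y => F (x, y) ^+ 4).
have ib : itg P b := itg_inner F4.
(* Jensen's inequality is available for almost every section only; the maximum is a bound valid
   everywhere that agrees with [b] almost surely. *)
pose b' x := Num.max (b x) (Ex Q (fun y => F (x, y)) ^+ 4).
have me4 : measurable_fun setT (fun x => Ex Q (fun y => F (x, y)) ^+ 4) by exact: measurable_funX.
have mb' : measurable_fun setT b' by apply: measurable_maxr => //; exact: itg_meas ib.
have aeb : {ae P, forall x, b x = b' x}.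
  apply: filterS (ae_itg_prod F4) => x hx; apply/esym/max_idPl.
  by apply: (@Ex_pow4_le _ _ Q); split => //; exact: (measurableT_comp mF (measurable_pair1 x)).
have ib' := ae_itg mb' aeb ib.
have i4 : itg P (fun x => Ex Q (fun y => F (x, y)) ^+ 4).
  apply: (itg_le me4 ib') => x; rewrite ger0_norm; first by rewrite /b' le_max lexx orbT.
  by rewrite -[4%N]/(2 * 2)%N exprM sqr_ge0.
split => //; rewrite (Ex_prod F4) -/b (ae_eq_Ex (itg_meas ib) mb' aeb).
by apply: Ex_le => // x; rewrite /b' le_max lexx orbT.
Qed.

End Jensen.

(** * Counting index tuples *)

Section Counting.
Local Close Scope classical_set_scope.
Local Open Scope nat_scope.

(** Two of the r positions are confined to I. The factor n^2 stands on the left to avoid the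
    exponent r - 2. *)
Lemma card_two_in (n r : nat) (I : {set 'I_n}) (p q : 'I_r) : p != q ->
  #|[set j : r.-tuple 'I_n | (tnth j p \in I) && (tnth j q \in I)]| * n ^ 2 <= #|I| ^ 2 * n ^ r.
Proof.
move=> pq; pose F (x : 'I_r) : {set 'I_n} := if (x == p) || (x == q) then I else [set: 'I_n].
pose phi (j : r.-tuple 'I_n) : {ffun 'I_r -> 'I_n} := [ffun k => tnth j k].
have phi_inj : injective phi.
  by move=> j j' /ffunP h; apply: eq_from_tnth => k; have := h k; rewrite !ffunE.
rewrite -(card_imset _ phi_inj).
have le : #|phi @: [set j : r.-tuple 'I_n | (tnth j p \in I) && (tnth j q \in I)]| <= #|family F|.
  apply: subset_leq_card; apply/fintype.subsetP => z /imsetP[j jA ->].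
  move: jA; rewrite inE => /andP[jp jq].
  apply/familyP => x; rewrite ffunE /F; case: eqP => [->|_] //=.
  by case: eqP => [->|_] //=; rewrite inE.
apply: leq_trans (leq_mul le (leqnn _)) _.
have -> : #|family F| = \prod_(x < r) #|F x|.
  by rewrite card_family foldrE big_map big_enum.
have -> : n ^ r = \prod_(x < r) n by rewrite prod_nat_const card_ord.
have prodE (G : 'I_r -> nat) :
    \prod_(x < r) G x = G p * (G q * \prod_(x < r | (x != p) && (x != q)) G x).
  by rewrite (bigD1 p)//= (bigD1 q)// eq_sym.
rewrite !prodE {1}/F eqxx /= {1}/F eqxx orbT.
rewrite (eq_bigr (fun=> n)); last first.
  by move=> x /andP[/negbTE xp /negbTE xq]; rewrite /F xp xq /= cardsT card_ord.
by apply: eq_leq; rewrite !expnS !expn0 !muln1; set z := \prod_(_ < r | _) _; nia.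
Qed.

Lemma card_share (n r : nat) (I : {set 'I_n}) :
  #|[set j : r.-tuple 'I_n | 1 < #|I :&: [set k in j]|]| * n ^ 2 <= r ^ 2 * #|I| ^ 2 * n ^ r.
Proof.
pose B (w : 'I_r * 'I_r) := [set j : r.-tuple 'I_n | (w.1 != w.2) && ((tnth j w.1 \in I) && (tnth j w.2 \in I))].
have cardE (V : finType) (S : {set V}) : #|S| = \sum_v (v \in S : nat).
  by rewrite -sum1_card big_mkcond; apply: eq_bigr => v _; case: (v \in S).
have le : #|[set j : r.-tuple 'I_n | 1 < #|I :&: [set k in j]|]| <= \sum_w #|B w|.
  rewrite cardE (eq_bigr (fun w => \sum_j (j \in B w : nat))); last by move=> w _; rewrite cardE.
  rewrite exchange_big /=; apply: leq_sum => j _; rewrite inE.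
  case: card_gt1P => // -[x [y [xI yI xy]]].
  move: xI yI; rewrite !inE => /andP[xI xj] /andP[yI yj].
  case/tnthP: xj => p pE; case/tnthP: yj => q qE.
  rewrite (bigD1 (p, q))//= inE /= -pE -qE xI yI !andbT.
  by have -> : p != q by apply: contra_neq xy => pq; rewrite pE qE pq.
apply: leq_trans (leq_mul le (leqnn _)) _; rewrite big_distrl /=.
apply: (@leq_trans (\sum_(w : 'I_r * 'I_r) #|I| ^ 2 * n ^ r)); last first.
  by rewrite sum_nat_const card_prod card_ord mulnA.
apply: leq_sum => -[p q] _; case: (eqVneq p q) => [->|pq].
  rewrite (_ : B _ = finset.set0) ?cards0//; apply/setP => j; rewrite !inE /= eqxx//.
apply: leq_trans (card_two_in I pq); rewrite leq_mul2r; apply/orP; right.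
by apply: subset_leq_card; apply/fintype.subsetP => j; rewrite !inE /= => /andP[].
Qed.

(** For k < r <= n each factor n - k is at least n / r. *)
Lemma ffact_lower (n r : nat) : 0 < r -> r <= n -> n ^ r <= r ^ r * n ^_ r.
Proof.
move=> r0 rn; rewrite ffact_prod.
have -> : n ^ r = \prod_(x < r) n by rewrite prod_nat_const card_ord.
have -> : r ^ r = \prod_(x < r) r by rewrite prod_nat_const card_ord.
rewrite -big_split /=; apply: leq_prod => k _; have := ltn_ord k; nia.
Qed.

End Counting.

(** * Hoeffding decomposition *)

Section Hoeffding.
Context (R : realType) dT (T : measurableType dT) (n r : nat) (mu : 'I_n -> probability T R).
Local Notation Pi := (prodN mu).
Context (c : R) (c0 : 0 <= c) (H : r.-tuple 'I_n -> n.-tuple T -> R).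
Hypothesis H4 : forall i : r.-tuple 'I_n, uniq i -> L4 Pi (H i).
Hypothesis H1 : forall i : r.-tuple 'I_n, uniq i -> Ex Pi (H i) = 0.
Hypothesis Hc : forall i : r.-tuple 'I_n, uniq i -> Ex Pi (fun t => H i t ^+ 4) <= c ^+ 2.
Hypothesis Hdep : forall (i : r.-tuple 'I_n) t t', (forall k, k \in i -> tnth t k = tnth t' k) -> H i t = H i t'.

(** The conditional mean of H_i given coordinate a, as an explicit integral defined at every x. *)
Definition proj1 (i : r.-tuple 'I_n) (a : 'I_n) (x : T) : R := Ex Pi (fun t => H i (upd a x t)).

Lemma upd_law (a : 'I_n) (f : n.-tuple T -> R) : L4 Pi f ->
  L4 (prodP (mu a) Pi) (fun z => f (upd a z.1 z.2)) /\
  Ex (prodP (mu a) Pi) (fun z => f (upd a z.1 z.2) ^+ 4) = Ex Pi (fun t => f t ^+ 4) /\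
  Ex (prodP (mu a) Pi) (fun z => f (upd a z.1 z.2)) = Ex Pi f.
Proof.
move=> hf; split; first exact: (L4_law_eq (measurable_upd a) (@upd_rect _ _ _ _ mu a) hf).
have [mf f4] := hf; split.
  have [_] := Ex_law_eq (measurable_upd a) (@upd_rect _ _ _ _ mu a) (measurable_funX 4 mf).
  exact.
have [_] := Ex_law_eq (measurable_upd a) (@upd_rect _ _ _ _ mu a) mf.
by apply; exact: L4_itg.
Qed.

Lemma proj1_moments (i : r.-tuple 'I_n) a : uniq i ->
  [/\ L4 (mu a) (proj1 i a), Ex (mu a) (proj1 i a) = 0 & Ex (mu a) (fun x => proj1 i a x ^+ 4) <= c ^+ 2].
Proof.
move=> ui; have [h4 [h5 h6]] := upd_law a (H4 ui).
have [k4 k5] := cond_L4 h4; split => //; last by apply: le_trans k5 _; rewrite h5 Hc.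
by rewrite /proj1 -(Ex_prod (L4_itg h4)) h6 H1.
Qed.

Lemma L4_coord a (f : T -> R) : L4 (mu a) f -> L4 Pi (fun t => f (tnth t a)) /\
  Ex Pi (fun t => f (tnth t a) ^+ 4) = Ex (mu a) (fun x => f x ^+ 4) /\
  Ex Pi (fun t => f (tnth t a)) = Ex (mu a) f.
Proof.
move=> [mf f4]; have [I1 E1] := Ex_coord mu a mf; have [I4 E4] := Ex_coord mu a (measurable_funX 4 mf).
split; last by split; [exact: E4|apply: E1; exact: L4_itg].
by split; [apply: measurableT_comp => //; exact: measurable_tnth|exact/I4].
Qed.

Definition resid (i : r.-tuple 'I_n) (t : n.-tuple T) : R :=
  H i t - \sum_(p < r) proj1 i (tnth i p) (tnth t (tnth i p)).

Lemma resid_L4 (i : r.-tuple 'I_n) : uniq i -> L4 Pi (resid i).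
Proof.
move=> ui; apply: L4B (H4 ui) _; apply: L4_sum => p _.
by have [h _ _] := proj1_moments (tnth i p) ui; case: (L4_coord h).
Qed.

Lemma Ex2_le d (S : measurableType d) (P : probability S R) (f : S -> R) : L4 P f ->
  Ex P (fun x => f x ^+ 4) <= c ^+ 2 -> Ex P (fun x => f x ^+ 2) <= c.
Proof.
move=> hf h; rewrite -(@ler_pXn2r _ 2)// ?nnegrE//; last by apply: Ex_ge0 => x; exact: sqr_ge0.
exact: le_trans (Ex_sqr_le hf) h.
Qed.

(** Lagrange's identity: the difference is half the sum of the squares (f k - f l)^2. *)
Lemma sqr_sum_in (I : finType) (A : {set I}) (f : I -> R) :
  (\sum_(k in A) f k) ^+ 2 <= #|A|%:R * \sum_(k in A) f k ^+ 2.
Proof.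
rewrite -subr_ge0.
have -> : #|A|%:R * \sum_(k in A) f k ^+ 2 - (\sum_(k in A) f k) ^+ 2 =
    (\sum_(k in A) \sum_(l in A) (f k - f l) ^+ 2) / 2.
  transitivity ((\sum_(k in A) (#|A|%:R * f k ^+ 2 + \sum_(l in A) f l ^+ 2 - 2 * (f k * \sum_(l in A) f l))) / 2).
    rewrite sumrB big_split /= -!mulr_sumr -mulr_suml sumr_const -mulr_natl expr2.
    by field.
  congr (_ / 2); apply: eq_bigr => k _.
  rewrite [RHS](eq_bigr (fun l => f k ^+ 2 + f l ^+ 2 - 2 * (f k * f l))); last by move=> l _; ring.
  by rewrite sumrB big_split /= sumr_const -!mulr_sumr mulr_natl.
by rewrite divr_ge0//; apply: sumr_ge0 => k _; apply: sumr_ge0 => l _; exact: sqr_ge0.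
Qed.

Lemma sqr_sum_le (I : finType) (f : I -> R) : (\sum_k f k) ^+ 2 <= #|I|%:R * \sum_k f k ^+ 2.
Proof.
have E (g : I -> R) : \sum_k g k = \sum_(k in [set: I]%SET) g k by apply: eq_bigl => k; rewrite inE.
by rewrite !E -cardsT; exact: sqr_sum_in.
Qed.

Lemma pow4_sum_in (I : finType) (A : {set I}) (f : I -> R) :
  (\sum_(k in A) f k) ^+ 4 <= #|A|%:R ^+ 3 * \sum_(k in A) f k ^+ 4.
Proof.
have p (x : R) : x ^+ 4 = (x ^+ 2) ^+ 2 by rewrite -exprM.
have s0 : 0 <= \sum_(k in A) f k ^+ 2 by apply: sumr_ge0 => k _; exact: sqr_ge0.
apply: (@le_trans _ _ ((#|A|%:R * \sum_(k in A) f k ^+ 2) ^+ 2)).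
  by rewrite p lerXn2r ?nnegrE ?sqr_ge0 ?mulr_ge0// sqr_sum_in.
rewrite exprMn (exprSr _ 2) -mulrA ler_wpM2l ?sqr_ge0//.
apply: le_trans (sqr_sum_in A (fun k => f k ^+ 2)) _.
by rewrite ler_wpM2l//; apply: ler_sum => k _; rewrite p.
Qed.

Lemma resid_sqr (i : r.-tuple 'I_n) : uniq i -> Ex Pi (fun t => resid i t ^+ 2) <= (2 + 2 * r%:R ^+ 2) * c.
Proof.
move=> ui; have h4 := H4 ui.
have e4 p : L4 Pi (fun t => proj1 i (tnth i p) (tnth t (tnth i p))).
  by have [h _ _] := proj1_moments (tnth i p) ui; case: (L4_coord h).
have e2 p : Ex Pi (fun t => proj1 i (tnth i p) (tnth t (tnth i p)) ^+ 2) <= c.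
  have [h _ h'] := proj1_moments (tnth i p) ui; have [k4 [k5 _]] := L4_coord h.
  by apply: Ex2_le => //; rewrite k5.
have i2 := L4_sqr h4.
have is2 : itg Pi (fun t => \sum_(p < r) proj1 i (tnth i p) (tnth t (tnth i p)) ^+ 2).
  by apply: itg_sum => p _; exact: L4_sqr.
apply: (@le_trans _ _ (Ex Pi (fun t => 2 * H i t ^+ 2 + (2 * r%:R) * \sum_(p < r) proj1 i (tnth i p) (tnth t (tnth i p)) ^+ 2))).
  apply: Ex_le; [exact: L4_sqr (resid_L4 ui)|by apply: itgD; exact: itgZ|move=> t].
  have := sqr_sum_le (fun p => proj1 i (tnth i p) (tnth t (tnth i p))).
  rewrite card_ord /resid; move: (H i t) (\sum_p _) (\sum_p _ ^+ 2) => x y z h.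
  have := sqr_ge0 (x + y); lra.
rewrite (ExD (itgZ _ i2) (itgZ _ is2)) (ExZ _ i2) (ExZ _ is2) Ex_sum; last by move=> p _; exact: L4_sqr.
have b1 := Ex2_le h4 (Hc ui).
have b2 : \sum_(p < r) Ex Pi (fun t => proj1 i (tnth i p) (tnth t (tnth i p)) ^+ 2) <= r%:R * c.
  apply: (@le_trans _ _ (\sum_(p < r) c)); first by apply: ler_sum.
  by rewrite sumr_const card_ord mulr_natl.
have := ler_wpM2l (ler0n R r) b2; lra.
Qed.

Lemma resid_dep (i : r.-tuple 'I_n) t t' : (forall k, k \in i -> tnth t k = tnth t' k) -> resid i t = resid i t'.
Proof.
move=> h; rewrite /resid (Hdep h); congr (_ - _); apply: eq_bigr => p _.
by rewrite h// mem_tnth.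
Qed.

(** Conditioning on the coordinates of i, which [merge] realises, freezes the first factor; the
    conditional mean of the second is then zero. *)
Lemma resid_orth (i j : r.-tuple 'I_n) : uniq i -> uniq j ->
  (#|[set k in i] :&: [set k in j]| <= 1)%N -> Ex Pi (fun t => resid i t * resid j t) = 0.
Proof.
move=> ui uj hij; pose I := [set k in i].
have di := resid_L4 ui; have dj := resid_L4 uj.
have iD := L4_mul2 di dj.
have [I1 E1] := Ex_law_eq (@measurable_merge _ _ _ I) (@merge_rect _ _ _ _ mu I) (itg_meas iD).
have im : itg (prodP Pi Pi) (fun z => resid i (merge I z) * resid j (merge I z)) by exact/I1.
rewrite -(E1 iD) (Ex_prod im).
rewrite -[RHS](Ex_cst Pi 0); apply: ae_eq_Ex => //; first exact: itg_meas (itg_inner im).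
have [J1 _] := Ex_law_eq (@measurable_merge _ _ _ I) (@merge_rect _ _ _ _ mu I) (H4 uj).1.
have jm : itg (prodP Pi Pi) (fun z => H j (merge I z)) by exact/J1/L4_itg/H4.
apply: filterS (ae_itg_prod jm) => t ht.
have Di t' : resid i (merge I (t, t')) = resid i t.
  by apply: resid_dep => k ki; rewrite tnth_mktuple inE ki.
under eq_Ex do rewrite Di.
have eE q t' : proj1 j (tnth j q) (tnth (merge I (t, t')) (tnth j q)) =
    if tnth j q \in I then proj1 j (tnth j q) (tnth t (tnth j q)) else proj1 j (tnth j q) (tnth t' (tnth j q)).
  by rewrite tnth_mktuple; case: ifP.
have ie q : itg Pi (fun t' => proj1 j (tnth j q) (tnth (merge I (t, t')) (tnth j q))).
  apply: (itg_ext (fun t' => esym (eE q t'))); case: (tnth j q \in I); first exact: itg_cst.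
  by have [h _ _] := proj1_moments (tnth j q) uj; apply: L4_itg; case: (L4_coord h).
have is1 := @itg_sum _ _ _ Pi _ (index_enum 'I_r) xpredT _ (fun q _ => ie q).
have idm : itg Pi (fun t' => resid j (merge I (t, t'))) by exact: itgB.
rewrite ExZ// /resid (ExB ht is1) (Ex_sum _ (fun q _ => ie q)).
rewrite [X in _ * X](_ : _ = 0) ?mulr0//; apply/eqP; rewrite subr_eq0; apply/eqP.
have e0 q : tnth j q \notin I -> Ex Pi (fun t' => proj1 j (tnth j q) (tnth (merge I (t, t')) (tnth j q))) = 0.
  move=> /negbTE jI; rewrite (eq_Ex _ (eE q)) jI.
  by have [h h1 _] := proj1_moments (tnth j q) uj; case: (L4_coord h) => _ [_ ->].
(* Without a shared index the conditional mean of H_j is its plain mean 0. With one shared index a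
   it is the projection on a, the single projection that survives the averaging. *)
have [/eqP|/set0Pn[a]] := boolP (I :&: [set k in j] == finset.set0).
  move=> I0; have nI k : k \in j -> k \notin I.
    move=> kj; apply/negP => kI; have : k \in I :&: [set k in j] by rewrite inE kI inE.
    by rewrite I0 inE.
  rewrite big1; last by move=> q _; apply: e0; apply: nI; exact: mem_tnth.
  rewrite (eq_Ex _ (g := H j)) ?H1// => t'; apply: Hdep => k kj.
  by rewrite tnth_mktuple (negbTE (nI k kj)).
rewrite inE => /andP[aI]; rewrite inE => aj.
have onlya k : k \in j -> k \in I -> k = a.
  move=> kj kI; apply/eqP; apply: contraLR hij => ka; rewrite -ltnNge; apply/card_gt1P.
  by exists k, a; rewrite !inE aj kj ka !andbT; move: aI kI; rewrite !inE.
case/tnthP: (aj) => q0 q0a.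
rewrite (bigD1 q0)//= big1 ?addr0; last first.
  move=> q qq0; apply: e0; apply/negP => qI; have := onlya _ (mem_tnth q j) qI.
  by rewrite q0a => /(elimT (tuple_uniqP j) uj) E; rewrite E eqxx in qq0.
rewrite (eq_Ex _ (eE q0)) -q0a aI Ex_cst /proj1; apply: eq_Ex => t'; apply: Hdep => k kj.
rewrite !tnth_mktuple; case: eqP => [->|ka]; first by rewrite aI.
by case: ifP => // kI; case: ka; exact: onlya.
Qed.

(** By orthogonality only pairs of tuples sharing at least two indices contribute, a fraction of
    order n^(-2) of all n^(2r) pairs; each contributes at most the bound of [resid_sqr]. *)
Lemma resid_sum : n%:R ^+ 2 * Ex Pi (fun t => (\sum_(i : r.-tuple 'I_n | uniq i) resid i t) ^+ 2) <=
  r%:R ^+ 4 * (n%:R ^+ r) ^+ 2 * ((2 + 2 * r%:R ^+ 2) * c).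
Proof.
set K := (2 + 2 * r%:R ^+ 2) * c.
have K0 : 0 <= K by rewrite mulr_ge0// addr_ge0// mulr_ge0// sqr_ge0.
have iD (i j : r.-tuple 'I_n) : uniq i -> uniq j -> itg Pi (fun t => resid i t * resid j t).
  by move=> ui uj; apply: L4_mul2; exact: resid_L4.
have E : Ex Pi (fun t => (\sum_(i : r.-tuple 'I_n | uniq i) resid i t) ^+ 2) =
   \sum_(i : r.-tuple 'I_n | uniq i) \sum_(j : r.-tuple 'I_n | uniq j) Ex Pi (fun t => resid i t * resid j t).
  rewrite (eq_Ex _ (g := fun t => \sum_(i : r.-tuple 'I_n | uniq i) \sum_(j : r.-tuple 'I_n | uniq j) resid i t * resid j t)).
    rewrite Ex_sum => [|i ui]; last by apply: itg_sum => j uj; exact: iD.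
    by apply: eq_bigr => i ui; rewrite Ex_sum// => j uj; exact: iD.
  by move=> t; rewrite expr2 mulr_suml; apply: eq_bigr => i _; rewrite mulr_sumr.
have le (i j : r.-tuple 'I_n) : uniq i -> uniq j ->
    Ex Pi (fun t => resid i t * resid j t) <= (j \in [set j : r.-tuple 'I_n | (1 < #|[set k in i] :&: [set k in j]|)%N]%SET)%:R * K.
  move=> ui uj; rewrite inE; case: ltnP => h; last by rewrite resid_orth// mul0r.
  rewrite mul1r.
  have di := L4_sqr (resid_L4 ui); have dj := L4_sqr (resid_L4 uj).
  apply: (@le_trans _ _ (Ex Pi (fun t => 2^-1 * resid i t ^+ 2 + 2^-1 * resid j t ^+ 2))).
    apply: Ex_le; [exact: iD|by apply: itgD; exact: itgZ|move=> t].
    have := sqr_ge0 (resid i t - resid j t); lra.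
  rewrite (ExD (itgZ _ di) (itgZ _ dj)) (ExZ _ di) (ExZ _ dj).
  have := resid_sqr ui; have := resid_sqr uj; rewrite -/K.
  by move: (Ex _ _) (Ex _ _) => x y ? ?; clearbody K; lra.
have cI (i : r.-tuple 'I_n) : (#|[set k in i]| <= r)%N.
  by rewrite cardsE; apply: leq_trans (card_size i) _; rewrite size_tuple.
have le2 (i : r.-tuple 'I_n) : uniq i ->
    n%:R ^+ 2 * \sum_(j : r.-tuple 'I_n | uniq j) Ex Pi (fun t => resid i t * resid j t) <= r%:R ^+ 4 * n%:R ^+ r * K.
  move=> ui; set B := [set j : r.-tuple 'I_n | (1 < #|[set k in i] :&: [set k in j]|)%N]%SET.
  apply: (@le_trans _ _ (n%:R ^+ 2 * (#|B|%:R * K))).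
    apply: ler_wpM2l; first exact: sqr_ge0.
    apply: (@le_trans _ _ (\sum_(j : r.-tuple 'I_n) (j \in B)%:R * K)).
      rewrite big_mkcond; apply: ler_sum => j _; case: ifP => uj; first exact: le.
      by rewrite mulr_ge0.
    rewrite -mulr_suml (_ : \sum_j _ = #|B|%:R)//.
    by rewrite -natr_sum -sum1_card [in RHS]big_mkcond.
  rewrite mulrA ler_wpM2r// -natrX -natrM -!natrX -natrM ler_nat mulnC.
  apply: leq_trans (card_share r [set k in i]) _.
  rewrite leq_mul2r; apply/orP; right; rewrite -[4%N]/(2 + 2)%N expnD leq_mul2l leq_exp2r// cI orbT//.
rewrite E mulr_sumr.
apply: (@le_trans _ _ (\sum_(i : r.-tuple 'I_n) r%:R ^+ 4 * n%:R ^+ r * K)).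
  rewrite big_mkcond; apply: ler_sum => i _; case: ifP => ui; first exact: le2.
  by rewrite mulr_ge0// mulr_ge0// exprn_ge0.
rewrite sumr_const card_tuple card_ord -[leLHS]mulr_natl natrX [leRHS](_ : _ = n%:R ^+ r * (r%:R ^+ 4 * n%:R ^+ r * K))//.
by rewrite expr2; ring.
Qed.

Section Symmetry.
Variable r0 : 'I_r.
Hypothesis Hsym : forall (s : {perm 'I_r}) (i : r.-tuple 'I_n) t, H [tuple tnth i (s k) | k < r] t = H i t.

(** A transposition moves the projected index to the position r0; the symmetry of H makes all r
    positions contribute alike. *)
Lemma sum_proj1 t :
  \sum_(i : r.-tuple 'I_n | uniq i) \sum_(p < r) proj1 i (tnth i p) (tnth t (tnth i p)) =
  r%:R * \sum_(a < n) \sum_(i : r.-tuple 'I_n | uniq i && (tnth i r0 == a)) proj1 i a (tnth t a).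
Proof.
rewrite exchange_big /=.
transitivity (\sum_(p < r) \sum_(i : r.-tuple 'I_n | uniq i) proj1 i (tnth i r0) (tnth t (tnth i r0))); last first.
  rewrite [RHS]mulr_natl sumr_const card_ord; congr (_ *+ _).
  rewrite [RHS](eq_bigr (fun a => \sum_(i : r.-tuple 'I_n | uniq i && (tnth i r0 == a)) proj1 i (tnth i r0) (tnth t (tnth i r0)))).
    by rewrite (partition_big (fun i : r.-tuple 'I_n => tnth i r0) xpredT).
  by move=> a _; apply: eq_bigr => i /andP[_ /eqP ->].
apply: eq_bigr => p _; pose s := tperm p r0.
pose phi (i : r.-tuple 'I_n) : r.-tuple 'I_n := [tuple tnth i (s k) | k < r].
have phiK : involutive phi.
  by move=> i; apply: eq_from_tnth => k; rewrite !tnth_mktuple tpermK.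
have phi_uniq (i : r.-tuple 'I_n) : uniq (phi i) = uniq i.
  have h (j : r.-tuple 'I_n) : uniq j -> uniq (phi j).
    move=> /tuple_uniqP uj; apply/tuple_uniqP => k l; rewrite !tnth_mktuple => /uj.
    exact: perm_inj.
  by apply/idP/idP => [/h|/h//]; rewrite phiK.
rewrite (reindex_inj (inv_inj phiK)) /=; apply: eq_big => [i|i _]; first by rewrite phi_uniq.
rewrite {2 3}/phi tnth_mktuple tpermL /proj1; apply: eq_Ex => t'; exact: Hsym.
Qed.

End Symmetry.

End Hoeffding.

(** * The sample and its conditional means *)

Section Sample.
Context (R : realType) (dO dT : measure_display) (Omega : measurableType dO)
  (T : measurableType dT) (P : probability Omega R) (n : nat) (X : 'I_n -> {RV P >-> T}).
Hypothesis indep : mutually_independent P (fun i => X i : Omega -> T).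

Lemma measX i : measurable_fun setT (X i : Omega -> T).
Proof. exact: measurable_funPT. Qed.

Definition muX i : probability T R := law P (measX i).
Local Notation Pi := (prodN muX).

Definition Xt (w : Omega) : n.-tuple T := [tuple X i w | i < n].

Lemma measurable_Xt : measurable_fun setT Xt.
Proof.
apply/measurable_fun_tnthP => k; rewrite (_ : _ \o _ = X k); first exact: measX.
by apply/funext => w /=; rewrite tnth_mktuple.
Qed.

Lemma Xt_rect (A : 'I_n -> set T) : (forall k, measurable (A k)) ->
  P (Xt @^-1` rect A) = (\prod_(k < n) muX k (A k))%E.
Proof.
move=> mA; have := indep [set: 'I_n]%SET mA.
rewrite (_ : \bigcap_(i in _) _ = Xt @^-1` rect A).
  by move=> ->; apply: eq_bigl => k; rewrite inE.
apply/seteqP; split => w h k; first by rewrite tnth_mktuple; apply: h; rewrite /= inE.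
by move=> _; have := h k; rewrite tnth_mktuple.
Qed.

Lemma Ex_Xt (f : n.-tuple T -> R) : measurable_fun setT f ->
  (itg P (f \o Xt) <-> itg Pi f) /\ (itg Pi f -> Ex P (f \o Xt) = Ex Pi f).
Proof. by move=> mf; apply: Ex_law_eq => //; [exact: measurable_Xt|exact: Xt_rect]. Qed.

Lemma Ex_setint d (S : measurableType d) (Q : probability S R) (B : set S) (f : S -> R) :
  measurable B -> itg Q f ->
  itg Q (fun w => \1_B w * f w) /\ (\int[Q]_(w in B) (f w)%:E = (Ex Q (fun w => \1_B w * f w))%:E)%E.
Proof.
move=> mB hf; have i1 : itg Q (fun w => \1_B w * f w).
  apply: (itg_le _ (itg_abs hf)) => [|w].
    by apply: measurable_funM; [exact/measurable_indicP|exact: itg_meas hf].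
  by rewrite normrM indicE; case: (w \in B); rewrite ?normr1 ?mul1r// normr0 mul0r.
split => //; rewrite -(Ex_EFin i1) integral_mkcond; apply: eq_integral => w _.
by rewrite patchE indicE; case: (w \in B); rewrite ?mul1r ?mul0r.
Qed.

Lemma Ex_X a (f : T -> R) : measurable_fun setT f ->
  (itg P (fun w => f (X a w)) <-> itg (muX a) f) /\
  (itg (muX a) f -> Ex P (fun w => f (X a w)) = Ex (muX a) f).
Proof.
move=> mf; have J := itg_law P (measX a) mf; split; first by split => /J.
by move=> /J hf; rewrite /muX (Ex_law (measX a) mf hf).
Qed.

(** By independence the explicit integral phi0 satisfies [is_cond_mean], so [xget] selects a genuine
    version; two versions have equal integrals over all measurable sets and hence agree almost
    everywhere. *)
Lemma cond_mean_ae a (f : n.-tuple T -> R) : itg Pi f ->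
  let phi := cond_mean P (f \o Xt) (X a) in
  [/\ measurable_fun setT phi, itg (muX a) phi &
   {ae muX a, forall x, phi x = Ex Pi (fun t => f (upd a x t))}].
Proof.
move=> hf phi; have mf := itg_meas hf.
have [IX EX] := Ex_Xt mf; have iX := IX.2 hf.
have [IU EU] := Ex_law_eq (measurable_upd a) (@upd_rect _ _ _ _ muX a) mf.
have iU := IU.2 hf.
pose phi0 x := Ex Pi (fun t => f (upd a x t)).
have i0 : itg (muX a) phi0 := itg_inner iU.
have m0 := itg_meas i0.
have key A : measurable A ->
    (\int[P]_(w in X a @^-1` A) (phi0 (X a w))%:E = \int[P]_(w in X a @^-1` A) ((f \o Xt) w)%:E)%E.
  move=> mA; have mXA : measurable (X a @^-1` A).
    by rewrite -[_ @^-1` _]setTI; exact: measX.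
  have i0X := (Ex_X a m0).1.2 i0.
  have [j1 ->] := Ex_setint mXA i0X; have [j2 ->] := Ex_setint mXA iX; congr EFin.
  have mF : measurable_fun setT (fun t : n.-tuple T => \1_A (tnth t a) * f t).
    have m1 : measurable_fun setT (\1_A : T -> R) by exact/measurable_indicP.
    by apply: measurable_funM => //; exact: (measurableT_comp m1 (measurable_tnth a)).
  have E1 w : \1_(X a @^-1` A) w * (f \o Xt) w = (fun t : n.-tuple T => \1_A (tnth t a) * f t) (Xt w) :> R.
    by rewrite /= tnth_mktuple !indicE; congr ((nat_of_bool _)%:R * _); apply/idP/idP; rewrite !inE.
  have [IF EF] := Ex_Xt mF.
  have iF : itg Pi (fun t : n.-tuple T => \1_A (tnth t a) * f t) by apply/IF; exact: (itg_ext E1).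
  rewrite [RHS](eq_Ex _ E1) [RHS]EF//.
  have [IU' EU'] := Ex_law_eq (measurable_upd a) (@upd_rect _ _ _ _ muX a) mF.
  rewrite -(EU' iF) (Ex_prod (IU'.2 iF)).
  have mA1 : measurable_fun setT (fun x => \1_A x * phi0 x).
    by apply: measurable_funM => //; exact/measurable_indicP.
  have E2 w : \1_(X a @^-1` A) w * phi0 (X a w) = (fun x => \1_A x * phi0 x) (X a w) :> R.
    by rewrite /= !indicE; congr ((nat_of_bool _)%:R * _); apply/idP/idP; rewrite !inE.
  have [IG EG] := Ex_X a mA1.
  rewrite (eq_Ex _ E2) EG; last by apply/IG; exact: (itg_ext E2).
  apply: eq_Ex => x /=.
  have E3 t : \1_A (tnth (upd a x t) a) * f (upd a x t) = \1_A x * f (upd a x t) :> R.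
    by rewrite tnth_mktuple eqxx.
  rewrite (eq_Ex _ E3) indicE; case: (x \in A).
    by rewrite mul1r; apply: eq_Ex => t; rewrite mul1r.
  by rewrite mul0r (eq_Ex _ (g := fun=> 0)) ?Ex_cst// => t; rewrite mul0r.
have c0 : is_cond_mean P (f \o Xt) (X a) phi0.
  by split => //; exact: (Ex_X a m0).1.2.
have [mp ip hp] : is_cond_mean P (f \o Xt) (X a) phi.
  by have := @xgetPex _ (fun=> 0) [set phi | is_cond_mean P (f \o Xt) (X a) phi]; apply; exists phi0.
have iphi : itg (muX a) phi by apply/(Ex_X a mp).1.
split => //.
have := @integral_ae_eq _ _ _ (muX a) setT measurableT (EFin \o phi0) (EFin \o phi) iphi.
have m0' : measurable_fun setT (EFin \o phi0) by exact/measurable_EFinP.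
move=> /(_ m0') h; have : ae_eq (muX a) setT (EFin \o phi) (EFin \o phi0).
  apply: h => E _ mE.
  have [j1 ->] := Ex_setint mE iphi; have [j2 ->] := Ex_setint mE i0.
  have mXE : measurable (X a @^-1` E) by rewrite -[_ @^-1` _]setTI; exact: measX.
  have ipX := (Ex_X a mp).1.2 iphi; have i0X := (Ex_X a m0).1.2 i0.
  have := hp E mE; rewrite -(key E mE).
  have [k1 ->] := Ex_setint mXE ipX; have [k2 ->] := Ex_setint mXE i0X.
  have [_ F1] := Ex_X a (itg_meas j1); have [_ F2] := Ex_X a (itg_meas j2).
  rewrite -(F1 j1) -(F2 j2) => -[G]; congr EFin; rewrite -[RHS]/(Ex P (fun w => (fun x => \1_E x * phi0 x) (X a w))).
  have S (g : T -> R) w : \1_E (X a w) * g (X a w) = \1_(X a @^-1` E) w * g (X a w).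
    by rewrite !indicE; congr ((nat_of_bool _)%:R * _); apply/idP/idP; rewrite !inE.
  by rewrite (eq_Ex _ (S phi)) G; apply: eq_Ex => w; rewrite S.
by apply: filterS => x /= /(_ I) [].
Qed.

End Sample.

Lemma card_uniq_head (n r : nat) (a : 'I_n) :
  (#|[set i : r.+1.-tuple 'I_n | uniq i && (tnth i ord0 == a)]%SET| <= n.-1 ^_ r)%N.
Proof.
pose phi (i : r.+1.-tuple 'I_n) : r.-tuple 'I_n := [tuple of behead i].
have inj : {in [set i : r.+1.-tuple 'I_n | uniq i && (tnth i ord0 == a)]%SET &, injective phi}.
  move=> i j; rewrite !inE; case/tupleP: i => x s; case/tupleP: j => y t /=.
  rewrite !(tnth_nth x) /= => /andP[_ /eqP ->] /andP[_ /eqP ->] /(congr1 val) /= st.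
  by apply/val_inj; rewrite /= st.
rewrite -(card_in_imset inj) (_ : n.-1 = #|predC1 a|) -?card_uniq_tuples; last by rewrite cardC1 card_ord.
apply: subset_leq_card; apply/fintype.subsetP => z /imsetP[i hi ->]; move: hi; rewrite !inE.
case/tupleP: i => x s; rewrite (tnth_nth x) /= => /andP[/andP[xs us] /eqP xa].
by rewrite us andbT; apply/allP => y ys; rewrite inE; apply: contra xs => /eqP ya; rewrite xa -ya.
Qed.

Lemma mean_Ex (R : realType) d (S : measurableType d) (P : probability S R) (f : S -> R) :
  mean P f = Ex P f.
Proof. by rewrite /mean unlock. Qed.

(** * U-statistics *)

Section UStatistic.
Context (R : realType) (dO dT : measure_display) (Omega : measurableType dO)
  (T : measurableType dT) (P : probability Omega R) (r' n d : nat) (X : 'I_n -> {RV P >-> T})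
  (h : r'.+1.-tuple T -> 'cV[R]_d) (C : R).
Local Notation r := r'.+1.
Hypothesis indep : mutually_independent P (fun i => X i : Omega -> T).
Hypothesis mh : measurable_stat_kernel h.
Hypothesis sh : symmetric_stat_kernel h.
Hypothesis rn : (r <= n)%N.
Hypothesis C1 : 1 < C.
Hypothesis hB : forall (m : 'I_d) (i : r.-tuple 'I_n),
  ('E_P[fun w => (`|h (subsample X i w) m 0| ^+ 4)%R] < C%:E)%E.
Local Notation Pi := (prodN (muX X)).

Definition sub (i : r.-tuple 'I_n) (t : n.-tuple T) : r.-tuple T := [tuple tnth t (tnth i k) | k < r].

Definition hm (m : 'I_d) (i : r.-tuple 'I_n) (t : n.-tuple T) : R := h (sub i t) m 0.

Lemma sub_Xt i w : sub i (Xt X w) = subsample X i w.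
Proof. by apply: eq_from_tnth => k; rewrite !tnth_mktuple. Qed.

Lemma measurable_hm m i : measurable_fun setT (hm m i).
Proof.
apply: (measurableT_comp (mh m)); apply/measurable_fun_tnthP => k.
rewrite (_ : _ \o _ = fun t => tnth t (tnth i k)); first exact: measurable_tnth.
by apply/funext => t /=; rewrite tnth_mktuple.
Qed.

Lemma hm_moment m i : L4 Pi (hm m i) /\ Ex Pi (fun t => hm m i t ^+ 4) <= C.
Proof.
have E w : `|h (subsample X i w) m 0| ^+ 4 = ((fun t => hm m i t ^+ 4) \o Xt X) w.
  rewrite /= /hm sub_Xt -normrX ger0_norm// -[4%N]/(2 * 2)%N exprM; exact: sqr_ge0.
have := hB m i; rewrite unlock => hlt.
have mf := measurable_funX 4 (measurable_hm m i).
have mX := measurableT_comp mf (measurable_Xt X).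
have nn w : 0 <= ((fun t => hm m i t ^+ 4) \o Xt X) w by rewrite -E exprn_ge0.
have hlt' : (\int[P]_w (((fun t => hm m i t ^+ 4) \o Xt X) w)%:E < C%:E)%E.
  by under eq_integral do rewrite -E.
have ii : itg P ((fun t => hm m i t ^+ 4) \o Xt X).
  apply/integrableP; split; first exact/measurable_EFinP.
  under eq_integral => w _ do rewrite /= ger0_norm ?(nn w)//.
  exact: lt_trans hlt' (ltry _).
have [I E'] := Ex_Xt indep mf; have iP := I.1 ii.
split; first by split => //; exact: measurable_hm.
by rewrite -(E' iP) -lee_fin -(Ex_EFin ii); exact: ltW.
Qed.

(** Each index tuple is centred at its own mean, since the X_i need not share a law. *)
Definition cen m i t : R := hm m i t - Ex Pi (hm m i).

(** Chosen so that kap^2 = 16 C bounds the centred fourth moments: (x - e)^4 <= 8 x^4 + 8 e^4, and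
    e^4 <= C when e is the mean. *)
Definition kap : R := 4 * Num.sqrt C.

Lemma kap_ge0 : 0 <= kap. Proof. by rewrite mulr_ge0// sqrtr_ge0. Qed.

Lemma kap2 : kap ^+ 2 = 16 * C.
Proof. by rewrite exprMn sqr_sqrtr ?(ltW (lt_trans ltr01 C1))//; congr (_ * _); rewrite expr2 -natrM. Qed.

Lemma cen_L4 m i : L4 Pi (cen m i).
Proof. by apply: L4B (L4_cst _ _); case: (hm_moment m i). Qed.

Lemma cen_mean m i : Ex Pi (cen m i) = 0.
Proof.
have [h4 _] := hm_moment m i.
by rewrite /cen (ExB (L4_itg h4) (itg_cst _ _)) Ex_cst subrr.
Qed.

Lemma cen_moment m i : Ex Pi (fun t => cen m i t ^+ 4) <= kap ^+ 2.
Proof.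
have [h4 hC] := hm_moment m i; have i4 : itg Pi (fun t => hm m i t ^+ 4) by case: h4.
have j := Ex_pow4_le h4; set e := Ex Pi (hm m i) in j *.
apply: (@le_trans _ _ (Ex Pi (fun t => 8 * hm m i t ^+ 4 + 8 * e ^+ 4))).
  apply: Ex_le; [by case: (cen_L4 m i)|by apply: itgD; [exact: itgZ|exact: itg_cst]|move=> t].
  rewrite /cen -/e; move: (hm m i t) => x.
  have p (y : R) : y ^+ 4 = (y ^+ 2) ^+ 2 by rewrite -exprM.
  have q1 : (x - e) ^+ 2 <= 2 * (x ^+ 2 + e ^+ 2) by have := sqr_ge0 (x + e); lra.
  have q2 : ((x - e) ^+ 2) ^+ 2 <= (2 * (x ^+ 2 + e ^+ 2)) ^+ 2.
    by rewrite lerXn2r ?nnegrE ?sqr_ge0// mulr_ge0// addr_ge0 ?sqr_ge0.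
  by rewrite !p; have := sqr_ge0 (x ^+ 2 - e ^+ 2); lra.
rewrite (ExD (itgZ _ i4) (itg_cst _ _)) (ExZ _ i4) Ex_cst kap2; lra.
Qed.

Lemma cen_dep m (i : r.-tuple 'I_n) t t' : (forall k, k \in i -> tnth t k = tnth t' k) -> cen m i t = cen m i t'.
Proof.
move=> ht; rewrite /cen /hm; congr (h _ m 0 - _); apply: eq_from_tnth => k.
by rewrite !tnth_mktuple ht// mem_tnth.
Qed.

Lemma hm_sym m (s : {perm 'I_r}) (i : r.-tuple 'I_n) t : hm m [tuple tnth i (s k) | k < r] t = hm m i t.
Proof.
rewrite /hm -[in RHS](sh s); congr (h _ m 0); apply: eq_from_tnth => k.
by rewrite !tnth_mktuple.
Qed.

Lemma cen_sym m (s : {perm 'I_r}) (i : r.-tuple 'I_n) t : cen m [tuple tnth i (s k) | k < r] t = cen m i t.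
Proof. by rewrite /cen hm_sym; congr (_ - _); apply: eq_Ex => t'; rewrite hm_sym. Qed.

Local Notation N' := ((n.-1 ^_ r')%:R : R).

Lemma N'_gt0 : 0 < N'.
Proof. by rewrite ltr0n ffact_gt0 -ltnS (leq_trans rn)// leqSpred. Qed.

Lemma n_gt0 : 0 < n%:R :> R. Proof. by rewrite ltr0n (leq_trans _ rn). Qed.

(** The Hájek projection with explicit integrals in place of chosen conditional means; [hajek_ae]
    shows that it agrees with [hajek] almost everywhere. *)
Definition gX (a : 'I_n) (x : T) : 'cV[R]_d :=
  \col_m (N'^-1 * \sum_(i : r.-tuple 'I_n | uniq i && (tnth i ord0 == a)) proj1 (muX X) (cen m) i a x).

Lemma hajek_coord (a : 'I_n) (x : T) m : hajek X h a x m 0 =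
  N'^-1 * \sum_(i : r.-tuple 'I_n | uniq i && (tnth i ord0 == a))
    (cond_mean P (hm m i \o Xt X) (X a) x - Ex Pi (hm m i)).
Proof.
rewrite /hajek mxE summxE; congr (_ * _); apply: eq_big => [i|i _].
  by case/tupleP: i => y s; rewrite (tnth_nth y).
rewrite !mxE mean_Ex; congr (cond_mean _ _ _ _ - _).
  by apply/funext => w; rewrite /= /hm sub_Xt.
have [_ E] := Ex_Xt indep (measurable_hm m i); have [h4 _] := hm_moment m i.
by rewrite -(E (L4_itg h4)); apply: eq_Ex => w; rewrite /= /hm sub_Xt.
Qed.

Lemma hajek_ae a : (forall m, itg (muX X a) (fun x => hajek X h a x m 0)) /\
  {ae muX X a, forall x, hajek X h a x = gX a x}.
Proof.
have hc m i := cond_mean_ae indep a (L4_itg (hm_moment m i).1).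
split.
  move=> m; apply: (itg_ext (fun x => esym (hajek_coord a x m))).
  by apply: itgZ; apply: itg_sum => i _; apply: itgB; [case: (hc m i)|exact: itg_cst].
(* There are finitely many coordinates and index tuples, so one null set serves them all. *)
have ae1 : {ae muX X a, forall x, forall w : 'I_d * r.-tuple 'I_n,
    cond_mean P (hm w.1 w.2 \o Xt X) (X a) x - Ex Pi (hm w.1 w.2) = proj1 (muX X) (cen w.1) w.2 a x}.
  apply: filter_forall => -[m i] /=.
  have [h4 _] := hm_moment m i; have [_ _ h1] := hc m i.
  have [u4 _] := upd_law a h4.
  have u1 := ae_itg_prod (L4_itg u4).
  apply: filterS2 h1 u1 => x -> hx.
  by rewrite /proj1 /cen (ExB hx (itg_cst _ _)) Ex_cst.
apply: filterS ae1 => x hx; apply/matrixP => m j; rewrite (ord1 j) hajek_coord mxE.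
by congr (_ * _); apply: eq_bigr => i _; exact: (hx (m, i)).
Qed.

Lemma gX_coord a m : [/\ L4 (muX X a) (fun x => gX a x m 0), Ex (muX X a) (fun x => gX a x m 0) = 0 &
  Ex (muX X a) (fun x => gX a x m 0 ^+ 4) <= kap ^+ 2].
Proof.
have hp (i : r.-tuple 'I_n) (ui : uniq i) :=
  proj1_moments (fun i _ => cen_L4 m i) (fun i _ => cen_mean m i) (fun i _ => cen_moment m i) a ui.
set A := [set i : r.-tuple 'I_n | uniq i && (tnth i ord0 == a)]%SET.
have gE x : gX a x m 0 = N'^-1 * \sum_(i in A) proj1 (muX X) (cen m) i a x.
  by rewrite mxE; congr (_ * _); apply: eq_bigl => i; rewrite inE.
have uA i : i \in A -> uniq i by rewrite inE => /andP[].
have p4 i : i \in A -> L4 (muX X a) (proj1 (muX X) (cen m) i a).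
  by move=> /uA ui; case: (hp i ui).
have L : L4 (muX X a) (fun x => gX a x m 0).
  by apply: (L4_ext (fun x => esym (gE x))); apply: L4Z; exact: L4_sum.
split => //.
  rewrite (eq_Ex _ gE) ExZ; last by apply: itg_sum => i iA; apply: L4_itg; exact: p4.
  rewrite Ex_sum; last by move=> i iA; apply: L4_itg; exact: p4.
  by rewrite big1 ?mulr0// => i /uA ui; case: (hp i ui).
have N0 := N'_gt0.
have is4 : itg (muX X a) (fun x => \sum_(i in A) proj1 (muX X) (cen m) i a x ^+ 4).
  by apply: itg_sum => i /p4 [].
have AN : #|A|%:R <= N' by rewrite ler_nat; exact: card_uniq_head.
apply: (@le_trans _ _ (Ex (muX X a) (fun x => N'^-1 ^+ 4 * (N' ^+ 3 * \sum_(i in A) proj1 (muX X) (cen m) i a x ^+ 4)))).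
  apply: Ex_le; [by case: L|by do 2 apply: itgZ|move=> x].
  rewrite gE exprMn ler_wpM2l ?exprn_ge0 ?invr_ge0 ?(ltW N0)//.
  apply: le_trans (pow4_sum_in A _) _; apply: ler_wpM2r.
    by apply: sumr_ge0 => i _; rewrite -[4%N]/(2 * 2)%N exprM sqr_ge0.
  by rewrite lerXn2r ?nnegrE.
rewrite ExZ; last exact: itgZ.
rewrite ExZ// Ex_sum; last by move=> i /p4 [].
apply: (@le_trans _ _ (N'^-1 ^+ 4 * (N' ^+ 3 * (N' * kap ^+ 2)))).
  apply: ler_wpM2l; first by rewrite exprn_ge0// invr_ge0 ltW.
  apply: ler_wpM2l; first by rewrite exprn_ge0// ltW.
  apply: (@le_trans _ _ (\sum_(i in A) kap ^+ 2)).
    by apply: ler_sum => i /uA ui; case: (hp i ui).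
  by rewrite sumr_const -[leLHS]mulr_natl ler_wpM2r ?sqr_ge0.
rewrite [leLHS](_ : _ = kap ^+ 2)//; field; exact: lt0r_neq0.
Qed.

Definition xiX (a : 'I_n) (x : T) : 'cV[R]_d := (Num.sqrt n%:R)^-1 *: gX a x.

Definition SigX (a : 'I_n) : 'M[R]_d :=
  \matrix_(k, l) Ex (muX X a) (fun x => xiX a x k 0 * xiX a x l 0).

Lemma xiX_L4v a : L4v (muX X a) (xiX a).
Proof.
move=> k; have [h4 _ _] := gX_coord a k.
by apply: L4_ext (L4Z (Num.sqrt n%:R)^-1 h4) => x; rewrite [in RHS]mxE.
Qed.

Lemma summand_X a : summand (kap / n%:R) (muX X a) (xiX a) (SigX a).
Proof.
have hx := xiX_L4v a; have n0 := n_gt0.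
split => //.
- move=> v; rewrite (eq_Ex _ (g := fun x => \sum_k v k 0 * xiX a x k 0)); last by move=> x; rewrite ipE.
  rewrite Ex_sum; last by move=> k _; apply: itgZ; exact: L4_itg.
  rewrite big1// => k _; rewrite ExZ; last exact: L4_itg.
  have [h4 h1 _] := gX_coord a k.
  rewrite (eq_Ex _ (g := fun x => (Num.sqrt n%:R)^-1 * gX a x k 0)); last by move=> x; rewrite mxE.
  by rewrite (ExZ _ (L4_itg h4)) h1 !mulr0.
- move=> v.
  rewrite (eq_Ex _ (g := fun x => \sum_k \sum_l v k 0 * v l 0 * (xiX a x k 0 * xiX a x l 0))); last first.
    move=> x; rewrite ipE expr2 mulr_suml; apply: eq_bigr => k _; rewrite mulr_sumr.
    by apply: eq_bigr => l _; ring.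
  have ikl k l : itg (muX X a) (fun x => v k 0 * v l 0 * (xiX a x k 0 * xiX a x l 0)).
    by apply: itgZ; exact: L4_mul2.
  rewrite Ex_sum; last by move=> k _; apply: itg_sum => l _.
  rewrite [RHS]mxE (eq_bigr (fun k => \sum_l Ex (muX X a) (fun x => v k 0 * v l 0 * (xiX a x k 0 * xiX a x l 0)))); last first.
    by move=> k _; rewrite Ex_sum.
  rewrite exchange_big /=; apply: eq_bigr => l _; rewrite mxE mulr_suml; apply: eq_bigr => k _.
  by rewrite !mxE ExZ; [ring|exact: L4_mul2].
- by apply/matrixP => k l; rewrite !mxE; apply: eq_Ex => x; rewrite mulrC.
move=> k; have [h4 _ hk] := gX_coord a k.
rewrite (eq_Ex _ (g := fun x => (Num.sqrt n%:R)^-1 ^+ 4 * gX a x k 0 ^+ 4)); last first.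
  by move=> x; rewrite mxE exprMn.
rewrite ExZ; last by case: h4.
have -> : (kap / n%:R) ^+ 2 = (Num.sqrt n%:R)^-1 ^+ 4 * kap ^+ 2.
  by rewrite -[4%N]/(2 * 2)%N exprM exprVn (sqr_sqrtr (ltW n0)) exprMn mulrC.
by rewrite ler_wpM2l// exprn_ge0// invr_ge0 sqrtr_ge0.
Qed.

Lemma Gamma_X : Gamma X h = \sum_a SigX a.
Proof.
have n0 := n_gt0.
apply/matrixP => k l; rewrite mxE !summxE mulr_sumr; apply: eq_bigr => a _.
rewrite !mxE mean_Ex.
have [hi hae] := hajek_ae a; have mk := itg_meas (hi k); have ml := itg_meas (hi l).
have mkl : measurable_fun setT (fun x => hajek X h a x k 0 * hajek X h a x l 0) by exact: measurable_funM.
have [gk _ _] := gX_coord a k; have [gl _ _] := gX_coord a l.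
have ig := L4_mul2 gk gl.
have ae : {ae muX X a, forall x, gX a x k 0 * gX a x l 0 = hajek X h a x k 0 * hajek X h a x l 0}.
  by apply: filterS hae => x ->.
have ih := ae_itg mkl ae ig.
rewrite (eq_Ex _ (g := fun w => (fun x => hajek X h a x k 0 * hajek X h a x l 0) (X a w))); last first.
  by move=> w; rewrite mxE big_ord1 [X in _ * X]mxE.
rewrite ((Ex_X X a mkl).2 ih) -(ae_eq_Ex (itg_meas ig) mkl ae) -ExZ//.
apply: eq_Ex => x; rewrite !mxE.
move: (gX a x k 0) (gX a x l 0) => p q.
rewrite (_ : n%:R^-1 = (Num.sqrt n%:R)^-1 * (Num.sqrt n%:R)^-1); first by ring.
by rewrite -invfM -expr2 sqr_sqrtr// ltW.
Qed.

Definition statT (t : n.-tuple T) : 'cV[R]_d :=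
  \col_m (Num.sqrt n%:R / r%:R * ((n ^_ r)%:R^-1 * \sum_(i : r.-tuple 'I_n | uniq i) cen m i t)).

Lemma tstat_Xt w : tstat X h w = statT (Xt X w).
Proof.
apply/matrixP => m j; rewrite (ord1 j) !mxE mean_Ex; congr (_ * _).
have E w' : ustat X h w' m 0 = (n ^_ r)%:R^-1 * \sum_(i : r.-tuple 'I_n | uniq i) (hm m i \o Xt X) w'.
  by rewrite mxE summxE; congr (_ * _); apply: eq_bigr => i _; rewrite /= /hm sub_Xt.
have ih i : itg P (hm m i \o Xt X) /\ Ex P (hm m i \o Xt X) = Ex Pi (hm m i).
  have [I E'] := Ex_Xt indep (measurable_hm m i); have [h4 _] := hm_moment m i.
  by split; [exact/I/L4_itg|exact/E'/L4_itg].
rewrite (eq_Ex _ E) ExZ; last by apply: itg_sum => i _; case: (ih i).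
rewrite summxE -mulrBr; congr (_ * _).
rewrite Ex_sum => [|i _]; last by case: (ih i).
by rewrite -sumrB; apply: eq_bigr => i _; rewrite /cen (ih i).2 /hm sub_Xt.
Qed.

(** The projection parts cancel exactly: the r positions compensate the factor 1 / r, and n ^_ r = n
    (n - 1) ^_ (r - 1) turns sqrt n into the 1 / sqrt n of [xiX]. *)
Lemma statT_sub t m : statT t m 0 - sumX xiX t m 0 =
  Num.sqrt n%:R / r%:R * ((n ^_ r)%:R^-1 * \sum_(i : r.-tuple 'I_n | uniq i) resid (muX X) (cen m) i t).
Proof.
have n0 := n_gt0; have N0 := N'_gt0.
rewrite [statT t m 0]mxE /resid [in RHS]sumrB (sum_proj1 _ ord0 (cen_sym m)) !mulrBr; congr (_ - _).
rewrite summxE ffactnS natrM.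
have E a : xiX a (tnth t a) m 0 = (Num.sqrt n%:R)^-1 * N'^-1 *
    \sum_(i : r.-tuple 'I_n | uniq i && (tnth i ord0 == a)) proj1 (muX X) (cen m) i a (tnth t a).
  by rewrite !mxE mulrA.
rewrite (eq_bigr _ (fun a _ => E a)) -mulr_sumr.
set S := \sum_a _.
have s2 := sqr_sqrtr (ltW n0); have s0 : 0 < Num.sqrt (n%:R : R) by rewrite sqrtr_gt0.
have r0 : (r%:R : R) != 0 by rewrite pnatr_eq0.
rewrite -[in (n%:R * N')^-1]s2; move: (Num.sqrt n%:R) s0 (r%:R : R) r0 => s s0 rr r0; field.
by rewrite r0 !gt_eqF.
Qed.

(** The factor r^2 is the r^4 of [resid_sum] over the r^2 of the normalisation of T_n, (r^r)^2 comes
    from [ffact_lower] and 2 + 2 r^2 from [resid_sqr]. *)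
Definition Kres : R := (r%:R ^+ 2 * (r%:R ^+ r) ^+ 2 * (2 + 2 * r%:R ^+ 2)) * kap.

Lemma statT_sumX : L4v Pi statT /\ Ex Pi (fun t => sqn (statT t - sumX xiX t)) <= d%:R * (Kres / n%:R).
Proof.
have n0 := n_gt0.
have sT : L4v Pi statT.
  move=> m; apply: (L4_ext (f := fun t => Num.sqrt n%:R / r%:R * ((n ^_ r)%:R^-1 * \sum_(i : r.-tuple 'I_n | uniq i) cen m i t))).
    by move=> t; rewrite mxE.
  by do 2 apply: L4Z; apply: L4_sum => i _; exact: cen_L4.
split => //.
have sX : L4v Pi (sumX xiX).
  move=> m; apply: (L4_ext (f := fun t => \sum_a xiX a (tnth t a) m 0)); first by move=> t; rewrite summxE.
  by apply: L4_sum => a _; case: (L4_coord (xiX_L4v a m)).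
pose c := (Num.sqrt (n%:R : R) / r%:R * (n ^_ r)%:R^-1) ^+ 2.
have D4 m : L4 Pi (fun t => \sum_(i : r.-tuple 'I_n | uniq i) resid (muX X) (cen m) i t).
  by apply: L4_sum => i ui; apply: (resid_L4 (c := kap)) => // j _; [exact: cen_L4|exact: cen_mean|exact: cen_moment].
rewrite (eq_Ex _ (g := fun t => \sum_m c * (\sum_(i : r.-tuple 'I_n | uniq i) resid (muX X) (cen m) i t) ^+ 2)); last first.
  move=> t; apply: eq_bigr => m _; have -> : (statT t - sumX xiX t) m 0 = statT t m 0 - sumX xiX t m 0 by rewrite mxE [X in _ + X]mxE.
  by rewrite statT_sub /c -exprMn mulrA.
rewrite Ex_sum; last by move=> m _; apply: itgZ; exact: L4_sqr.
apply: (@le_trans _ _ (\sum_(m < d) Kres / n%:R)); last by rewrite sumr_const card_ord mulr_natl.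
apply: ler_sum => m _; rewrite ExZ; last exact: L4_sqr.
have := resid_sum kap_ge0 (fun i _ => cen_L4 m i) (fun i _ => cen_mean m i) (fun i _ => cen_moment m i) (@cen_dep m).
set E := Ex _ _ => hE.
have P0 : 0 < (n ^_ r)%:R :> R by rewrite ltr0n ffact_gt0.
have lowN : (n%:R : R) ^+ r <= r%:R ^+ r * (n ^_ r)%:R.
  by rewrite -!natrX -natrM ler_nat; exact: ffact_lower.
have rp : 0 < r%:R :> R by rewrite ltr0n.
have low2 : ((n%:R : R) ^+ r) ^+ 2 <= (r%:R ^+ r) ^+ 2 * (n ^_ r)%:R ^+ 2.
  by rewrite -exprMn lerXn2r ?nnegrE ?mulr_ge0 ?exprn_ge0 ?(ltW n0) ?(ltW rp) ?(ltW P0).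
have K0 : 0 <= r%:R ^+ 4 * ((2 + 2 * r%:R ^+ 2) * kap) :> R.
  by rewrite mulr_ge0 ?exprn_ge0 ?(ltW rp)// mulr_ge0 ?kap_ge0// addr_ge0// mulr_ge0 ?sqr_ge0.
have := ler_wpM2l K0 low2 => low3.
have cE : c = n%:R / r%:R ^+ 2 / (n ^_ r)%:R ^+ 2.
  by rewrite /c !exprMn !exprVn (sqr_sqrtr (ltW n0)).
have hE2 : n%:R ^+ 2 * E <= r%:R ^+ 4 * ((2 + 2 * r%:R ^+ 2) * kap) * ((r%:R ^+ r) ^+ 2 * (n ^_ r)%:R ^+ 2).
  by apply: le_trans low3; rewrite [leRHS]mulrAC.
have EE : E <= r%:R ^+ 4 * ((2 + 2 * r%:R ^+ 2) * kap) * ((r%:R ^+ r) ^+ 2 * (n ^_ r)%:R ^+ 2) / n%:R ^+ 2.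
  by rewrite ler_pdivlMr ?exprn_gt0// mulrC.
have c0 : 0 <= c by exact: sqr_ge0.
apply: le_trans (ler_wpM2l c0 EE) _; rewrite cE /Kres.
rewrite le_eqVlt; apply/orP; left; apply/eqP.
move: ((n ^_ r)%:R : R) P0 (n%:R : R) n0 => p p0 q q0; move: (r%:R : R) rp => rr rr0.
by field; rewrite !gt_eqF.
Qed.

End UStatistic.

(** * Comparison on balls *)

Section Smoothing.
Context (R : realType).

Lemma indic_sstep n (s e : R) (z : 'cV[R]_n) : 0 < e ->
  (sqn z <= s)%R%:R <= sstep s e z /\ sstep s e z <= (sqn z <= s + 3 * e)%R%:R.
Proof.
move=> e0; rewrite /sstep; set y := (sqn z - s) / e.
have [/andP[h0 h1] _ _] := stepP y; split.
  case: (lerP (sqn z) s) => // h; rewrite step_le0 ?lexx// /y.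
  by rewrite mulr_le0_ge0 ?subr_le0 ?invr_ge0 ?(ltW e0).
case: (lerP (sqn z) (s + 3 * e)) => // h; rewrite step_ge3// /y ler_pdivlMr//; lra.
Qed.

Lemma mem_set_le n (c : R) (T : Type) (Z : T -> 'cV[R]_n) w :
  \1_[set w | sqn (Z w) <= c] w = (sqn (Z w) <= c)%R%:R :> R.
Proof. by rewrite indicE; congr ((nat_of_bool _)%:R); apply/idP/idP; rewrite inE. Qed.

Lemma measurable_sqn_le n d (T : measurableType d) (Z : T -> 'cV[R]_n) (c : R) : meas_vec Z ->
  measurable [set w | sqn (Z w) <= c].
Proof.
move=> mZ; rewrite (_ : [set w | _] = (fun w => sqn (Z w)) @^-1` `]-oo, c]%classic); last first.
  by apply/seteqP; split => t /=; rewrite in_itv.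
by rewrite -[_ @^-1` _]setTI; apply: measurable_sqn.
Qed.

Lemma sstep_lipschitz n (s e : R) (z z' : 'cV[R]_n) : 0 < e ->
  `|sstep s e z - sstep s e z'| <= 4 / e * `|sqn z - sqn z'|.
Proof.
move=> e0; have := step_lipschitz ((sqn z' - s) / e) ((sqn z - sqn z') / e).
rewrite -mulrDl (_ : sqn z' - s + (sqn z - sqn z') = sqn z - s); last by ring.
by rewrite normrM normfV (gtr0_norm e0) (mulrC `|_|) mulrA.
Qed.

(* AM-GM on the cross term of [|W + D|^2 - |W|^2 = 2 <W, D> + |D|^2]. *)
Lemma sqn_diff n (w x : 'cV[R]_n) (p : R) : 0 < p ->
  `|sqn x - sqn w| <= p * sqn w + (1 + p^-1) * sqn (x - w).
Proof.
move=> p0; set v := x - w; have -> : x = w + v by rewrite /v addrC subrK.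
rewrite sqnD (_ : _ - _ = 2 * ip w v + sqn v); last by ring.
have v0 := sqn_ge0 v; have w0 := sqn_ge0 w.
have q : 2 * `|ip w v| <= p * sqn w + p^-1 * sqn v.
  have cs : `|ip w v| <= Num.sqrt (sqn w * sqn v).
    by rewrite -sqrtr_sqr ler_wsqrtr// ip_cs.
  apply: (le_trans (ler_wpM2l (ler0n _ 2) cs)).
  rewrite sqrtrM//.
  have a2 := sqr_sqrtr w0; have b2 := sqr_sqrtr v0.
  move: (Num.sqrt (sqn w)) (Num.sqrt (sqn v)) a2 b2 => a b <- <-.
  rewrite -subr_ge0 (_ : _ - _ = (p * a - b) ^+ 2 / p); last by field; rewrite gt_eqF.
  by rewrite divr_ge0 ?sqr_ge0 ?(ltW p0).
apply: le_trans (ler_normD _ _) _; rewrite normrM (@ger0_norm _ 2)// (ger0_norm v0); lra.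
Qed.

(** The choice A = tau + dl / tau makes A tau^2 and M / A comparable: the first equals tau^3 + dl
    tau and the second is at most 3 times that. The terms carrying an extra dl are absorbed by dl <=
    e. *)
Lemma lindeberg_rate (tau dl th e N : R) : 0 < tau -> 0 < dl -> 0 < e -> 0 <= th -> 0 <= N ->
  dl <= e -> N * th ^+ 4 = dl ^+ 2 ->
  N * (2 * swap_bound e tau (3 * tau ^+ 4 + dl ^+ 2) (tau + dl / tau) th) <=
  720 * (tau ^+ 3 * (N * th ^+ 3) / e ^+ 3 + tau * (N * th ^+ 3) / e ^+ 2 + dl / e).
Proof.
move=> t0 d0 e0 h0 N0 de Nth; rewrite /swap_bound.
set A := tau + dl / tau; set M := 3 * tau ^+ 4 + dl ^+ 2.
have AE : A = (tau ^+ 2 + dl) / tau by rewrite /A; field; rewrite gt_eqF.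
have s0 : 0 < tau ^+ 2 + dl by rewrite addr_gt0// exprn_gt0.
have AM : A * tau ^+ 2 + M / A <= 4 * (tau ^+ 3 + dl * tau).
  have -> : M / A = M * tau / (tau ^+ 2 + dl) by rewrite AE invf_div mulrA.
  have -> : A * tau ^+ 2 = tau ^+ 3 + dl * tau by rewrite AE; field; rewrite gt_eqF.
  suff : M * tau / (tau ^+ 2 + dl) <= 3 * (tau ^+ 3 + dl * tau) by lra.
  rewrite ler_pdivrMr// (_ : _ * _ * _ = (3 * (tau ^+ 2 + dl) ^+ 2) * tau); last by ring.
  rewrite ler_pM2r// /M.
  have := mulr_ge0 (sqr_ge0 tau) (ltW d0); have := sqr_ge0 dl.
  have -> : tau ^+ 4 = (tau ^+ 2) ^+ 2 by rewrite -exprM.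
  lra.
have e3 : 0 < e ^+ 3 by rewrite exprn_gt0.
have e2 : 0 < e ^+ 2 by rewrite exprn_gt0.
have b1 : dl * tau / e ^+ 3 <= tau / e ^+ 2.
  rewrite (_ : dl * tau / e ^+ 3 = dl / e * (tau / e ^+ 2)); last by field; rewrite gt_eqF.
  rewrite ler_piMl// ?divr_ge0 ?(ltW t0) ?(ltW e2)//.
  by rewrite ler_pdivrMr// mul1r.
have b2 : dl ^+ 2 / e ^+ 2 <= dl / e.
  rewrite (_ : dl ^+ 2 / e ^+ 2 = dl / e * (dl / e)); last by field; rewrite gt_eqF.
  rewrite ler_piMl// ?divr_ge0 ?(ltW d0) ?(ltW e0)//.
  by rewrite ler_pdivrMr// mul1r.
have c1 : 2 * (A * tau ^+ 2 + M / A) / e ^+ 3 + tau / e ^+ 2 <= 8 * (tau ^+ 3 / e ^+ 3) + 9 * (tau / e ^+ 2).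
  have ie : 0 <= (e ^+ 3)^-1 by rewrite invr_ge0 ltW.
  have := ler_wpM2r ie AM; lra.
have Nt0 : 0 <= N * th ^+ 3 by rewrite mulr_ge0// exprn_ge0.
have := ler_wpM2r Nt0 c1.
have -> : N * (2 * (10 * ((2 * (A * tau ^+ 2 + M / A) / e ^+ 3 + tau / e ^+ 2) * (4 * th ^+ 3) + 3 * th ^+ 4 / e ^+ 2))) =
   80 * ((2 * (A * tau ^+ 2 + M / A) / e ^+ 3 + tau / e ^+ 2) * (N * th ^+ 3)) + 60 * (dl ^+ 2 / e ^+ 2).
  by rewrite -Nth; ring.
have p3 : 0 <= tau ^+ 3 * (N * th ^+ 3) / e ^+ 3.
  by apply: divr_ge0 (ltW e3); apply: mulr_ge0 Nt0; rewrite exprn_ge0// ltW.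
have pd : 0 <= dl / e by rewrite divr_ge0 ?(ltW d0) ?(ltW e0).
lra.
Qed.

End Smoothing.

Section Comparison.
Context (R : realType) (dO dT : measure_display) (Omega : measurableType dO)
  (T : measurableType dT) (P : probability Omega R) (r' n d : nat) (X : 'I_n -> {RV P >-> T})
  (h : r'.+1.-tuple T -> 'cV[R]_d) (C : R).
Local Notation r := r'.+1.
Hypothesis indep : mutually_independent P (fun i => X i : Omega -> T).
Hypothesis mh : measurable_stat_kernel h.
Hypothesis sh : symmetric_stat_kernel h.
Hypothesis rn : (r <= n)%N.
Hypothesis C1 : 1 < C.
Hypothesis hB : forall (m : 'I_d) (i : r.-tuple 'I_n),
  ('E_P[fun w => (`|h (subsample X i w) m 0| ^+ 4)%R] < C%:E)%E.
Hypothesis eig : 0 < second_largest_eigenvalue (Gamma X h).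
Local Notation Pi := (prodN (muX X)).
Local Notation G := (Gamma X h).
Local Notation k := (kap C).

Let sX a := summand_X indep mh rn C1 hB a.

Lemma Gamma_sym : G^T = G.
Proof.
rewrite (Gamma_X indep mh rn C1 hB) raddf_sum; apply: eq_bigr => a _.
by have [_ _ _ e _] := sX a; exact: e.
Qed.

Lemma Gamma_psd : psd G.
Proof.
move=> u; rewrite (Gamma_X indep mh rn C1 hB) mulmx_sumr mulmx_suml summxE.
by apply: sumr_ge0 => a _; exact: (summand_psd (sX a)).
Qed.

Lemma d_gt0 : 0 < d%:R :> R.
Proof.
have [V [l [_ _ _ _ [i _]]]] := eigen2 Gamma_sym Gamma_psd eig.
by rewrite ltr0n (leq_ltn_trans _ (ltn_ord i)).
Qed.

Definition dlt : R := d%:R / Num.sqrt n%:R.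
(** The root of d times the bound k / n on a coordinate variance; it satisfies n th^4 = (k
    dlt)^2. *)
Definition thX : R := Num.sqrt (d%:R * (k / n%:R)).

Lemma k_gt0 : 0 < k.
Proof. by rewrite mulr_gt0// sqrtr_gt0 (lt_trans ltr01). Qed.

Lemma thX_gt0 : 0 < thX.
Proof. by rewrite sqrtr_gt0 mulr_gt0 ?d_gt0// divr_gt0 ?k_gt0// (n_gt0 _ rn). Qed.

Lemma thX2 : thX ^+ 2 = d%:R * (k / n%:R).
Proof. by rewrite sqr_sqrtr// mulr_ge0// divr_ge0// ltW// k_gt0. Qed.

Lemma thX4 : n%:R * thX ^+ 4 = (k * dlt) ^+ 2.
Proof.
have n0 := n_gt0 R rn.
rewrite -[4%N]/(2 * 2)%N exprM thX2 /dlt.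
have s2 := sqr_sqrtr (ltW n0); have s0 : 0 < Num.sqrt (n%:R : R) by rewrite sqrtr_gt0.
rewrite -[in LHS]s2; move: (Num.sqrt n%:R) s0 => s s0; field; exact: lt0r_neq0.
Qed.

Lemma dlt_gt0 : 0 < dlt.
Proof. by rewrite divr_gt0 ?d_gt0// sqrtr_gt0 (n_gt0 _ rn). Qed.

(** The 4 is the Lipschitz constant of [step], k comes from the mean square of the linear sum W and
    2 [Kres] from T_n - W. *)
Definition K1 : R := 4 * (k + 2 * Kres r' C).

Lemma sumX_sqn : L4v Pi (sumX (xiX X h)) /\ Ex Pi (fun t => sqn (sumX (xiX X h) t)) <= d%:R * k.
Proof.
have n0 := n_gt0 R rn.
have c0 : 0 <= k / n%:R by rewrite divr_ge0// ltW// k_gt0.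
have [X4 Xm] := sumX_moments thX_gt0 thX2 sX.
split => //; rewrite Ex_sqn//.
apply: (@le_trans _ _ (\sum_(m < d) k)); last by rewrite sumr_const card_ord mulr_natl.
apply: ler_sum => m _; have [_ X2 _] := Xm (delta_mx m 0).
rewrite (eq_Ex _ (g := fun t => ip (delta_mx m 0) (sumX (xiX X h) t) ^+ 2)); last first.
  by move=> t; rewrite /ip coord_lin.
rewrite X2 -mulmxA coord_lin -colE mxE summxE.
apply: (@le_trans _ _ (\sum_(a < n) k / n%:R)).
  by apply: ler_sum => a _; case: (summand_coord c0 (sX a) m) => _ /andP[].
by rewrite sumr_const card_ord -[leLHS]mulr_natr divfK// gt_eqF.
Qed.

Lemma sstep_stat (s e : R) : 0 < e ->
  `|Ex Pi (fun t => sstep s e (statT X h t)) - Ex Pi (fun t => sstep s e (sumX (xiX X h) t))| <= K1 * dlt / e.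
Proof.
move=> e0; have n0 := n_gt0 R rn.
have [X4 X2] := sumX_sqn; have [T4 T2] := statT_sumX indep mh sh rn C1 hB.
have iT := itg_sstep s e Pi (L4v_meas T4); have iX := itg_sstep s e Pi (L4v_meas X4).
have iD : itg Pi (fun t => sqn (statT X h t - sumX (xiX X h) t)).
  apply: L4v_sqn => m; apply: (L4_ext _ (L4B (T4 m) (X4 m))) => t.
  by rewrite [RHS]mxE [X in _ = _ + X]mxE.
have iW := L4v_sqn X4.
have s0 : 0 < Num.sqrt (n%:R : R) by rewrite sqrtr_gt0.
(* Balances the two terms of [sqn_diff]: the mean of |W|^2 is of order d and that of |T_n - W|^2 of
   order d / n, so both contribute d / sqrt n. *)
pose p := (Num.sqrt (n%:R : R))^-1.
have p0 : 0 < p by rewrite invr_gt0.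
have c0 : 0 <= 4 / e by rewrite divr_ge0// ltW.
rewrite -ExB//; apply: le_trans (Ex_abs_le (itgB iT iX)) _.
apply: (@le_trans _ _ (Ex Pi (fun t => 4 / e * (p * sqn (sumX (xiX X h) t) + (1 + p^-1) * sqn (statT X h t - sumX (xiX X h) t))))).
  apply: Ex_le; [by apply: itg_abs; exact: itgB|by apply: itgZ; apply: itgD; exact: itgZ|move=> t].
  by apply: le_trans (sstep_lipschitz s _ _ e0) _; rewrite ler_wpM2l// sqn_diff.
rewrite ExZ; last by apply: itgD; exact: itgZ.
rewrite (ExD (itgZ _ iW) (itgZ _ iD)) (ExZ _ iW) (ExZ _ iD).
have Kr0 : 0 <= Kres r' C :> R.
  rewrite /Kres mulr_ge0 ?kap_ge0// !mulr_ge0 ?sqr_ge0// addr_ge0// mulr_ge0 ?sqr_ge0//.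
have b1 := ler_wpM2l (ltW p0) X2.
have p1 : 0 <= 1 + p^-1 by rewrite addr_ge0// invr_ge0 ltW.
have b2 := ler_wpM2l p1 T2.
have n1 : 1 <= Num.sqrt (n%:R : R).
  rewrite -[leLHS](sqrtr1 R); apply: ler_wsqrtr; rewrite ler1n; exact: leq_trans rn.
have b3 : (1 + p^-1) * (d%:R * (Kres r' C / n%:R)) <= 2 * Kres r' C * dlt.
  rewrite /p invrK /dlt; have s2 := sqr_sqrtr (ltW n0).
  move: (Num.sqrt n%:R) s2 s0 n1 => q s2 q0 q1.
  rewrite -s2 [leRHS](_ : _ = (2 * q) * (d%:R * (Kres r' C / q ^+ 2))).
    by rewrite ler_wpM2r ?mulr_ge0 ?invr_ge0 ?sqr_ge0//; lra.
  by field; rewrite gt_eqF.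
have b4 : p * (d%:R * k) = k * dlt by rewrite /p /dlt; ring.
rewrite /K1 [leRHS](_ : _ = 4 / e * ((k + 2 * Kres r' C) * dlt)); last by ring.
by rewrite ler_wpM2l//; lra.
Qed.

Lemma itg_le_indic m dS (S : measurableType dS) (Q : probability S R) (Y : S -> 'cV[R]_m) s :
  meas_vec Y -> itg Q \1_[set w | sqn (Y w) <= s].
Proof. by move=> mY; apply: itg_indic; exact: measurable_sqn_le. Qed.

Lemma cdf_sstep m dS (S : measurableType dS) (Q : probability S R) (Y : S -> 'cV[R]_m) (s e : R) :
  meas_vec Y -> 0 < e ->
  Ex Q \1_[set w | sqn (Y w) <= s] <= Ex Q (fun w => sstep s e (Y w)) /\
  Ex Q (fun w => sstep s e (Y w)) <= Ex Q \1_[set w | sqn (Y w) <= s + 3 * e].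
Proof.
move=> mY e0; split; apply: Ex_le; [exact: itg_le_indic|exact: itg_sstep| |exact: itg_sstep|exact: itg_le_indic|];
  by move=> w; rewrite mem_set_le; case: (indic_sstep s (Y w) e0).
Qed.

Section target.
Context dQ (S : measurableType dQ) (Q : probability S R) (Z : S -> 'cV[R]_d).
Hypothesis mZ : meas_vec Z.
Hypothesis cosZ : forall u : 'cV[R]_d, Ex Q (fun w => cos ((u^T *m Z w) 0 0)) = expR (- (u^T *m G *m u) 0 0 / 2).

Definition tauX : R := Num.sqrt (opnorm G).
Definition winv : R := frobnorm G * Num.sqrt (Num.sqrt (ell G)).

Definition rate (e : R) : R :=
  K1 * dlt / e + 720 * (tauX ^+ 3 * (n%:R * thX ^+ 3) / e ^+ 3 + tauX * (n%:R * thX ^+ 3) / e ^+ 2 + k * dlt / e)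
  + 2560 * e / winv.

(** The step falls over a length 3e, and passing between Gaussian vectors with equal transforms
    costs a further e. Windows thus have width 4e, and 2560 = 4 * 640. *)
Lemma comparison (s e : R) : 0 <= s -> 0 < e -> k * dlt <= e ->
  `|Ex Pi \1_[set t | sqn (statT X h t) <= s] - Ex Q \1_[set w | sqn (Z w) <= s]| <= rate e.
Proof.
move=> s0 e0 de; have n0 := n_gt0 R rn.
have [op0 opG] := opnorm_quad Gamma_sym Gamma_psd eig.
have tau0 : 0 < tauX by rewrite sqrtr_gt0.
have tau2 : tauX ^+ 2 = opnorm G by rewrite sqr_sqrtr// ltW.
have th0 := thX_gt0; have kd0 : 0 < k * dlt by rewrite mulr_gt0 ?k_gt0 ?dlt_gt0.
have c0 : 0 <= k / n%:R by rewrite divr_ge0// ltW// k_gt0.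
pose A := tauX + k * dlt / tauX; pose M := 3 * tauX ^+ 4 + (k * dlt) ^+ 2.
have A0 : 0 < A by rewrite addr_gt0// divr_gt0.
have GE := Gamma_X indep mh rn C1 hB.
have [X4 _] := sumX_sqn; have [T4 _] := statT_sumX indep mh sh rn C1 hB.
have win (s' e' : R) := gauss_window Gamma_sym Gamma_psd eig mZ cosZ (s := s') (e := e').
have lind (a : R) : exists dS' (S' : measurableType dS') (Q' : probability S' R) (Y : S' -> 'cV[R]_d),
    [/\ meas_vec Y, forall u : 'cV[R]_d, Ex Q' (fun w => cos ((u^T *m Y w) 0 0)) = Ex Q (fun w => cos ((u^T *m Z w) 0 0)) &
    `|Ex Pi (fun t => sstep a e (statT X h t)) - Ex Q' (fun w => sstep a e (Y w))| <=
      K1 * dlt / e + 720 * (tauX ^+ 3 * (n%:R * thX ^+ 3) / e ^+ 3 + tauX * (n%:R * thX ^+ 3) / e ^+ 2 + k * dlt / e)].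
  have hV v : (v^T *m (0 + \sum_a SigX X h a) *m v) 0 0 <= tauX ^+ 2 * sqn v by rewrite add0r -GE tau2.
  have hM : 3 * tauX ^+ 4 + n%:R * thX ^+ 4 <= M by rewrite thX4.
  (* The Gaussian part starts as the zero vector, carried by a copy of [Pi]. *)
  have [dS' [S' [Q' [Y [gY hY]]]]] := lindeberg a e0 tau0 A0 th0 c0 thX2 sX (@gvec_cst0 R d _ _ Pi) hV hM.
  exists dS', S', Q', Y; split; first exact: L4v_meas (gvec_L4v gY).
    by move=> u; have [_ -> _ _] := gY u; rewrite add0r -GE cosZ.
  have st := sstep_stat a e0.
  have lr := lindeberg_rate tau0 kd0 e0 (ltW th0) (ler0n _ n) de thX4.
  have E : Ex (prodP Pi Pi) (fun z => sstep a e (0 + sumX (xiX X h) z.2)) = Ex Pi (fun t => sstep a e (sumX (xiX X h) t)).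
    rewrite -(Ex_snd Pi (itg_sstep a e Pi (L4v_meas X4))); apply: eq_Ex => z; rewrite add0r//.
  rewrite E in hY; move: st (le_trans hY lr); rewrite !ler_norml => /andP[? ?] /andP[? ?].
  by apply/andP; split; lra.
have w0 : 0 < winv.
  have [F0 /andP[l0 _]] := frob_ell Gamma_sym Gamma_psd eig.
  by rewrite mulr_gt0// !sqrtr_gt0.
rewrite /rate; set B := K1 * dlt / e + _ in lind *.
rewrite ler_norml; apply/andP; split.
  (* For the lower bound the step starts at s - 3e so as to vanish beyond s. If s - 4e is negative,
     the Gaussian probability compared is 0. *)
  have [dS' [S' [Q' [Y [mY cY]]]]] := lind (s - 3 * e).
  rewrite ler_norml => /andP[b1 b2].
  have [_ u1] := cdf_sstep Pi (s - 3 * e) (L4v_meas T4) e0.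
  have [u2 _] := cdf_sstep Q' (s - 3 * e) mY e0.
  rewrite subrK in u1.
  have u3 : Ex Q \1_[set w | sqn (Z w) <= s - 4 * e] <= Ex Q' \1_[set w | sqn (Y w) <= s - 3 * e].
    case: (lerP 0 (s - 4 * e)) => se; first by apply: (sqn_cdf_le mZ mY (fun u => esym (cY u))) => //; lra.
    apply: (@le_trans _ _ 0); last by apply: Ex_ge0 => w; rewrite indicE.
    rewrite (eq_Ex _ (g := fun=> 0)) ?Ex_cst// => w; rewrite indicE memNset//= => hh.
    by have := sqn_ge0 (Z w); lra.
  have := win (s - 4 * e) (4 * e); rewrite subrK => /(_ s0); rewrite mulr_gt0// => /(_ isT).
  rewrite -/winv (_ : 640 * (4 * e) = 2560 * e); last by ring.
  lra.
have [dS' [S' [Q' [Y [mY cY]]]]] := lind s.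
rewrite ler_norml => /andP[b1 b2].
have [u1 _] := cdf_sstep Pi s (L4v_meas T4) e0.
have [_ u2] := cdf_sstep Q' s mY e0.
have u3 : Ex Q' \1_[set w | sqn (Y w) <= s + 3 * e] <= Ex Q \1_[set w | sqn (Z w) <= s + 4 * e].
  by apply: (sqn_cdf_le mY mZ cY); lra.
have s4 : 0 <= s + 4 * e by lra.
have := win s (4 * e) s4; rewrite mulr_gt0// => /(_ isT).
rewrite -/winv (_ : 640 * (4 * e) = 2560 * e); last by ring.
lra.
Qed.

End target.

End Comparison.

(** * Choice of the smoothing parameter *)

Section Rates.
Context (R : realType).

Lemma powR_root (y : R) m : 0 <= y -> (0 < m)%N -> (y `^ (1 / m%:R)) ^+ m = y.
Proof.
move=> y0 m0; rewrite -powR_mulrn ?powR_ge0// -powRrM div1r mulVf ?powRr1//.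
by rewrite pnatr_eq0 -lt0n.
Qed.

Lemma powR_comb (D q1 q2 : R) (a b c : nat) : 0 < D ->
  D `^ (a%:R + b%:R * q1 - c%:R * q2) = D ^+ a * (D `^ q1) ^+ b / (D `^ q2) ^+ c.
Proof.
move=> D0; rewrite /powR (gt_eqF D0) -!expRM_natl -[X in X ^+ a](lnK D0) -expRM_natl.
by rewrite -expRN -!expRD; congr expR; ring.
Qed.

Lemma powR_quarter (l : R) (m : nat) : 0 <= l -> l `^ (m%:R / 4) = (Num.sqrt (Num.sqrt l)) ^+ m.
Proof.
move=> l0; set v := Num.sqrt _; have v0 : 0 <= v by exact: sqrtr_ge0.
have -> : l = v ^+ 4 by rewrite -[4%N]/(2 * 2)%N exprM !sqr_sqrtr ?sqrtr_ge0.
rewrite -[v ^+ 4]powR_mulrn// -powRrM (_ : 4%:R * (m%:R / 4) = m%:R :> R); first by rewrite powR_mulrn.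
by field.
Qed.

(* [e = w x], where x is the largest of the values at which each error term balances
   against [e / w]; if this e is below the admissible range, the bound exceeds 1. *)
Lemma choose_eps (D c1 dl k eta tau w x1 x2 x3 : R) : 0 <= c1 -> 0 < dl -> 0 < k -> 0 < w ->
  0 < x1 -> 0 < x2 -> 0 < x3 -> D <= 1 ->
  x1 ^+ 2 = dl / w -> x2 ^+ 4 = tau ^+ 3 * eta / w ^+ 3 -> x3 ^+ 3 = tau * eta / w ^+ 2 ->
  (forall e, 0 < e -> k * dl <= e ->
     D <= c1 * dl / e + 720 * (tau ^+ 3 * eta / e ^+ 3 + tau * eta / e ^+ 2 + k * dl / e) + 2560 * e / w) ->
  D <= (c1 + 720 * (2 + k) + 2560 + k) * Num.max (Num.max x1 x2) x3.
Proof.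
move=> c10 dl0 k0 w0 x10 x20 x30 D1 h1 h2 h3 hD.
set x := Num.max _ _.
have x1x : x1 <= x by rewrite !le_max lexx.
have x2x : x2 <= x by rewrite !le_max lexx orbT.
have x3x : x3 <= x by rewrite !le_max lexx orbT.
have x0 : 0 < x by exact: lt_le_trans x1x.
have K0 : 0 <= c1 + 720 * (2 + k) + 2560 by lra.
case: (lerP (k * dl) (w * x)) => hk; last first.
  have dE : dl = x1 ^+ 2 * w by rewrite h1 divfK// gt_eqF.
  have : x < k * x1 ^+ 2.
    by rewrite -(ltr_pM2l w0) (lt_le_trans hk)// dE mulrA mulrC.
  have : x1 ^+ 2 <= x * x by rewrite expr2 ler_pM// ltW.
  move=> a1 a2; have a3 : x < k * x * x.
    by apply: lt_le_trans a2 _; rewrite -mulrA ler_pM2l.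
  have a4 : 1 < k * x by rewrite -(ltr_pM2r x0) mul1r.
  have := mulr_ge0 K0 (ltW x0); lra.
have wx0 : 0 < w * x by rewrite mulr_gt0.
apply: le_trans (hD _ wx0 hk) _.
have t1 : dl / (w * x) <= x.
  rewrite (_ : dl / (w * x) = x1 ^+ 2 / x); last by rewrite h1 invfM mulrA.
  by rewrite ler_pdivrMr// -expr2 lerXn2r ?nnegrE// ltW.
have t2 : tau ^+ 3 * eta / (w * x) ^+ 3 <= x.
  rewrite (_ : _ / _ = x2 ^+ 4 / x ^+ 3); last by rewrite h2 exprMn invfM mulrA.
  by rewrite ler_pdivrMr ?exprn_gt0// -exprS lerXn2r ?nnegrE// ltW.
have t3 : tau * eta / (w * x) ^+ 2 <= x.
  rewrite (_ : _ / _ = x3 ^+ 3 / x ^+ 2); last by rewrite h3 exprMn invfM mulrA.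
  by rewrite ler_pdivrMr ?exprn_gt0// -exprS lerXn2r ?nnegrE// ltW.
have t4 : 2560 * (w * x) / w = 2560 * x by field; rewrite gt_eqF.
have := ler_wpM2l c10 t1; have := ler_wpM2l (ltW k0) t1; have := mulr_ge0 (ltW k0) (ltW x0).
rewrite t4; lra.
Qed.

Lemma le_sum4 (a k b : R) : 0 < a -> 0 < k -> 0 < b ->
  [/\ 1 <= 1 + a + k + b, a <= 1 + a + k + b, k <= 1 + a + k + b & b <= 1 + a + k + b].
Proof. by move=> a0 k0 b0; split; lra. Qed.

(** * From the balanced scales to the three terms of [Delta] *)

Section terms.
Context (n d : nat) (q1 q2 l op F k a1 b2 : R).
Hypotheses (n0 : 0 < n%:R :> R) (d0 : 0 < d%:R :> R) (l0 : 0 < l) (l1 : l <= 1) (op0 : 0 < op)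
  (F0 : 0 < F) (k0 : 0 < k) (a10 : 0 < a1) (b20 : 0 < b2).
Hypothesis hop : op <= a1 * d%:R `^ q1.
Hypothesis hF : d%:R `^ q2 <= b2 * F.

Let L := 1 + a1 + k + b2.
Let v := Num.sqrt (Num.sqrt l).
Let D1 : R := d%:R `^ q1.
Let D2 : R := d%:R `^ q2.

(** D1 stands in numerators and D2 in denominators, which matches op <= L D1 and D2 <= L F. A single
    L dominates every constant, and L^2 raised to the power 4, 8 or 6 covers all that accumulate. *)
Lemma Delta_bound (x1 x2 x3 : R) : 0 < x1 -> 0 < x2 -> 0 < x3 ->
  x1 ^+ 4 = d%:R ^+ 2 / n%:R / (F * v) ^+ 2 ->
  x2 ^+ 8 = op ^+ 3 * (d%:R ^+ 3 * k ^+ 3 / n%:R) / (F * v) ^+ 6 ->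
  x3 ^+ 6 = op * (d%:R ^+ 3 * k ^+ 3 / n%:R) / (F * v) ^+ 4 ->
  Num.max (Num.max x1 x2) x3 <= L ^+ 2 * Delta n d q1 q2 l.
Proof.
move=> x10 x20 x30 h1 h2 h3.
have v0 : 0 < v by rewrite !sqrtr_gt0.
have v1 : v <= 1.
  by do 2 (rewrite -[leRHS](sqrtr1 R); apply: ler_wsqrtr).
have D10 : 0 < D1 by exact: powR_gt0.
have D20 : 0 < D2 by exact: powR_gt0.
have [L1 La Lk Lb] : [/\ 1 <= L, a1 <= L, k <= L & b2 <= L] by exact: le_sum4.
have L0 : 0 < L by exact: lt_le_trans L1.
have opL : op <= L * D1 by apply: le_trans hop _; rewrite ler_pM2r.
have FL : D2 <= L * F by apply: le_trans hF _; rewrite ler_pM2r.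
have Lp i j : (i <= j)%N -> L ^+ i <= L ^+ j by move=> ij; rewrite ler_weXn2l.
have pw (a b : R) m : 0 <= a -> a <= b -> a ^+ m <= b ^+ m.
  by move=> a0 ab; rewrite lerXn2r ?nnegrE// (le_trans a0).
have p0 (x : R) m : 0 < x -> 0 <= x ^+ m by move=> x0; exact: exprn_ge0 (ltW x0).
have root (x y : R) m : (0 < m)%N -> 0 < x -> 0 < y -> x ^+ m <= (L ^+ 2) ^+ m * y -> x <= L ^+ 2 * y `^ (1 / m%:R).
  move=> m0 x0 y0 h; rewrite -(@ler_pXn2r _ m)// ?nnegrE ?mulr_ge0 ?powR_ge0 ?sqr_ge0 ?(ltW x0) ?(ltW L0)//.
  by rewrite exprMn powR_root// ltW.
have E1 : d%:R `^ (2 - 2 * q2) / (n%:R * l `^ (3 / 4)) = d%:R ^+ 2 / D2 ^+ 2 / (n%:R * v ^+ 3).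
  rewrite (powR_quarter 3 (ltW l0)) (_ : 2 - 2 * q2 = 2%:R + 0%:R * q1 - 2%:R * q2); last by ring.
  by rewrite powR_comb// expr0 mulr1.
have E2 : d%:R `^ (3 + 3 * q1 - 6 * q2) / (n%:R * l `^ (3 / 2)) = d%:R ^+ 3 * D1 ^+ 3 / D2 ^+ 6 / (n%:R * v ^+ 6).
  rewrite powR_comb// (_ : 3 / 2 = 6%:R / 4 :> R); last by field.
  by rewrite (powR_quarter 6 (ltW l0)).
have E3 : d%:R `^ (3 + q1 - 4 * q2) / (n%:R * l) = d%:R ^+ 3 * D1 / D2 ^+ 4 / (n%:R * v ^+ 4).
  rewrite (_ : 3 + q1 - 4 * q2 = 3%:R + 1%:R * q1 - 4%:R * q2); last by ring.
  rewrite powR_comb// expr1; congr (_ / (_ * _)).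
  by rewrite -[4%N]/(2 * 2)%N exprM !sqr_sqrtr ?sqrtr_ge0 ?(ltW l0).
rewrite /Delta E1 E2 E3.
set y1 := _ / (n%:R * v ^+ 3); set y2 := _ / (n%:R * v ^+ 6); set y3 := _ / (n%:R * v ^+ 4).
have LL : 0 <= L ^+ 2 by exact: sqr_ge0.
have y10 : 0 < y1 by rewrite !divr_gt0 ?mulr_gt0 ?exprn_gt0.
have y20 : 0 < y2 by rewrite !divr_gt0 ?mulr_gt0 ?exprn_gt0.
have y30 : 0 < y3 by rewrite !divr_gt0 ?mulr_gt0 ?exprn_gt0.
have b1 : x1 <= L ^+ 2 * y1 `^ (1 / 4).
  apply: (root x1 y1 4) => //; rewrite h1 -exprM.
  (* Balancing yields v^2 = l^(1/2) in the denominator; v <= 1 trades it for the v^3 = l^(3/4) of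
     [Delta]. *)
  have key : D2 ^+ 2 * v <= L ^+ 8 * F ^+ 2.
    apply: (@le_trans _ _ ((L * F) ^+ 2 * 1)); first by rewrite ler_pM ?sqr_ge0 ?(ltW v0)// pw// ltW.
    by rewrite mulr1 exprMn ler_wpM2r ?sqr_ge0// Lp.
  have c0 : 0 <= d%:R ^+ 2 / (n%:R * v ^+ 3 * D2 ^+ 2 * F ^+ 2).
    by rewrite divr_ge0// ?sqr_ge0// ltW// !mulr_gt0 ?exprn_gt0.
  have := ler_wpM2l c0 key; congr (_ <= _); rewrite /y1.
    by field; rewrite !gt_eqF.
  by field; rewrite !gt_eqF.
have b2' : x2 <= L ^+ 2 * y2 `^ (1 / 8).
  apply: (root x2 y2 8) => //; rewrite h2 -exprM.
  have key : op ^+ 3 * k ^+ 3 * D2 ^+ 6 <= L ^+ 16 * (D1 ^+ 3 * F ^+ 6).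
    apply: (@le_trans _ _ ((L * D1) ^+ 3 * L ^+ 3 * (L * F) ^+ 6)).
      have o3 := pw _ _ 3 (ltW op0) opL; have k3 := pw _ _ 3 (ltW k0) Lk; have f6 := pw _ _ 6 (ltW D20) FL.
      by apply: ler_pM f6; [exact: mulr_ge0 (p0 _ _ op0) (p0 _ _ k0)|exact: p0|exact: ler_pM (p0 _ _ op0) (p0 _ _ k0) o3 k3].
    rewrite [leLHS](_ : _ = L ^+ 12 * (D1 ^+ 3 * F ^+ 6)); last by ring.
    by rewrite ler_wpM2r ?Lp// mulr_ge0 ?exprn_ge0 ?(ltW D10) ?(ltW F0).
  have c0 : 0 <= d%:R ^+ 3 / (n%:R * v ^+ 6 * D2 ^+ 6 * F ^+ 6).
    by rewrite divr_ge0// ?exprn_ge0// ltW// !mulr_gt0 ?exprn_gt0.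
  have := ler_wpM2l c0 key; congr (_ <= _); rewrite /y2.
    by field; rewrite !gt_eqF.
  by field; rewrite !gt_eqF.
have b3 : x3 <= L ^+ 2 * y3 `^ (1 / 6).
  apply: (root x3 y3 6) => //; rewrite h3 -exprM.
  have key : op * k ^+ 3 * D2 ^+ 4 <= L ^+ 12 * (D1 * F ^+ 4).
    apply: (@le_trans _ _ ((L * D1) * L ^+ 3 * (L * F) ^+ 4)).
      have k3 := pw _ _ 3 (ltW k0) Lk; have f4 := pw _ _ 4 (ltW D20) FL.
      by apply: ler_pM f4; [exact: mulr_ge0 (ltW op0) (p0 _ _ k0)|exact: p0|exact: ler_pM (ltW op0) (p0 _ _ k0) opL k3].
    rewrite [leLHS](_ : _ = L ^+ 8 * (D1 * F ^+ 4)); last by ring.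
    by rewrite ler_wpM2r ?Lp// mulr_ge0 ?exprn_ge0 ?(ltW D10) ?(ltW F0).
  have c0 : 0 <= d%:R ^+ 3 / (n%:R * v ^+ 4 * D2 ^+ 4 * F ^+ 4).
    by rewrite divr_ge0// ?exprn_ge0// ltW// !mulr_gt0 ?exprn_gt0.
  have := ler_wpM2l c0 key; congr (_ <= _); rewrite /y3.
    by field; rewrite !gt_eqF.
  by field; rewrite !gt_eqF.
have Lmax (a b : R) : L ^+ 2 * Num.max a b = Num.max (L ^+ 2 * a) (L ^+ 2 * b) by rewrite maxr_pMr.
by rewrite !Lmax !ge_max !le_max b1 b2' b3 !orbT.
Qed.

End terms.
End Rates.

Lemma pr_indic (R : realType) d (S : measurableType d) (P : probability S R) (A : set S) :
  measurable A -> P A = (Ex P \1_A)%:E.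
Proof. by move=> mA; rewrite Ex_indic// fineK//; exact: fin_num_measure. Qed.

Lemma centered_gaussian_cos (R : realType) d (S : measurableType d) (Q : probability S R) n
    (Z : S -> 'cV[R]_n) (G : 'M[R]_n) : psd G -> centered_gaussian Q Z G ->
  meas_vec Z /\
  forall u : 'cV[R]_n, Ex Q (fun w => cos ((u^T *m Z w) 0 0)) = expR (- (u^T *m G *m u) 0 0 / 2).
Proof.
move=> pG gZ; split.
  move=> k; have [mZ _] := gZ (delta_mx k 0).
  by apply: (eq_measurable_fun _ _ mZ) => w _; rewrite coord_lin.
by move=> u; have [mZ hZ] := gZ u; exact: meas_normal_law_cos.
Qed.

Lemma abs_sub_le1 (R : realType) (x y : R) : 0 <= x <= 1 -> 0 <= y <= 1 -> `|x - y| <= 1.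
Proof. by move=> /andP[? ?] /andP[? ?]; rewrite ler_norml; apply/andP; split; lra. Qed.

Theorem proposition2p3 (R : realType) (r : nat) (hr : (2 <= r)%N)
    (C : R) (hC : 1 < C)
    (a1 a2 b1 b2 : R) (ha1 : 0 < a1) (ha2 : 0 < a2) (hb1 : 0 < b1) (hb2 : 0 < b2) :
  exists2 K : R, 0 < K &
  forall (q1 q2 : R) (n d : nat)
    (dT : measure_display) (T : measurableType dT)
    (dO : measure_display) (Omega : measurableType dO) (P : probability Omega R)
    (X : 'I_n -> {RV P >-> T}) (h : r.-tuple T -> 'cV[R]_d)
    (dO' : measure_display) (Omega' : measurableType dO')
    (Q : probability Omega' R) (Z : Omega' -> 'cV[R]_d),
  0 <= q1 -> q1 <= q2 -> q2 <= 1 ->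
  (r <= n)%N ->
  mutually_independent P (fun i => X i : Omega -> T) ->
  measurable_stat_kernel h ->
  symmetric_stat_kernel h ->
  asymp a1 a2 (opnorm (Gamma X h)) (d%:R `^ q1) ->
  asymp b1 b2 (frobnorm (Gamma X h)) (d%:R `^ q2) ->
  (forall (m : 'I_d) (i : r.-tuple 'I_n),
     ('E_P[fun w => (`|h (subsample X i w) m 0| ^+ 4)%R] < C%:E)%E) ->
  1 / C < second_largest_eigenvalue (Gamma X h) ->
  centered_gaussian Q Z (Gamma X h) ->
  (ereal_sup [set `| P [set w | (l2norm (tstat X h w) <= a)%R]
                     - Q [set w | (l2norm (Z w) <= a)%R] |
             | a in [set a : R | (0 <= a)%R]]
   <= (K * Delta n d q1 q2 (ell (Gamma X h)))%:E)%E.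
Proof.
case: r hr => [//|r' hr]; have C0 : 0 < C by exact: lt_trans hC.
pose k := kap C; have k0 : 0 < k by exact: k_gt0.
have Kr0 : 0 <= Kres r' C :> R.
  rewrite /Kres mulr_ge0 ?kap_ge0// !mulr_ge0 ?sqr_ge0// addr_ge0// mulr_ge0 ?sqr_ge0//.
pose c1 := K1 r' C; have c10 : 0 <= c1 by rewrite mulr_ge0// addr_ge0 ?(ltW k0)// mulr_ge0.
pose L := 1 + a1 + k + b2; have L0 : 0 < L by rewrite /L; lra.
(* c1 accounts for the passage from T_n to W, 720 (2 + k) for the replacement, 2560 for the window
   and the last k for the regime where the bound exceeds 1. All depend on C and r alone; L adds the
   dependence on a1 and b2. *)
pose K0 := c1 + 720 * (2 + k) + 2560 + k; have K00 : 0 < K0 by rewrite /K0; lra.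
exists (K0 * L ^+ 2); first by rewrite mulr_gt0// exprn_gt0.
move=> q1 q2 n d dT T dO Omega P X h dO' Omega' Q Z _ _ _ rn indep mh sh [hop _] [_ hF] hB eig gZ.
have eig0 : 0 < second_largest_eigenvalue (Gamma X h).
  by apply: le_lt_trans eig; rewrite divr_ge0// ltW.
have sG := Gamma_sym indep mh rn hC hB; have pG := Gamma_psd indep mh rn hC hB.
have [mZ cosZ] := centered_gaussian_cos pG gZ.
have [F0 /andP[l0 l1]] := frob_ell sG pG eig0; have [op0 _] := opnorm_quad sG pG eig0.
have d0 := d_gt0 indep mh rn hC hB eig0; have n0 := n_gt0 R rn.
have w0 : 0 < winv X h by rewrite mulr_gt0// !sqrtr_gt0.
have t0 : 0 < tauX X h by rewrite sqrtr_gt0.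
have tau2 : tauX X h ^+ 2 = opnorm (Gamma X h) by rewrite sqr_sqrtr// ltW.
have dl0 : 0 < dlt R n d by rewrite divr_gt0// sqrtr_gt0.
have dl2 : dlt R n d ^+ 2 = d%:R ^+ 2 / n%:R by rewrite exprMn exprVn sqr_sqrtr// ltW.
pose th := thX n d C.
have th0 : 0 < th by rewrite sqrtr_gt0 mulr_gt0// divr_gt0.
have th2 : th ^+ 2 = d%:R * (k / n%:R) by rewrite sqr_sqrtr// mulr_ge0// divr_ge0// ltW.
pose eta := n%:R * th ^+ 3; have eta0 : 0 < eta by rewrite mulr_gt0// exprn_gt0.
have eta2 : eta ^+ 2 = d%:R ^+ 3 * k ^+ 3 / n%:R.
  by rewrite exprMn -exprM mulnC exprM th2; field; rewrite gt_eqF.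
pose y1 := dlt R n d / winv X h; pose y2 := tauX X h ^+ 3 * eta / winv X h ^+ 3.
pose y3 := tauX X h * eta / winv X h ^+ 2.
have y10 : 0 < y1 by rewrite divr_gt0.
have y20 : 0 < y2 by apply: divr_gt0; [apply: mulr_gt0 => //|]; exact: exprn_gt0.
have y30 : 0 < y3 by apply: divr_gt0; [exact: mulr_gt0|exact: exprn_gt0].
have xp (y : R) m : 0 < y -> 0 < y `^ (1 / m%:R) by exact: powR_gt0.
have z1 := powR_root (ltW y10) (isT : (0 < 2)%N); have z2 := powR_root (ltW y20) (isT : (0 < 4)%N).
have z3 := powR_root (ltW y30) (isT : (0 < 3)%N).
have [Km _] : Num.max (Num.max (y1 `^ (1 / 2)) (y2 `^ (1 / 4))) (y3 `^ (1 / 3)) <= L ^+ 2 * Delta n d q1 q2 (ell (Gamma X h)) /\ true.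
  split => //; apply: (Delta_bound n0 d0 l0 l1 op0 F0 k0 ha1 hb2 hop hF); rewrite ?xp//.
  - by rewrite -[4%N]/(2 * 2)%N exprM z1 exprMn exprVn dl2.
  - rewrite -[8%N in LHS]/(4 * 2)%N exprM z2 -tau2 -eta2 /y2 -/(winv X h).
    by field; rewrite gt_eqF.
  rewrite -[6%N in LHS]/(3 * 2)%N exprM z3 -tau2 -eta2 /y3 -/(winv X h).
  by field; rewrite gt_eqF.
have [T4 _] := statT_sumX indep mh sh rn hC hB.
apply: ub_ereal_sup => _ [a /= a0 <-].
have a20 : 0 <= a ^+ 2 by exact: sqr_ge0.
pose A := [set t | sqn (statT X h t) <= a ^+ 2].
have mA : measurable A by exact: measurable_sqn_le (L4v_meas T4).
have mB : measurable [set w | sqn (Z w) <= a ^+ 2] by exact: measurable_sqn_le.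
have PE : P [set w | (l2norm (tstat X h w) <= a)%R] = (Ex (prodN (muX X)) \1_A)%:E.
  have mi : measurable_fun setT (\1_A : _ -> R) by exact/measurable_indicP.
  have [_ <-] := Ex_Xt indep mi; last exact: itg_indic.
  have mA' : measurable (Xt X @^-1` A) by rewrite -[_ @^-1` _]setTI; exact: (measurable_Xt X).
  rewrite (_ : [set w | _] = Xt X @^-1` A); last first.
    by apply/seteqP; split => w; rewrite /A /= (tstat_Xt indep mh hB)// l2norm_le.
  by rewrite pr_indic//; congr EFin; apply: eq_Ex => w; rewrite /= !indicE.
have QE : Q [set w | (l2norm (Z w) <= a)%R] = (Ex Q \1_[set w | sqn (Z w) <= a ^+ 2])%:E.
  by rewrite -pr_indic//; congr (Q _); apply/seteqP; split => w /=; rewrite l2norm_le.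
rewrite PE QE -EFinB abse_EFin lee_fin.
have b01 d' (S : measurableType d') (N : probability S R) (B : set S) : measurable B -> 0 <= Ex N \1_B <= 1.
  move=> hm; rewrite -!lee_fin -pr_indic//.
  by apply/andP; split; [exact: measure_ge0|exact: probability_le1].
have D1 : `|Ex (prodN (muX X)) \1_A - Ex Q \1_[set w | sqn (Z w) <= a ^+ 2]| <= 1.
  exact: abs_sub_le1 (b01 _ _ (prodN (muX X)) A mA) (b01 _ _ Q _ mB).
have cmp (e : R) : 0 < e -> k * dlt R n d <= e ->
    `|Ex (prodN (muX X)) \1_A - Ex Q \1_[set w | sqn (Z w) <= a ^+ 2]| <= rate X h C e.
  by move=> e0 he; exact: (comparison indep mh sh rn hC hB eig0 mZ cosZ a20 e0 he).
have fin := choose_eps c10 dl0 k0 w0 (xp y1 2 y10) (xp y2 4 y20) (xp y3 3 y30) D1 z1 z2 z3 cmp.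
apply: (le_trans fin); rewrite -mulrA; apply: ler_wpM2l Km; exact: ltW.
Qed.
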